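(* Let $\alpha\in(1,2)$ and let $\rho\in C_c^2(\mathbb{R}^2)$ be nonnegative (the initial mass density). For each $n\ge1$ let $u_n$ be the odometer function of the truncated $\alpha$-stable divisible sandpile on $\frac1n\mathbb{Z}^2$ started from $\rho_n=\rho|_{\frac1n\mathbb{Z}^2}$, and let $u=s-\gamma$ be the continuous odometer function. Then $$u_n^{\square}\longrightarrow u\qquad\text{uniformly on }\mathbb{R}^2\text{ as } n\to\infty.$$
   Context: **Jump laws.** $B_R=\{x\in\mathbb{R}^2:|x|<R\}$, $\mu$ is Lebesgue measure on $\mathbb{R}^2$. Fix $\alpha\in(1,2)$ and $0<r<M$. For $n\ge1$ and $y\in\frac1n\mathbb{Z}^2$ put $y^{\square}=y+[-\frac1{2n},\frac1{2n}]^2$, $F_n(y)=n^2\mu\big(y^{\square}\cap(B_M\setminus B_{r/n})\big)$, $$k_n=\frac{n^{2-\alpha}}4\Big(\int_{B_M}\frac{dy}{|y|^\alpha}-\frac1{n^2}\sum_{y\in\frac1n\mathbb{Z}^2\setminus\{0\}}\frac{F_n(y)}{|y|^\alpha}\Big),$$ $$p_n(y)=c_n\Big(k_n\mathbf 1_{\{|y|=1/n\}}+\frac{F_n(y)}{(n|y|)^{2+\alpha}}\Big)\ (y\neq0),\qquad p_n(0)=0,$$ with $c_n$ chosen so that $\sum_y p_n(y)=1$. Standing assumption: $r,M$ are such that $M>1$ and $k_n>0$ for all $n$ (possible: it holds for $r$ large, $M>r$). The limit $c=\lim_n c_n\in(0,\infty)$ exists. **Sandpile on $\frac1n\mathbb{Z}^2$.**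 A mass configuration is a nonnegative function on $\frac1n\mathbb{Z}^2$; a site is full if its mass is at least $1$. Toppling a full site $x$ with mass $m$: $x$ keeps mass $1$ and each site $x+y$ receives mass $(m-1)p_n(y)$; the amount emitted from $x$ is $m-1$. Starting from $\rho_n$, topple full sites one at a time, in an infinite sequence in which only full sites are toppled and every site that is initially full or becomes full is toppled infinitely often (if there is no full site, nothing happens). The total mass emitted from each site is finite and does not depend on the order of topplings. The odometer is $u_n(x)=n^{-\alpha}\times$ (total mass emitted from $x$); equivalently, with $L_{M,n}f(x)=n^\alpha\sum_y p_n(y)(f(x+y)-f(x))$, the final mass distribution is $\nu_n=\rho_n+L_{M,n}u_n$. **Extension.** For a function $f$ on $\frac1n\mathbb{Z}^2$, $f^{\square}(x)=f(x^{n})$ for $x\in\mathbb{R}^2$, where $x^{n}$ is the unique point of $\frac1n\mathbb{Z}^2$ in $\prod_{i=1,2}(x_i-\frac1{2n},x_i+\frac1{2n}]$. **Continuous objects.** For $f\in C^2$, $$L_Mf(x)=\frac c2\int_{B_M}\frac{f(x+y)+f(x-y)-2f(x)}{|y|^{2+\alpha}}dy.$$ A function $f\in L^1_{loc}(\mathbb{R}^2)$ is superharmonic if $\int f\,L_M\phi\,dx\le0$ for all nonnegative $\phi\in C_c^\infty(\mathbb{R}^2)$. Let $\psi_M(\theta)=c\int_{B_M}\frac{1-\cos(\theta\cdot y)}{|y|^{2+\alpha}}dy$, fix $x_0\in\mathbb{R}^2$ with $|x_0|=1$, and let $$G_M(x)=\frac1{(2\pi)^2}\int_{\mathbb{R}^2}\frac{\cos(\theta\cdot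 x)-\cos(\theta\cdot x_0)}{\psi_M(\theta)}d\theta\quad(x\ne0),$$ an improper integral ($\lim_{R\to\infty}\int_{B_R}$). With $\sigma_M^2=c\int_{B_M}|y|^{-\alpha}dy$, the obstacle is $\gamma(x)=-\frac{|x|^2}{\sigma_M^2}-\int_{\mathbb{R}^2}G_M(x-y)\rho(y)dy$; its least superharmonic majorant is $s(x)=\inf\{f(x): f \text{ continuous, superharmonic, } f\ge\gamma\}$; the continuous odometer is $u=s-\gamma$. *)

(* Defs.v *)
From HB Require Import structures.
From mathcomp Require Import all_boot all_order all_algebra.
From mathcomp Require Import all_classical all_reals all_analysis.
From mathcomp Require Import ring lra.

Set Implicit Arguments.
Unset Strict Implicit.
Unset Printing Implicit Defensive.
Import Order.TTheory GRing.Theory Num.Theory.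
Import numFieldNormedType.Exports.
Local Open Scope classical_set_scope.
Local Open Scope ring_scope.

Section Plane.
Variable R : realType.
Implicit Types (x y : R * R) (f : R * R -> R) (rad : R).

(* The library norm on [R * R] is the sup norm, hence an explicit Euclidean
   norm; the product topology is the usual one. *)
Definition enorm x : R := Num.sqrt (x.1 ^+ 2 + x.2 ^+ 2).

Definition dotp x y : R := x.1 * y.1 + x.2 * y.2.

Definition eball rad : set (R * R) := [set x | enorm x < rad].

Definition leb2 : set (measurableTypeR R * measurableTypeR R) -> \bar R :=
  ((@lebesgue_measure R) \x (@lebesgue_measure R))%E.

HB.instance Definition _ := Measure.on leb2.

Definition e1 : R * R := (1, 0).
Definition e2 : R * R := (0, 1).

Fixpoint is_Ck (k : nat) f : Prop :=
  if k is k'.+1 then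
    [/\ continuous f,
        forall x, derivable (f : R * R -> R^o) x e1
               /\ derivable (f : R * R -> R^o) x e2,
        is_Ck k' ('D_e1 (f : R * R -> R^o)) &
        is_Ck k' ('D_e2 (f : R * R -> R^o))]
  else continuous f.

Definition compactly_supported f : Prop :=
  compact (closure [set x | f x != 0]).

Definition is_test_function f : Prop :=
  (forall k, is_Ck k f) /\ compactly_supported f.

Definition is_L1loc f : Prop :=
  forall K : set (R * R), compact K -> leb2.-integrable K (EFin \o f).

End Plane.

(* The integer pair [z] stands for the lattice point [z / n]; functions on the
   rescaled lattice are functions of [z]. *)

Section Lattice.
Variable R : realType.

Definition site := (int * int)%type.

Definition pt (n : nat) (z : site) : R * R :=
  (z.1%:~R / n%:R, z.2%:~R / n%:R).

Definition cell (n : nat) (z : site) : set (R * R) :=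
  [set x | `|x.1 - (pt n z).1| <= (2 * n%:R)^-1 /\
           `|x.2 - (pt n z).2| <= (2 * n%:R)^-1].

Definition nearest (n : nat) (x : R * R) : site :=
  (Num.floor (n%:R * x.1 + 2^-1), Num.floor (n%:R * x.2 + 2^-1)).

Fact floor_half (n : nat) (t : R) (m : int) : (0 < n)%N ->
  (m == Num.floor (n%:R * t + 2^-1)) =
  (t - (2 * n%:R)^-1 < m%:~R / n%:R <= t + (2 * n%:R)^-1).
Proof.
move=> n_gt0; have n0 : 0 < n%:R :> R by rewrite ltr0n.
have nn0 : n%:R != 0 :> R by rewrite gt_eqF.
rewrite ltr_pdivlMr // ler_pdivrMr //.
have hn : (2 * n%:R)^-1 * n%:R = 2^-1 :> R by field.
rewrite eq_sym floor_eq intrD andbC.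
by congr andb; apply/idP/idP; lra.
Qed.

Fact nearestP (n : nat) (x : R * R) (z : site) : (0 < n)%N ->
  z = nearest n x <->
  x.1 - (2 * n%:R)^-1 < (pt n z).1 <= x.1 + (2 * n%:R)^-1 /\
  x.2 - (2 * n%:R)^-1 < (pt n z).2 <= x.2 + (2 * n%:R)^-1.
Proof.
move=> n_gt0; case: z => z1 z2; rewrite /nearest /=.
by rewrite -!floor_half//; split => [[<- <-]|[/eqP -> /eqP ->]].
Qed.

Definition box_ext (n : nat) (f : site -> R) (x : R * R) : R := f (nearest n x).

End Lattice.

Section JumpLaw.
Variables (R : realType) (alpha r M : R).

Definition F_ (n : nat) (z : site) : R :=
  n%:R ^+ 2 * fine (leb2 (cell n z `&` (eball M `\` eball (r / n%:R)))).

(* [F_ n] has finite support, so the finitely supported sums below are the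
   sums over the whole lattice. *)
Definition k_ (n : nat) : R :=
  n%:R `^ (2 - alpha) / 4 *
  (\int[@leb2 R]_(y in eball M) (enorm y `^ alpha)^-1
   - (n%:R ^+ 2)^-1 *
     \sum_(z \in [set z : site | z != 0]) F_ n z / enorm (pt R n z) `^ alpha).

Definition jump_weight (n : nat) (z : site) : R :=
  k_ n * (enorm (pt R n z) == n%:R^-1)%:R
  + F_ n z / (n%:R * enorm (pt R n z)) `^ (2 + alpha).

Definition c_ (n : nat) : R :=
  (\sum_(z \in [set z : site | z != 0]) jump_weight n z)^-1.

Definition p_ (n : nat) (z : site) : R :=
  if z == 0 then 0 else c_ n * jump_weight n z.

Definition c_lim : R := limn c_.

End JumpLaw.

Section Sandpile.
Variable R : realType.
Implicit Types (p eta : site -> R) (X : nat -> option site).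

Definition full eta (x : site) : Prop := 1 <= eta x.

Definition topple p (x : site) eta : site -> R :=
  fun z => if z == x then 1 else eta z + (eta x - 1) * p (z - x).

(* [X k = None] means that nothing happens at step [k]; [legal_toppling] allows
   it only when no site is full. *)
Fixpoint mass p eta X (k : nat) : site -> R :=
  if k is k'.+1 then
    if X k' is Some x then topple p x (mass p eta X k') else mass p eta X k'
  else eta.

Definition legal_toppling p eta X : Prop :=
  (forall k, if X k is Some x then full (mass p eta X k) x
             else forall x, ~ full (mass p eta X k) x) /\
  (forall k x, full (mass p eta X k) x ->
     forall N, exists2 j, (N <= j)%N & X j = Some x).

Definition emitted p eta X (k : nat) (x : site) : R :=
  if X k == Some x then mass p eta X k x - 1 else 0.

(* The partial sums are nondecreasing for a legal toppling sequence; the limit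
   is taken in [R] since the total mass emitted from each site is finite. *)
Definition total_emitted p eta X (x : site) : R :=
  limn (fun N => \sum_(0 <= k < N) emitted p eta X k x).

Definition odometer (alpha : R) (n : nat) p eta X (x : site) : R :=
  n%:R `^ (- alpha) * total_emitted p eta X x.

End Sandpile.

Section Continuous.
Variables (R : realType) (alpha r M : R).
Implicit Types (x y theta : R * R) (f phi rho : R * R -> R).

Local Notation c := (c_lim alpha r M).

Definition L_M f x : R :=
  c / 2 * \int[@leb2 R]_(y in eball M)
    ((f (x + y) + f (x - y) - 2 * f x) / enorm y `^ (2 + alpha)).

Definition superharmonic f : Prop :=
  is_L1loc f /\
  forall phi, is_test_function phi -> (forall x, 0 <= phi x) ->
    \int[@leb2 R]_x (f x * L_M phi x) <= 0.

Definition psi_M theta : R :=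
  c * \int[@leb2 R]_(y in eball M)
    ((1 - cos (dotp theta y)) / enorm y `^ (2 + alpha)).

(* Improper integral over balls; the value at [x = 0], where the limit does not
   exist, is irrelevant. *)
Definition G_M (x0 x : R * R) : R :=
  ((2 * pi) ^+ 2)^-1 *
  lim ((fun rad : R => \int[@leb2 R]_(theta in eball rad)
    ((cos (dotp theta x) - cos (dotp theta x0)) / psi_M theta)) @ +oo).

Definition sigma2_M : R :=
  c * \int[@leb2 R]_(y in eball M) (enorm y `^ alpha)^-1.

Definition obstacle (x0 : R * R) rho x : R :=
  - (enorm x ^+ 2 / sigma2_M) - \int[@leb2 R]_y (G_M x0 (x - y) * rho y).

Definition least_majorant (gamma : R * R -> R) x : R :=
  inf [set f x | f in [set f : R * R -> R |
    [/\ continuous f, superharmonic f & forall y, gamma y <= f y]]].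

Definition cont_odometer (x0 : R * R) rho x : R :=
  least_majorant (obstacle x0 rho) x - obstacle x0 rho x.

End Continuous.

(* Main.v *)
(* Adding the obstacle identifies the continuous odometer with the pointwise infimum of the
   continuous functions [w >= 0] satisfying [L_M w <= 1 - rho] weakly, because the potential of
   [rho] makes the obstacle a weak solution of [L_M gamma = rho - 1] (Fourier inversion of the
   symbol).  The discrete odometer has the same description, by the least action principle and a
   maximum principle on the lattice, and the rescaled discrete operators converge to [L_M]
   uniformly on smooth functions.  Hence competitors can be exchanged: mollifying [u_n] and adding
   a small multiple of [1 + cos (x_1 / R)], on which [L_M] is strictly negative near the support,
   gives a competitor for [u]; averaging a competitor for [u] against a bump function gives one
   for [u_n], up to a small quadratic corrector.  So [u_n] converges to [u] at every point, and
   uniformly since the [u_n] share a Lipschitz constant and a bounded support: the first by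
   comparing [u_n] with its translates, the second by a barrier. *)

Require Import Defs.
From HB Require Import structures.
From mathcomp Require Import all_boot all_order all_algebra.
From mathcomp Require Import all_classical all_reals all_analysis.
From mathcomp Require Import measurable_realfun.
From mathcomp Require Import zify ring lra.
Import Order.TTheory GRing.Theory Num.Theory.
Import numFieldNormedType.Exports.
Set Implicit Arguments.
Unset Strict Implicit.
Unset Printing Implicit Defensive.
Local Open Scope classical_set_scope.
Local Open Scope ring_scope.

(** * Lebesgue integration on the plane *)

(** The weight [k_] is tuned so that the second moment of the discrete jump law, scaled by
    [n ^ alpha], is exactly [c_ n] times that of the continuous kernel. Quadratic functions are
    therefore exact correctors on every lattice, with constants bounded in [n], and barriers built
    from the norm have a radius that does not depend on [n]. The delicate object is [G_M]. The
    symbol grows like |theta|^alpha with [alpha < 2], so its inverse is not integrable at infinity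
    and the defining integral converges only through oscillation; near 0 the inverse behaves like
    |theta|^-2, which the subtracted cosine at [x0] compensates. The kernel is never computed.
    Paired with [jump_op phi], a truncated integral sees the symbol cancel, the [x0] term drops
    because [jump_op phi] has integral 0, and Fourier inversion of [phi] at one point remains. What
    has to be known of [G_M] is a majorant of order 1 + 1/|x| on bounded sets, uniform in the
    truncation. Odometers and competitors are not smooth, so the operators are moved by symmetry
    onto a bump function, and consistency is invoked for that bump alone. *)

Lemma leb2X (R : realType) (A B : set (measurableTypeR R)) :
  measurable A -> measurable B ->
  leb2 (A `*` B) = (lebesgue_measure A * lebesgue_measure B)%E.
Proof. exact: product_measure1E. Qed.

Lemma leb2_sigma_finite (R : realType) : sigma_finite setT (@leb2 R).
Proof.
pose I n := (`[- n%:R, n%:R]%classic : set (measurableTypeR R)).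
have mI n : measurable (I n) by exact: measurable_itv.
have fI n : (lebesgue_measure (I n) < +oo)%E.
  by rewrite /I lebesgue_measure_itv/=; case: ifP => _; rewrite -?EFinB ?ltry.
exists (fun n => I n `*` I n) => [|n].
  apply/esym/seteqP; split => // -[x y] _.
  exists (Num.truncn (Num.max `|x| `|y|)).+1 => //.
  have := truncnS_gt (Num.max `|x| `|y|); rewrite gt_max => /andP[hx hy].
  by split; rewrite /I /= in_itv /= -ler_norml ltW.
split; first exact: measurableX.
by rewrite leb2X// lte_mul_pinfty// ge0_fin_numE.
Qed.

HB.instance Definition _ (R : realType) :=
  Measure_isSigmaFinite.Build _ _ _ (@leb2 R) (@leb2_sigma_finite R).

Section RealIntegral.
Context d (T : measurableType d) (R : realType) (mu : {measure set T -> \bar R}).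
Implicit Types f g h : T -> R.
Local Notation intg f := (mu.-integrable setT (EFin \o f)).

Lemma intg_meas f : intg f -> measurable_fun setT f.
Proof. by move=> /integrableP[/measurable_EFinP]. Qed.

Lemma intg_le f g : measurable_fun setT f -> intg g ->
  (forall x, `|f x| <= g x) -> intg f.
Proof.
move=> mf ig fg; apply: (le_integrable _ _ _ ig) => //.
  exact/measurable_EFinP.
by move=> x _ /=; rewrite lee_fin (le_trans (fg x))// ler_norm.
Qed.

Lemma intg_norm f : intg f -> intg (fun x => `|f x|).
Proof. exact: integrable_norm. Qed.

Lemma intgD f g : intg f -> intg g -> intg (fun x => f x + g x).
Proof. by move=> If Ig; apply: eq_integrable (integrableD measurableT If Ig). Qed.

Lemma intgB f g : intg f -> intg g -> intg (fun x => f x - g x).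
Proof. by move=> If Ig; apply: eq_integrable (integrableB measurableT If Ig). Qed.

Lemma intgZ c f : intg f -> intg (fun x => c * f x).
Proof. by move=> If; apply: eq_integrable (integrableZl measurableT c If). Qed.

Lemma intg_sum I (s : seq I) (F : I -> T -> R) :
  (forall i, intg (F i)) -> intg (fun x => \sum_(i <- s) F i x).
Proof.
move=> IF; elim: s => [|i s ih].
  apply: (@eq_integrable _ _ _ mu setT measurableT (cst 0%E)).
    by move=> x _ /=; rewrite big_nil.
  exact: integrable0.
apply: eq_integrable (intgD (IF i) ih) => // x _ /=.
by rewrite big_cons.
Qed.

Lemma Rint_sum I (s : seq I) (F : I -> T -> R) :
  (forall i, intg (F i)) ->
  \int[mu]_x (\sum_(i <- s) F i x) = \sum_(i <- s) \int[mu]_x F i x.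
Proof.
move=> IF; elim: s => [|i s ih].
  rewrite big_nil; under eq_Rintegral do rewrite big_nil.
  by rewrite Rintegral_cst// mul0r.
rewrite big_cons -ih -RintegralD//; last exact: intg_sum.
by apply: eq_Rintegral => x _; rewrite big_cons.
Qed.

Lemma RintN f : intg f -> \int[mu]_x (- f x) = - \int[mu]_x f x.
Proof.
move=> If; rewrite -mulN1r -RintegralZl//.
by apply: eq_Rintegral => x _; rewrite mulN1r.
Qed.

Lemma Rint_le_norm f g : intg f -> intg g -> (forall x, `|f x| <= g x) ->
  `|\int[mu]_x f x| <= \int[mu]_x g x.
Proof.
move=> If Ig fg; apply: le_trans (le_normr_Rintegral measurableT If) _.
by apply: le_Rintegral => //; exact: intg_norm.
Qed.

Lemma Rint_dct (f_ : nat -> T -> R) f g :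
  (forall n, measurable_fun setT (f_ n)) ->
  (forall x, f_ n x @[n --> \oo] --> f x) -> intg g ->
  (forall n x, `|f_ n x| <= g x) ->
  intg f /\ \int[mu]_x f_ n x @[n --> \oo] --> \int[mu]_x f x.
Proof.
move=> mf ff ig fg.
have mlim : measurable_fun setT f.
  by apply: (measurable_fun_cvg mf) => x _; exact: ff.
have If : intg f.
  apply: intg_le ig _ => // x.
  rewrite -(cvg_lim _ (cvg_norm (ff x)))//.
  apply: limr_le; first by apply/cvg_ex; eexists; exact: cvg_norm (ff x).
  by apply: nearW => n; exact: fg.
split => //.
apply: fine_cvg; rewrite fineK; last exact: integrable_fin_num.
apply: (@dominated_cvg _ _ _ mu setT measurableT (fun n x => (f_ n x)%:E)
  (EFin \o f) (EFin \o g)) => //.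
- by move=> n; exact/measurable_EFinP.
- by move=> x _; apply: cvg_EFin; [exact: nearW|exact: ff].
- by move=> n x _ /=; rewrite lee_fin; exact: fg.
Qed.

Lemma intg_indicT (A : set T) : measurable A -> (mu A < +oo)%E -> intg \1_A.
Proof.
move=> mA fA; apply/integrableP; split; first exact/measurable_EFinP.
rewrite (eq_integral (fun x => (\1_A x)%:E)); last first.
  by move=> x _ /=; rewrite ger0_norm.
by rewrite integral_indic// setIT.
Qed.

Lemma intg_bounded (A : set T) f (K : R) : measurable A -> (mu A < +oo)%E ->
  measurable_fun setT f -> (forall x, `|f x| <= K * \1_A x) -> intg f.
Proof.
move=> mA fA mf fK; apply: intg_le mf _ fK.
by apply: intgZ; exact: intg_indicT.
Qed.

Lemma Rint_indic (A : set T) f : \int[mu]_(x in A) f x = \int[mu]_x (\1_A x * f x).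
Proof.
rewrite Rintegral_mkcond; apply: eq_Rintegral => x _.
by rewrite patchE indicE; case: ifPn => _; rewrite ?mul1r ?mul0r.
Qed.

Lemma intg_indic (A : set T) f : measurable A ->
  mu.-integrable A (EFin \o f) <-> intg (fun x => \1_A x * f x).
Proof.
move=> mA; rewrite (integrable_mkcond _ mA).
by split; apply: eq_integrable => // x _;
  rewrite patchE /= indicE; case: ifPn => _; rewrite ?mul1r ?mul0r.
Qed.

End RealIntegral.
Section RealFubini.
Context d1 d2 (T1 : measurableType d1) (T2 : measurableType d2) (R : realType).
Variables (m1 : {sigma_finite_measure set T1 -> \bar R})
          (m2 : {sigma_finite_measure set T2 -> \bar R}).

Lemma meas_sectl (f : T1 * T2 -> R) x : measurable_fun setT f ->
  measurable_fun setT (fun y => f (x, y)).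
Proof. by move=> mf; apply: measurableT_comp => //; exact: measurable_fun_pair. Qed.

Lemma meas_sectr (f : T1 * T2 -> R) y : measurable_fun setT f ->
  measurable_fun setT (fun x => f (x, y)).
Proof. by move=> mf; apply: measurableT_comp => //; exact: measurable_fun_pair. Qed.

(** The iterated integral of the absolute value is at most the product of the integrals of |g| and
    |h|, which is finite; Tonelli's criterion concludes. *)
Lemma intg_prod (f : T1 * T2 -> R) (g : T1 -> R) (h : T2 -> R) :
  measurable_fun setT f -> m1.-integrable setT (EFin \o g) ->
  m2.-integrable setT (EFin \o h) ->
  (forall x y, `|f (x, y)| <= g x * h y) ->
  (m1 \x m2)%E.-integrable setT (EFin \o f).
Proof.
move=> mf Ig Ih fgh; apply/integrable12ltyP; first exact/measurable_EFinP.
have Inh := intg_norm Ih; have Ing := intg_norm Ig.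
apply: (@le_lt_trans _ _ (\int[m1]_x (`|g x|%:E * \int[m2]_y `|h y|%:E))%E).
  apply: ge0_le_integral => //.
  - by move=> x _; exact: integral_ge0.
  - apply: (@measurable_fun_fubini_tonelli_F _ _ _ _ _ m2
      (fun z => `|(f z)%:E|%E)) => //.
    by apply: measurableT_comp => //; exact/measurable_EFinP.
  - apply: emeasurable_funM => //.
    by apply/measurable_EFinP/measurableT_comp => //; exact: intg_meas Ig.
  - move=> x _; rewrite -integralZl//; apply: ge0_le_integral => //.
    + apply: measurableT_comp => //; apply/measurable_EFinP.
      exact: (meas_sectl x mf).
    + by apply: measurable_int; exact: (integrableZl measurableT `|g x| Inh).
    + move=> y _; rewrite -EFinM lee_fin (le_trans (fgh x y))//.
      by rewrite -normrM ler_norm.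
set c := (\int[m2]_y _)%E.
have cE : c = (fine c)%:E by rewrite fineK//; exact: integrable_fin_num Inh.
rewrite cE integralZr//.
have := integrable_fin_num measurableT Ing.
by move=> /fineK /= <-; rewrite -EFinM ltry.
Qed.

(* With a dominating product [g x * h y] all sections are integrable, so no
   almost-everywhere qualification is needed. *)
Lemma Rint_fubini (f : T1 * T2 -> R) (g : T1 -> R) (h : T2 -> R) :
  measurable_fun setT f -> m1.-integrable setT (EFin \o g) ->
  m2.-integrable setT (EFin \o h) ->
  (forall x y, `|f (x, y)| <= g x * h y) ->
  [/\ m1.-integrable setT (EFin \o (fun x => \int[m2]_y f (x, y))),
      m2.-integrable setT (EFin \o (fun y => \int[m1]_x f (x, y))),
      \int[m1]_x \int[m2]_y f (x, y) = \int[(m1 \x m2)%E]_z f z &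
      \int[m2]_y \int[m1]_x f (x, y) = \int[(m1 \x m2)%E]_z f z].
Proof.
move=> mf Ig Ih fgh; have If := intg_prod mf Ig Ih fgh.
have Isx x : m2.-integrable setT (EFin \o (fun y => f (x, y))).
  exact: intg_le (meas_sectl x mf) (intgZ (g x) Ih) (fgh x).
have Isy y : m1.-integrable setT (EFin \o (fun x => f (x, y))).
  apply: intg_le (meas_sectr y mf) (intgZ (h y) Ig) _ => x.
  by rewrite mulrC.
have E1 x : (\int[m2]_y f (x, y))%:E = fubini_F m2 (EFin \o f) x.
  by rewrite /fubini_F /Rintegral fineK//; exact: (integrable_fin_num _ (Isx x)).
have E2 y : (\int[m1]_x f (x, y))%:E = fubini_G m1 (EFin \o f) y.
  by rewrite /fubini_G /Rintegral fineK//; exact: (integrable_fin_num _ (Isy y)).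
split.
- apply: eq_integrable (integrable_fubini_F If) => // x _; exact/esym/E1.
- apply: (intg_le (g := fun y => (\int[m1]_x g x) * h y)).
  + apply/measurable_EFinP.
    by apply: eq_measurable_fun (measurable_fubini_G If) => y _; rewrite -E2.
  + exact: intgZ.
  + move=> y; rewrite -RintegralZr//; apply: Rint_le_norm => //.
    by apply: eq_integrable (intgZ (h y) Ig) => // x _ /=; rewrite mulrC.
- rewrite /Rintegral -(integral12_prod_meas1 If); congr fine.
  by apply: eq_integral => x _; exact: E1.
- rewrite /Rintegral -(integral21_prod_meas1 If); congr fine.
  by apply: eq_integral => x _; exact: E2.
Qed.

Lemma Rint_prod (g : T1 -> R) (h : T2 -> R) :
  m1.-integrable setT (EFin \o g) -> m2.-integrable setT (EFin \o h) ->
  (m1 \x m2)%E.-integrable setT (EFin \o (fun z => g z.1 * h z.2)) /\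
  \int[(m1 \x m2)%E]_z (g z.1 * h z.2) = (\int[m1]_x g x) * (\int[m2]_y h y).
Proof.
move=> Ig Ih.
have mgh : measurable_fun setT (fun z : T1 * T2 => g z.1 * h z.2).
  apply: measurable_funM; apply: measurableT_comp => //.
    exact: intg_meas Ig.
  exact: intg_meas Ih.
have b x y : `|g (x, y).1 * h (x, y).2| <= `|g x| * `|h y| by rewrite normrM.
split; first exact: intg_prod mgh (intg_norm Ig) (intg_norm Ih) b.
have [_ _ <- _] := Rint_fubini mgh (intg_norm Ig) (intg_norm Ih) b.
rewrite -RintegralZr//; apply: eq_Rintegral => x _ /=.
by rewrite RintegralZl.
Qed.

End RealFubini.

(** Measurability of [powR] is transported through 1/t = t (t^2)^-1, an identity that also holds at
    t = 0, where both sides are 0. *)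
Lemma measurable_funVr d (T : measurableType d) (R : realType) (f : T -> R) :
  measurable_fun setT f -> measurable_fun setT (fun x => (f x)^-1).
Proof.
move=> mf.
have -> : (fun x => (f x)^-1) = (fun x => f x * (f x * f x) `^ (-1)).
  apply/funext => x; rewrite powR_inv1 -?expr2 ?sqr_ge0//.
  have [->|fx] := eqVneq (f x) 0; first by rewrite invr0 mul0r.
  by rewrite expr2 invfM mulrA divff// mul1r.
apply: measurable_funM => //.
apply: (measurableT_comp (measurable_powR _)).
exact: measurable_funM.
Qed.

Notation intg2 f := ((@leb2 _).-integrable setT (EFin \o f)).

Section EuclideanNorm.
Variable R : realType.
Implicit Types x y z : R * R.

Lemma enorm_ge0 x : 0 <= enorm x.
Proof. exact: sqrtr_ge0. Qed.

Lemma enorm_sqr x : enorm x ^+ 2 = x.1 ^+ 2 + x.2 ^+ 2.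
Proof. by rewrite sqr_sqrtr// addr_ge0 ?sqr_ge0. Qed.

Lemma enormN x : enorm (- x) = enorm x.
Proof. by rewrite /enorm /= !sqrrN. Qed.

Lemma enorm0 : enorm (0 : R * R) = 0.
Proof. by rewrite /enorm /= expr0n addr0 sqrtr0. Qed.

Lemma enorm_scale (a : R) x : enorm (a * x.1, a * x.2) = `|a| * enorm x.
Proof.
by rewrite /enorm /= !exprMn -mulrDr sqrtrM ?sqr_ge0// sqrtr_sqr.
Qed.

(** Lagrange's identity: the two squares differ by the square of the determinant of [x] and [y]. *)
Lemma dotp_le x y : `|dotp x y| <= enorm x * enorm y.
Proof.
rewrite -(@ler_pXn2r _ 2%N) ?nnegrE ?mulr_ge0 ?enorm_ge0//.
rewrite exprMn !enorm_sqr real_normK ?num_real// /dotp -subr_ge0.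
have -> : (x.1 ^+ 2 + x.2 ^+ 2) * (y.1 ^+ 2 + y.2 ^+ 2) -
  (x.1 * y.1 + x.2 * y.2) ^+ 2 = (x.1 * y.2 - x.2 * y.1) ^+ 2 by ring.
exact: sqr_ge0.
Qed.

Lemma enorm_sqrD x y :
  enorm (x + y) ^+ 2 = enorm x ^+ 2 + 2 * dotp x y + enorm y ^+ 2.
Proof. by rewrite !enorm_sqr /dotp /=; ring. Qed.

Lemma enormD x y : enorm (x + y) <= enorm x + enorm y.
Proof.
rewrite -(@ler_pXn2r _ 2%N) ?nnegrE ?addr_ge0 ?enorm_ge0//.
rewrite enorm_sqrD; have := dotp_le x y; have := ler_norm (dotp x y).
by nra.
Qed.

Lemma enormB x y : enorm (x - y) <= enorm x + enorm y.
Proof. by rewrite -(enormN y) enormD. Qed.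

Lemma enorm_geB x y : enorm x - enorm y <= enorm (x - y).
Proof. by rewrite lerBlDr -{1}(subrK y x) enormD. Qed.

Lemma fst_le_enorm x : `|x.1| <= enorm x.
Proof. by rewrite -sqrtr_sqr ler_sqrt ?lerDl ?addr_ge0 ?sqr_ge0. Qed.

Lemma snd_le_enorm x : `|x.2| <= enorm x.
Proof. by rewrite -sqrtr_sqr ler_sqrt ?lerDr ?addr_ge0 ?sqr_ge0. Qed.

Lemma enorm_le x : enorm x <= `|x.1| + `|x.2|.
Proof.
rewrite -(@ler_pXn2r _ 2%N) ?nnegrE ?addr_ge0 ?enorm_ge0//.
rewrite enorm_sqr -(real_normK (num_real x.1)) -(real_normK (num_real x.2)).
by have := normr_ge0 x.1; have := normr_ge0 x.2; nra.
Qed.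

Lemma enorm_eq0 x : (enorm x == 0) = (x == 0).
Proof.
apply/eqP/eqP => [h|->]; last exact: enorm0.
have := fst_le_enorm x; have := snd_le_enorm x; rewrite h !normr_le0.
by case: x {h} => a b /= /eqP -> /eqP ->.
Qed.

Lemma enorm_gt0 x : (0 < enorm x) = (x != 0).
Proof. by rewrite lt_neqAle enorm_ge0 andbT eq_sym enorm_eq0. Qed.

Lemma continuous_fstR : continuous (fst : R * R -> R).
Proof. by move=> x; exact: cvg_fst. Qed.

Lemma continuous_sndR : continuous (snd : R * R -> R).
Proof. by move=> x; exact: cvg_snd. Qed.

Lemma continuous_enorm : continuous (@enorm R).
Proof.
have -> : @enorm R = Num.sqrt \o (fun x : R * R => x.1 * x.1 + x.2 * x.2).
  by apply/funext => x; rewrite /enorm !expr2.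
move=> x; apply: continuous_comp; last exact: sqrt_continuous.
by apply: cvgD; apply: cvgM; (exact: continuous_fstR || exact: continuous_sndR).
Qed.

Lemma dotpD x y z : dotp x (y + z) = dotp x y + dotp x z.
Proof. by rewrite /dotp /=; ring. Qed.

Lemma dotpB x y z : dotp x (y - z) = dotp x y - dotp x z.
Proof. by rewrite /dotp /=; ring. Qed.

Lemma dotpN x y : dotp x (- y) = - dotp x y.
Proof. by rewrite /dotp /=; ring. Qed.

Lemma dotpDl x y z : dotp (x + y) z = dotp x z + dotp y z.
Proof. by rewrite /dotp /=; ring. Qed.

Lemma dotpC x y : dotp x y = dotp y x.
Proof. by rewrite /dotp; ring. Qed.

End EuclideanNorm.
Section PlaneMeasure.
Variable R : realType.
Local Notation mR := (measurableTypeR R).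

(** The measurable sets of the plane are generated by rectangles. An open set is the union of the
    countably many squares with rational centre and radius that it contains. *)
Lemma open_measurable2 (U : set (R * R)) : open U -> measurable (U : set (mR * mR)).
Proof.
move=> oU.
pose B (p : rat * rat * rat) : set (R * R) :=
  ball (ratr p.1.1 : R) (ratr p.2) `*` ball (ratr p.1.2 : R) (ratr p.2).
have -> : U = \bigcup_p (if `[< B p `<=` U >] then B p else set0).
  apply/seteqP; split=> [x Ux|x [p _]]; last first.
    by case: ifPn => // /asboolP + Bx; exact.
  have : nbhs x U by exact: open_nbhs_nbhs.
  rewrite -nbhs_ballE => -[e /= e0 xU].
  have [q /andP[q0 qe]] : exists q : rat, (0 < ratr q :> R) && (ratr q < e / 2).
    have /rat_in_itvoo[q] : 0 < e / 2 by rewrite divr_gt0.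
    by rewrite in_itv /= => h; exists q.
  have near_rat (t : R) : exists p : rat, `|ratr p - t| < ratr q.
    have /rat_in_itvoo[p] : t - ratr q < t + ratr q by lra.
    by rewrite in_itv /= => h; exists p; rewrite ltr_distl.
  have [p1 h1] := near_rat x.1; have [p2 h2] := near_rat x.2.
  exists (p1, p2, q) => //; case: asboolP => [_|]; first by split.
  case=> y [/= y1 y2]; apply: xU; split => /=.
    rewrite /ball /= in y1 *; rewrite distrC in h1.
    have := ler_distD (ratr p1) x.1 y.1; lra.
  rewrite /ball /= in y2 *; rewrite distrC in h2.
  have := ler_distD (ratr p2) x.2 y.2; lra.
apply: countable_bigcupT_measurable => // p.
case: asboolP => _ //; apply: measurableX; exact: measurable_ball.
Qed.

Lemma continuous_measurable2 (f : R * R -> R) : continuous f ->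
  measurable_fun (setT : set (mR * mR)) (f : _ -> mR).
Proof.
move=> /continuousP cf; apply: (measurability _ (RGenOpens.measurableE R)).
move=> _ [_ [a [b ->] <-]]; rewrite setTI; apply: open_measurable2.
exact/cf/interval_open.
Qed.

Lemma measurable_eball rad : measurable (@eball R rad : set (mR * mR)).
Proof.
apply: open_measurable2; rewrite (_ : eball rad = (@enorm R) @^-1` `]-oo, rad[).
  by move/continuousP : (@continuous_enorm R); apply; exact: interval_open.
by apply/seteqP; split => x; rewrite /eball /= in_itv.
Qed.

Lemma measurable_enorm : measurable_fun (setT : set (mR * mR)) (@enorm R).
Proof. by apply: continuous_measurable2; exact: continuous_enorm. Qed.

Lemma compact_measurable2 (K : set (R * R)) : compact K ->
  measurable (K : set (mR * mR)).
Proof.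
move=> /compact_closed cK; rewrite -(setCK K); apply: measurableC.
by apply: open_measurable2; apply: closed_openC; apply: cK; exact: norm_hausdorff.
Qed.

Definition box (r : R) : set (R * R) := `[-r, r]%classic `*` `[-r, r]%classic.

Lemma boxE r (x : R * R) : box r x <-> `|x.1| <= r /\ `|x.2| <= r.
Proof. by rewrite /box /= !in_itv /= !ler_norml. Qed.

Lemma measurable_box r : measurable (box r : set (mR * mR)).
Proof. by apply: measurableX; exact: measurable_itv. Qed.

Lemma leb2_box r : 0 <= r -> leb2 (box r) = ((2 * r) ^+ 2)%:E.
Proof.
move=> r0; rewrite leb2X; try exact: measurable_itv.
rewrite lebesgue_measure_itv /= lte_fin.
have [->|rn0] := eqVneq r 0; first by rewrite oppr0 ltxx mul0e mulr0 expr0n.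
rewrite ifT; first by rewrite -EFinB -EFinM; congr EFin; ring.
by rewrite gtrN// lt_neqAle eq_sym rn0.
Qed.

Lemma leb2_box_lty r : (leb2 (box r) < +oo)%E.
Proof.
have [r0|r0] := leP 0 r; first by rewrite leb2_box// ltry.
rewrite (_ : box r = set0) ?measure0//; apply/seteqP; split => // x /boxE[h _].
by have := normr_ge0 x.1; lra.
Qed.

Lemma eball_box r : @eball R r `<=` box r.
Proof.
move=> x /ltW xr; apply/boxE; split; apply: le_trans xr.
  exact: fst_le_enorm.
exact: snd_le_enorm.
Qed.

Lemma leb2_eball_lty r : (leb2 (@eball R r) < +oo)%E.
Proof.
apply: le_lt_trans (leb2_box_lty r).
apply: le_measure; rewrite ?inE; [exact: measurable_eball|exact: measurable_box|].
exact: eball_box.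
Qed.

Lemma bounded_in_box (K : set (R * R)) : compact K ->
  exists2 r : R, 0 < r & forall x, K x -> enorm x < r.
Proof.
move=> /compact_bounded[M [Mr KM]].
exists (2 * (`|M| + 1) + 1) => [|x Kx]; first by have := normr_ge0 M; lra.
have h := KM (`|M| + 1) _ x Kx.
have {h} : `|x| <= `|M| + 1.
  by apply: h; have := ler_norm M; lra.
rewrite prod_normE /= ge_max => /andP[h1 h2].
by have := enorm_le x; lra.
Qed.

Lemma EFin_mulBr (k : R) (u v : \bar R) : u \is a fin_num -> v \is a fin_num ->
  (k%:E * u - k%:E * v = k%:E * (u - v))%E.
Proof. by move=> uf vf; rewrite muleBr// fin_num_adde_defl// fin_numN. Qed.

Section Affine.
Variables (a : R) (a0 : a != 0).

Definition aff1 (b : R) (t : mR) : mR := a * t + b.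

Lemma measurable_aff1 b : measurable_fun setT (aff1 b).
Proof. by apply: measurable_funD => //; exact: measurable_funM. Qed.

(** By uniqueness of Lebesgue measure, it is enough to compare it with the rescaled image measure on
    half-open intervals. *)
Lemma lebesgue_aff1 b (A : set mR) : measurable A ->
  lebesgue_measure A =
    (`|a|%:E * lebesgue_measure (aff1 b @^-1` A))%E.
Proof.
have an0 : 0 < `|a| by rewrite normr_gt0.
apply: (@lebesgue_measure_unique R
  (mscale (NngNum (normr_ge0 a))
   (measure_function_pushforward__canonical__measure_function_Measure
      (@lebesgue_measure R) (measurable_aff1 b)))).
move=> _ [[s t] _ <-] /=; rewrite /mscale /pushforward /=.
rewrite lebesgue_measure_itv /= lte_fin /pushforward.
(* In the first case [a] is negative: the preimage of a left-open interval is then closed on the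
   left and open on the right, of the same length. *)
have [a_gt0|a_lt0|/eqP] := ltgtP a 0; last by rewrite (negbTE a0).
- rewrite (_ : _ @^-1` _ = `[(t - b) / a, (s - b) / a[%classic); last first.
    apply/seteqP; split => u; rewrite /= !in_itv /= /aff1.
      by rewrite ler_ndivrMr// ltr_ndivlMr//; lra.
    by rewrite ler_ndivrMr// ltr_ndivlMr//; lra.
  rewrite lebesgue_measure_itv /= lte_fin ltr_nM2r ?invr_lt0// ltrD2r.
  case: ifP => _; last by rewrite mule0.
  by rewrite -!EFinB -EFinM ltr0_norm//; congr EFin; field.
- rewrite (_ : _ @^-1` _ = `](s - b) / a, (t - b) / a]%classic); last first.
    apply/seteqP; split => u; rewrite /= !in_itv /= /aff1.
      by rewrite ltr_pdivrMr// ler_pdivlMr//; lra.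
    by rewrite ltr_pdivrMr// ler_pdivlMr//; lra.
  rewrite lebesgue_measure_itv /= lte_fin ltr_pM2r ?invr_gt0// ltrD2r.
  case: ifP => _; last by rewrite mule0.
  by rewrite -!EFinB -EFinM gtr0_norm//; congr EFin; field.
Qed.

Definition aff2 (b : R * R) (x : mR * mR) : mR * mR :=
  (aff1 b.1 x.1, aff1 b.2 x.2).

Lemma measurable_aff2 b : measurable_fun setT (aff2 b).
Proof.
by apply: measurable_fun_pair; apply: measurableT_comp => //; exact: measurable_aff1.
Qed.

Let push b : {measure set (mR * mR) -> \bar R} :=
  mscale (NngNum (sqr_ge0 `|a|))
    (measure_function_pushforward__canonical__measure_function_Measure
      (@leb2 R) (measurable_aff2 b)).

(** Uniqueness of the product measure reduces the claim to rectangles, where each coordinate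
    contributes one factor |a|. *)
Lemma leb2_aff2 b (A : set (mR * mR)) : measurable A -> leb2 A = push b A.
Proof.
move=> mA; apply: product_measure_unique => // U V mU mV.
rewrite /push /= /mscale /= /pushforward.
rewrite (_ : _ @^-1` _ = (aff1 b.1 @^-1` U) `*` (aff1 b.2 @^-1` V))//.
have mpre c (W : set mR) : measurable W -> measurable (aff1 c @^-1` W).
  by move=> mW; rewrite -[X in measurable X]setTI; exact: measurable_aff1.
rewrite leb2X; [|exact: mpre|exact: mpre].
rewrite (lebesgue_aff1 b.1 mU) (lebesgue_aff1 b.2 mV).
by rewrite muleACA -EFinM -expr2.
Qed.

Lemma ge0_integral_aff2 b (f : mR * mR -> \bar R) :
  measurable_fun setT f -> (forall x, (0 <= f x)%E) ->
  (\int[@leb2 R]_x f x = (`|a| ^+ 2)%:E * \int[@leb2 R]_x f (aff2 b x))%E.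
Proof.
move=> mf f0.
rewrite (eq_measure_integral (push b)); last by move=> A mA _; exact: leb2_aff2.
etransitivity.
  apply: (@ge0_integral_mscale _ _ R
    (measure_function_pushforward__canonical__measure_function_Measure
      (@leb2 R) (measurable_aff2 b)) setT measurableT _ f mf) => x _; exact: f0.
apply: (congr1 (fun z => (`|a| ^+ 2)%:E * z)%E).
apply: (ge0_integral_pushforward (measurable_aff2 b) (@leb2 R) measurableT mf).
by move=> x _; exact: f0.
Qed.

Lemma intg_aff2 b (f : R * R -> R) : intg2 f ->
  intg2 (f \o aff2 b).
Proof.
move=> /integrableP[mf foo]; apply/integrableP; split.
  by apply: (measurableT_comp mf); exact: measurable_aff2.
have a2 : 0 < `|a| ^+ 2 by rewrite exprn_gt0// normr_gt0.
move: foo; rewrite (ge0_integral_aff2 b); last 2 first.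
- exact: measurableT_comp.
- by [].
move=> h; rewrite -(@lte_pmul2l _ (`|a| ^+ 2)%:E)// ?lte_fin//.
by rewrite gt0_muley ?lte_fin.
Qed.

Lemma Rint_aff2 b (f : R * R -> R) : intg2 f ->
  \int[@leb2 R]_x f x = `|a| ^+ 2 * \int[@leb2 R]_x f (aff2 b x).
Proof.
move=> If; pose h : mR * mR -> \bar R := EFin \o (f \o aff2 b).
have Ih : (@leb2 R).-integrable setT h := intg_aff2 b If.
have mf : measurable_fun setT (EFin \o f) by case/integrableP : If.
have fp := integrable_pos_fin_num measurableT Ih.
have fn := integrable_neg_fin_num measurableT Ih.
have Ep : (\int[@leb2 R]_x (EFin \o f)^\+ x =
    (`|a| ^+ 2)%:E * \int[@leb2 R]_x h^\+ x)%E.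
  rewrite (_ : h^\+%E = (EFin \o f)^\+%E \o aff2 b); last by rewrite !unlock.
  by apply: (ge0_integral_aff2 b (measurable_funepos mf)) => x; exact: funepos_ge0.
have En : (\int[@leb2 R]_x (EFin \o f)^\- x =
    (`|a| ^+ 2)%:E * \int[@leb2 R]_x h^\- x)%E.
  rewrite (_ : h^\-%E = (EFin \o f)^\-%E \o aff2 b); last by rewrite !unlock.
  by apply: (ge0_integral_aff2 b (measurable_funeneg mf)) => x; exact: funeneg_ge0.
have E : (\int[@leb2 R]_x (f x)%:E = (`|a| ^+ 2)%:E * \int[@leb2 R]_x h x)%E.
  rewrite [LHS]integralE [in RHS]integralE Ep En.
  exact: EFin_mulBr.
rewrite /Rintegral E fineM//; exact: integrable_fin_num Ih.
Qed.

End Affine.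

Lemma intg_shift (b : R * R) (f : R * R -> R) : intg2 f ->
  intg2 (fun x => f (x + b)).
Proof.
move=> If; apply: eq_integrable (intg_aff2 (oner_neq0 R) b If) => // x _ /=.
by rewrite /aff2 /aff1 !mul1r.
Qed.

Lemma Rint_shift (b : R * R) (f : R * R -> R) : intg2 f ->
  \int[@leb2 R]_x f (x + b) = \int[@leb2 R]_x f x.
Proof.
move=> If; rewrite (Rint_aff2 (oner_neq0 R) b If) normr1 expr1n mul1r.
by apply: eq_Rintegral => x _ /=; rewrite /aff2 /aff1 !mul1r.
Qed.

Lemma aff2N1 (b x : R * R) : aff2 (-1) b x = b - x.
Proof.
by case: b x => [b1 b2] [x1 x2]; rewrite /aff2 /aff1 /= !mulN1r ![- _ + _]addrC.
Qed.

Lemma intg_reflect (b : R * R) (f : R * R -> R) : intg2 f ->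
  intg2 (fun x => f (b - x)).
Proof.
have n1 : -1 != 0 :> R by rewrite oppr_eq0 oner_neq0.
move=> If; apply: eq_integrable (intg_aff2 n1 b If) => // x _ /=.
by rewrite aff2N1.
Qed.

Lemma Rint_reflect (b : R * R) (f : R * R -> R) : intg2 f ->
  \int[@leb2 R]_x f (b - x) = \int[@leb2 R]_x f x.
Proof.
have n1 : -1 != 0 :> R by rewrite oppr_eq0 oner_neq0.
move=> If; rewrite (Rint_aff2 n1 b If) normrN1 expr1n mul1r.
by apply: eq_Rintegral => x _ /=; rewrite aff2N1.
Qed.

End PlaneMeasure.

(** * Integrability of powers of the norm near the origin and near infinity *)

Section DyadicIntegrability.
Variable R : realType.
Implicit Types (f : R * R -> R) (c r : nat -> R).
Local Notation mR := (measurableTypeR R).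

(* The boxes of radii [r k] will be a dyadic decomposition near 0 or near infinity, where [f] is
   a power of the norm. *)
Lemma intg_cover f c r :
  measurable_fun (setT : set (mR * mR)) (f : _ -> mR) ->
  (forall k, 0 <= c k) -> (forall k, 0 <= r k) ->
  (forall y, f y != 0 -> exists2 k, box (r k) y & `|f y| <= c k) ->
  cvgn (series (fun k => c k * (2 * r k) ^+ 2)) -> intg2 f.
Proof.
move=> mf c0 r0 fc cv; apply/integrableP; split; first exact/measurable_EFinP.
have mcb k : measurable_fun (setT : set (mR * mR))
    (fun y => (c k * \1_(box (r k)) y)%:E).
  by apply/measurable_EFinP; apply: measurable_funM => //;
     apply: measurable_indic; exact: measurable_box.
apply: (@le_lt_trans _ _ (\int[@leb2 R]_y
    (\sum_(0 <= k <oo) (c k * \1_(box (r k)) y)%:E))%E).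
  apply: ge0_le_integral => //.
  - by apply: measurableT_comp => //; exact/measurable_EFinP.
  - by apply: ge0_emeasurable_sum => k x *; rewrite ?lee_fin ?mulr_ge0.
  - move=> y _ /=.
    have cb0 k : (0 <= (c k * \1_(box (r k)) y)%:E)%E by rewrite lee_fin mulr_ge0.
    have [->|fy0] := eqVneq (f y) 0; first by rewrite normr0; exact: nneseries_ge0.
    have [k bk fk] := fc y fy0.
    apply: (@le_trans _ _ (\sum_(0 <= i < k.+1) (c i * \1_(box (r i)) y)%:E)%E).
      rewrite big_nat_recr//= indicE mem_set// mulr1.
      apply: (@le_trans _ _ (c k)%:E); first by rewrite lee_fin.
      by rewrite leeDr// sume_ge0.
    exact: nneseries_lim_ge.
rewrite integral_nneseries//; last by move=> k y _; rewrite lee_fin mulr_ge0.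
rewrite (eq_eseriesr (g := fun k => (c k * (2 * r k) ^+ 2)%:E)); last first.
  move=> k _; under eq_integral do rewrite EFinM.
  rewrite ge0_integralZl//; last 2 first.
  - by apply/measurable_EFinP/measurable_indic; exact: measurable_box.
  - by rewrite lee_fin.
  have mb := measurable_box (r k).
  have ib : (\int[@leb2 R]_x (\1_(box (r k)) x)%:E = ((2 * r k) ^+ 2)%:E)%E.
    by rewrite (integral_indic _ measurableT mb) setIT; exact: leb2_box.
  rewrite [RHS]EFinM; apply: (congr1 (fun z => ((c k)%:E * z)%E)); exact: ib.
rewrite (_ : (\sum_(0 <= k <oo) (c k * (2 * r k) ^+ 2)%:E)%E =
    (limn (series (fun k => c k * (2 * r k) ^+ 2)))%:E) ?ltry//.
rewrite -EFin_lim//; congr (limn _); apply/funext => n.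
by rewrite /series /= sumEFin.
Qed.

Lemma powR_half_cvg (b s : R) : 0 < b < 1 ->
  exists k, s * b ^+ k < 1.
Proof.
move=> /andP[b0 b1].
have : (fun k => s * b ^+ k) @ \oo --> s * 0.
  by apply: cvgMr; apply: cvg_expr; rewrite gtr0_norm.
rewrite mulr0 => /cvgrPdist_lt /(_ 1 ltr01)[N _ hN].
exists N; have := hN N (leqnn N); rewrite /= sub0r normrN.
by apply: le_lt_trans; exact: ler_norm.
Qed.

Lemma powR_exprn (x e : R) k : 0 <= x -> (x ^+ k) `^ e = (x `^ e) ^+ k.
Proof. by move=> x0; rewrite -powR_mulrn// -powRrM mulrC powRrM powR_mulrn ?powR_ge0. Qed.

Lemma measurable_enorm_powR a :
  measurable_fun (setT : set (mR * mR)) (fun y => enorm y `^ a : mR).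
Proof. by apply: (measurableT_comp (measurable_powR a)); exact: measurable_enorm. Qed.

(** Between radii [rad / 2^(k+1)] and [rad / 2^k] the function is at most its value at the inner
    radius; with the area of the box this gives a geometric series of ratio 2^(a - 2). *)
Lemma intg_near (a rad : R) : 0 < a < 2 ->
  intg2 (fun y => \1_(@eball R rad) y * enorm y `^ (- a)).
Proof.
move=> /andP[a0 a2].
have [r0|r0] := leP rad 0.
  rewrite (_ : (fun y => _) = (fun y => 0)); first exact: integrable0.
  apply/funext => y; rewrite indicE memNset ?mul0r// => h.
  by have := enorm_ge0 y; rewrite leNgt (lt_le_trans h).
pose h : R := 2^-1.
have h0 : 0 < h by rewrite /h invr_gt0.
have hk k : 0 < h ^+ k by rewrite exprn_gt0.
pose q := h `^ (- a) * h ^+ 2.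
apply: (@intg_cover _ (fun k => (rad * h ^+ k.+1) `^ (- a)) (fun k => rad * h ^+ k)).
- apply: measurable_funM; last exact: measurable_enorm_powR.
  by apply: measurable_indic; exact: measurable_eball.
- by move=> k; exact: powR_ge0.
- by move=> k; rewrite mulr_ge0 ?ltW.
- move=> y; rewrite indicE; case: (boolP (y \in _)) => [|_]; last by rewrite mul0r eqxx.
  rewrite inE mul1r => yr y0.
  (* At the origin the function is 0, because [powR] sends 0 to 0 for a nonzero exponent. *)
  have e0 : 0 < enorm y.
    rewrite lt_neqAle enorm_ge0 andbT; apply: contraNneq y0 => <-.
    by rewrite powR0// oppr_eq0 gt_eqF.
  have [k hk1 hk2] : exists2 k, rad * h ^+ k.+1 < enorm y & enorm y <= rad * h ^+ k.
    have ex : exists k, rad * h ^+ k.+1 < enorm y.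
      have [|k hkk] := @powR_half_cvg h (rad / enorm y).
        by rewrite h0 /= /h invf_lt1// ltr1n.
      exists k; rewrite mulrAC ltr_pdivrMr// mul1r in hkk.
      apply: le_lt_trans hkk; rewrite ler_pM2l// exprS ler_piMl ?ltW//.
      by rewrite /h invf_lt1// ltr1n.
    case: (ex_minnP ex) => k hkk mk; exists k => //.
    case: k hkk mk => [_ _|k hkk mk]; first by rewrite expr0 mulr1 ltW.
    by rewrite leNgt; apply/negP => /mk; rewrite ltnn.
  exists k; first by apply/boxE; split; apply: le_trans hk2;
    [exact: fst_le_enorm|exact: snd_le_enorm].
  rewrite ger0_norm ?powR_ge0// !powRN lef_pV2 ?posrE ?powR_gt0 ?mulr_gt0//.
  apply: ge0_ler_powR; last exact: ltW.
  - exact: ltW.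
  - by rewrite nnegrE mulr_ge0 ?ltW.
  - by rewrite nnegrE ltW.
- rewrite (_ : (fun k => _) = geometric ((rad * h) `^ (- a) * (2 * rad) ^+ 2) q).
    apply: is_cvg_geometric_series; rewrite ger0_norm; last first.
      by rewrite mulr_ge0 ?powR_ge0 ?exprn_ge0 ?ltW.
    rewrite /q -powR_mulrn ?ltW// -powRD; last by apply/implyP => _; exact: lt0r_neq0.
    rewrite -[X in _ < X](congr1 (fun f : R -> R => f (- a + 2)) (powR1 R)); apply: gt0_ltr_powR.
    - by lra.
    - by rewrite nnegrE ltW.
    - by rewrite nnegrE.
    - by rewrite /h invf_lt1// ltr1n.
  apply/funext => k; rewrite /= /q exprMn (exprS h k) mulrA.
  rewrite powRM ?mulr_ge0 ?ltW// powR_exprn ?ltW// [(_ * h ^+ 2) ^+ k]exprMn.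
  by rewrite [(h ^+ 2) ^+ k]exprAC; ring.
Qed.

(** The mirror image of [intg_near], with boxes of radius [rad * 2^(k+1)] and ratio 2^(2 - b). *)
Lemma intg_far (b rad : R) : 0 < rad -> 2 < b ->
  intg2 (fun y => \1_(~` @eball R rad) y * enorm y `^ (- b)).
Proof.
move=> r0 b2.
have k2 k : 0 < (2 : R) ^+ k by rewrite exprn_gt0.
pose q : R := 2 `^ (- b) * 2 ^+ 2.
apply: (@intg_cover _ (fun k => (rad * 2 ^+ k) `^ (- b)) (fun k => rad * 2 ^+ k.+1)).
- apply: measurable_funM; last exact: measurable_enorm_powR.
  by apply: measurable_indic; apply: measurableC; exact: measurable_eball.
- by move=> k; exact: powR_ge0.
- by move=> k; rewrite mulr_ge0 ?ltW.
- move=> y; rewrite indicE; case: (boolP (y \in _)) => [|_]; last by rewrite mul0r eqxx.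
  rewrite inE mul1r /eball /= => /negP; rewrite -leNgt => ry _.
  have e0 : 0 < enorm y by apply: lt_le_trans ry.
  have [k hk1 hk2] : exists2 k, rad * 2 ^+ k <= enorm y & enorm y <= rad * 2 ^+ k.+1.
    have ex : exists k, enorm y <= rad * 2 ^+ k.+1.
      have [|k hkk] := @powR_half_cvg 2^-1 (enorm y / rad).
        by rewrite invr_gt0 ltr0n /= invf_lt1// ltr1n.
      exists k; move: hkk; rewrite exprVn mulrAC ltr_pdivrMr// mul1r.
      rewrite ltr_pdivrMr// => /ltW/le_trans; apply.
      by rewrite ler_pM2l// exprS ler_peMl ?ltW// ltr1n.
    case: (ex_minnP ex) => k hkk mk; exists k => //.
    case: k hkk mk => [_ _|k hkk mk]; first by rewrite expr0 mulr1.
    by apply: ltW; rewrite ltNge; apply/negP => /mk; rewrite ltnn.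
  exists k; first by apply/boxE; split; apply: le_trans hk2;
    [exact: fst_le_enorm|exact: snd_le_enorm].
  rewrite ger0_norm ?powR_ge0// !powRN lef_pV2 ?posrE ?powR_gt0 ?mulr_gt0//.
  apply: ge0_ler_powR => //; first by lra.
  - by rewrite nnegrE mulr_ge0 ?ltW.
  - by rewrite nnegrE ltW.
- rewrite (_ : (fun k => _) = geometric (rad `^ (- b) * (4 * rad) ^+ 2) q).
    apply: is_cvg_geometric_series; rewrite ger0_norm; last first.
      by rewrite mulr_ge0 ?powR_ge0 ?exprn_ge0.
    rewrite /q -powR_mulrn// -powRD; last by apply/implyP => _; exact: lt0r_neq0.
    rewrite (_ : - b + 2%:R = - (b - 2)); last by ring.
    rewrite powRN invf_lt1 ?powR_gt0// -[X in X < _](congr1 (fun f : R -> R => f (b - 2)) (powR1 R)).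
    by apply: gt0_ltr_powR; rewrite ?nnegrE ?ltr1n//; lra.
  apply/funext => k; rewrite /= /q exprMn (exprS 2 k).
  rewrite powRM ?ltW// powR_exprn// [(_ * 2 ^+ 2) ^+ k]exprMn.
  by rewrite [(2 ^+ 2) ^+ k]exprAC; ring.
Qed.

End DyadicIntegrability.

(** * Divisible sandpiles for finite-range symmetric jump laws *)

Lemma seq_min (T : eqType) (R : realDomainType) (f : T -> R) (s : seq T) (x : T) :
  x \in s -> exists2 z, z \in s & forall y, y \in s -> f z <= f y.
Proof.
elim: s x => // a s ih x _; case: s ih => [_|b s ih].
  by exists a; rewrite ?mem_head// => y; rewrite inE => /eqP ->.
have [z zs hz] := ih b (mem_head _ _).
have [le|lt] := leP (f a) (f z).
  exists a; first exact: mem_head.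
  move=> y; rewrite inE => /predU1P[->//|ys].
  exact: le_trans le (hz y ys).
exists z; first by rewrite inE zs orbT.
move=> y; rewrite inE => /predU1P[->|ys]; [exact: ltW|exact: hz].
Qed.

Lemma cvg_bigsum (R : realType) (I : Type) (s : seq I) (f : nat -> I -> R) (l : I -> R) :
  (forall i, f k i @[k --> \oo] --> l i) ->
  \sum_(i <- s) f k i @[k --> \oo] --> \sum_(i <- s) l i.
Proof.
move=> fl; elim: s => [|i s ih].
  by rewrite big_nil; under eq_cvg do rewrite big_nil; exact: cvg_cst.
by rewrite big_cons; under eq_cvg do rewrite big_cons; exact: cvgD.
Qed.

(** * Polynomial inequalities behind the barrier *)

Section BarrierPolynomials.
Variable R : realType.
Implicit Types Q X t m d : R.

(** Taylor expansion of the cubed positive part with remainder |d|^3. Past the kink, where d > t,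
    the right-hand side equals 2 d^3 - (d - t)^3 and is nonnegative. *)
Lemma cube_incr t d : 0 <= t ->
  Num.max (t - d) 0 ^+ 3 <= t ^+ 3 - 3 * t ^+ 2 * d + 3 * t * d ^+ 2 + `|d| ^+ 3.
Proof.
move=> t0; have [td|td] := leP 0 (t - d).
  have [d0|d0] := leP 0 d.
    have d3 : 0 <= d ^+ 3 by rewrite exprn_ge0.
    have -> : (t - d) ^+ 3 = t ^+ 3 - 3 * t ^+ 2 * d + 3 * t * d ^+ 2 - d ^+ 3 by ring.
    by rewrite lerD2l (@le_trans _ _ 0) ?oppr_le0 ?exprn_ge0.
  have -> : (t - d) ^+ 3 = t ^+ 3 - 3 * t ^+ 2 * d + 3 * t * d ^+ 2 + (- d) ^+ 3 by ring.
  by rewrite ltr0_norm.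
have d0 : 0 <= d by lra.
rewrite expr0n /= ger0_norm//.
have h1 : (d - t) ^+ 3 <= d ^+ 3 by rewrite ler_pXn2r ?nnegrE//; lra.
have h2 : 0 <= d ^+ 3 by rewrite exprn_ge0.
have -> : t ^+ 3 - 3 * t ^+ 2 * d + 3 * t * d ^+ 2 + d ^+ 3 =
  2 * d ^+ 3 - (d - t) ^+ 3 by ring.
rewrite subr_ge0 (le_trans h1)//; lra.
Qed.

(** The polynomial is the factor of [sig2] in [lap_cube]. Well inside the ball [t] is almost Q^2, so
    the first term, close to -3 Q^4, outweighs the two others. *)
Lemma barrier_inner Q X t m : 0 < Q -> 0 < m -> m <= Q / 100 -> 0 <= X ->
  X <= Q / 100 -> t = Q ^+ 2 - X ^+ 2 ->
  - 3 * t ^+ 2 + 3 * t * (2 * X + m) ^+ 2 + m * (2 * X + m) ^+ 3 <= - (29 / 10 * Q ^+ 4).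
Proof.
move=> Q0 m0 mQ X0 XQ tE; set B := 2 * X + m.
have B0 : 0 <= B by rewrite /B; lra.
have BQ : B <= Q / 10 by rewrite /B; lra.
have q1 : 0 <= Q / 10 by lra.
have mq : m <= Q / 10 by lra.
have Xq : X <= Q / 10 by lra.
have B2 : B ^+ 2 <= (Q / 10) ^+ 2 by rewrite ler_pXn2r.
have B3 : B ^+ 3 <= (Q / 10) ^+ 3 by rewrite ler_pXn2r.
have mB3 : m * B ^+ 3 <= Q / 10 * (Q / 10) ^+ 3.
  by apply: ler_pM; [exact: ltW|exact: exprn_ge0| |].
have X2 : X ^+ 2 <= (Q / 10) ^+ 2 by rewrite ler_pXn2r.
have X20 := sqr_ge0 X.
have Q2 : 0 < Q ^+ 2 by rewrite exprn_gt0.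
have e0 : (Q / 10) ^+ 2 = 1 / 100 * Q ^+ 2 by field.
have t0 : 99 / 100 * Q ^+ 2 <= t by rewrite tE; rewrite e0 in X2; clear -X2; lra.
have t1 : t <= Q ^+ 2 by rewrite tE gerBl.
have t00 : 0 <= t by clear -t0 Q2; lra.
have s0 : 0 <= 99 / 100 * Q ^+ 2 by clear -Q2; lra.
have t2 : (99 / 100 * Q ^+ 2) ^+ 2 <= t ^+ 2 by rewrite ler_pXn2r.
have tB : t * B ^+ 2 <= Q ^+ 2 * (Q / 10) ^+ 2.
  by apply: ler_pM; [|exact: sqr_ge0| |].
have -> : - (29 / 10 * Q ^+ 4) = - (29/10) * (Q ^+ 2 * Q ^+ 2) by ring.
have e1 : Q / 10 * (Q / 10) ^+ 3 = 1 / 10000 * (Q ^+ 2 * Q ^+ 2) by field.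
have e2 : Q ^+ 2 * (Q / 10) ^+ 2 = 1 / 100 * (Q ^+ 2 * Q ^+ 2) by field.
have e3 : (99 / 100 * Q ^+ 2) ^+ 2 = 99 / 100 * (99 / 100) * (Q ^+ 2 * Q ^+ 2) by field.
have q0 : 0 < Q ^+ 2 * Q ^+ 2 by rewrite mulr_gt0.
rewrite e1 in mB3; rewrite e2 in tB; rewrite e3 in t2; rewrite -[3 * t * _]mulrA.
move: (Q ^+ 2 * Q ^+ 2) (t ^+ 2) (t * B ^+ 2) (m * B ^+ 3) mB3 tB t2 q0.
by clear; move=> q T U V; lra.
Qed.

(** Neglecting [m], the factor is -15 t^2 + 12 t Q^2, with maximum 12/5 Q^4 at t = 2/5 Q^2; the
    remaining 1/5 absorbs the terms in [m]. What counts is that 26/29 is below 9/10. *)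
Lemma barrier_outer Q X t m : 0 < Q -> 0 < m -> m <= Q / 100 -> 0 <= X ->
  X <= Q + m -> t = Num.max (Q ^+ 2 - X ^+ 2) 0 ->
  - 3 * t ^+ 2 + 3 * t * (2 * X + m) ^+ 2 + m * (2 * X + m) ^+ 3 <= 26 / 10 * Q ^+ 4.
Proof.
move=> Q0 m0 mQ X0 XQ tE; set B := 2 * X + m.
have Q0' := ltW Q0; have m0' := ltW m0.
have B0 : 0 <= B by rewrite /B; lra.
have BQ : B <= 21 / 10 * Q by rewrite /B; lra.
have q3 : 0 <= 21 / 10 * Q by lra.
have B3 : B ^+ 3 <= (21 / 10 * Q) ^+ 3 by rewrite ler_pXn2r.
have mB3 : m * B ^+ 3 <= Q / 100 * (21 / 10 * Q) ^+ 3.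
  by apply: ler_pM; [|exact: exprn_ge0| |].
have Q2 : 0 < Q ^+ 2 by rewrite exprn_gt0.
have q0 : 0 < Q ^+ 2 * Q ^+ 2 by rewrite mulr_gt0.
have e1 : Q / 100 * (21 / 10 * Q) ^+ 3 = 1 / 100 * (21 / 10) * (21 / 10) * (21 / 10) * (Q ^+ 2 * Q ^+ 2) by field.
have -> : 26 / 10 * Q ^+ 4 = 26 / 10 * (Q ^+ 2 * Q ^+ 2) by ring.
rewrite e1 in mB3.
have [XleQ|QltX] := leP X Q; last first.
  have -> : t = 0.
    by rewrite tE; apply/max_idPr; rewrite subr_le0 ler_pXn2r// ltW.
  rewrite expr0n /= mulr0 mulr0 mul0r !add0r.
  by move: (Q ^+ 2 * Q ^+ 2) (m * B ^+ 3) mB3 q0; clear; move=> q V; lra.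
have tE' : t = Q ^+ 2 - X ^+ 2.
  by rewrite tE; apply/max_idPl; rewrite subr_ge0 ler_pXn2r.
have t0 : 0 <= t by rewrite tE le_max lexx orbT.
have tQ : t <= Q ^+ 2 by rewrite tE' gerBl sqr_ge0.
have B2 : B ^+ 2 <= 4 * (Q ^+ 2 - t) + 1 / 20 * Q ^+ 2.
  have -> : Q ^+ 2 - t = X ^+ 2 by rewrite tE'; ring.
  have h1 : X * m <= Q * (Q / 100) by apply: ler_pM.
  have mQ' : m <= Q by lra.
  have h2 : m * m <= Q * (Q / 100) by apply: ler_pM.
  have -> : B ^+ 2 = 4 * X ^+ 2 + 4 * (X * m) + m * m by rewrite /B; ring.
  have e4 : Q * (Q / 100) = Q ^+ 2 / 100 by ring.
  rewrite e4 in h1 h2.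
  by move: (Q ^+ 2) (X ^+ 2) (X * m) (m * m) h1 h2; clear; move=> q x u v; lra.
have tB : t * B ^+ 2 <= t * (4 * (Q ^+ 2 - t) + 1 / 20 * Q ^+ 2).
  by rewrite ler_wpM2l.
(* The bound on [t * B ^+ 2] leads to -15 t^2 + 243/20 t Q^2, and 81/200 Q^2 is the point where this
   is maximal. *)
have sq : 0 <= (t - 81 / 200 * Q ^+ 2) ^+ 2 by rewrite sqr_ge0.
have e6 : t * (4 * (Q ^+ 2 - t) + 1 / 20 * Q ^+ 2) =
  81 / 20 * (t * Q ^+ 2) - 4 * t ^+ 2 by field.
have e7 : (t - 81 / 200 * Q ^+ 2) ^+ 2 = t ^+ 2
  - 81 / 100 * (t * Q ^+ 2) + 81 / 200 * (81 / 200) * (Q ^+ 2 * Q ^+ 2) by field.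
rewrite e6 in tB; rewrite e7 in sq; rewrite -[3 * t * _]mulrA.
move: (Q ^+ 2 * Q ^+ 2) (t ^+ 2) (t * Q ^+ 2) (t * B ^+ 2) (m * B ^+ 3) mB3 tB sq q0.
by clear; move=> q T U V W; lra.
Qed.

End BarrierPolynomials.

(* A symmetric finite-range jump law [p] on the lattice, summed over a finite
   list [S] containing its support; [P] places sites in the plane. *)
Section JumpKernel.
Variables (R : realType) (p : site -> R) (S : seq site).
Hypothesis S_uniq : uniq S.
Hypothesis S_opp : perm_eq (map -%R S) S.
Hypothesis p_supp : forall y, p y != 0 -> y \in S.
Hypothesis p_ge0 : forall y, 0 <= p y.
Hypothesis p_opp : forall y, p (- y) = p y.
Hypothesis p0 : p 0 = 0.
Hypothesis p_sum : \sum_(y <- S) p y = 1.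
Implicit Types (f g v w eta : site -> R) (x y z : site).

Definition lap f z : R := \sum_(y <- S) p y * (f (z + y) - f z).

Lemma eq_lap f g z : f =1 g -> lap f z = lap g z.
Proof. by move=> fg; apply: eq_bigr => y _; rewrite !fg. Qed.

Lemma lapE f z : lap f z = \sum_(y <- S) p y * f (z + y) - f z.
Proof.
rewrite /lap; under eq_bigr do rewrite mulrBr.
by rewrite sumrB -mulr_suml p_sum mul1r.
Qed.

Lemma sum_opp (F : site -> R) : \sum_(y <- S) F (- y) = \sum_(y <- S) F y.
Proof. by rewrite -[RHS](perm_big _ S_opp) /= big_map. Qed.

(** By symmetry of the law the average may be taken over [z - y], the form in which topplings
    distribute mass. *)
Lemma lap_conv f z : lap f z = \sum_(y <- S) p y * f (z - y) - f z.
Proof.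
rewrite lapE; congr (_ - _).
by rewrite -[LHS]sum_opp; under eq_bigr do rewrite p_opp.
Qed.

Lemma lapD f g z : lap (fun x => f x + g x) z = lap f z + lap g z.
Proof. by rewrite /lap -big_split /=; apply: eq_bigr => y _; ring. Qed.

Lemma lapZ (c : R) f z : lap (fun x => c * f x) z = c * lap f z.
Proof. by rewrite /lap mulr_sumr; apply: eq_bigr => y _; ring. Qed.

Lemma lap_shift f h z : lap (fun x => f (x + h)) z = lap f (z + h).
Proof. by apply: eq_bigr => y _; rewrite addrAC. Qed.

Section LegalToppling.
Variables (eta : site -> R) (X : nat -> option site).
Hypothesis eta_ge0 : forall z, 0 <= eta z.
Hypothesis X_legal : legal_toppling p eta X.

Definition odo k x : R := \sum_(0 <= j < k) emitted p eta X j x.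

Lemma emitted_ge0 k x : 0 <= emitted p eta X k x.
Proof.
rewrite /emitted; case: eqP => // Xk.
by have := X_legal.1 k; rewrite Xk /full subr_ge0.
Qed.

(** Emitting m - 1 from [x] adds m - 1 times the Laplacian of the indicator of [x]. At [x] itself
    this removes m - 1 and returns nothing, as [p 0 = 0], so mass 1 stays. *)
Lemma mass_odo k z : mass p eta X k z = eta z + lap (odo k) z.
Proof.
elim: k z => [|k ih] z.
  rewrite /= /lap big1 ?addr0// => y _.
  by rewrite /odo !big_nil subrr mulr0.
have odoS x : odo k.+1 x = odo k x + emitted p eta X k x.
  by rewrite /odo big_nat_recr.
rewrite (eq_lap _ odoS) lapD addrA -ih /= /emitted.
case Xk : (X k) => [x|]; last first.
  by rewrite /lap big1 ?addr0// => y _; rewrite subrr mulr0.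
set m := mass p eta X k x.
have E y : (if Some x == Some y then mass p eta X k y - 1 else 0) =
    (m - 1) * (y == x)%:R.
  rewrite (_ : (Some x == Some y) = (y == x)); last by rewrite eq_sym.
  by case: eqP => [->|_]; rewrite ?mulr1 ?mulr0.
rewrite (eq_lap _ E) lapZ lap_conv /topple.
have -> : \sum_(y <- S) p y * (z - y == x)%:R = p (z - x).
  have [zxS|zxS] := boolP (z - x \in S).
    rewrite (bigD1_seq (z - x))//= subKr eqxx mulr1 big1 ?addr0// => y yzx.
    rewrite (_ : (z - y == x) = false) ?mulr0//; apply: contraNF yzx => /eqP <-.
    by rewrite subKr.
  have -> : p (z - x) = 0 by apply/eqP; apply: contraNT zxS; exact: p_supp.
  rewrite big_seq big1// => y yS; case: eqP => [zy|_]; last by rewrite mulr0.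
  by case/negP : zxS; rewrite -zy subKr.
case: eqP => [->|_]; last by rewrite subr0.
by rewrite (subrr x) p0 -/m /=; ring.
Qed.

(** Least action principle, by induction on topplings. Toppling [z] resets its odometer to
    [eta z - 1] plus the average of the odometer over the jumps from [z]; this is monotone in the
    other values, and for [w] in their place it is at most [w z]. *)
Lemma odo_le_supersol w : (forall z, 0 <= w z) ->
  (forall z, eta z + lap w z <= 1) -> forall k z, odo k z <= w z.
Proof.
move=> w0 hw; elim=> [|k ih] z; first by rewrite /odo big_nil.
rewrite /odo big_nat_recr//= -/(odo k z) /emitted.
case: eqP => [Xk|_]; last by rewrite addr0.
rewrite mass_odo lapE.
apply: (@le_trans _ _ (eta z + \sum_(y <- S) p y * w (z + y) - 1)).
  have : \sum_(y <- S) p y * odo k (z + y) <= \sum_(y <- S) p y * w (z + y).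
    by apply: ler_sum => y _; apply: ler_wpM2l.
  by lra.
by have := hw z; rewrite lapE; lra.
Qed.

Lemma odo_homo x : {homo (fun k => odo k x) : m n / (m <= n)%N >-> m <= n}.
Proof.
apply/nondecreasing_seqP => k.
by rewrite /odo big_nat_recr//= lerDl emitted_ge0.
Qed.

Variable w : site -> R.
Hypothesis w_ge0 : forall z, 0 <= w z.
Hypothesis w_super : forall z, eta z + lap w z <= 1.

Local Notation V := (total_emitted p eta X).

Lemma odo_cvg x : odo k x @[k --> \oo] --> V x.
Proof.
apply: nondecreasing_is_cvgn; first exact: odo_homo.
by exists (w x) => _ [k _ <-]; exact: odo_le_supersol.
Qed.

Lemma total_emitted_ge0 x : 0 <= V x.
Proof.
apply: limr_ge; first exact: odo_cvg.
by apply: nearW => k; apply: sumr_ge0 => j _; exact: emitted_ge0.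
Qed.

Lemma total_emitted_le x : V x <= w x.
Proof.
apply: limr_le; first exact: odo_cvg.
by apply: nearW => k; exact: odo_le_supersol.
Qed.

Lemma mass_cvg z : mass p eta X k z @[k --> \oo] --> eta z + lap V z.
Proof.
under eq_cvg do rewrite mass_odo.
apply: cvgD; first exact: cvg_cst.
rewrite /lap; apply: cvg_bigsum => y; apply: cvgMr.
by apply: cvgB; exact: odo_cvg.
Qed.

(** The site is toppled infinitely often and has mass exactly 1 right after each toppling, so the
    limit of its masses can only be 1. *)
Lemma final_mass_full z k : full (mass p eta X k) z -> eta z + lap V z = 1.
Proof.
move=> fk; apply/eqP; rewrite -subr_eq0 -normr_le0; apply/ler_addgt0Pr => e e0.
rewrite add0r; have /cvgrPdist_lt /(_ e e0)[N _ hN] := @mass_cvg z.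
have [j Nj Xj] := X_legal.2 k z fk N.
have := hN j.+1 (leqW Nj); rewrite /= Xj /topple eqxx.
exact: ltW.
Qed.

Lemma final_mass_le1 z : eta z + lap V z <= 1.
Proof.
have [[k /final_mass_full ->//]|nf] := pselect (exists k, full (mass p eta X k) z).
rewrite -(cvg_lim _ (@mass_cvg z))//; apply: limr_le.
  by apply/cvg_ex; eexists; exact: mass_cvg.
apply: nearW => k; rewrite leNgt; apply/negP => h; apply: nf.
by exists k; exact: ltW.
Qed.

(** A site that emits was full at some time, so [final_mass_full] applies; a site that is never full
    emits nothing. *)
Lemma final_mass_eq1 z : 0 < V z -> eta z + lap V z = 1.
Proof.
move=> Vz; have [[k /final_mass_full ->//]|nf] :=
  pselect (exists k, full (mass p eta X k) z).
suff V0 : V z = 0 by rewrite V0 ltxx in Vz.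
apply/cvg_lim => //; rewrite (_ : (fun _ => _) = fun=> 0); first exact: cvg_cst.
apply/funext => k; rewrite big1// => j _; rewrite /emitted.
case: eqP => // Xj; case: nf; exists j.
by have := X_legal.1 j; rewrite Xj.
Qed.

End LegalToppling.

Variables (P : site -> R * R) (m : R).
Hypothesis PD : forall x y, P (x + y) = P x + P y.
Hypothesis p_range : forall y, p y != 0 -> enorm (P y) <= m.
Hypothesis m_gt0 : 0 < m.
Hypothesis p_e1 : 0 < p (1, 0).

Definition sig2 : R := \sum_(y <- S) p y * enorm (P y) ^+ 2.

(* At a negative minimum of [v - V] on the support of [V], the mean value
   inequality propagates the minimum to the next site in direction (1,0), and
   so on out of the support. *)
Lemma comparison (V v : site -> R) (K : nat) :
  (forall z, 0 <= V z) ->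
  (forall z, 0 < V z -> (`|z.1| <= K)%N /\ (`|z.2| <= K)%N) ->
  (forall z, 0 < V z -> lap v z <= lap V z) ->
  (forall z y, 0 < V z -> p y != 0 -> V (z + y) = 0 -> 0 <= v (z + y)) ->
  forall z, 0 < V z -> V z <= v z.
Proof.
move=> V0 VK Vv v0 z1 Vz1; rewrite -subr_ge0.
pose d z := v z - V z.
pose rng := [seq i%:Z - K%:Z | i <- iota 0 (2 * K).+1%N].
pose s := [seq z <- [seq (a, b) | a <- rng, b <- rng] | 0 < V z].
have rngP (a : int) : (`|a| <= K)%N -> a \in rng.
  move=> aK; apply/mapP; exists (absz (a + K%:Z)); last by lia.
  by rewrite mem_iota; lia.
have sP z : (z \in s) = (0 < V z).
  rewrite mem_filter; apply: andb_idr => /VK[h1 h2].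
  by rewrite [z]surjective_pairing; apply: allpairs_f; exact: rngP.
have [z0 z0s zmin] : exists2 z, z \in s & forall y, y \in s -> d z <= d y.
  by apply: (@seq_min _ _ d s z1); rewrite sP.
apply: le_trans (zmin z1 _); last by rewrite sP.
rewrite leNgt; apply/negP => dneg.
have dmin z y : 0 < V z -> p y != 0 -> d z0 <= d (z + y).
  move=> Vz py; have := V0 (z + y); rewrite le_eqVlt => /predU1P[V0y|Vpos].
    by apply: le_trans (ltW dneg) _; rewrite /d -V0y subr0; exact: v0.
  by apply: zmin; rewrite sP.
have step k : 0 < V (z0 + (k%:Z, 0)) /\ d (z0 + (k%:Z, 0)) = d z0.
  elim: k => [|k [Vk dk]]; first by rewrite addr0 -sP.
  set zk := z0 + (k%:Z, 0) in Vk dk *.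
  have zkS : z0 + (k.+1%:Z, 0) = zk + (1, 0).
    by rewrite /zk -addrA; congr (_ + _); rewrite [RHS]/GRing.add /= /add_pair /= addr0 -addn1 PoszD.
  have sum0 : \sum_(y <- S) p y * (d (zk + y) - d zk) = 0.
    apply/eqP; rewrite eq_le; apply/andP; split; last first.
      apply: sumr_ge0 => y _; have [->|py] := eqVneq (p y) 0; first by rewrite mul0r.
      by rewrite mulr_ge0// subr_ge0 dk; exact: dmin.
    have := Vv zk Vk; rewrite -subr_le0 /lap -sumrB; apply: le_trans.
    by apply: ler_sum => y _; rewrite /d -mulrBr; apply: ler_wpM2l => //; lra.
  have e1S : ((1, 0) : site) \in S by apply: p_supp; rewrite gt_eqF.
  have ge0 y : 0 <= p y * (d (zk + y) - d zk).
    have [->|py] := eqVneq (p y) 0; first by rewrite mul0r.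
    by rewrite mulr_ge0// subr_ge0 dk; exact: dmin.
  have de : d (zk + (1, 0)) = d zk.
    move: sum0; rewrite (bigD1_seq (1, 0))//= => /eqP.
    rewrite paddr_eq0 ?sumr_ge0// => /andP[+ _].
    by rewrite mulf_eq0 gt_eqF//= subr_eq0 => /eqP.
  rewrite zkS de dk; split => //.
  have := V0 (zk + (1, 0)); rewrite le_eqVlt => /predU1P[V0e|//].
  have : 0 <= d (zk + (1, 0)).
    rewrite /d -V0e subr0; apply: v0 => //; first by rewrite gt_eqF.
  by rewrite de dk leNgt dneg.
(* The first coordinate starts at -K or more, so after 2K + 1 steps it exceeds K and the site cannot
   belong to the support. *)
have [] := step (2 * K).+1; move=> /VK[/= h _] _.
have := z0s; rewrite sP => /VK[h' _].
by lia.
Qed.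

Lemma sum_odd (F : site -> R) : (forall y, F (- y) = - F y) ->
  \sum_(y <- S) p y * F y = 0.
Proof.
move=> Fo; have : \sum_(y <- S) p y * F y = - \sum_(y <- S) p y * F y.
  rewrite -[LHS]sum_opp -sumrN; apply: eq_bigr => y _.
  by rewrite p_opp Fo mulrN.
by move=> h; lra.
Qed.

Lemma P0 : P 0 = 0.
Proof. by apply: (addrI (P 0)); rewrite -PD !addr0. Qed.

Lemma PN y : P (- y) = - P y.
Proof. by apply/eqP; rewrite -addr_eq0 -PD addNr P0. Qed.

(** The cross term is odd in the jump and cancels. The constant Laplacian of the squared norm is
    what makes quadratic correctors exact. *)
Lemma lap_sqr z : lap (fun x => enorm (P x) ^+ 2) z = sig2.
Proof.
rewrite /lap /sig2 -[RHS]addr0 -[X in _ + X](@sum_odd (fun y => 2 * dotp (P z) (P y))).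
  by rewrite -big_split /=; apply: eq_bigr => y _; rewrite PD enorm_sqrD; ring.
by move=> y; rewrite PN dotpN mulrN.
Qed.

(** The paraboloid [q], with Laplacian [- del], pays for the excess of [eta] over [eta']. It is
    nonnegative up to radius [R1 + m], the farthest point that one jump from the support can reach,
    and its maximum is the error term. *)
Lemma comparison_q (V v : site -> R) (eta eta' : site -> R) (K : nat) (R1 del : R) :
  0 < sig2 -> 0 <= R1 -> 0 <= del ->
  (forall z, 0 <= V z) ->
  (forall z, 0 < V z -> (`|z.1| <= K)%N /\ (`|z.2| <= K)%N) ->
  (forall z, 0 < V z -> enorm (P z) <= R1) ->
  (forall z, 0 < V z -> eta z + lap V z = 1) ->
  (forall z, 0 < V z -> eta' z + lap v z <= 1) ->
  (forall z, 0 < V z -> eta z - eta' z <= del) ->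
  (forall z, enorm (P z) <= R1 + m -> 0 <= v z) ->
  forall z, 0 < V z -> V z <= v z + del * (R1 + m) ^+ 2 / sig2.
Proof.
move=> s0 R10 del0 V0 VK VR Veq vle ee v0 z Vz.
pose q x := - (del / sig2) * enorm (P x) ^+ 2 + del * (R1 + m) ^+ 2 / sig2.
have ds0 : 0 <= del / sig2 by rewrite divr_ge0// ltW.
have Rm0 : 0 <= R1 + m by rewrite addr_ge0// ltW.
apply: (@le_trans _ _ (v z + q z)); last first.
  rewrite lerD2l /q gerDr mulNr oppr_le0 mulr_ge0// sqr_ge0//.
have lapc (c : R) x : lap (fun=> c) x = 0.
  by rewrite /lap big1// => y _; rewrite subrr mulr0.
have lapq x : lap q x = - del.
  rewrite /q (lapD (fun x => - (del / sig2) * enorm (P x) ^+ 2) (fun=> _)).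
  by rewrite lapc lapZ lap_sqr addr0 mulNr divfK ?gt_eqF.
apply: (@comparison V (fun x => v x + q x) K V0 VK _ _ z) => //.
  move=> x Vx; rewrite lapD lapq.
  by have := Veq x Vx; have := vle x Vx; have := ee x Vx; lra.
move=> x y Vx py _.
have xyR : enorm (P (x + y)) <= R1 + m.
  by rewrite PD (le_trans (enormD _ _))// lerD//; [exact: VR|exact: p_range].
rewrite addr_ge0//; first exact: v0.
rewrite /q addrC mulNr -mulrA [_ ^+ 2 / _]mulrC mulrA -mulrBr mulr_ge0//.
by rewrite subr_ge0 ler_pXn2r ?nnegrE ?enorm_ge0.
Qed.

Section Barrier.
Variable Q : R.
Hypothesis Q_gt0 : 0 < Q.

(** Its cube is the building block of the barrier: it vanishes outside the ball of radius [Q] and is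
    twice continuously differentiable across the circle, which suits a second-order estimate of
    [lap]. *)
Definition depth (z : site) : R := Num.max (Q ^+ 2 - enorm (P z) ^+ 2) 0.

(** A jump changes the squared norm by [d], made of a part linear in the jump, which cancels by
    symmetry, and of the squared jump length. With |d| at most the jump length times 2|z| + m, every
    remaining term carries the squared length and sums to a multiple of [sig2]. *)
Lemma lap_cube z : lap (fun x => depth x ^+ 3) z <=
  sig2 * (- 3 * depth z ^+ 2 + 3 * depth z * (2 * enorm (P z) + m) ^+ 2
          + m * (2 * enorm (P z) + m) ^+ 3).
Proof.
set t := depth z; set B := 2 * enorm (P z) + m.
have t0 : 0 <= t by rewrite /t /depth le_max lexx orbT.
have B0 : 0 <= B by rewrite addr_ge0 ?mulr_ge0 ?enorm_ge0// ltW.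
rewrite /sig2 mulr_suml.
(* Once the vanishing sum of the odd part is added, the inequality can be proved jump by jump. *)
rewrite -[leRHS]addr0 -[X in _ <= _ + X](@sum_odd
  (fun y => - 3 * t ^+ 2 * (2 * dotp (P z) (P y)))); last first.
  by move=> y; rewrite PN dotpN !mulrN.
rewrite -big_split /=; apply: ler_sum => y _.
have [->|py] := eqVneq (p y) 0; first by rewrite !mul0r addr0.
rewrite -mulrA -mulrDr; apply: ler_wpM2l => //.
have ym := p_range py; have y0 := enorm_ge0 (P y).
set e := enorm (P y) in ym y0 *.
pose d := 2 * dotp (P z) (P y) + e ^+ 2.
have dB : `|d| <= e * B.
  rewrite /d (le_trans (ler_normD _ _))// normrM ger0_norm// (ger0_norm (sqr_ge0 e)).
  have := dotp_le (P z) (P y); rewrite -/e /B.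
  have : e ^+ 2 <= e * m by rewrite expr2 ler_wpM2l.
  lra.
have d2 : d ^+ 2 <= e ^+ 2 * B ^+ 2.
  rewrite -exprMn -(real_normK (num_real d)) ler_pXn2r ?nnegrE ?mulr_ge0//.
have d3 : `|d| ^+ 3 <= e ^+ 2 * (m * B ^+ 3).
  apply: (@le_trans _ _ ((e * B) ^+ 3)).
    by rewrite ler_pXn2r ?nnegrE ?mulr_ge0.
  rewrite exprMn mulrA ler_wpM2r ?exprn_ge0// exprSr ler_wpM2l ?sqr_ge0//.
have tzy : depth (z + y) ^+ 3 <= Num.max (t - d) 0 ^+ 3.
  have md0 : 0 <= Num.max (t - d) 0 by rewrite le_max lexx orbT.
  have dz0 : 0 <= depth (z + y) by rewrite le_max lexx orbT.
  have h : Q ^+ 2 - enorm (P z) ^+ 2 <= t by rewrite /t /depth le_max lexx.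
  rewrite ler_pXn2r// /depth PD enorm_sqrD -/e ge_max !le_max lexx orbT andbT.
  by apply/orP; left; rewrite /d; lra.
have cube := cube_incr d t0.
have td2 : 3 * t * d ^+ 2 <= 3 * t * (e ^+ 2 * B ^+ 2) by rewrite ler_wpM2l// mulr_ge0.
have -> : e ^+ 2 * (- 3 * t ^+ 2 + 3 * t * B ^+ 2 + m * B ^+ 3) +
    - 3 * t ^+ 2 * (2 * dotp (P z) (P y)) =
  3 * t * (e ^+ 2 * B ^+ 2) + e ^+ 2 * (m * B ^+ 3) - 3 * t ^+ 2 * d.
  by rewrite /d; ring.
rewrite lerBlDr (le_trans tzy)// (le_trans cube)// -/t.
have -> : 3 * t * (e ^+ 2 * B ^+ 2) + e ^+ 2 * (m * B ^+ 3) - 3 * t ^+ 2 * d + t ^+ 3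
  = t ^+ 3 - 3 * t ^+ 2 * d + 3 * t * (e ^+ 2 * B ^+ 2) + e ^+ 2 * (m * B ^+ 3) by ring.
by rewrite lerD// lerD.
Qed.

End Barrier.

Lemma barrier_step (a : R) : 0 < sig2 -> 0 < a ->
  exists W : site -> R, [/\ forall z, 0 <= W z,
    forall z, 100 * (a + m) + m <= enorm (P z) -> W z = 0,
    forall z, enorm (P z) < a -> lap W z <= -1 &
    forall z, lap W z <= if enorm (P z) < 100 * (a + m) + m then 9 / 10 else 0].
Proof.
move=> s0 a0; set Q := 100 * (a + m).
have Q0 : 0 < Q by rewrite mulr_gt0// addr_gt0.
have m0 := m_gt0.
have QE : Q / 100 = a + m by rewrite /Q mulrC mulKf.
have mQ : m <= Q / 100 by rewrite QE; lra.
have aQ : a <= Q / 100 by rewrite QE; lra.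
(* This normalises the inner bound of [barrier_inner] to -1; the outer bound becomes 26/29, below
   9/10. *)
pose c := (29 / 10 * (sig2 * Q ^+ 4))^-1.
have c0 : 0 < c by rewrite invr_gt0 mulr_gt0// mulr_gt0// exprn_gt0.
have cE : c * (sig2 * Q ^+ 4) = 10 / 29.
  rewrite /c; field; rewrite ?gt_eqF//.
have depth0 z : 0 <= depth Q z by rewrite le_max lexx orbT.
have depthout z : Q <= enorm (P z) -> depth Q z = 0.
  move=> h; apply/max_idPr; rewrite subr_le0 ler_pXn2r ?nnegrE ?enorm_ge0//.
  exact: ltW.
exists (fun z => c * depth Q z ^+ 3); split.
- by move=> z; rewrite mulr_ge0 ?exprn_ge0// ltW.
- by move=> z h; rewrite depthout ?expr0n ?mulr0//; lra.
- move=> z za; rewrite lapZ.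
  have b := lap_cube Q z.
  have dE : depth Q z = Q ^+ 2 - enorm (P z) ^+ 2.
    apply/max_idPl; rewrite subr_ge0 ler_pXn2r ?nnegrE ?enorm_ge0//; first lra.
    exact: ltW.
  have i := barrier_inner Q0 m_gt0 mQ (enorm_ge0 (P z)) (ltW (lt_le_trans za aQ)) dE.
  apply: (@le_trans _ _ (c * (sig2 * - (29 / 10 * Q ^+ 4)))).
    rewrite ler_pM2l// (le_trans b)// ler_pM2l//.
  have -> : c * (sig2 * - (29 / 10 * Q ^+ 4)) = - (29 / 10) * (c * (sig2 * Q ^+ 4)) by ring.
  by rewrite cE; lra.
- move=> z; case: ifPn => [zQ|]; last first.
    rewrite -leNgt => zQ; rewrite lapZ /lap big1 ?mulr0// => y _.
    have [->|py] := eqVneq (p y) 0; first by rewrite mul0r.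
    rewrite !depthout ?subrr ?mulr0//; first lra.
    have h := p_range py; have := enorm_geB (P z) (- P y).
    by rewrite opprK enormN -PD; lra.
  rewrite lapZ; have b := lap_cube Q z.
  have o := barrier_outer Q0 m_gt0 mQ (enorm_ge0 (P z)) (ltW zQ) (erefl _).
  apply: (@le_trans _ _ (c * (sig2 * (26 / 10 * Q ^+ 4)))).
    rewrite ler_pM2l// (le_trans b)// ler_pM2l//.
  have -> : c * (sig2 * (26 / 10 * Q ^+ 4)) = 26 / 10 * (c * (sig2 * Q ^+ 4)) by ring.
  by rewrite cE; lra.
Qed.

(** The factor 100 is the ratio of radii required by the polynomial estimates, and the last [m]
    covers the sites outside the ball from which a jump reaches it. The recursion involves only the
    jump range, so the radius is common to all meshes. *)
Fixpoint barrier_rad (J : nat) (a : R) : R :=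
  if J is J'.+1 then barrier_rad J' (100 * (a + m) + m) else a.

(* Each step trades a source of height [lambda] on a ball for one of height
   [9/10 lambda] on a larger ball. *)
Lemma barrier (J : nat) (a : R) : 0 < sig2 -> 0 < a ->
  exists W : site -> R, [/\ forall z, 0 <= W z,
    forall z, barrier_rad J a <= enorm (P z) -> W z = 0 &
    forall z, (if enorm (P z) < a then (10 / 9) ^+ J else 0) + lap W z <= 1].
Proof.
move=> s0; elim: J a => [|J ih] a a0.
  exists (fun=> 0); split => // z.
  rewrite /lap big1 => [|y _]; last by rewrite subrr mulr0.
  by case: ifP; rewrite ?expr0 addr0.
have [|W' [W'0 W'out W'le]] := ih (100 * (a + m) + m).
  by rewrite !(addr_gt0, mulr_gt0).
have [W [W0 Wout Win Wle]] := barrier_step s0 a0.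
have l0 : 0 < (10 / 9 : R) ^+ J.+1 by rewrite exprn_gt0.
have rad_le b I : 0 < b -> b <= barrier_rad I b.
  elim: I b => //= I ihI b b0; apply: le_trans (ihI _ _).
    by have := m_gt0; lra.
  by have := m_gt0; lra.
exists (fun z => (10 / 9) ^+ J.+1 * W z + W' z); split.
- by move=> z; rewrite addr_ge0// mulr_ge0// ltW.
- move=> z h; rewrite W'out// Wout ?mulr0 ?addr0//; apply: le_trans h.
  by apply: rad_le; have := m_gt0; lra.
- move=> z; rewrite lapD lapZ addrA; apply: le_trans (W'le z); rewrite lerD2r.
  have lE : (10 / 9 : R) ^+ J.+1 * (9 / 10) = (10 / 9) ^+ J.
    by rewrite exprS; field.
  have hz := Wle z; case: ifPn => za.
    rewrite ifT; last by have := m_gt0; lra.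
    have h1 := Win z za.
    apply: (@le_trans _ _ 0); last by rewrite exprn_ge0.
    by rewrite -[X in X + _]mulr1 -mulrDr pmulr_rle0//; lra.
  rewrite add0r; move: hz; case: ifPn => _ hz.
    by rewrite -lE ler_pM2l.
  by rewrite pmulr_rle0.
Qed.

End JumpKernel.

(** * The jump laws of the truncated stable sandpile *)

Definition irange (K : nat) : seq int := [seq i%:Z - K%:Z | i <- iota 0 (2 * K).+1%N].

Definition ibox (K : nat) : seq site := [seq (a, b) | a <- irange K, b <- irange K].

Lemma mem_irange K a : (a \in irange K) = (absz a <= K)%N.
Proof.
apply/mapP/idP => [[i]|aK]; first by rewrite mem_iota => h ->; lia.
by exists (absz (a + K%:Z)); rewrite ?mem_iota; lia.
Qed.

Lemma mem_ibox K z : (z \in ibox K) = (absz z.1 <= K)%N && (absz z.2 <= K)%N.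
Proof.
rewrite -!mem_irange; apply/idP/andP => [|[h1 h2]].
  by case/allpairsP => -[a b] /= [ha hb ->].
by rewrite [z]surjective_pairing; apply: allpairs_f.
Qed.

Lemma uniq_irange K : uniq (irange K).
Proof. by rewrite map_inj_uniq ?iota_uniq// => i j; lia. Qed.

Lemma uniq_ibox K : uniq (ibox K).
Proof.
by apply: allpairs_uniq; [exact: uniq_irange|exact: uniq_irange|case=> a b [c d]].
Qed.

Lemma perm_ibox_opp K : perm_eq (map -%R (ibox K)) (ibox K).
Proof.
apply: uniq_perm.
- by rewrite map_inj_uniq ?uniq_ibox//; exact: oppr_inj.
- exact: uniq_ibox.
- move=> z; apply/mapP/idP => [[y yS ->]|zS].
    by move: yS; rewrite !mem_ibox /= !abszN.
  by exists (- z); rewrite ?opprK// mem_ibox /= !abszN -mem_ibox.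
Qed.

Lemma fsbig_nonzero (R : realType) (F : site -> R) (S : seq site) : uniq S ->
  F 0 = 0 -> (forall z, F z != 0 -> z \in S) ->
  \sum_(z \in [set z : site | z != 0]) F z = \sum_(z <- S) F z.
Proof.
move=> uS F0 FS; rewrite fsbig_supp; apply: fsbig_fwiden => //.
- by move=> z [_ /= Fz]; apply: FS; exact/eqP.
- move=> z [_ /= h]; apply/eqP/negPn/negP => Fz; apply: h; split; last exact/eqP.
  by apply: contra_neq Fz => ->.
Qed.

Section Cells.
Variables (R : realType) (n : nat).
Hypothesis n_gt0 : (0 < n)%N.
Local Notation mR := (measurableTypeR R).
Local Notation pt := (pt R n).

Lemma nR_gt0 : 0 < n%:R :> R. Proof. by rewrite ltr0n. Qed.

Lemma ptD x y : pt (x + y) = pt x + pt y.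
Proof. by rewrite /pt /= !intrD !mulrDl. Qed.

Lemma pt0 : pt 0 = 0.
Proof. by rewrite /pt /= !mul0r. Qed.

Lemma ptN x : pt (- x) = - pt x.
Proof. by apply/eqP; rewrite -addr_eq0 -ptD addNr pt0. Qed.

Lemma enorm_ptE z : n%:R * enorm (pt z) = enorm ((z.1%:~R : R), (z.2%:~R : R)).
Proof.
have -> : pt z = (n%:R^-1 * z.1%:~R, n%:R^-1 * z.2%:~R) by rewrite /pt ![n%:R^-1 * _]mulrC.
rewrite (enorm_scale n%:R^-1 ((z.1%:~R : R), (z.2%:~R : R))).
by rewrite ger0_norm ?invr_ge0 ?ler0n// mulVKf// gt_eqF ?nR_gt0.
Qed.

(* Half-open cells partition the plane; the closed cells of [F_] differ from them by null sets. *)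
Definition halfcell (z : site) : set (R * R) := [set x | nearest n x = z].

Lemma halfcellE z : halfcell z =
  `[(pt z).1 - (2 * n%:R)^-1, (pt z).1 + (2 * n%:R)^-1[%classic `*`
  `[(pt z).2 - (2 * n%:R)^-1, (pt z).2 + (2 * n%:R)^-1[%classic.
Proof.
apply/seteqP; split => x.
  move=> /esym/(nearestP _ _ n_gt0) [/andP[h1 h2] /andP[h3 h4]].
  by move: h1 h2 h3 h4 => /= h1 h2 h3 h4; split; rewrite /= in_itv /=; apply/andP; split; lra.
move=> [/=]; rewrite !in_itv /= => /andP[h1 h2] /andP[h3 h4].
by apply/esym/(nearestP _ _ n_gt0); split; apply/andP; split=> /=; lra.
Qed.

Lemma measurable_halfcell z : measurable (halfcell z : set (mR * mR)).
Proof. by rewrite halfcellE; apply: measurableX; exact: measurable_itv. Qed.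

Lemma cellE z : @cell R n z =
  `[(pt z).1 - (2 * n%:R)^-1, (pt z).1 + (2 * n%:R)^-1]%classic `*`
  `[(pt z).2 - (2 * n%:R)^-1, (pt z).2 + (2 * n%:R)^-1]%classic.
Proof.
by apply/seteqP; split => x; rewrite /cell /= !in_itv /= !ler_distl.
Qed.

Lemma measurable_cell z : measurable (@cell R n z : set (mR * mR)).
Proof. by rewrite cellE; apply: measurableX; exact: measurable_itv. Qed.

Lemma leb2_cell z (A : set (R * R)) : measurable (A : set (mR * mR)) ->
  leb2 (cell n z `&` A) = leb2 (halfcell z `&` A).
Proof.
move=> mA.
have mc := measurable_cell z; have mh := measurable_halfcell z.
pose L1 : set (mR * mR) := [set (pt z).1 + (2 * n%:R)^-1] `*` setT.
pose L2 : set (mR * mR) := setT `*` [set (pt z).2 + (2 * n%:R)^-1].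
have m1 : measurable L1 by apply: measurableX => //; exact: measurable_set1.
have m2 : measurable L2 by apply: measurableX => //; exact: measurable_set1.
have z1 : leb2 L1 = 0%E.
  by rewrite leb2X// lebesgue_measure_set1 mul0e.
have z2 : leb2 L2 = 0%E.
  by rewrite leb2X// lebesgue_measure_set1 mule0.
apply/eqP; rewrite eq_le; apply/andP; split; last first.
  apply: le_measure; rewrite ?inE; try exact: measurableI.
  apply: setSI; rewrite halfcellE cellE => x [] /=; rewrite !in_itv /=.
  by move=> /andP[h1 h2] /andP[h3 h4]; rewrite h1 h3 !ltW.
apply: (@le_trans _ _ (leb2 ((halfcell z `&` A) `|` (L1 `|` L2)))).
  apply: le_measure; rewrite ?inE.
  - exact: measurableI.
  - by apply: measurableU; [exact: measurableI|exact: measurableU].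
  - move=> x [cx Ax].
    have [e1|e1] := eqVneq x.1 ((pt z).1 + (2 * n%:R)^-1); first by right; left.
    have [e2|e2] := eqVneq x.2 ((pt z).2 + (2 * n%:R)^-1); first by right; right.
    left; split => //; move: cx; rewrite cellE halfcellE => -[/=].
    rewrite !in_itv /= => /andP[a1 a2] /andP[b1 b2].
    by rewrite a1 b1 !lt_neqAle a2 b2 e1 e2.
apply: le_trans (measureU2 _ _ _) _; [exact: measurableI|exact: measurableU|].
rewrite -[leRHS]adde0; apply: leeD => //.
apply: le_trans (measureU2 _ m1 m2) _.
by rewrite -[leRHS]adde0; apply: leeD; [rewrite -z1|rewrite -z2].
Qed.

Lemma nearest_dist (x : R * R) : enorm (x - pt (nearest n x)) <= n%:R^-1.
Proof.
have [/andP[h1 h2] /andP[h3 h4]] := (nearestP x (nearest n x) n_gt0).1 erefl.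
apply: le_trans (enorm_le _) _; rewrite /=.
have e : n%:R^-1 = (2 * n%:R)^-1 + (2 * n%:R)^-1 :> R.
  by rewrite invfM -mulrDl; field; rewrite gt_eqF ?nR_gt0.
rewrite e; apply: lerD; rewrite ler_distl; move: h1 h2 h3 h4 => /= *; apply/andP; split; lra.
Qed.

Lemma nearest_pt z : nearest n (pt z) = z.
Proof.
apply/esym/(nearestP _ _ n_gt0).
have h : 0 < (2 * n%:R)^-1 :> R by rewrite invr_gt0 mulr_gt0 ?nR_gt0.
by rewrite !gtrBl !lerDl h ltW.
Qed.

Lemma nearest_add_pt (x : R * R) z : nearest n (x + pt z) = nearest n x + z.
Proof.
apply/esym/(nearestP _ _ n_gt0).
have [/andP[h1 h2] /andP[h3 h4]] := (nearestP x (nearest n x) n_gt0).1 erefl.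
rewrite ptD; move: h1 h2 h3 h4 => /= *; split; apply/andP; split; lra.
Qed.

Lemma measurable_box_ext (f : site -> R) :
  measurable_fun (setT : set (mR * mR)) (box_ext n f : _ -> mR).
Proof.
move=> _ B mB; rewrite setTI.
rewrite (_ : _ @^-1` B = \bigcup_z (if f z \in B then halfcell z else set0)).
  apply: countable_bigcupT_measurable; first exact: countableP.
  by move=> z; case: ifP => _ //; exact: measurable_halfcell.
apply/seteqP; split => x.
  by move=> Bx; exists (nearest n x) => //; rewrite ifT// inE.
by move=> [z _] /=; case: ifPn => // zB hx; rewrite /box_ext hx; exact: set_mem.
Qed.

Lemma index_bound (z : site) (b : R) : enorm (pt z) <= b ->
  z \in ibox (Num.truncn (n%:R * b)).+1.
Proof.
move=> zb; rewrite mem_ibox.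
have key (a : int) : `|a%:~R / n%:R| <= b -> (absz a <= (Num.truncn (n%:R * b)).+1)%N.
  rewrite normrM (ger0_norm (x := n%:R^-1)) ?invr_ge0 ?ler0n// ler_pdivrMr ?nR_gt0// => h.
  rewrite -(ler_nat R); apply: ltW; apply: le_lt_trans (truncnS_gt _).
  by rewrite natr_absz intr_norm mulrC.
apply/andP; split; apply: key; apply: le_trans zb.
  exact: (fst_le_enorm (pt z)).
exact: (snd_le_enorm (pt z)).
Qed.

(** On [A] the extension is a finite combination of indicators of half-open cells, so lattice sums
    weighted by areas of closed cells are planar integrals. *)
Lemma Rint_box_ext (A : set (R * R)) (f : site -> R) (S : seq site) :
  measurable (A : set (mR * mR)) -> (leb2 A < +oo)%E -> uniq S ->
  (forall x, A x -> nearest n x \in S) ->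
  intg2 (fun x => \1_A x * box_ext n f x) /\
  \int[@leb2 R]_x (\1_A x * box_ext n f x) =
    \sum_(z <- S) f z * fine (leb2 (cell n z `&` A)).
Proof.
move=> mA fA uS AS.
have mI z : measurable (halfcell z `&` A : set (mR * mR)).
  by apply: measurableI => //; exact: measurable_halfcell.
have fI z : (leb2 (halfcell z `&` A) < +oo)%E.
  apply: le_lt_trans fA; apply: le_measure; rewrite ?inE//.
have E x : \1_A x * box_ext n f x = \sum_(z <- S) f z * \1_(halfcell z `&` A) x.
  rewrite indicE; case: (boolP (x \in A)) => xA; [move/set_mem: xA => xA|].
    rewrite mul1r (bigD1_seq (nearest n x)) ?AS//= big1 ?addr0 => [|z zx].
      by rewrite indicE mem_set ?mulr1//; split.
    rewrite indicE memNset ?mulr0// => -[/= h _].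
    by rewrite h eqxx in zx.
  rewrite mul0r big1// => z _; rewrite indicE memNset ?mulr0// => -[_].
  by move=> xA'; move: xA; rewrite mem_set.
have Iz z : intg2 (fun x => f z * \1_(halfcell z `&` A) x).
  by apply: intgZ; apply: intg_indicT; [exact: mI|exact: fI].
split.
  apply: eq_integrable (intg_sum S Iz) => // x _ /=; by rewrite E.
under eq_Rintegral do rewrite E.
rewrite Rint_sum//; apply: eq_bigr => z _.
rewrite RintegralZl//; last by apply: intg_indicT; [exact: mI|exact: fI].
congr (_ * _); rewrite leb2_cell// /Rintegral; congr fine.
by rewrite (integral_indic _ measurableT (mI z)) setIT.
Qed.

End Cells.

(** * The jump law at a fixed mesh *)

Section JumpLawFacts.
Variables (R : realType) (alpha r M : R) (n : nat).
Hypothesis alpha_gt1 : 1 < alpha.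
Hypothesis alpha_lt2 : alpha < 2.
Hypothesis r_gt0 : 0 < r.
Hypothesis r_ltM : r < M.
Hypothesis M_gt1 : 1 < M.
Hypothesis n_gt0 : (0 < n)%N.
Hypothesis k_gt0 : 0 < k_ alpha r M n.
Local Notation mR := (measurableTypeR R).
Local Notation pt := (pt R n).
Local Notation F := (F_ r M n).
Local Notation p := (p_ alpha r M n).

Definition annulus : set (R * R) := eball M `\` eball (r / n%:R).

Lemma measurable_annulus : measurable (annulus : set (mR * mR)).
Proof. by apply: measurableD; exact: measurable_eball. Qed.

Lemma annulus_lty : (leb2 annulus < +oo)%E.
Proof.
apply: le_lt_trans (leb2_eball_lty M); apply: le_measure; rewrite ?inE.
- exact: measurable_annulus.
- exact: measurable_eball.
- by move=> x [].
Qed.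

(** A cell that meets the ball of radius [M] has its centre within [M + 1 / n]; the radius [M + 1]
    serves every [n] and also covers the four neighbours. *)
Definition Sn : seq site := ibox (Num.truncn (n%:R * (M + 1))).+1.

Lemma invn_le1 : n%:R^-1 <= 1 :> R.
Proof. by rewrite invf_le1 ?ltr0n// ler1n. Qed.

Lemma nearest_annulus x : annulus x -> nearest n x \in Sn.
Proof.
move=> [xM _]; apply: index_bound => //.
have h := nearest_dist n_gt0 x; have := enorm_geB (pt (nearest n x)) x.
rewrite -(enormN (_ - _)) opprB; move: xM; rewrite /eball /=; have := invn_le1; lra.
Qed.

Lemma F_ge0 z : 0 <= F z.
Proof. by rewrite mulr_ge0 ?exprn_ge0 ?ler0n// fine_ge0. Qed.

Lemma F_supp z : F z != 0 -> enorm (pt z) <= M + 1.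
Proof.
apply: contraNT; rewrite -ltNge => zM; rewrite /F_ leb2_cell//; last exact: measurable_annulus.
rewrite (_ : _ `&` _ = set0) ?measure0 ?mulr0//; apply/seteqP; split => // x [hx [xM _]].
move: hx; rewrite /halfcell /= => hx.
have h := nearest_dist n_gt0 x; have := enorm_geB (pt (nearest n x)) x.
rewrite -(enormN (_ - _)) opprB hx; move: h xM; rewrite hx /eball /=; have := invn_le1; lra.
Qed.

Lemma F_opp z : F (- z) = F z.
Proof.
rewrite /F_; congr (_ * _); have mA := measurable_annulus.
have mc y : measurable (cell n y `&` annulus : set (mR * mR)).
  by apply: measurableI; [exact: measurable_cell|exact: mA].
have n1 : -1 != 0 :> R by rewrite oppr_eq0 oner_neq0.
rewrite (leb2_aff2 n1 0 (mc (- z))); congr fine.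
rewrite /= /mscale /= normrN1 expr1n mul1e /pushforward; congr (leb2 _).
apply/seteqP; split => x; rewrite /preimage /=.
  rewrite aff2N1 sub0r; move=> [[c1 c2] [a1 a2]]; rewrite ptN in c1 c2.
  split; first by split; [move: c1|move: c2]; rewrite /= -opprD normrN.
  by split; [move: a1|move: a2]; rewrite /eball /= enormN.
move=> [[c1 c2] [a1 a2]]; rewrite aff2N1 sub0r; split.
  by rewrite /cell /= !mulrNz !mulNr -!opprD !normrN.
by split; [move: a1|move: a2]; rewrite /eball /= enormN.
Qed.

Lemma sum_F (f : site -> R) : \sum_(z <- Sn) F z * f z =
  n%:R ^+ 2 * \int[@leb2 R]_x (\1_annulus x * box_ext n f x).
Proof.
have [_ ->] := Rint_box_ext n_gt0 f measurable_annulus annulus_lty (uniq_ibox _)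
  (@nearest_annulus).
rewrite mulr_sumr; apply: eq_bigr => z _; rewrite /F_; ring.
Qed.

Definition nbrs : seq site := [:: (1, 0); (-1, 0); (0, 1); (0, -1)].

Lemma nbrsP z : (enorm (pt z) == n%:R^-1) = (z \in nbrs).
Proof.
have n0 := nR_gt0 R n_gt0.
rewrite -(inj_eq (mulfI (lt0r_neq0 n0))) enorm_ptE// divff ?lt0r_neq0//.
rewrite -(@eqrXn2 _ 2%N) ?enorm_ge0// enorm_sqr expr1n /=.
rewrite -!rmorphXn -rmorphD /= -[1]/(1%:~R) eqr_int.
case: z => a b /=; rewrite /nbrs !inE !xpair_eqE.
apply/idP/idP; last by case/or4P => /andP[/eqP -> /eqP ->].
move=> /eqP h.
have ha : (`|a| <= 1)%N by nia.
have hb : (`|b| <= 1)%N by nia.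
by lia.
Qed.

Lemma e1_in_Sn : ((1, 0) : site) \in Sn.
Proof. by rewrite mem_ibox. Qed.

Lemma nbrs_Sn (z : site) : z \in nbrs -> z \in Sn.
Proof.
move=> zn; rewrite /Sn mem_ibox; move: zn; case: z => a b.
rewrite /nbrs !inE !xpair_eqE /= => /or4P[] /andP[/eqP -> /eqP ->] //.
Qed.

Local Notation w := (jump_weight alpha r M n).

Lemma jump_weight_ge0 z : 0 <= w z.
Proof.
apply: addr_ge0; first by apply: mulr_ge0; [exact: ltW|exact: ler0n].
by apply: divr_ge0; [exact: F_ge0|exact: powR_ge0].
Qed.

Lemma jump_weight_supp z : w z != 0 -> enorm (pt z) <= M + 1.
Proof.
apply: contraNT; rewrite -ltNge => zM; rewrite /jump_weight.
have -> : F z = 0 by apply/eqP; apply: contraTT zM => /F_supp; rewrite -leNgt.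
rewrite mul0r addr0 (_ : (enorm _ == _) = false) ?mulr0//.
by apply: contraTF zM => /eqP ->; rewrite -leNgt (le_trans invn_le1)//; have := M_gt1; lra.
Qed.

Lemma jump_weight0 : w 0 = 0.
Proof.
rewrite /jump_weight nbrsP pt0 enorm0 !mulr0 powR0; last by rewrite gt_eqF//; have := alpha_gt1; lra.
by rewrite invr0 mulr0 addr0.
Qed.

Lemma jump_weight_sum :
  \sum_(z \in [set z : site | z != 0]) w z = \sum_(z <- Sn) w z.
Proof.
apply: fsbig_nonzero; [exact: uniq_ibox|exact: jump_weight0|].
by move=> z /jump_weight_supp; exact: index_bound.
Qed.

Lemma jump_weight_e1 : 0 < w (1, 0).
Proof.
rewrite ltr_pwDl ?divr_ge0 ?F_ge0 ?powR_ge0//.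
by rewrite (nbrsP (1, 0)) mulr1.
Qed.

Lemma c_gt0 : 0 < c_ alpha r M n.
Proof.
rewrite invr_gt0 jump_weight_sum (bigD1_seq _ e1_in_Sn (uniq_ibox _)) /=.
by rewrite ltr_pwDl ?jump_weight_e1// sumr_ge0// => z _; exact: jump_weight_ge0.
Qed.

Lemma p_E z : p z = c_ alpha r M n * w z.
Proof. by rewrite /p_; case: eqP => // ->; rewrite jump_weight0 mulr0. Qed.

Lemma pn_ge0 z : 0 <= p z.
Proof. by rewrite p_E mulr_ge0 ?jump_weight_ge0// ltW// c_gt0. Qed.

Lemma pn0 : p 0 = 0.
Proof. by rewrite /p_ eqxx. Qed.

Lemma pn_range z : p z != 0 -> enorm (pt z) <= M + 1.
Proof. by rewrite p_E mulf_eq0 negb_or => /andP[_ /jump_weight_supp]. Qed.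

Lemma pn_supp z : p z != 0 -> z \in Sn.
Proof. by move/pn_range; exact: index_bound. Qed.

Lemma pn_opp z : p (- z) = p z.
Proof.
rewrite !p_E /jump_weight F_opp ptN enormN//.
Qed.

Lemma pn_sum : \sum_(z <- Sn) p z = 1.
Proof.
under eq_bigr do rewrite p_E.
rewrite -mulr_sumr -jump_weight_sum mulVf// -[X in X != 0]invrK invr_eq0.
by rewrite gt_eqF// c_gt0.
Qed.

Lemma pn_e1 : 0 < p (1, 0).
Proof. by rewrite p_E mulr_gt0 ?jump_weight_e1// c_gt0. Qed.

(** Separates the four neighbours from an integral over the annulus, the form in which rescaling and
    dominated convergence apply. *)
Lemma sum_jump (f : site -> R) : \sum_(z <- Sn) p z * f z =
  c_ alpha r M n * (k_ alpha r M n * \sum_(z <- nbrs) f z + n%:R `^ (- alpha) *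
    \int[@leb2 R]_x (\1_annulus x *
      box_ext n (fun z => f z / enorm (pt z) `^ (2 + alpha)) x)).
Proof.
under eq_bigr do rewrite p_E -mulrA.
rewrite -mulr_sumr; congr (_ * _); rewrite /jump_weight.
under eq_bigr do rewrite mulrDl.
rewrite big_split /=; congr (_ + _).
  under eq_bigr do rewrite -mulrA; rewrite -mulr_sumr; congr (_ * _).
  transitivity (\sum_(z <- Sn | z \in nbrs) f z).
    rewrite [RHS]big_mkcond /=; apply: eq_bigr => z _; rewrite nbrsP.
    by case: ifP => _; rewrite ?mul1r ?mul0r.
  rewrite -[LHS]big_filter; apply: perm_big; apply: uniq_perm.
  - by rewrite filter_uniq ?uniq_ibox.
  - by [].
  - by move=> z; rewrite mem_filter andb_idr//; exact: nbrs_Sn.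
have n0 := nR_gt0 R n_gt0.
transitivity (n%:R `^ (- (2 + alpha)) *
  \sum_(z <- Sn) F z * (f z / enorm (pt z) `^ (2 + alpha))).
  rewrite mulr_sumr; apply: eq_bigr => z _.
  rewrite powRM ?enorm_ge0 ?ler0n// invfM powRN; ring.
rewrite sum_F mulrA; congr (_ * _).
rewrite -(powR_mulrn 2 (ltW n0)) -powRD; last by rewrite lt0r_neq0 ?implybT.
by congr (_ `^ _); ring.
Qed.

(** This identity is the purpose of [k_]: the neighbour term restores exactly the second moment lost
    when the kernel is replaced by its values at cell centres. *)
Lemma sig2E : n%:R `^ alpha * sig2 p Sn (pt) =
  c_ alpha r M n * \int[@leb2 R]_(y in eball M) (enorm y `^ alpha)^-1.
Proof.
have n0 := nR_gt0 R n_gt0.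
have na : n%:R `^ alpha * n%:R `^ (- alpha) = 1 :> R.
  by rewrite powRN mulfV// gt_eqF// powR_gt0.
rewrite /sig2 sum_jump mulrCA; congr (_ * _).
rewrite mulrDr [n%:R `^ alpha * (n%:R `^ _ * _)]mulrA na mul1r.
have nb : \sum_(z <- nbrs) enorm (pt z) ^+ 2 = 4 * n%:R ^- 2.
  have e z : z \in nbrs -> enorm (pt z) ^+ 2 = n%:R ^- 2.
    by rewrite -nbrsP => /eqP ->; rewrite exprVn.
  by rewrite /nbrs !big_cons big_nil !e//; ring.
rewrite nb.
have Fsum : \sum_(z \in [set z : site | z != 0]) F z / enorm (pt z) `^ alpha =
    n%:R ^+ 2 * \int[@leb2 R]_x (\1_annulus x * box_ext n (fun z => (enorm (pt z) `^ alpha)^-1) x).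
  rewrite -sum_F; apply: fsbig_nonzero; first exact: uniq_ibox.
    by rewrite pt0 enorm0 powR0 ?invr0 ?mulr0// gt_eqF//; have := alpha_gt1; lra.
  move=> z; rewrite mulf_eq0 negb_or => /andP[/F_supp h _]; exact: index_bound h.
set I0 := (RHS).
have kE : n%:R `^ alpha * (k_ alpha r M n * (4 * n%:R ^- 2)) =
    I0 - \int[@leb2 R]_x (\1_annulus x * box_ext n (fun z => (enorm (pt z) `^ alpha)^-1) x).
  rewrite /k_ Fsum mulKf ?expf_neq0 ?lt0r_neq0//.
  have e : n%:R `^ alpha * n%:R `^ (2 - alpha) = n%:R ^+ 2 :> R.
    rewrite -powRD ?lt0r_neq0 ?implybT// -powR_mulrn ?ler0n//; congr (_ `^ _); ring.
  rewrite -/I0; set J := (X in I0 - X).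
  transitivity (n%:R `^ alpha * n%:R `^ (2 - alpha) * n%:R ^- 2 * (I0 - J)); first by field; exact: lt0r_neq0.
  by rewrite e divff ?mul1r// expf_neq0// lt0r_neq0.
rewrite kE -[RHS]addr0 -addrA; congr (_ + _).
apply/eqP; rewrite addrC subr_eq0; apply/eqP; apply: eq_Rintegral => x _; congr (_ * _).
rewrite /box_ext; set e := enorm _.
(* On the cell of the origin both sides are 0, since the inverse of 0 is 0. *)
have [->|e0] := eqVneq e 0; first by rewrite expr0n mul0r powR0 ?invr0// gt_eqF//; have := alpha_gt1; lra.
rewrite powRD ?e0 ?implybT// invfM powR_mulrn ?enorm_ge0// mulrA divff ?mul1r//.
by rewrite expf_neq0.
Qed.

End JumpLawFacts.

(** * Test functions *)

Section SmoothCalculus.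
Variable R : realType.
Implicit Types (f g phi : R * R -> R) (x y h : R * R) (b : bool).

Definition dir b : R * R := if b then e1 R else e2 R.

Lemma pair_eqR x y : x.1 = y.1 -> x.2 = y.2 -> x = y.
Proof. by case: x y => a c [a' c'] /= -> ->. Qed.

(** The derivative is an argument, so that the derivative of a difference can be recognised as the
    difference of the derivative. *)
Definition pderiv b f df := forall x, is_derive x (dir b) (f : R * R -> R^o) (df x : R^o).

Definition dif h f x : R := f (h + x) - f x.

Lemma pderiv_dif b f df h : pderiv b f df -> pderiv b (dif h f) (dif h df).
Proof.
move=> H x; apply: is_deriveB; last exact: H.
have [D1 D2] := H (h + x).
have e : (fun s : R => s^-1 *: (((fun z => f (h + z) : R^o) \o shift x) (s *: dir b) - f (h + x))) =
   (fun s : R => s^-1 *: (((f : R * R -> R^o) \o shift (h + x)) (s *: dir b) - f (h + x))).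
  by apply/funext => s /=; rewrite addrCA.
split; first by rewrite /derivable e.
by rewrite /derive e.
Qed.

Lemma pderiv_slice b f df x (t : R) : pderiv b f df ->
  is_derive t (1 : R) (fun s : R => f (s *: dir b + x) : R) (df (t *: dir b + x) : R).
Proof.
move=> H; have [D1 D2] := H (t *: dir b + x).
have e : (fun s : R => s^-1 *: (((fun z => f (z *: dir b + x) : R^o) \o shift t) (s *: 1) -
       f (t *: dir b + x))) =
   (fun s : R => s^-1 *: (((f : R * R -> R^o) \o shift (t *: dir b + x)) (s *: dir b) - f (t *: dir b + x))).
  by apply/funext => s /=; rewrite /shift /= [s *: 1]mulr1 scalerDl addrA.
split; first by rewrite /derivable e.
by rewrite /derive e.
Qed.

Lemma lipschitz_derive (g dg : R -> R) (K a c : R) :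
  (forall t : R, is_derive t (1 : R) g (dg t)) -> (forall t, `|dg t| <= K) ->
  `|g c - g a| <= K * `|c - a|.
Proof.
move=> H HK.
wlog ac : a c / a < c => [th|].
  have [/th//|ca|->] := ltgtP a c; last by rewrite !subrr normr0 mulr0.
  by rewrite distrC [X in _ * X]distrC; exact: th.
have [d _ ->] : exists2 d, d \in `]a, c[ & g c - g a = dg d * (c - a).
  apply: MVT => //; apply: continuous_subspaceT => t.
  apply: differentiable_continuous; apply/derivable1_diffP.
  by have [] := H t.
by rewrite normrM ler_wpM2r.
Qed.

Lemma pderiv_lip b f df K x t : pderiv b f df -> (forall z, `|df z| <= K) ->
  `|f (t *: dir b + x) - f x| <= K * `|t|.
Proof.
move=> H HK.
have := lipschitz_derive (g := fun s => f (s *: dir b + x)) 0 t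
  (fun s => pderiv_slice x s H) (fun s => HK _).
by rewrite scale0r add0r subr0.
Qed.

Lemma test_continuous f : is_test_function f -> continuous f.
Proof. by move=> [/(_ 0%N)]. Qed.

Lemma cs_box f : compactly_supported f ->
  exists2 rad : R, 0 < rad & forall x, f x != 0 -> enorm x < rad.
Proof.
move=> cf; have [rad r0 H] := bounded_in_box cf.
by exists rad => // x fx; apply: H; exact: subset_closure.
Qed.

Lemma cs_bounded f : continuous f -> compactly_supported f ->
  exists2 K : R, 0 <= K & forall x, `|f x| <= K.
Proof.
move=> cf csf.
have := @compact_bounded _ _ _ (continuous_compact (continuous_subspaceT cf) csf).
case=> K [Kr HK]; exists (`|K| + 1); first by rewrite addr_ge0.
move=> x; have [->|fx] := eqVneq (f x) 0; first by rewrite normr0 addr_ge0.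
apply: (HK (`|K| + 1)); first by rewrite (le_lt_trans (ler_norm K))// ltrDl.
by exists x => //; exact: subset_closure.
Qed.

Lemma test_pderiv b f : is_test_function f ->
  pderiv b f ('D_(dir b) (f : R * R -> R^o)).
Proof.
move=> [/(_ 1%N) [_ H _ _] _] x; have [h1 h2] := H x.
by case: b; [exact: (DeriveDef h1 erefl)|exact: (DeriveDef h2 erefl)].
Qed.

Lemma cs_deriv b f : compactly_supported f ->
  compactly_supported ('D_(dir b) (f : R * R -> R^o) : R * R -> R).
Proof.
move=> cf; apply: (subclosed_compact _ cf); first exact: closed_closure.
rewrite (closure_id (closure [set x | f x != 0])).1; last exact: closed_closure.
apply: closure_subset => x; apply: contraPP => /= hx.
have nx : \forall y \near x, f y = 0.
  have : open (~` closure [set x | f x != 0]) by apply: closed_openC; exact: closed_closure.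
  rewrite openE => /(_ x hx); apply: filterS => y hy.
  by apply/eqP/negPn/negP => fy; apply: hy; exact: subset_closure.
apply/negP/negPn/eqP.
rewrite (@near_eq_derive _ _ _ (f : R * R -> R^o) (fun=> 0) x (dir b))//.
exact: derive_cst.
Qed.

Lemma test_deriv b f : is_test_function f ->
  is_test_function ('D_(dir b) (f : R * R -> R^o) : R * R -> R).
Proof.
move=> [H cf]; split; last exact: cs_deriv.
by move=> k; have [_ _ h1 h2] := H k.+1; case: b.
Qed.

(** Differences commute with partial derivatives, so each further difference costs one derivative of
    [f] and gains, by the mean value theorem, one factor |t|. Applied to second differences and to
    the decay of Fourier transforms. *)
Lemma test_iter_dif b k f : is_test_function f ->
  exists2 K : R, 0 <= K & forall x (t : R), `|iter k (dif (t *: dir b)) f x| <= K * `|t| ^+ k.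
Proof.
elim: k f => [|k IH] f tf.
  have [K K0 HK] := cs_bounded (test_continuous tf) tf.2.
  by exists K => // x t; rewrite expr0 mulr1.
have [K K0 HK] := IH _ (test_deriv b tf); exists K => // x t.
have H : pderiv b (iter k (dif (t *: dir b)) f)
    (iter k (dif (t *: dir b)) ('D_(dir b) (f : R * R -> R^o))).
  by elim: k {IH HK} => [|k IH] /=; [exact: test_pderiv|exact: pderiv_dif].
by rewrite iterS /dif exprSr mulrA; apply: pderiv_lip H _ => z; exact: HK.
Qed.

Lemma dir_decomp y : y = y.1 *: dir true + y.2 *: dir false.
Proof.
case: y => a c; rewrite /dir /e1 /e2 /=; congr pair; rewrite /=.
  by rewrite [_ *: 1]mulr1 [_ *: 0]mulr0 addr0.
by rewrite [_ *: 0]mulr0 [_ *: 1]mulr1 add0r.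
Qed.

Lemma lip_dirs f K :
  (forall b x (t : R), `|f (t *: dir b + x) - f x| <= K * `|t|) ->
  forall x y, `|f (y + x) - f x| <= K * (`|y.1| + `|y.2|).
Proof.
move=> H x y; rewrite {1}[y]dir_decomp -addrA.
have := H true (y.2 *: dir false + x) y.1; have := H false x y.2.
set A := f (_ + (_ + _)); set B := f (y.2 *: _ + x) => h1 h2.
by rewrite mulrDr (le_trans (ler_distD B _ _))// lerD.
Qed.

Lemma C1_lip f : is_Ck 1 f -> compactly_supported f ->
  exists2 K : R, 0 <= K & forall x y, `|f (x + y) - f x| <= K * enorm y.
Proof.
move=> [cf df c1 c2] sf.
have pd b : pderiv b f ('D_(dir b) (f : R * R -> R^o)).
  move=> x; have [h1 h2] := df x.
  by case: b; [exact: (DeriveDef h1 erefl)|exact: (DeriveDef h2 erefl)].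
have [K1 K10 H1] := cs_bounded c1 (cs_deriv (b := true) sf).
have [K2 K20 H2] := cs_bounded c2 (cs_deriv (b := false) sf).
exists (2 * (K1 + K2)); first by rewrite mulr_ge0 ?addr_ge0.
move=> x y; rewrite [x + y]addrC.
have H b z t : `|f (t *: dir b + z) - f z| <= (K1 + K2) * `|t|.
  apply: (pderiv_lip _ _ (pd b)) => u.
  case: b; [apply: le_trans (H1 u) _|apply: le_trans (H2 u) _]; by rewrite ?lerDl ?lerDr.
apply: le_trans (lip_dirs H _ _) _.
rewrite [2 * _]mulrC -mulrA ler_wpM2l ?addr_ge0//.
have := fst_le_enorm y; have := snd_le_enorm y; lra.
Qed.

Lemma test_lip f : is_test_function f ->
  exists2 K : R, 0 <= K & forall x y, `|f (x + y) - f x| <= K * enorm y.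
Proof. by move=> tf; apply: C1_lip; [exact: tf.1 1%N|exact: tf.2]. Qed.

(** Iterated differences along the axes are bounded by products of step lengths, and the symmetric
    second difference is a sum of such differences. *)
Lemma test_dif2 f : is_test_function f ->
  exists2 K : R, 0 <= K &
    forall x y, `|f (x + y) + f (x - y) - 2 * f x| <= K * enorm y ^+ 2.
Proof.
move=> tf.
have [K [K0 HK]] : exists K : R, 0 <= K /\ forall b b' x (t s : R),
    `|dif (s *: dir b') (dif (t *: dir b) f) x| <= K * `|t| * `|s|.
  have HH b : exists2 K : R, 0 <= K & forall b' x (t s : R),
      `|dif (s *: dir b') (dif (t *: dir b) f) x| <= K * `|t| * `|s|.
    have [K1 K10 H1] := test_iter_dif b 1 (test_deriv true tf).
    have [K2 K20 H2] := test_iter_dif b 1 (test_deriv false tf).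
    exists (K1 + K2); first exact: addr_ge0.
    move=> b' x t s; rewrite {1}/dif.
    apply: (pderiv_lip _ _ (pderiv_dif (t *: dir b) (test_pderiv b' tf))) => z.
    case: b'; [have := H1 z t|have := H2 z t]; rewrite /= expr1 => h;
      by rewrite (le_trans h)// ler_wpM2r// ?lerDl ?lerDr.
  have [Ka Ka0 Ha] := HH true; have [Kb Kb0 Hb] := HH false.
  exists (Ka + Kb); split; first exact: addr_ge0.
  move=> b b' x t s; case: b; [have := Ha b' x t s|have := Hb b' x t s] => h;
    by rewrite (le_trans h)// -!mulrA ler_wpM2r ?mulr_ge0// ?lerDl ?lerDr.
exists (4 * K); first by rewrite mulr_ge0.
move=> x y; set a := y.1; set c := y.2.
have L b t := @lip_dirs (dif (t *: dir b) f) (K * `|t|) (fun b' x s => HK b b' x t s).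
have h1 := L true a (x - a *: dir true) y.
have h2 := L false c (x - y) y.
(* Telescoping along the two coordinates of [y]: each bracket is the change, under translation by
   [y], of a difference along one axis. *)
have -> : f (x + y) + f (x - y) - 2 * f x =
   (dif (a *: dir true) f (y + (x - a *: dir true)) - dif (a *: dir true) f (x - a *: dir true))
 + (dif (c *: dir false) f (y + (x - y)) - dif (c *: dir false) f (x - y)).
  rewrite /dif.
  have -> : a *: dir true + (y + (x - a *: dir true)) = x + y.
    by apply: pair_eqR => /=; ring.
  have -> : a *: dir true + (x - a *: dir true) = x by rewrite addrC subrK.
  have -> : y + (x - y) = x by rewrite addrC subrK.
  have -> : y + (x - a *: dir true) = c *: dir false + x.
    by rewrite {1}[y]dir_decomp -/a -/c [a *: _ + _]addrC -addrA; congr (_ + _); rewrite addrC subrK.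
  have -> : c *: dir false + (x - y) = x - a *: dir true.
    rewrite [y in x - y]dir_decomp -/a -/c opprD [- _ - _]addrC.
    by apply: pair_eqR => /=; ring.
  ring.
apply: le_trans (ler_normD _ _) _; apply: le_trans (lerD h1 h2) _.
rewrite -mulrDl -mulrDr.
have := fst_le_enorm y; have := snd_le_enorm y; rewrite -/a -/c => hc ha.
have -> : 4 * K * enorm y ^+ 2 = K * (2 * enorm y) * (2 * enorm y) by ring.
have ac : `|a| + `|c| <= 2 * enorm y by lra.
by apply: ler_pM => //; rewrite ?mulr_ge0 ?addr_ge0// ler_wpM2l.
Qed.

End SmoothCalculus.

(** * Smooth functions of one variable and bump functions *)

Section Smooth1.
Variable R : realType.
Implicit Types f g : R -> R.

(** Each derivative is exhibited, so closure under sums, products and affine substitutions follows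
    by induction on [k]. *)
Fixpoint smooth1 k f : Prop :=
  if k is k'.+1 then
    exists2 g, (forall t : R, is_derive t (1 : R) f (g t)) & smooth1 k' g
  else continuous f.

Lemma derive_continuous f g : (forall t : R, is_derive t (1 : R) f (g t)) -> continuous f.
Proof.
move=> H t; apply: differentiable_continuous; apply/derivable1_diffP.
by have [] := H t.
Qed.

Lemma smooth1S k f : smooth1 k.+1 f -> smooth1 k f.
Proof.
elim: k f => [|k IH] f [g H sg]; first exact: derive_continuous H.
by exists g => //; exact: IH.
Qed.

Lemma smooth1D k f g : smooth1 k f -> smooth1 k g -> smooth1 k (fun t => f t + g t).
Proof.
elim: k f g => [|k IH] f g; first by move=> cf cg t; apply: cvgD; [exact: cf|exact: cg].
move=> [f' Hf sf] [g' Hg sg]; exists (fun t => f' t + g' t); last exact: IH.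
by move=> t; have := Hf t; have := Hg t => h1 h2; exact: is_deriveD.
Qed.

Lemma smooth1M k f g : smooth1 k f -> smooth1 k g -> smooth1 k (fun t => f t * g t).
Proof.
elim: k f g => [|k IH] f g; first by move=> cf cg t; apply: cvgM; [exact: cf|exact: cg].
move=> sf sg; have [f' Hf sf'] := sf; have [g' Hg sg'] := sg.
exists (fun t => f t * g' t + g t * f' t).
  by move=> t; apply: (is_deriveM (Hf t) (Hg t)).
by apply: smooth1D; apply: IH => //; exact: smooth1S.
Qed.

Lemma smooth1_cst k (c : R) : smooth1 k (fun=> c).
Proof.
elim: k c => [|k IH] c; first by move=> t; exact: cvg_cst.
by exists (fun=> 0) => // t; exact: is_derive_cst.
Qed.

Lemma is_derive_affine (a b t : R) : is_derive t (1 : R) (fun t : R => a * t + b) a.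
Proof.
have := is_deriveD (is_deriveM (is_derive_cst a t (1 : R)) (is_derive_id t (1 : R)))
  (is_derive_cst b t (1 : R)).
by move/is_derive_eq; apply; rewrite scaler0 !addr0 [_ *: 1]mulr1.
Qed.

Lemma smooth1_affine k f (a b : R) : smooth1 k f -> smooth1 k (fun t => f (a * t + b)).
Proof.
elim: k f => [|k IH] f.
  move=> cf t; apply: (@continuous_comp _ _ _ (fun t => a * t + b) f); last exact: cf.
  by apply: (@derive_continuous _ (fun=> a)) => s; exact: is_derive_affine.
move=> [f' Hf sf]; exists (fun t => f' (a * t + b) * a).
  by move=> t; exact: (is_derive1_comp (Hf _) (is_derive_affine a b t)).
by apply: smooth1M; [exact: IH|exact: smooth1_cst].
Qed.

(* The functions [exp (- 1 / t) / t ^ j] are smooth at 0 since each derivative is a combination of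
   functions of the same family. *)
Definition flat j (t : R) : R := if 0 < t then expR (- t^-1) * t^-1 ^+ j else 0.

Lemma flat_ge0 j t : 0 <= flat j t.
Proof.
rewrite /flat; case: ifP => // t0; rewrite mulr_ge0 ?expR_ge0 ?exprn_ge0// invr_ge0 ltW//.
Qed.

(** With s = 1/t, the inequality exp(s/(j+1)) >= s/(j+1) is raised to the power j + 1. The linear
    bound settles differentiability at the origin. *)
Lemma flat_le j t : `|flat j t| <= (j.+1)%:R ^+ j.+1 * `|t|.
Proof.
rewrite ger0_norm ?flat_ge0// /flat; case: ifP => [t0|_]; last by rewrite mulr_ge0 ?exprn_ge0.
rewrite (gtr0_norm t0).
have s0 : 0 < t^-1 by rewrite invr_gt0.
set s := t^-1 in s0 *; have -> : t = s^-1 by rewrite /s invrK.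
have J0 : 0 < j.+1%:R :> R by rewrite ltr0n.
have h : (s / j.+1%:R) ^+ j.+1 <= expR s.
  have -> : expR s = expR (s / j.+1%:R) ^+ j.+1.
    by rewrite -expRM_natl mulrC divfK// gt_eqF.
  apply: lerXn2r; rewrite ?nnegrE ?expR_ge0 ?divr_ge0 ?ltW//.
  apply: lt_le_trans (expR_ge1Dx _); rewrite ltrDr; exact: ltr01.
rewrite expRN ler_pdivlMr// -mulrA ler_pdivrMl ?expR_gt0//.
move: h; rewrite expr_div_n ler_pdivrMr ?exprn_gt0// => h.
by rewrite -exprSr [X in _ <= X]mulrC [X in _ <= X]mulrC (le_trans h)// mulrC.
Qed.

Lemma flat_is_derive j (t : R) :
  is_derive t (1 : R) (flat j) (flat j.+2 t - j%:R * flat j.+1 t).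
Proof.
have [t0|t0|->] := ltgtP t 0.
- have -> : flat j.+2 t - j%:R * flat j.+1 t = 0.
    by rewrite /flat ltNge (ltW t0) /= mulr0 subr0.
  have H0 := is_derive_cst (0 : R) t (1 : R); apply: near_eq_is_derive H0.
  by near=> s; rewrite /flat ifF//; apply/negbTE; rewrite -leNgt; apply/ltW; near: s; exact: lt_nbhsl.
- pose F (s : R) := expR (- s) * s ^+ j.
  apply: (@near_eq_is_derive _ _ _ (F \o (fun s : R => s^-1))).
    by near=> s; rewrite /flat ifT//; near: s; exact: lt_nbhsr.
  have dF (s : R) : is_derive s (1 : R) F (expR (- s) * (j%:R * s ^+ j.-1) + s ^+ j * - expR (- s)).
    have h1 : is_derive s (1:R) (fun s => expR (- s)) (- expR (- s)).
      have := is_derive1_comp (is_derive_expR (- s)) (is_deriveN (is_derive_id s (1:R))).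
      by move/is_derive_eq; apply; rewrite mulrN1.
    have h2 : is_derive s (1:R) (fun s => s ^+ j) (j%:R * s ^+ j.-1).
      have := is_deriveX j (is_derive_id s (1:R)).
      rewrite (_ : id ^+ j = (fun s : R => s ^+ j)); last by apply/funext => u; rewrite exprfctE.
      by move/is_derive_eq; apply; rewrite [_ *: 1]mulr1.
    exact: (is_deriveM h1 h2).
  have tn0 : t != 0 by rewrite gt_eqF.
  have dV := is_deriveV tn0 (is_derive_id t (1:R)).
  have := is_derive1_comp (dF t^-1) dV; move/is_derive_eq; apply.
  rewrite /flat t0 [_ *: 1]mulr1 -exprVn; set s := t^-1.
  by case: j {F dF} => [|j] /=; rewrite !exprS; ring.
- have -> : flat j.+2 0 - j%:R * flat j.+1 0 = 0.
    by rewrite /flat ltxx mulr0 subr0.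
  have H : (fun h : R => h^-1 *: ((flat j \o shift 0) (h *: (1:R)) - flat j 0)) @ 0^' --> (0:R).
    apply/cvgr0Pnorm_lt => e e0.
    pose K : R := (j.+2)%:R ^+ j.+2.
    have K0 : 0 < K by rewrite exprn_gt0// ltr0n.
    near=> h; have hn : h != 0 by near: h; exact: nbhs_dnbhs_neq.
    (* The difference quotient at 0 is the next member of the family, which [flat_le] sends to 0. *)
    have -> : h^-1 *: ((flat j \o shift 0) (h *: (1:R)) - flat j 0) = flat j.+1 h.
      rewrite /= /shift /= addr0 [_ *: 1]mulr1 /flat ltxx subr0.
      by case: ifP => _; rewrite ?scaler0// [_ *: _]mulrC -mulrA -exprSr.
    apply: le_lt_trans (flat_le _ _) _.
    rewrite -/K mulrC -ltr_pdivlMr//; near: h.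
    by apply: dnbhs0_lt; rewrite divr_gt0.
  split; first by apply/cvg_ex; exists 0.
  by apply/cvg_lim => //.
Unshelve. all: by end_near. Qed.

Lemma smooth1_flat k j : smooth1 k (flat j).
Proof.
elim: k j => [|k IH] j /=; first by apply: derive_continuous => t; exact: flat_is_derive.
exists (fun t => flat j.+2 t - j%:R * flat j.+1 t); first by move=> t; exact: flat_is_derive.
rewrite (_ : (fun _ => _) = (fun t => flat j.+2 t + (- j%:R) * flat j.+1 t)); last first.
  by apply/funext => t; rewrite mulNr.
by apply: smooth1D => //; apply: smooth1M => //; exact: smooth1_cst.
Qed.

(** Both partial derivatives are again of product form, so the induction closes. *)
Lemma is_Ck_tensor k (a b : R -> R) : smooth1 k a -> smooth1 k b ->
  is_Ck k (fun x : R * R => a x.1 * b x.2).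
Proof.
have C (a' b' : R -> R) : continuous a' -> continuous b' ->
    continuous (fun x : R * R => a' x.1 * b' x.2).
  move=> ca cb x; apply: (@cvgM _ _ _ _ (fun x : R * R => a' x.1) (fun x : R * R => b' x.2)).
    by apply: (@continuous_comp _ _ _ fst a'); [exact: continuous_fstR|exact: ca].
  by apply: (@continuous_comp _ _ _ snd b'); [exact: continuous_sndR|exact: cb].
elim: k a b => [|k IH] a b; first exact: C.
move=> sa sb; have [a' Ha sa'] := sa; have [b' Hb sb'] := sb.
have d1 x : is_derive x (e1 R) (fun x : R * R => a x.1 * b x.2 : R^o) (a' x.1 * b x.2 : R^o).
  have [D1 D2] : is_derive x.1 (1:R) (fun t => a t * b x.2) (a' x.1 * b x.2).
    have := is_deriveM (Ha x.1) (is_derive_cst (b x.2) x.1 (1:R)); move/is_derive_eq; apply.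
    by rewrite scaler0 add0r [_ *: _]mulrC.
  have e : (fun h : R => h^-1 *: (((fun x : R * R => a x.1 * b x.2 : R^o) \o shift x) (h *: e1 R)
      - (a x.1 * b x.2))) =
      (fun h : R => h^-1 *: (((fun t => a t * b x.2) \o shift x.1) (h *: (1:R)) - (a x.1 * b x.2))).
    by apply/funext => h; rewrite /= /shift /= [_ *: 0]mulr0 add0r.
  by split; [rewrite /derivable e|rewrite /derive e].
have d2 x : is_derive x (e2 R) (fun x : R * R => a x.1 * b x.2 : R^o) (a x.1 * b' x.2 : R^o).
  have [D1 D2] : is_derive x.2 (1:R) (fun t => a x.1 * b t) (a x.1 * b' x.2).
    have := is_deriveM (is_derive_cst (a x.1) x.2 (1:R)) (Hb x.2); move/is_derive_eq; apply.
    by rewrite scaler0 addr0.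
  have e : (fun h : R => h^-1 *: (((fun x : R * R => a x.1 * b x.2 : R^o) \o shift x) (h *: e2 R)
      - (a x.1 * b x.2))) =
      (fun h : R => h^-1 *: (((fun t => a x.1 * b t) \o shift x.2) (h *: (1:R)) - (a x.1 * b x.2))).
    by apply/funext => h; rewrite /= /shift /= [_ *: 0]mulr0 add0r.
  by split; [rewrite /derivable e|rewrite /derive e].
split.
- by apply: C; [exact: derive_continuous Ha|exact: derive_continuous Hb].
- by move=> x; split; [have [] := d1 x|have [] := d2 x].
- rewrite (_ : 'D_(e1 R) _ = (fun x : R * R => a' x.1 * b x.2)).
    by apply: IH => //; exact: smooth1S.
  by apply/funext => x; have [_] := d1 x.
- rewrite (_ : 'D_(e2 R) _ = (fun x : R * R => a x.1 * b' x.2)).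
    by apply: IH => //; exact: smooth1S.
  by apply/funext => x; have [_] := d2 x.
Qed.

Lemma cs_of_box (f : R * R -> R) r : (forall x, f x != 0 -> box r x) ->
  compactly_supported f.
Proof.
move=> H; have cb : compact (box r : set (R * R)).
  by apply: compact_setX; exact: segment_compact.
apply: (subclosed_compact _ cb); first exact: closed_closure.
rewrite (closure_id (box r)).1; last exact: compact_closed.
by apply: closure_subset => x; exact: H.
Qed.

Lemma intg_cs (f : R * R -> R) : continuous f -> compactly_supported f -> intg2 f.
Proof.
move=> cf sf; have [K K0 HK] := cs_bounded cf sf; have [rad rad0 H] := cs_box sf.
apply: (@intg_bounded _ _ R (@leb2 R) (eball rad) f K).
- exact: measurable_eball.
- exact: leb2_eball_lty.
- exact: continuous_measurable2.
- move=> x; rewrite indicE; have [->|fx] := eqVneq (f x) 0; first by rewrite normr0 mulr_ge0.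
  by rewrite mem_set ?mulr1//; exact: H.
Qed.

Lemma Rint_indicE (A : set (R * R)) :
  measurable (A : set (measurableTypeR R * measurableTypeR R)) ->
  \int[@leb2 R]_x \1_A x = fine (leb2 A).
Proof. by move=> mA; rewrite /Rintegral (integral_indic _ measurableT mA) setIT. Qed.

Lemma bump_exists (eps : R) : 0 < eps -> exists eta : R * R -> R,
  [/\ is_test_function eta, forall x, 0 <= eta x,
      forall x, eta x != 0 -> enorm x <= eps &
      \int[@leb2 R]_x eta x = 1].
Proof.
move=> e0; pose a := 2 / eps.
have a0 : 0 < a by rewrite divr_gt0.
pose b (t : R) := flat 0 (a * t + 1) * flat 0 ((- a) * t + 1).
have sb k : smooth1 k b by apply: smooth1M; apply: smooth1_affine; exact: smooth1_flat.
have b_ge0 t : 0 <= b t by rewrite mulr_ge0 ?flat_ge0.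
have b_supp t : b t != 0 -> `|t| <= eps / 2.
  rewrite /b mulf_eq0 negb_or /flat; case: ifP => h1; rewrite ?eqxx//.
  case: ifP => h2; rewrite ?eqxx ?andbF// => _.
  rewrite ler_norml -(ler_pM2l a0) -[X in _ && X](ler_pM2l a0).
  have -> : a * - (eps / 2) = - 1 by rewrite /a; field; exact: lt0r_neq0.
  have -> : a * (eps / 2) = 1 by rewrite /a; field; exact: lt0r_neq0.
  apply/andP; split; lra.
pose f (x : R * R) := b x.1 * b x.2.
have f_ge0 x : 0 <= f x by exact: mulr_ge0.
have f_box x : f x != 0 -> box (eps / 2) x.
  by rewrite mulf_eq0 negb_or => /andP[/b_supp h1 /b_supp h2]; apply/boxE.
have cf : continuous f by apply: (is_Ck_tensor (k := 0)); exact: (sb 0%N).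
have If : intg2 f := intg_cs cf (cs_of_box f_box).
(* On the square of half-width eps / 4 both arguments of [flat] are at least 1/2, so each of the
   four factors is at least exp(-2). *)
have I0 : 0 < \int[@leb2 R]_x f x.
  have q0 : 0 <= eps / 4 by rewrite divr_ge0// ltW.
  pose k0 := (expR (- 2) * expR (- 2)) * (expR (- 2) * expR (- 2)) : R.
  have lb t : `|t| <= eps / 4 -> expR (- 2) * expR (- 2) <= b t.
    rewrite ler_norml -(ler_pM2l a0) -[X in _ && X](ler_pM2l a0).
    have -> : a * - (eps / 4) = - (1 / 2) by rewrite /a; field; exact: lt0r_neq0.
    have -> : a * (eps / 4) = 1 / 2 by rewrite /a; field; exact: lt0r_neq0.
    move=> /andP[h1 h2].
    have key s : 1 / 2 <= s -> expR (- 2) <= flat 0 s.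
      move=> hs; have s0 : 0 < s by apply: lt_le_trans hs; lra.
      rewrite /flat s0 expr0 mulr1 ler_expR lerN2 -[leRHS]invrK lef_pV2 ?posrE//; lra.
    by rewrite /b; apply: ler_pM; rewrite ?expR_ge0//; apply: key; lra.
  have Ib : intg2 (fun x : R * R => k0 * \1_(box (eps / 4)) x).
    by apply: intgZ; apply: intg_indicT; [exact: measurable_box|exact: leb2_box_lty].
  apply: (@lt_le_trans _ _ (\int[@leb2 R]_x (k0 * \1_(box (eps / 4)) x))).
    rewrite RintegralZl//; last by apply: intg_indicT; [exact: measurable_box|exact: leb2_box_lty].
    rewrite (Rint_indicE (measurable_box _)) (leb2_box q0) /=.
    by rewrite mulr_gt0 ?exprn_gt0 ?mulr_gt0 ?expR_gt0// divr_gt0.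
  apply: le_Rintegral => // x _; rewrite indicE.
  case: (boolP (x \in _)) => [/set_mem/boxE [h1 h2]|_]; last by rewrite mulr0.
  by rewrite mulr1; apply: ler_pM; rewrite ?mulr_ge0 ?expR_ge0 ?lb.
exists (fun x => ((\int[@leb2 R]_x f x)^-1 * b x.1) * b x.2).
have E x : ((\int[@leb2 R]_x f x)^-1 * b x.1) * b x.2 = (\int[@leb2 R]_x f x)^-1 * f x.
  by rewrite -mulrA.
split.
- split.
    move=> k; apply: (is_Ck_tensor (a := fun t => (\int[@leb2 R]_x f x)^-1 * b t)) => //.
    by apply: smooth1M => //; exact: smooth1_cst.
  apply: (@cs_of_box _ (eps / 2)) => x; rewrite E mulf_eq0 negb_or => /andP[_]; exact: f_box.
- by move=> x; rewrite E mulr_ge0// invr_ge0 ltW.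
- move=> x; rewrite E mulf_eq0 negb_or => /andP[_ /f_box/boxE[h1 h2]].
  by apply: le_trans (enorm_le _) _; lra.
- under eq_Rintegral do rewrite E.
  by rewrite RintegralZl// mulVf// gt_eqF.
Qed.

End Smooth1.

Notation meas2 f := (measurable_fun (setT : set (measurableTypeR _ * measurableTypeR _))
  (f : _ -> measurableTypeR _)).

(** Joint measurability of a curried function of two points, as required by Fubini's theorem. *)
Definition meas4 (R : realType) (F : R * R -> R * R -> R) : Prop :=
  measurable_fun setT (fun z : (measurableTypeR R * measurableTypeR R) *
    (measurableTypeR R * measurableTypeR R) => F z.1 z.2 : measurableTypeR R).

Section PlaneIntegral.
Variable R : realType.
Local Notation mR := (measurableTypeR R).
Implicit Types (f g a : R * R -> R) (x y : R * R) (F G : R * R -> R * R -> R).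

Lemma int2_le f g : meas2 f -> intg2 g -> (forall x, `|f x| <= g x) -> intg2 f.
Proof. exact: intg_le. Qed.

Lemma Rint2_eq f g : (forall x, f x = g x) -> \int[@leb2 R]_x f x = \int[@leb2 R]_x g x.
Proof. by move=> /funext ->. Qed.

Lemma int2_eq f g : (forall x, f x = g x) -> intg2 f -> intg2 g.
Proof. by move=> /funext ->. Qed.

Lemma Rint2_0 f : (forall x, f x = 0) -> \int[@leb2 R]_x f x = 0.
Proof. by move=> h; rewrite (Rint2_eq h) /Rintegral integral0. Qed.

Lemma Rint2Z (c : R) f : intg2 f -> \int[@leb2 R]_x (c * f x) = c * \int[@leb2 R]_x f x.
Proof. by move=> h; rewrite RintegralZl. Qed.

Lemma Rint2D f g : intg2 f -> intg2 g ->
  \int[@leb2 R]_x (f x + g x) = \int[@leb2 R]_x f x + \int[@leb2 R]_x g x.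
Proof. by move=> h h'; rewrite RintegralD. Qed.

Lemma Rint2B f g : intg2 f -> intg2 g ->
  \int[@leb2 R]_x (f x - g x) = \int[@leb2 R]_x f x - \int[@leb2 R]_x g x.
Proof. by move=> h h'; rewrite RintegralB. Qed.

Lemma Rint2_norm f g : intg2 f -> intg2 g -> (forall x, `|f x| <= g x) ->
  `|\int[@leb2 R]_x f x| <= \int[@leb2 R]_x g x.
Proof. exact: Rint_le_norm. Qed.

Lemma Rint2_mono f g : intg2 f -> intg2 g -> (forall x, f x <= g x) ->
  \int[@leb2 R]_x f x <= \int[@leb2 R]_x g x.
Proof. by move=> h1 h2 h; apply: le_Rintegral. Qed.

Lemma Rint2_ge0 f : (forall x, 0 <= f x) -> 0 <= \int[@leb2 R]_x f x.
Proof. by move=> h; apply: Rintegral_ge0. Qed.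

Lemma int2_meas f : intg2 f -> meas2 f.
Proof. exact: intg_meas. Qed.

Lemma int2_indic (A : set (R * R)) : measurable (A : set (mR * mR)) -> (leb2 A < +oo)%E ->
  intg2 (\1_A : R * R -> R).
Proof. exact: intg_indicT. Qed.

Lemma int2_ball rad : intg2 (\1_(@eball R rad) : R * R -> R).
Proof. by apply: int2_indic; [exact: measurable_eball|exact: leb2_eball_lty]. Qed.

Lemma meas2M f g : meas2 f -> meas2 g -> meas2 (fun x => f x * g x).
Proof. exact: measurable_funM. Qed.

Lemma meas2D f g : meas2 f -> meas2 g -> meas2 (fun x => f x + g x).
Proof. exact: measurable_funD. Qed.

Lemma meas2B f g : meas2 f -> meas2 g -> meas2 (fun x => f x - g x).
Proof. exact: measurable_funB. Qed.

Lemma meas2V f : meas2 f -> meas2 (fun x => (f x)^-1).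
Proof. exact: measurable_funVr. Qed.

Lemma meas2_cst (c : R) : meas2 (fun _ : R * R => c).
Proof. exact: measurable_cst. Qed.

Lemma meas2_indic (A : set (R * R)) : measurable (A : set (mR * mR)) -> meas2 (\1_A : R * R -> R).
Proof. exact: measurable_indic. Qed.

Lemma meas2_ball rad : meas2 (\1_(@eball R rad) : R * R -> R).
Proof. apply: meas2_indic; exact: measurable_eball. Qed.

Lemma meas2_shift f y : meas2 f -> meas2 (fun x => f (x + y)).
Proof.
move=> mf; have := measurableT_comp mf (measurable_aff2 (1 : R) y).
apply: eq_measurable_fun => x _ /=.
by congr f; apply: pair_eqR; rewrite /= /aff1 mul1r.
Qed.

Lemma meas4_l a : meas2 a -> meas4 (fun x _ : R * R => a x).
Proof. by move=> ma; exact: (measurableT_comp ma measurable_fst). Qed.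

Lemma meas4_r a : meas2 a -> meas4 (fun _ y : R * R => a y).
Proof. by move=> ma; exact: (measurableT_comp ma measurable_snd). Qed.

Lemma meas4M F G : meas4 F -> meas4 G -> meas4 (fun x y => F x y * G x y).
Proof. exact: measurable_funM. Qed.

Lemma meas4D F G : meas4 F -> meas4 G -> meas4 (fun x y => F x y + G x y).
Proof. exact: measurable_funD. Qed.

Lemma meas4B F G : meas4 F -> meas4 G -> meas4 (fun x y => F x y - G x y).
Proof. exact: measurable_funB. Qed.

Lemma meas4_lin f (u v : R) : meas2 f ->
  meas4 (fun x y => f (u * x.1 + v * y.1, u * x.2 + v * y.2)).
Proof.
move=> mf.
have mg : measurable_fun setT (fun z : (mR * mR) * (mR * mR) =>
   ((u * z.1.1 + v * z.2.1, u * z.1.2 + v * z.2.2) : mR * mR)).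
  have m11 : measurable_fun setT (fun z : (mR * mR) * (mR * mR) => z.1.1 : mR).
    exact: (measurableT_comp measurable_fst measurable_fst).
  have m12 : measurable_fun setT (fun z : (mR * mR) * (mR * mR) => z.1.2 : mR).
    exact: (measurableT_comp measurable_snd measurable_fst).
  have m21 : measurable_fun setT (fun z : (mR * mR) * (mR * mR) => z.2.1 : mR).
    exact: (measurableT_comp measurable_fst measurable_snd).
  have m22 : measurable_fun setT (fun z : (mR * mR) * (mR * mR) => z.2.2 : mR).
    exact: (measurableT_comp measurable_snd measurable_snd).
  have L (h k : (mR * mR) * (mR * mR) -> mR) : measurable_fun setT h -> measurable_fun setT k ->
      measurable_fun setT (fun z => u * h z + v * k z : mR).
    move=> mh mk; apply: measurable_funD.
      by apply: measurable_funM => //; exact: measurable_cst.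
    by apply: measurable_funM => //; exact: measurable_cst.
  exact: measurable_fun_pair (L _ _ m11 m21) (L _ _ m12 m22).
exact: (measurableT_comp mf mg).
Qed.

Lemma meas4_add f : meas2 f -> meas4 (fun x y => f (x + y)).
Proof.
move=> mf; apply: eq_measurable_fun (meas4_lin 1 1 mf) => z _ /=.
by congr f; apply: pair_eqR; rewrite /= !mul1r.
Qed.

Lemma meas4_sub f : meas2 f -> meas4 (fun x y => f (x - y)).
Proof.
move=> mf; apply: eq_measurable_fun (meas4_lin 1 (-1) mf) => z _ /=.
by congr f; apply: pair_eqR; rewrite /= !mul1r !mulN1r.
Qed.

Lemma meas4_sectr F y : meas4 F -> meas2 (fun x => F x y).
Proof.
exact: (@meas_sectr _ _ _ _ _ (fun z : (mR * mR) * (mR * mR) => F z.1 z.2)).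
Qed.

Lemma meas4_sectl F x : meas4 F -> meas2 (fun y => F x y).
Proof.
exact: (@meas_sectl _ _ _ _ _ (fun z : (mR * mR) * (mR * mR) => F z.1 z.2)).
Qed.

Lemma Rint2_fubini F g h : meas4 F -> intg2 g -> intg2 h ->
  (forall x y, `|F x y| <= g x * h y) ->
  [/\ intg2 (fun x => \int[@leb2 R]_y F x y), intg2 (fun y => \int[@leb2 R]_x F x y) &
  \int[@leb2 R]_x \int[@leb2 R]_y F x y = \int[@leb2 R]_y \int[@leb2 R]_x F x y].
Proof.
move=> mF ig ih H.
have [I1 I2 E1 E2] := Rint_fubini mF ig ih H.
by split; [exact: I1|exact: I2|exact: etrans E1 (esym E2)].
Qed.

Lemma Rint2_dct (f_ : nat -> R * R -> R) f g :
  (forall n, meas2 (f_ n)) -> (forall x, f_ n x @[n --> \oo] --> f x) -> intg2 g ->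
  (forall n x, `|f_ n x| <= g x) ->
  intg2 f /\ \int[@leb2 R]_x f_ n x @[n --> \oo] --> \int[@leb2 R]_x f x.
Proof. exact: Rint_dct. Qed.

End PlaneIntegral.

(** * The truncated stable operator and its symbol *)

Section Trig.
Variable R : realType.
Implicit Types t a b : R.

Lemma sin_le_norm t : `|sin t| <= `|t|.
Proof.
have := @lipschitz_derive _ (@sin R) (@cos R) 1 0 t (fun t => is_derive_sin t) (@cos_max R).
by rewrite sin0 !subr0 mul1r.
Qed.

Lemma cos_half t : 1 - cos t = 2 * sin (t / 2) ^+ 2.
Proof.
have {1}-> : t = (t / 2) *+ 2 by rewrite mulr2n; field.
rewrite cos_mulr2n cos2sin2 mulr2n; ring.
Qed.

Lemma onem_cos_ge0 t : 0 <= 1 - cos t.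
Proof. by rewrite subr_ge0 cos_le1. Qed.

Lemma onem_cos_le t : 1 - cos t <= t ^+ 2 / 2.
Proof.
rewrite cos_half -real_normK ?num_real//.
have h := sin_le_norm (t / 2).
apply: le_trans (ler_wpM2l _ (lerXn2r 2 _ _ h)) _; rewrite ?nnegrE//.
by rewrite real_normK ?num_real//; lra.
Qed.

Lemma sin_ge_half t : 0 <= t <= 1 -> t / 2 <= sin t.
Proof.
move=> /andP[t0 t1]; have [->|tn0] := eqVneq t 0; first by rewrite sin0 mul0r.
have tp : 0 < t by rewrite lt_neqAle eq_sym tn0.
have [d] : exists2 d, d \in `]0, t[ & sin t - sin 0 = cos d * (t - 0).
  apply: MVT => //; apply: continuous_subspaceT => x; exact: continuous_sin.
rewrite in_itv /= sin0 !subr0 => /andP[d0 dt] ->.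
have d1 : d ^+ 2 <= 1 by rewrite -[leRHS](expr1n _ 2) lerXn2r ?nnegrE//; lra.
have h := onem_cos_le d.
by rewrite mulrC ler_wpM2r//; lra.
Qed.

Lemma onem_cos_ge t : `|t| <= 1 -> t ^+ 2 / 8 <= 1 - cos t.
Proof.
move=> t1; rewrite -cos_norm -[t ^+ 2]real_normK ?num_real//; move: t1 (normr_ge0 t).
move: `|t| => u u1 u0; rewrite cos_half.
have h : 0 <= u / 2 / 2 <= sin (u / 2).
  by apply/andP; split; [lra|apply: sin_ge_half; apply/andP; split; lra].
case/andP: h => h0 h; have := lerXn2r 2 (_ : u / 2 / 2 \is Num.nneg) (_ : sin (u / 2) \is Num.nneg) h.
by rewrite !nnegrE => /(_ h0 (le_trans h0 h)); lra.
Qed.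

Lemma cosB_prod a b : cos a - cos b = - 2 * (sin ((a + b) / 2) * sin ((a - b) / 2)).
Proof.
have {1}-> : cos a = cos ((a + b) / 2 + (a - b) / 2) by congr cos; field.
have {1}-> : cos b = cos ((a + b) / 2 - (a - b) / 2) by congr cos; field.
rewrite cosD cosB; ring.
Qed.

(** The second sine is kept: it is bounded by 1 and by its argument, and [psi1_modulus] interpolates
    between the two bounds. *)
Lemma cosB_le a b : `|cos a - cos b| <= `|a - b| * `|sin ((a + b) / 2)|.
Proof.
rewrite cosB_prod !normrM normrN (ger0_norm (x := 2))//.
have := sin_le_norm ((a - b) / 2); rewrite normrM (ger0_norm (x := 2^-1))//.
have := normr_ge0 (sin ((a + b) / 2)).
move: `|sin ((a + b) / 2)| `|sin ((a - b) / 2)| `|a - b|.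
by move=> u s d u0 h; have := ler_wpM2l u0 h; lra.
Qed.

End Trig.

(** * The operator with constant removed: domination, self-adjointness, plane waves *)

Section JumpIntegral.
Variables (R : realType) (alpha M : R).
Hypothesis alpha_gt1 : 1 < alpha.
Hypothesis alpha_lt2 : alpha < 2.
Local Notation mR := (measurableTypeR R).
Implicit Types (f g a phi : R * R -> R) (x y : R * R).

Definition D2 f x y : R := f (x + y) + f (x - y) - 2 * f x.
Definition jump_kernel y : R := \1_(eball M) y * (enorm y `^ (2 + alpha))^-1.
(** What is left of the kernel against a second difference of size |y|^2; it is integrable because
    [alpha < 2] and dominates all integrals below. *)
Definition jdom y : R := \1_(eball M) y * enorm y `^ (- alpha).
Definition jump_op f x : R := \int[@leb2 R]_y (jump_kernel y * D2 f x y).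

Lemma L_ME r f x : L_M alpha r M f x = c_lim alpha r M / 2 * jump_op f x.
Proof.
rewrite /L_M Rint_indic; congr (_ * _); apply: eq_Rintegral => y _.
by rewrite /jump_kernel /D2 mulrAC -mulrA.
Qed.

Lemma jker_ge0 y : 0 <= jump_kernel y.
Proof. by rewrite mulr_ge0// invr_ge0 powR_ge0. Qed.

Lemma jdom_ge0 y : 0 <= jdom y.
Proof. by rewrite mulr_ge0// powR_ge0. Qed.

Lemma jker_sqr y : jump_kernel y * enorm y ^+ 2 = jdom y.
Proof.
rewrite /jump_kernel /jdom -mulrA; congr (_ * _).
have [->|e0] := eqVneq (enorm y) 0.
  by rewrite expr0n mulr0 powR0// oppr_eq0 gt_eqF//; have := alpha_gt1; lra.
rewrite powRD ?e0 ?implybT// invfM powR_mulrn ?enorm_ge0// mulrAC mulVf ?mul1r ?powRN//.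
by rewrite expf_neq0.
Qed.

Lemma intg_jdom : intg2 jdom.
Proof. by apply: intg_near; have := alpha_gt1; have := alpha_lt2; lra. Qed.

Lemma measurable_jker : meas2 jump_kernel.
Proof.
apply: meas2M; first exact: meas2_ball.
apply: meas2V; exact: measurable_enorm_powR.
Qed.

Lemma jker_out y : M <= enorm y -> jump_kernel y = 0.
Proof.
by move=> h; rewrite /jump_kernel indicE memNset ?mul0r// /eball /= ltNge h.
Qed.

Lemma continuous_D2 f x : continuous f -> continuous (D2 f x).
Proof.
move=> cf y; apply: cvgB; last exact: cvg_cst.
apply: cvgD.
  by apply: (@continuous_comp _ _ _ (fun y => x + y) f); [apply: cvgD; [exact: cvg_cst|exact: cvg_id]|exact: cf].
by apply: (@continuous_comp _ _ _ (fun y => x - y) f); [apply: cvgB; [exact: cvg_cst|exact: cvg_id]|exact: cf].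
Qed.

Lemma intg_jker_D2 f C x : continuous f ->
  (forall y, enorm y < M -> `|D2 f x y| <= C * enorm y ^+ 2) ->
  intg2 (fun y => jump_kernel y * D2 f x y).
Proof.
move=> cf HC; apply: (@int2_le _ _ (fun y => C * jdom y)).
- apply: meas2M; first exact: measurable_jker.
  exact: continuous_measurable2 (continuous_D2 cf).
- by apply: intgZ; exact: intg_jdom.
- move=> y; rewrite normrM (ger0_norm (jker_ge0 y)).
  have [yM|yM] := ltP (enorm y) M; last first.
    by rewrite jker_out// mul0r -jker_sqr jker_out// mul0r mulr0.
  by rewrite -jker_sqr mulrCA ler_wpM2l ?jker_ge0// HC.
Qed.

Lemma measurable_D2 f : continuous f -> meas4 (D2 f).
Proof.
move=> /continuous_measurable2 mf; apply: meas4B; first apply: meas4D.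
- exact: meas4_add.
- exact: meas4_sub.
- by apply: meas4_l; apply: meas2M => //; exact: meas2_cst.
Qed.

(** The double integrand is dominated by the product of [g] and [jdom], which legitimates the
    exchange. *)
Lemma J_fubini a f g : meas2 a -> continuous f -> intg2 g ->
  (forall x y, enorm y < M -> `|a x * D2 f x y| <= g x * enorm y ^+ 2) ->
  intg2 (fun x => a x * jump_op f x) /\
  \int[@leb2 R]_x (a x * jump_op f x) =
    \int[@leb2 R]_y (jump_kernel y * \int[@leb2 R]_x (a x * D2 f x y)).
Proof.
move=> ma cf ig H.
pose F x y : R := a x * (jump_kernel y * D2 f x y).
have mF : meas4 F.
  apply: meas4M; first exact: meas4_l.
  apply: meas4M; [apply: meas4_r; exact: measurable_jker|exact: measurable_D2].
have dF x y : `|F x y| <= g x * jdom y.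
  rewrite /F mulrCA normrM (ger0_norm (jker_ge0 y)).
  have [yM|yM] := ltP (enorm y) M; last first.
    by rewrite jker_out// mul0r -jker_sqr jker_out// mul0r mulr0.
  by rewrite -jker_sqr mulrCA ler_wpM2l ?jker_ge0// H.
have [I1 I2 E] := Rint2_fubini mF ig intg_jdom dF.
have e1 x : \int[@leb2 R]_y F x y = a x * jump_op f x.
  (* Where the weight vanishes the hypothesis says nothing about the second differences of [f], but
     both sides are 0. *)
  have [ax|ax] := eqVneq (a x) 0.
    by rewrite ax mul0r; apply: Rint2_0 => y; rewrite /F ax mul0r.
  apply: Rint2Z; apply: (@intg_jker_D2 _ (`|a x|^-1 * g x) _ cf) => y yM.
  have ax0 : 0 < `|a x|^-1 by rewrite invr_gt0 normr_gt0.
  by rewrite -mulrA -(ler_pdivrMl _ _ ax0) invrK -normrM; exact: H.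
have e2 y : \int[@leb2 R]_x F x y = jump_kernel y * \int[@leb2 R]_x (a x * D2 f x y).
  have [k0|k0] := eqVneq (jump_kernel y) 0.
    by rewrite k0 mul0r; apply: Rint2_0 => x; rewrite /F k0 mul0r mulr0.
  rewrite -Rint2Z; first by apply: Rint2_eq => x; rewrite /F mulrCA.
  apply: (@int2_le _ _ (fun x => enorm y ^+ 2 * g x)).
  - exact: meas2M ma (meas4_sectr y (measurable_D2 cf)).
  - exact: intgZ.
  move=> x; rewrite [leRHS]mulrC; apply: H; rewrite ltNge; apply: contraNN k0 => yM.
  by rewrite jker_out.
split; first exact: int2_eq e1 I1.
by rewrite -(Rint2_eq e1) E; exact: Rint2_eq.
Qed.

Lemma cs_rad f rad : (forall x, f x != 0 -> enorm x < rad) -> compactly_supported f.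
Proof. by move=> H; apply: (@cs_of_box _ _ rad) => x /H; exact: eball_box. Qed.

Lemma continuous_addl (f : R * R -> R) y : continuous f -> continuous (fun x => f (x + y)).
Proof.
move=> cf x; apply: (@continuous_comp _ _ _ (fun x => x + y) f); last exact: cf.
by apply: cvgD; [exact: cvg_id|exact: cvg_cst].
Qed.

Lemma bounded_on_ball f rad : continuous f ->
  exists2 K : R, 0 <= K & forall x, enorm x < rad -> `|f x| <= K.
Proof.
move=> cf; have cb : compact (box rad : set (R * R)).
  by apply: compact_setX; exact: segment_compact.
have := @compact_bounded _ _ _ (continuous_compact (continuous_subspaceT cf) cb).
case=> K [Kr HK]; exists (`|K| + 1); first by rewrite addr_ge0.
move=> x xr; apply: (HK (`|K| + 1)); first by rewrite (le_lt_trans (ler_norm K))// ltrDl.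
by exists x => //; exact: eball_box.
Qed.

(** After Fubini the claim concerns one jump [y], and there it is translation invariance. No decay
    of [f] is required: only values of [f] within [M] of the support of [phi] enter. *)
Lemma J_selfadj f phi C C' : continuous f -> continuous phi -> compactly_supported phi ->
  (forall x y, `|D2 f x y| <= C * enorm y ^+ 2) ->
  (forall x y, `|D2 phi x y| <= C' * enorm y ^+ 2) ->
  [/\ intg2 (fun x => f x * jump_op phi x), intg2 (fun x => phi x * jump_op f x) &
  \int[@leb2 R]_x (f x * jump_op phi x) = \int[@leb2 R]_x (phi x * jump_op f x)].
Proof.
move=> cf cphi sphi HC HC'.
have [rad rad0 Hrad] := cs_box sphi.
have [K K0 HK] := bounded_on_ball (rad + M) cf.
have iphi := intg_cs cphi sphi.
have cM (g h : R * R -> R) : continuous g -> continuous h -> continuous (fun x => g x * h x).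
  by move=> cg ch x; apply: cvgM; [exact: cg|exact: ch].
have [I1 E1] : intg2 (fun x => f x * jump_op phi x) /\ \int[@leb2 R]_x (f x * jump_op phi x) =
    \int[@leb2 R]_y (jump_kernel y * \int[@leb2 R]_x (f x * D2 phi x y)).
  apply: (@J_fubini _ _ (fun x => (K * C') * \1_(eball (rad + M)) x) (continuous_measurable2 cf) cphi).
  - by apply: intgZ; exact: int2_ball.
  - move=> x y yM; rewrite normrM indicE; case: (boolP (x \in _)) => [/set_mem xr|xr].
      by rewrite mulr1 -mulrA ler_pM ?HK ?HC'.
    have xr' : rad + M <= enorm x by rewrite leNgt; apply/negP => h; move/negP: xr; apply; exact: mem_set.
    have z u : rad <= enorm u -> phi u = 0.
      by move=> h; apply/eqP/negPn/negP => /Hrad; rewrite ltNge h.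
    have h1 := enorm_geB x (- y); rewrite opprK enormN in h1.
    have h2 := enorm_geB x y; have e0 := enorm_ge0 y.
    by rewrite /D2 !z ?mulr0 ?addr0 ?subr0 ?normr0 ?mulr0 ?mul0r//; lra.
have [I2 E2] : intg2 (fun x => phi x * jump_op f x) /\ \int[@leb2 R]_x (phi x * jump_op f x) =
    \int[@leb2 R]_y (jump_kernel y * \int[@leb2 R]_x (phi x * D2 f x y)).
  apply: (@J_fubini _ _ (fun x => C * `|phi x|) (continuous_measurable2 cphi) cf).
  - by apply: intgZ; exact: intg_norm.
  - by move=> x y yM; rewrite normrM mulrAC mulrC ler_wpM2r// HC.
split; [exact: I1|exact: I2|rewrite E1 E2; apply: Rint2_eq => y; congr (_ * _)].
have Ip (u v : R * R) : intg2 (fun x => f (x + u) * phi (x + v)).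
  apply: intg_cs; first by apply: cM; exact: continuous_addl.
  apply: (@cs_rad _ (rad + enorm v)) => x; rewrite mulf_eq0 negb_or => /andP[_ /Hrad h].
  have h1 := enormB (x + v) v; rewrite addrK in h1.
  by apply: le_lt_trans h1 _; rewrite ltrD2r; exact: h.
(* Translation by [w] moves a displacement from one factor to the other. *)
have sh (u v w : R * R) : \int[@leb2 R]_x (f (x + u) * phi (x + v)) =
    \int[@leb2 R]_x (f (x + (u + w)) * phi (x + (v + w))).
  rewrite -(Rint_shift w (Ip u v)); apply: Rint2_eq => x.
  by rewrite -!addrA [w + u]addrC [w + v]addrC.
transitivity (\int[@leb2 R]_x (f (x + 0) * phi (x + y)) + \int[@leb2 R]_x (f (x + 0) * phi (x - y))
   - 2 * \int[@leb2 R]_x (f (x + 0) * phi (x + 0))).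
  rewrite -(Rint2Z _ (Ip 0 0)) -(Rint2D (Ip _ _) (Ip _ _)) -Rint2B; [|exact: intgD|exact: intgZ].
  by apply: Rint2_eq => x; rewrite /D2 !addr0; ring.
transitivity (\int[@leb2 R]_x (f (x + y) * phi (x + 0)) + \int[@leb2 R]_x (f (x - y) * phi (x + 0))
   - 2 * \int[@leb2 R]_x (f (x + 0) * phi (x + 0))).
  rewrite (sh 0 y (- y)) (sh 0 (- y) y) !add0r subrr addNr; congr (_ - _); exact: addrC.
rewrite -(Rint2Z _ (Ip 0 0)) -(Rint2D (Ip _ _) (Ip _ _)) -Rint2B; [|exact: intgD|exact: intgZ].
by apply: Rint2_eq => x; rewrite /D2 !addr0; ring.
Qed.

Lemma dotp_continuous (theta : R * R) : continuous (dotp theta).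
Proof.
move=> x; apply: cvgD; apply: cvgM; try exact: cvg_cst.
  exact: continuous_fstR.
exact: continuous_sndR.
Qed.

Lemma continuous_cosdot (theta : R * R) : continuous (fun x => cos (dotp theta x)).
Proof.
move=> x; apply: (@continuous_comp _ _ _ (dotp theta) (@cos R)); first exact: dotp_continuous.
exact: continuous_cos.
Qed.

Lemma D2_cosdot (theta x y : R * R) :
  D2 (fun x => cos (dotp theta x)) x y = - 2 * cos (dotp theta x) * (1 - cos (dotp theta y)).
Proof. by rewrite /D2 dotpD dotpB cosD cosB; ring. Qed.

Lemma onem_cosdot_le (theta y : R * R) :
  1 - cos (dotp theta y) <= enorm theta ^+ 2 / 2 * enorm y ^+ 2.
Proof.
apply: le_trans (onem_cos_le _) _; have := dotp_le theta y.
rewrite -[dotp theta y ^+ 2]real_normK ?num_real// => h.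
rewrite [X in _ <= X]mulrAC ler_pM2r ?invr_gt0// -exprMn.
by apply: lerXn2r; rewrite ?nnegrE ?mulr_ge0 ?enorm_ge0.
Qed.

Lemma D2_cosdot_le (theta x y : R * R) :
  `|D2 (fun x => cos (dotp theta x)) x y| <= enorm theta ^+ 2 * enorm y ^+ 2.
Proof.
rewrite D2_cosdot !normrM normrN (ger0_norm (x := 2))// (ger0_norm (onem_cos_ge0 _)).
have h1 := cos_max (dotp theta x); have h2 := onem_cosdot_le theta y.
apply: (@le_trans _ _ (2 * 1 * (enorm theta ^+ 2 / 2 * enorm y ^+ 2))); last by lra.
by rewrite ler_pM ?onem_cos_ge0// ler_wpM2l.
Qed.

Definition jump_symbol (theta : R * R) : R := \int[@leb2 R]_y (jump_kernel y * (1 - cos (dotp theta y))).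

Lemma intg_psi1 theta : intg2 (fun y => jump_kernel y * (1 - cos (dotp theta y))).
Proof.
apply: (@int2_le _ _ (fun y => (enorm theta ^+ 2 / 2) * jdom y)).
- apply: meas2M; first exact: measurable_jker.
  apply: continuous_measurable2 => y; apply: cvgB; first exact: cvg_cst.
  exact: continuous_cosdot.
- apply: intgZ; exact: intg_jdom.
- move=> y; rewrite normrM (ger0_norm (jker_ge0 y)) (ger0_norm (onem_cos_ge0 _)).
  by rewrite -jker_sqr mulrCA ler_wpM2l ?jker_ge0// onem_cosdot_le.
Qed.

(** Plane waves are eigenfunctions. This identifies [psi_M] as the symbol of the operator and makes
    the cosine corrector explicit. *)
Lemma J_cosdot theta x : jump_op (fun x => cos (dotp theta x)) x = - 2 * jump_symbol theta * cos (dotp theta x).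
Proof.
rewrite /jump_op [RHS]mulrAC -(Rint2Z _ (intg_psi1 _)).
by apply: Rint2_eq => y; rewrite D2_cosdot; ring.
Qed.

Lemma psi_ME r theta : psi_M alpha r M theta = c_lim alpha r M * jump_symbol theta.
Proof.
rewrite /psi_M Rint_indic; congr (_ * _); apply: eq_Rintegral => y _.
by rewrite /jump_kernel mulrA mulrAC.
Qed.

Lemma D2_enorm2 x y : D2 (fun x => enorm x ^+ 2) x y = 2 * enorm y ^+ 2.
Proof. by rewrite /D2 !enorm_sqr /=; ring. Qed.

Lemma J_enorm2 x : jump_op (fun x => enorm x ^+ 2) x = 2 * \int[@leb2 R]_y jdom y.
Proof.
rewrite /jump_op -(Rint2Z _ intg_jdom).
by apply: Rint2_eq => y; rewrite D2_enorm2 mulrCA jker_sqr.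
Qed.

Lemma sigma2_ME r : sigma2_M alpha r M = c_lim alpha r M * \int[@leb2 R]_y jdom y.
Proof.
rewrite /sigma2_M Rint_indic; congr (_ * _); apply: eq_Rintegral => y _.
by rewrite /jdom powRN.
Qed.

End JumpIntegral.

(** * Convergence of the discrete operators *)

Lemma cvgn_eps (R : realType) (u : nat -> R) (l : R) :
  u @ \oo --> l <-> forall e, 0 < e -> exists N, forall n, (N <= n)%N -> `|u n - l| <= e.
Proof.
split=> [/cvgrPdist_le H e e0|H].
  by have [N _ HN] := H e e0; exists N => n Nn; rewrite distrC; exact: HN.
apply/cvgrPdist_le => e e0; have [N HN] := H e e0.
by exists N => // n Nn; rewrite /= distrC; exact: HN.
Qed.

Section PowerDifference.
Variable R : realType.
Implicit Types s t b : R.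

Lemma powRN_anti s t b : 0 < s -> s <= t -> 0 <= b -> t `^ (- b) <= s `^ (- b).
Proof.
move=> s0 st b0; have t0 := lt_le_trans s0 st.
rewrite !powRN lef_pV2 ?posrE ?powR_gt0//.
by apply: ge0_ler_powR; rewrite ?nnegrE// ltW.
Qed.

(** With u = s/t it reduces to 1 - u^b <= 1 - u^4 <= 4 (1 - u). The bound 4 on the exponent covers 2
    + alpha. *)
Lemma powRN_diff s t b : 0 < s -> s <= t -> 0 <= b <= 4 ->
  s `^ (- b) - t `^ (- b) <= 4 * (t - s) * s `^ (- (b + 1)).
Proof.
move=> s0 st /andP[b0 b4]; have t0 := lt_le_trans s0 st.
pose u := s / t; have u0 : 0 < u by rewrite divr_gt0.
have u1 : u <= 1 by rewrite ler_pdivrMr// mul1r.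
have -> : t `^ (- b) = u `^ b * s `^ (- b).
  have -> : u `^ b = s `^ b * t `^ (- b).
    by rewrite /u powRM ?invr_ge0 ?ltW// -(powR_inv1 (ltW t0)) -powRrM mulN1r.
  by rewrite mulrAC -powRD ?subrr ?powRr0 ?mul1r//; apply/implyP => _; exact: lt0r_neq0.
have h4 : u ^+ 4 <= u `^ b.
  rewrite -powR_mulrn ?(ltW u0)//.
    by apply: (ger_powR (introT andP (conj u0 u1))).
have -> : s `^ (- (b + 1)) = s `^ (- b) / s.
  rewrite opprD powRD ?powR_inv1 ?(ltW s0)//; apply/implyP => _; exact: lt0r_neq0.
have sb0 : 0 < s `^ (- b) by rewrite powR_gt0.
have e : 1 - u = (t - s) / t by rewrite /u mulrBl divff ?gt_eqF.
have h5 : 1 - u ^+ 4 <= 4 * (1 - u).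
  rewrite -subr_ge0.
  have -> : 4 * (1 - u) - (1 - u ^+ 4) = (1 - u) * ((1 - u) + (1 - u ^+ 2) + (1 - u ^+ 3)) by ring.
  have hk k : 0 <= 1 - u ^+ k by rewrite subr_ge0 exprn_ile1// ltW.
  have h1 := hk 1%N; rewrite expr1 in h1.
  by apply: mulr_ge0 => //; apply: addr_ge0 (hk 3); exact: addr_ge0.
have h6 : (t - s) / t <= (t - s) / s.
  by rewrite ler_wpM2l ?subr_ge0// lef_pV2.
rewrite -{1}[s `^ (- b)]mul1r -mulrBl mulrCA [X in _ <= X]mulrC ler_pM2r//.
by rewrite -mulrA; lra.
Qed.

Lemma powRN_dist s t m b : 0 < m -> m <= s -> m <= t -> 0 <= b <= 4 ->
  `|s `^ (- b) - t `^ (- b)| <= 4 * `|s - t| * m `^ (- (b + 1)).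
Proof.
move=> m0.
have key s' t' : m <= s' -> s' <= t' -> 0 <= b <= 4 ->
    `|s' `^ (- b) - t' `^ (- b)| <= 4 * `|s' - t'| * m `^ (- (b + 1)).
  move=> ms st b04; have s0 := lt_le_trans m0 ms; have /andP[b0 _] := b04.
  rewrite ger0_norm ?subr_ge0 ?powRN_anti//.
  apply: le_trans (powRN_diff s0 st b04) _.
  rewrite distrC ger0_norm ?subr_ge0//; apply: ler_wpM2l.
    by rewrite mulr_ge0// subr_ge0.
  by apply: powRN_anti => //; lra.
move=> ms mt b04; have [st|/ltW ts] := leP s t; first exact: key.
by rewrite distrC [`|s - t|]distrC; exact: key.
Qed.

End PowerDifference.
Section NearestNorm.
Variable R : realType.
Implicit Types (x y : R * R).

Definition nr n y : R := enorm (pt R n (nearest n y)).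

Lemma nr_ge0 n y : 0 <= nr n y. Proof. exact: enorm_ge0. Qed.

Lemma nr_dist n y : (0 < n)%N -> `|nr n y - enorm y| <= n%:R^-1.
Proof.
move=> n0; have h := nearest_dist n0 y; rewrite ler_distl.
have h1 := enorm_geB y (pt R n (nearest n y)).
have h2 := enorm_geB (pt R n (nearest n y)) y.
rewrite -(enormN (_ - y)) opprB in h2.
by rewrite /nr; move: h h1 h2; set a := enorm (pt _ _ _) => *; apply/andP; split; lra.
Qed.

Lemma nr_eq0_or n y : (0 < n)%N -> nr n y = 0 \/ n%:R^-1 <= nr n y.
Proof.
move=> n0; rewrite /nr; case: (nearest n y) => a b.
have nR0 := nR_gt0 R n0.
have h := @enorm_ptE R n n0 (a, b).
have [->|ab] := eqVneq ((a, b) : site) 0; first by left; rewrite pt0 enorm0.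
right; rewrite -(ler_pM2l nR0) divff ?gt_eqF// h /=.
have : 1 <= `|a%:~R| :> R \/ 1 <= `|b%:~R| :> R.
  have H (c : int) : c != 0 -> 1 <= `|c%:~R| :> R.
    move=> c0; rewrite -intr_norm -[1]/(1%:~R) ler_int.
    by move: c0; rewrite -normr_gt0; lia.
  move: ab; rewrite xpair_eqE negb_and => /orP[]; [left|right]; exact: H.
case=> hh; apply: le_trans hh _.
  exact: (fst_le_enorm ((a%:~R : R), (b%:~R : R))).
exact: (snd_le_enorm ((a%:~R : R), (b%:~R : R))).
Qed.

(** A nonzero lattice norm is at least 1/n, hence at least the error made by rounding [y]. *)
Lemma nr_ge_half n y : (0 < n)%N -> nr n y != 0 -> enorm y / 2 <= nr n y.
Proof.
move=> n0 nz; have [/eqP|h] := nr_eq0_or y n0; first by rewrite (negbTE nz).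
have := nr_dist y n0; rewrite ler_distl => /andP[h1 h2]; lra.
Qed.

Lemma nr_scale n y : (0 < n)%N -> nr n (aff2 n%:R^-1 0 y) = nr 1 y / n%:R.
Proof.
move=> n0; have nR0 := nR_gt0 R n0.
rewrite /nr; have -> : nearest n (aff2 n%:R^-1 0 y : R * R) = nearest 1 y.
  rewrite /nearest /aff2 /aff1 /=; congr pair; congr Num.floor; congr (_ + _);
  by rewrite addr0 mulrA divff ?gt_eqF.
set z := nearest 1 y.
apply: (mulfI (lt0r_neq0 nR0)); rewrite enorm_ptE// mulrCA divff ?gt_eqF// mulr1.
by rewrite -(@enorm_ptE R 1)// mul1r.
Qed.

Lemma enorm_aff (a : R) y : enorm (aff2 a 0 y) = `|a| * enorm y.
Proof. by rewrite -enorm_scale /aff2 /aff1 !addr0. Qed.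

Lemma meas2_nr n : (0 < n)%N -> meas2 (nr n).
Proof. by move=> n0; exact: (measurable_box_ext n0 (fun z => enorm (pt R n z))). Qed.

Lemma meas2_powR f (b : R) : meas2 f -> meas2 (fun y : R * R => f y `^ b).
Proof. by move=> mf; exact: (measurableT_comp (measurable_powR b) mf). Qed.

End NearestNorm.

(** * Convergence of the normalising constants *)

Section CLimit.
Variables (R : realType) (alpha r M : R).
Hypothesis alpha_gt1 : 1 < alpha.
Hypothesis alpha_lt2 : alpha < 2.
Hypothesis r_gt0 : 0 < r.
Hypothesis r_ltM : r < M.
Hypothesis M_gt1 : 1 < M.
Hypothesis k_gt0 : forall n : nat, (0 < n)%N -> 0 < k_ alpha r M n.
Local Notation c_ := (c_ alpha r M).
Local Notation k_ := (k_ alpha r M).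
Implicit Types (x y : R * R).

Let co r : R * R -> R := \1_(~` (@eball R r)).

Lemma coE rad y : co rad y = 1 - \1_(eball rad) y.
Proof. by rewrite /co !indicE in_setC; case: (_ \in _); rewrite /= ?subr0 ?subrr. Qed.

(* Rescaling the cells of mesh [1 / n] to unit cells turns [(c_ n)^-1] into the integral of this
   fixed function over the ball of radius [M n], whence the convergence of [c_]. *)
Definition hlim y : R :=
  enorm y `^ (- alpha) - co r y * nr 1 y `^ (- alpha) + co r y * nr 1 y `^ (- (2 + alpha)).

Lemma meas2_co rad : meas2 (co rad).
Proof. by apply: meas2_indic; apply: measurableC; exact: measurable_eball. Qed.

Lemma meas2_hlim : meas2 hlim.
Proof.
have mn := @meas2_nr R 1 isT.
apply: meas2D; first apply: meas2B.
- exact: measurable_enorm_powR.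
- by apply: meas2M; [exact: meas2_co|exact: meas2_powR].
- by apply: meas2M; [exact: meas2_co|exact: meas2_powR].
Qed.

Lemma nr1_powR_le1 b y : 0 < b -> nr 1 y `^ (- b) <= 1.
Proof.
move=> b0; have [->|] := nr_eq0_or y (isT : (0 < 1)%N).
  by rewrite powR0 ?ler01// oppr_eq0 gt_eqF.
rewrite invr1 => h; have := powRN_anti ltr01 h (ltW b0).
by rewrite powR1.
Qed.

Lemma co01 rad y : 0 <= co rad y <= 1.
Proof. by rewrite /co indicE; case: (_ \in _); rewrite /= lexx ler01. Qed.

(** On the ball of radius [A] the function is at most |y|^-alpha + 2. Outside, rounding changes
    |y|^-alpha by O(|y|^-(alpha + 1)), integrable since [alpha > 1]. The radius r + 2 ensures that
    [co r] is 1 and that [nr 1 y] is at least |y| / 2 out there. *)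
Lemma intg_hlim : intg2 hlim.
Proof.
have a1 := alpha_gt1; have a2 := alpha_lt2; have r0 := r_gt0.
pose A := r + 2.
have A0 : 0 < A by rewrite /A; lra.
pose g y : R := \1_(eball A) y * enorm y `^ (- alpha) + 2 * \1_(eball A) y
   + 4 * (2^-1 `^ (- (alpha + 1))) * (co A y * enorm y `^ (- (alpha + 1)))
   + 2^-1 `^ (- (2 + alpha)) * (co A y * enorm y `^ (- (2 + alpha))).
apply: (@int2_le _ _ g); first exact: meas2_hlim.
  apply: intgD; first (apply: intgD; first apply: intgD).
  - by apply: intg_near; lra.
  - by apply: intgZ; exact: int2_ball.
  - by apply: intgZ; apply: intg_far => //; lra.
  - by apply: intgZ; apply: intg_far => //; lra.
move=> y; have e0 := enorm_ge0 y.
have P b z : 0 <= z `^ b :> R by exact: powR_ge0.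
rewrite /g coE indicE /hlim; case: (boolP (y \in _)) => yA.
  have /andP[c0 c1] := co01 r y.
  have h1 := @nr1_powR_le1 alpha y ltac:(lra); have h2 := @nr1_powR_le1 (2 + alpha) y ltac:(lra).
  rewrite subrr !mul0r !mulr0 !addr0 mul1r mulr1.
  have q1 : 0 <= co r y * nr 1 y `^ (- alpha) <= 1.
    by rewrite mulr_ge0//= mulr_ile1.
  have q2 : 0 <= co r y * nr 1 y `^ (- (2 + alpha)) <= 1.
    by rewrite mulr_ge0//= mulr_ile1.
  have := P (- alpha) (enorm y).
  move: (co r y * _) q1 (co r y * _) q2 (enorm y `^ _) => u /andP[u0 u1] v /andP[v0 v1] w w0.
  by rewrite ler_norml; apply/andP; split; lra.
have yA' : A <= enorm y by rewrite leNgt; apply/negP => h; move/negP: yA; apply; exact: mem_set.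
have -> : co r y = 1.
  by rewrite /co indicE mem_set//= => h; move: h; rewrite /eball /=; move: yA'; rewrite /A; lra.
have d := nr_dist y (isT : (0 < 1)%N); rewrite invr1 in d.
have nz : enorm y / 2 <= nr 1 y.
  by move: d; rewrite ler_distl => /andP[d1 d2]; move: yA'; rewrite /A; lra.
have e2 : 0 < enorm y / 2 by move: yA'; rewrite /A; lra.
have pw b : 2^-1 `^ b * enorm y `^ b = (enorm y / 2) `^ b.
  by rewrite -powRM// mulrC.
rewrite subr0 !mul1r !mul0r mulr0 !add0r -mulrA pw pw.
apply: le_trans (ler_normD _ _) _; apply: lerD.
  apply: le_trans (powRN_dist e2 _ nz _) _; [lra|lra|].
  rewrite -mulrA ler_wpM2l//; rewrite -[leRHS]mul1r ler_wpM2r//.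
  by rewrite distrC.
rewrite ger0_norm//; apply: powRN_anti => //; lra.
Qed.

Lemma scale_indic n y : (0 < n)%N ->
  \1_(@eball R M) (aff2 n%:R^-1 0 y) = \1_(eball (M * n%:R)) y :> R.
Proof.
move=> n0; have nR0 := nR_gt0 R n0; rewrite !indicE; congr (_%:R); congr nat_of_bool.
apply/idP/idP => /set_mem h; apply: mem_set; move: h; rewrite /eball /= enorm_aff
  ger0_norm ?invr_ge0 ?ler0n// [n%:R^-1 * _]mulrC ltr_pdivrMr//.
Qed.

Lemma annulus_indic n y : (0 < n)%N ->
  \1_(annulus r M n) y = \1_(eball M) y * co (r / n%:R) y :> R.
Proof. by move=> n0; rewrite /annulus setDE indicI. Qed.

Lemma scale_co n y : (0 < n)%N -> co (r / n%:R) (aff2 n%:R^-1 0 y) = co r y.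
Proof.
move=> n0; have nR0 := nR_gt0 R n0; rewrite !coE !indicE; congr (1 - _%:R); congr nat_of_bool.
apply/idP/idP => /set_mem h; apply: mem_set; move: h; rewrite /eball /= enorm_aff
  ger0_norm ?invr_ge0 ?ler0n// [n%:R^-1 * _]mulrC ltr_pM2r ?invr_gt0//.
Qed.

Lemma intg_annulus_nr n b : (0 < n)%N ->
  intg2 (fun y => \1_(annulus r M n) y * nr n y `^ b).
Proof.
move=> n0.
have [H _] := Rint_box_ext n0 (fun z => enorm (pt R n z) `^ b) (measurable_annulus r M n)
  (annulus_lty r M n) (uniq_ibox _) (@nearest_annulus R r M n n0).
exact: H.
Qed.

Lemma k_E n : (0 < n)%N -> 4 * k_ n * n%:R `^ (alpha - 2) =
  \int[@leb2 R]_y jdom alpha M y - \int[@leb2 R]_y (\1_(annulus r M n) y * nr n y `^ (- alpha)).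
Proof.
move=> n0; have nR0 := nR_gt0 R n0.
have cn := c_gt0 alpha_gt1 alpha_lt2 r_gt0 r_ltM M_gt1 n0 (k_gt0 n0).
have := sig2E alpha_gt1 alpha_lt2 r_gt0 r_ltM M_gt1 n0 (k_gt0 n0).
rewrite /sig2 (sum_jump alpha_gt1 alpha_lt2 r_gt0 r_ltM M_gt1 n0 (k_gt0 n0)).
rewrite mulrCA => /(mulfI (lt0r_neq0 cn)).
have nb : \sum_(z <- nbrs) enorm (pt R n z) ^+ 2 = 4 * n%:R ^- 2.
  have e z : z \in nbrs -> enorm (pt R n z) ^+ 2 = n%:R ^- 2.
    by rewrite -(nbrsP alpha_gt1 alpha_lt2 r_gt0 r_ltM M_gt1 n0 (k_gt0 n0)) => /eqP ->; rewrite exprVn.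
  by rewrite /nbrs !big_cons big_nil !e//; ring.
rewrite nb.
have -> : \int[@leb2 R]_(x in eball M) (enorm x `^ alpha)^-1 = \int[@leb2 R]_y jdom alpha M y.
  by rewrite Rint_indic; apply: Rint2_eq => x; rewrite /jdom powRN.
have -> : \int[@leb2 R]_x (\1_(annulus r M n) x *
      box_ext n (fun z => enorm (pt R n z) ^+ 2 / enorm (pt R n z) `^ (2 + alpha)) x) =
    \int[@leb2 R]_y (\1_(annulus r M n) y * nr n y `^ (- alpha)).
  apply: Rint2_eq => x; congr (_ * _); rewrite /box_ext /nr; set e := enorm _.
  have [->|en0] := eqVneq e 0.
    by rewrite expr0n mul0r powR0// oppr_eq0 gt_eqF//; have := alpha_gt1; lra.
  rewrite powRD ?en0 ?implybT// invfM powR_mulrn ?enorm_ge0// mulrA divff ?mul1r ?powRN//.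
  by rewrite expf_neq0.
have na : n%:R `^ alpha * n%:R `^ (- alpha) = 1 :> R.
  by rewrite powRN mulfV// gt_eqF// powR_gt0.
have n2 : n%:R `^ (alpha - 2) = n%:R `^ alpha * n%:R ^- 2.
  rewrite powRD; last by apply/implyP => _; exact: lt0r_neq0.
  by rewrite powR_invn// ltW.
rewrite mulrDr [n%:R `^ alpha * (_ `^ _ * _)]mulrA na mul1r n2 => h.
by rewrite -h; ring.
Qed.

Lemma c_inv n : (0 < n)%N -> (c_ n)^-1 = \int[@leb2 R]_y (\1_(eball (M * n%:R)) y * hlim y).
Proof.
move=> n0; have nR0 := nR_gt0 R n0.
have cn := c_gt0 alpha_gt1 alpha_lt2 r_gt0 r_ltM M_gt1 n0 (k_gt0 n0).
have a1 := alpha_gt1; have a2 := alpha_lt2.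
have E1 : (c_ n)^-1 = 4 * k_ n + n%:R `^ (- alpha) *
    \int[@leb2 R]_y (\1_(annulus r M n) y * nr n y `^ (- (2 + alpha))).
  (* For the constant function 1 the left side of [sum_jump] is the total probability. *)
  have := sum_jump alpha_gt1 alpha_lt2 r_gt0 r_ltM M_gt1 n0 (k_gt0 n0) (fun=> 1).
  under eq_bigr do rewrite mulr1.
  rewrite (pn_sum alpha_gt1 alpha_lt2 r_gt0 r_ltM M_gt1 n0 (k_gt0 n0)) => h.
  apply: (mulfI (lt0r_neq0 cn)); rewrite divff ?lt0r_neq0//; apply: etrans h _.
  congr (_ * (_ + _ * _)).
    by rewrite /nbrs !big_cons big_nil; ring.
  by apply: Rint2_eq => x; congr (_ * _); rewrite /box_ext mul1r powRN.
pose f y : R := jdom alpha M y - \1_(annulus r M n) y * nr n y `^ (- alpha)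
  + n%:R ^- 2 * (\1_(annulus r M n) y * nr n y `^ (- (2 + alpha))).
have If1 := intg_annulus_nr (- alpha) n0; have If2 := intg_annulus_nr (- (2 + alpha)) n0.
have Ij := @intg_jdom R alpha M alpha_gt1 alpha_lt2.
have If : intg2 f := intgD (intgB Ij If1) (intgZ (n%:R ^- 2) If2).
have E2 : (c_ n)^-1 = n%:R `^ (2 - alpha) * \int[@leb2 R]_y f y.
  rewrite /f (Rint2D (intgB Ij If1) (intgZ (n%:R ^- 2) If2)).
  rewrite (Rint2B Ij If1) (Rint2Z _ If2) -k_E// E1 mulrDr; congr (_ + _).
    rewrite [RHS]mulrCA -powRD; last by apply/implyP => _; exact: lt0r_neq0.
    by rewrite (_ : 2 - alpha + (alpha - 2) = 0) ?powRr0 ?mulr1//; ring.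
  rewrite mulrA; congr (_ * _).
  rewrite -powR_invn ?(ltW nR0)// -powRD; last by apply/implyP => _; exact: lt0r_neq0.
  by congr (_ `^ _); ring.
have nn0 : n%:R^-1 != 0 :> R by rewrite invr_eq0 lt0r_neq0.
rewrite E2 (Rint_aff2 nn0 0 If) mulrA.
have Ih : intg2 (fun y => \1_(eball (M * n%:R)) y * hlim y).
  apply: (@int2_le _ _ (fun y => `|hlim y|)).
  - by apply: meas2M; [exact: meas2_ball|exact: meas2_hlim].
  - by apply: intg_norm; exact: intg_hlim.
  - move=> y; rewrite normrM indicE; case: (_ \in _) => /=; first by rewrite normr1 mul1r.
    by rewrite normr0 mul0r.
have e : n%:R `^ (2 - alpha) * `|n%:R^-1| ^+ 2 * n%:R `^ alpha = 1 :> R.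
  rewrite ger0_norm ?invr_ge0 ?(ltW nR0)// exprVn -powR_invn ?(ltW nR0)//.
  rewrite -!powRD; try (by apply/implyP => _; exact: lt0r_neq0).
  by rewrite (_ : 2 - alpha - 2 + alpha = 0) ?powRr0//; ring.
rewrite -[RHS]mul1r -[X in _ = X * _]e -[RHS]mulrA; congr (_ * _); rewrite -Rint2Z//.
apply: Rint2_eq => y; rewrite /f /jdom annulus_indic// scale_indic// scale_co// nr_scale//.
rewrite enorm_aff (ger0_norm (x := n%:R^-1)) ?invr_ge0 ?(ltW nR0)//.
have pw b z : 0 <= z -> (z / n%:R) `^ (- b) = n%:R `^ b * z `^ (- b) :> R.
  move=> z0; rewrite powRM ?invr_ge0 ?(ltW nR0)// -(powR_inv1 (ltW nR0)) -powRrM mulN1r opprK mulrC//.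
rewrite [n%:R^-1 * _]mulrC !pw ?nr_ge0 ?enorm_ge0//.
have -> : n%:R `^ (2 + alpha) = n%:R ^+ 2 * n%:R `^ alpha :> R.
  by rewrite powRD ?powR_mulrn ?(ltW nR0)//; apply/implyP => _; exact: lt0r_neq0.
have nn2 : n%:R != 0 :> R by exact: lt0r_neq0.
by rewrite /hlim; field.
Qed.

Lemma c_inv_cvg : (c_ n)^-1 @[n --> \oo] --> \int[@leb2 R]_y hlim y.
Proof.
have M0 : 0 < M by apply: lt_trans M_gt1.
have H1 y : \1_(eball (M * n.+1%:R)) y * hlim y @[n --> \oo] --> hlim y.
  apply/cvgn_eps => e e0; exists (Num.truncn (enorm y)) => n Nn.
  rewrite indicE mem_set ?mul1r ?subrr ?normr0 ?ltW//; rewrite /eball /=.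
  have h1 := truncnS_gt (enorm y).
  apply: (lt_le_trans h1); apply: (@le_trans _ _ n.+1%:R); first by rewrite ler_nat.
  by rewrite ler_peMl// ltW.
have H2 n y : `|\1_(eball (M * n.+1%:R)) y * hlim y| <= `|hlim y|.
  rewrite normrM indicE; case: (_ \in _) => /=; first by rewrite normr1 mul1r.
  by rewrite normr0 mul0r.
have [_ h] := Rint2_dct (fun n => meas2M (meas2_ball (M * n.+1%:R)) meas2_hlim) H1
  (intg_norm intg_hlim) H2.
rewrite -cvg_shiftS (_ : (fun n => (c_ n.+1)^-1) =
  (fun n => \int[@leb2 R]_y (\1_(eball (M * n.+1%:R)) y * hlim y))) //.
by apply/funext => n; rewrite c_inv.
Qed.

End CLimit.

(** * Positivity of the limit constant and consistency on smooth functions *)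

Section Consistency.
Variables (R : realType) (alpha r M : R).
Hypothesis alpha_gt1 : 1 < alpha.
Hypothesis alpha_lt2 : alpha < 2.
Hypothesis r_gt0 : 0 < r.
Hypothesis r_ltM : r < M.
Hypothesis M_gt1 : 1 < M.
Hypothesis k_gt0 : forall n : nat, (0 < n)%N -> 0 < k_ alpha r M n.
Local Notation c_ := (c_ alpha r M).
Local Notation k_ := (k_ alpha r M).
Local Notation c := (c_lim alpha r M).
Implicit Types (x y : R * R).

Lemma c_invE n : (0 < n)%N -> (c_ n)^-1 = \sum_(z <- Sn M n) jump_weight alpha r M n z.
Proof.
move=> n0; rewrite /Defs.c_ invrK.
exact: (jump_weight_sum alpha_gt1 alpha_lt2 r_gt0 r_ltM M_gt1 n0 (k_gt0 n0)).
Qed.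

Lemma jump_weight_le n z : (0 < n)%N -> z \in Sn M n -> jump_weight alpha r M n z <= (c_ n)^-1.
Proof.
move=> n0 zS; rewrite c_invE// (bigD1_seq z)//=; last exact: uniq_ibox.
rewrite lerDl sumr_ge0// => y _.
exact: (jump_weight_ge0 (k_gt0 n0)).
Qed.

Lemma k_le n : (0 < n)%N -> k_ n <= (c_ n)^-1.
Proof.
move=> n0; apply: le_trans (jump_weight_le n0 (e1_in_Sn M n)).
rewrite /jump_weight (nbrsP alpha_gt1 alpha_lt2 r_gt0 r_ltM M_gt1 n0 (k_gt0 n0) (1, 0)) mulr1.
by rewrite lerDl divr_ge0 ?F_ge0 ?powR_ge0.
Qed.

Lemma leb2_cell_area n z : (0 < n)%N -> leb2 (@cell R n z) = (n%:R ^- 2)%:E.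
Proof.
move=> n0; have nR0 := nR_gt0 R n0.
rewrite cellE leb2X; try exact: measurable_itv.
have h : 0 < (2 * n%:R)^-1 :> R by rewrite invr_gt0 mulr_gt0.
have L (a : R) : lebesgue_measure `[a - (2 * n%:R)^-1, a + (2 * n%:R)^-1]%classic = (n%:R^-1)%:E.
  rewrite lebesgue_measure_itv /= lte_fin; case: ltP => hh; last by exfalso; lra.
  by rewrite -EFinD; congr EFin; field; exact: lt0r_neq0.
by rewrite !L -EFinM; congr EFin; rewrite -invfM expr2.
Qed.

(** A single site bounds the total weight from below: at [A] lattice steps from the origin the whole
    cell lies in the annulus, so [F_] is 1 there and the weight is at least A^-(2 + alpha). *)
Lemma c_inv_ge : exists2 k : R, 0 < k & exists N, forall n, (N <= n)%N -> k <= (c_ n)^-1.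
Proof.
pose A := (Num.truncn (r + 2)).+1.
have rA : r + 2 < A%:R by exact: truncnS_gt.
have r0 := r_gt0; have M1 := M_gt1.
have A0 : 0 < A%:R :> R by lra.
exists (A%:R `^ (- (2 + alpha))); first by rewrite powR_gt0.
(* Then (A + 1)/n < 1 < M, so the cell stays inside the outer ball. *)
exists (A.+2) => n An.
have n0 : (0 < n)%N by apply: leq_trans An.
have nR0 := nR_gt0 R n0.
pose z : site := (A%:Z, 0).
have ptz : pt R n z = (A%:R / n%:R, 0) by rewrite /pt /z /= mul0r.
have ez : enorm (pt R n z) = A%:R / n%:R.
  by rewrite ptz /enorm /= expr0n addr0 sqrtr_sqr ger0_norm// divr_ge0// ltW.
have Anle : A%:R + 2 <= n%:R :> R by rewrite -natrD ler_nat addn2.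
have sub : cell n z `<=` annulus r M n.
  move=> x xz; have xz' : enorm (x - pt R n z) <= n%:R^-1.
    have [h1 h2] := xz; apply: le_trans (enorm_le _) _.
    apply: le_trans (lerD h1 h2) _; rewrite le_eqVlt; apply/orP; left; apply/eqP.
    by field; exact: lt0r_neq0.
  have h3 := enorm_geB x (pt R n z); have h4 := enorm_geB (pt R n z) x.
  rewrite -(enormN (_ - x)) opprB in h4; rewrite ez in h3 h4.
  split.
    rewrite /eball /=; apply: (@le_lt_trans _ _ (A%:R / n%:R + n%:R^-1)); first by lra.
    rewrite -[X in _ + X]mul1r -mulrDl ltr_pdivrMr//.
    by apply: (@lt_le_trans _ _ (1 * n%:R)); [lra|rewrite ler_pM2r// ltW].
  rewrite /eball /= => hx.
  have : (A%:R - 1 - r) / n%:R < 0 by rewrite !mulrBl mul1r; lra.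
  by rewrite pmulr_llt0 ?invr_gt0//; lra.
have zS : z \in Sn M n.
  apply: index_bound => //; rewrite ez; apply: (@le_trans _ _ 1); last lra.
  by rewrite ler_pdivrMr// mul1r; lra.
apply: le_trans (jump_weight_le n0 zS).
rewrite /jump_weight; apply: (@le_trans _ _ (F_ r M n z / (n%:R * enorm (pt R n z)) `^ (2 + alpha))).
  rewrite /F_ (setIidl sub) leb2_cell_area//= mulfV ?expf_neq0 ?lt0r_neq0// mul1r ez.
  by rewrite mulrCA divff ?lt0r_neq0// mulr1 powRN.
rewrite lerDr mulr_ge0 ?ler0n// ltW// k_gt0//.
Qed.

(** The limit is the inverse of the integral of [hlim], and [c_inv_ge] keeps that integral
    positive. *)
Lemma c_lim_spec : c_ n @[n --> \oo] --> c /\ 0 < c.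
Proof.
have H := c_inv_cvg alpha_gt1 alpha_lt2 r_gt0 r_ltM M_gt1 k_gt0.
set L := \int[_]_y _ in H.
have [k k0 [N HN]] := c_inv_ge.
have L0 : 0 < L.
  apply: lt_le_trans k0 _; rewrite -(cvg_lim (@Rhausdorff R) H); apply: limr_ge.
    by apply/cvg_ex; exists L.
  by exists N.
have cv : c_ n @[n --> \oo] --> L^-1.
  rewrite (_ : (fun n => c_ n) = (fun n => ((c_ n)^-1)^-1)).
    exact: (cvgV (lt0r_neq0 L0) H).
  by apply/funext => n; rewrite invrK.
have -> : c = L^-1 by apply/cvg_lim.
by rewrite invr_gt0.
Qed.

Lemma c_bounds : exists2 K : R, 0 < K & exists N, forall n, (N <= n)%N ->
  [/\ (0 < n)%N, 0 < c_ n, c_ n <= K, K^-1 <= c_ n & k_ n <= K].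
Proof.
have [cv c0] := c_lim_spec.
have [N HN] := (cvgn_eps _ _).1 cv (c / 2) (divr_gt0 c0 (ltr0Sn _ 1)).
exists (2 * c + 2 / c); first by rewrite addr_gt0 ?mulr_gt0 ?invr_gt0.
exists (maxn N 1) => n; rewrite geq_max => /andP[Nn n0].
have := HN n Nn; rewrite ler_distl => /andP[h1 h2].
have ci : 0 < c^-1 by rewrite invr_gt0.
have h3 : (2 * c + 2 / c)^-1 <= c / 2.
  have -> : c / 2 = (2 / c)^-1 by rewrite invf_div.
  by rewrite lef_pV2 ?posrE ?addr_gt0 ?mulr_gt0//; lra.
have h4 : k_ n <= 2 / c.
  apply: le_trans (k_le n0) _; have -> : 2 / c = (c / 2)^-1 by rewrite invf_div.
  by rewrite lef_pV2 ?posrE ?divr_gt0//; [lra|exact: c_gt0 (k_gt0 n0)].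
split=> //; lra.
Qed.

(** The discrete operator evaluated at arbitrary points of the plane, so that it can act on bump
    functions not centred on the lattice. *)
Definition scaled_jump n (f : R * R -> R) x : R :=
  n%:R `^ alpha * \sum_(z <- Sn M n) p_ alpha r M n z * (f (x + pt R n z) - f x).

Lemma Ln_D2 n f x : (0 < n)%N -> scaled_jump n f x =
  c_ n / 2 * (n%:R `^ alpha * k_ n * \sum_(z <- nbrs) D2 f x (pt R n z) +
    \int[@leb2 R]_y (\1_(annulus r M n) y *
      (D2 f x (pt R n (nearest n y)) / nr n y `^ (2 + alpha)))).
Proof.
move=> n0; have nR0 := nR_gt0 R n0.
have e : \sum_(z <- Sn M n) p_ alpha r M n z * (f (x + pt R n z) - f x) =
    2^-1 * \sum_(z <- Sn M n) p_ alpha r M n z * D2 f x (pt R n z).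
  set S1 := (LHS).
  have S2 : S1 = \sum_(z <- Sn M n) p_ alpha r M n z * (f (x - pt R n z) - f x).
    rewrite /S1 -(sum_opp (perm_ibox_opp _) (fun z => p_ alpha r M n z * (f (x + pt R n z) - f x))).
    apply: eq_bigr => z _; rewrite ptN.
    by rewrite (pn_opp alpha_gt1 alpha_lt2 r_gt0 r_ltM M_gt1 n0 (k_gt0 n0)).
  have -> : \sum_(z <- Sn M n) p_ alpha r M n z * D2 f x (pt R n z) = S1 + S1.
    rewrite {2}S2 /S1 -big_split /=; apply: eq_bigr => z _; rewrite /D2; ring.
  by field.
rewrite /scaled_jump e (sum_jump alpha_gt1 alpha_lt2 r_gt0 r_ltM M_gt1 n0 (k_gt0 n0)) /box_ext.
have na : n%:R `^ alpha * n%:R `^ (- alpha) = 1 :> R.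
  by rewrite powRN mulfV// gt_eqF// powR_gt0.
set I' := (X in _ = _ * (_ + X)); set I := (X in n%:R `^ (- alpha) * X).
have -> : I = I' by exact: Rint2_eq.
transitivity (c_ n / 2 * (n%:R `^ alpha * k_ n * \sum_(z <- nbrs) D2 f x (pt R n z) +
  (n%:R `^ alpha * n%:R `^ (- alpha)) * I')); first by ring.
by rewrite na mul1r.
Qed.

Lemma intg_small_ball e : 0 < e -> exists2 d : R, 0 < d &
  \int[@leb2 R]_y (\1_(eball d) y * enorm y `^ (- alpha)) <= e.
Proof.
move=> e0; have a1 := alpha_gt1; have a2 := alpha_lt2.
pose f_ (n : nat) y : R := \1_(eball n.+1%:R^-1) y * enorm y `^ (- alpha).
have H1 y : f_ n y @[n --> \oo] --> (0 : R).
  apply/cvgn_eps => e' e'0.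
  have [y0|y0] := eqVneq (enorm y) 0.
    exists 0%N => n _; rewrite /f_ y0 powR0 ?mulr0 ?subrr ?normr0 ?ltW// oppr_eq0 gt_eqF//; lra.
  have yp : 0 < enorm y by rewrite lt_neqAle eq_sym y0 enorm_ge0.
  exists (Num.truncn (enorm y)^-1) => n Nn; rewrite /f_ indicE memNset ?mul0r ?subrr ?normr0 ?ltW//.
  rewrite /eball /= => h; have h1 := truncnS_gt (enorm y)^-1.
  have : n.+1%:R^-1 < enorm y.
    rewrite -[ltRHS]invrK ltf_pV2 ?posrE ?invr_gt0//.
    by apply: (lt_le_trans h1); rewrite ler_nat.
  by move=> h2; have := lt_trans h h2; rewrite ltxx.
have mf n : meas2 (f_ n).
  by apply: meas2M; [exact: meas2_ball|exact: measurable_enorm_powR].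
have H2 n y : `|f_ n y| <= \1_(eball 1) y * enorm y `^ (- alpha).
  rewrite /f_ normrM (ger0_norm (powR_ge0 _ _)) ler_wpM2r ?powR_ge0// !indicE.
  case: (boolP (y \in eball n.+1%:R^-1)) => [/set_mem h|_]; last by rewrite normr0 ler0n.
  rewrite mem_set ?normr1//; rewrite /eball /=; apply: lt_le_trans h _.
  by rewrite invf_le1 ?ltr0n// ler1n.
have I1 : intg2 (fun y => \1_(eball 1) y * enorm y `^ (- alpha)) by apply: intg_near; lra.
have [_] := Rint2_dct mf H1 I1 H2.
rewrite (Rint2_0 (f := fun=> 0))// => /cvgn_eps /(_ e e0) [N /(_ N (leqnn _))].
rewrite subr0 => h; exists (N.+1%:R^-1); first by rewrite invr_gt0.
by apply: le_trans h; exact: ler_norm.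
Qed.

Lemma powRN_small e : 0 < e -> exists N, forall n, (N <= n)%N -> n%:R `^ (alpha - 2) <= e :> R.
Proof.
move=> e0; have a2 := alpha_lt2.
pose b := 2 - alpha; have b0 : 0 < b by rewrite subr_gt0.
exists (Num.truncn (e^-1 `^ b^-1)).+1 => n Nn.
have h : e^-1 `^ b^-1 <= n%:R.
  by apply: le_trans (ltW (truncnS_gt _)) _; rewrite ler_nat.
have ei : 0 < e^-1 by rewrite invr_gt0.
have n0 : 0 < n%:R :> R by apply: lt_le_trans h; exact: powR_gt0.
have -> : alpha - 2 = - b by rewrite /b; ring.
rewrite powRN -[leRHS]invrK lef_pV2 ?posrE ?powR_gt0//.
have := ge0_ler_powR (ltW b0) _ _ h; rewrite !nnegrE powR_ge0 (ltW n0) => /(_ isT isT).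
by rewrite -powRrM mulVf ?gt_eqF// powRr1// ltW.
Qed.

Section Error.
Variables (f : R * R -> R) (C L : R).
Hypothesis f_cont : continuous f.
Hypothesis C_ge0 : 0 <= C.
Hypothesis L_ge0 : 0 <= L.
Hypothesis f_D2 : forall x y, `|D2 f x y| <= C * enorm y ^+ 2.
Hypothesis f_lip : forall x y, `|f (x + y) - f x| <= L * enorm y.

(* The neighbours term of [p_] has order [n ^ (alpha - 2)], so consistency reduces to the integral
   of this error: [jump_err_near] is used on a small ball, [jump_err_far] off it. *)
Definition jump_err n x y : R :=
  \1_(annulus r M n) y * (D2 f x (pt R n (nearest n y)) / nr n y `^ (2 + alpha))
  - jump_kernel alpha M y * D2 f x y.

Lemma jump_err_near n x y : (0 < n)%N ->
  `|jump_err n x y| <= 5 * C * (\1_(eball M) y * enorm y `^ (- alpha)).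
Proof.
have a1 := alpha_gt1; have a2 := alpha_lt2; have C0 := C_ge0; move=> n0; rewrite /jump_err.
(* The constant 5 is 4 + 1: rounding at most halves the norm, which costs a factor 2^alpha <= 4, and
   the continuous kernel adds one more. *)
have h1 : `|\1_(annulus r M n) y * (D2 f x (pt R n (nearest n y)) / nr n y `^ (2 + alpha))|
   <= 4 * C * (\1_(eball M) y * enorm y `^ (- alpha)).
  rewrite annulus_indic// -mulrA normrM [leRHS]mulrCA ger0_norm//.
  apply: ler_wpM2l => //.
  apply: (@le_trans _ _ (C * nr n y `^ (- alpha))).
    rewrite !normrM; have /andP[q0 q1] : 0 <= (\1_(~` eball (r / n%:R)) y : R) <= 1.
      by rewrite indicE; case: (_ \in _); rewrite /= lexx ler01.
    rewrite (ger0_norm q0); apply: (@le_trans _ _ (1 * (`|D2 f x (pt R n (nearest n y))| * `|(nr n y `^ (2 + alpha))^-1|))).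
      by rewrite ler_wpM2r// mulr_ge0.
    rewrite mul1r (ger0_norm (x := _^-1)) ?invr_ge0 ?powR_ge0//.
    apply: (@le_trans _ _ (C * nr n y ^+ 2 * (nr n y `^ (2 + alpha))^-1)).
      by rewrite ler_wpM2r ?invr_ge0 ?powR_ge0// f_D2.
    rewrite -mulrA ler_wpM2l//; have [->|en0] := eqVneq (nr n y) 0.
      by rewrite expr0n mul0r powR_ge0.
    rewrite powRD ?en0 ?implybT// invfM powR_mulrn ?nr_ge0// mulrA divff ?expf_neq0// mul1r.
    by rewrite powRN.
  rewrite [4 * C]mulrC -mulrA ler_wpM2l//.
  have [->|en0] := eqVneq (nr n y) 0.
    by rewrite powR0 ?mulr_ge0 ?powR_ge0// oppr_eq0 gt_eqF//; lra.
  have h := nr_ge_half n0 en0.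
  have [y0|y0] := eqVneq (enorm y) 0.
    move: en0; have -> : y = pt R n 0 by rewrite pt0; apply/eqP; rewrite -enorm_eq0 y0.
    by rewrite /nr nearest_pt// pt0 enorm0 eqxx.
  have yp : 0 < enorm y / 2 by rewrite divr_gt0// lt_neqAle eq_sym y0 enorm_ge0.
  apply: le_trans (powRN_anti yp h _) _; first lra.
  rewrite powRM ?enorm_ge0// mulrC ler_wpM2r ?powR_ge0//.
  have h4 : (2^-1 : R) `^ 2 <= 2^-1 `^ alpha by apply: ger_powR; lra.
  rewrite powRN -[leRHS]invrK lef_pV2 ?posrE ?powR_gt0//; apply: le_trans h4.
  by rewrite (powR_mulrn 2)//; lra.
have h2 : `|jump_kernel alpha M y * D2 f x y| <= C * (\1_(eball M) y * enorm y `^ (- alpha)).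
  rewrite normrM (ger0_norm (jker_ge0 _ _ y)) -[\1_(eball M) y * _]/(jdom alpha M y).
  by rewrite -(jker_sqr M alpha_gt1) mulrCA ler_wpM2l ?jker_ge0.
have := ler_normB (\1_(annulus r M n) y * (D2 f x (pt R n (nearest n y)) / nr n y `^ (2 + alpha)))
  (jump_kernel alpha M y * D2 f x y); lra.
Qed.

Lemma jump_err_far n x y (d : R) : (0 < n)%N -> n%:R^-1 <= d / 2 -> r / n%:R <= d ->
  d <= enorm y -> enorm y < M ->
  `|jump_err n x y| <=
    (2 * L * (d / 2) `^ (- (2 + alpha)) + 4 * C * M ^+ 2 * (d / 2) `^ (- (3 + alpha))) / n%:R.
Proof.
have a1 := alpha_gt1; have a2 := alpha_lt2; have C0 := C_ge0; have L0 := L_ge0.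
have M1 := M_gt1; move=> n0 nd rd dy yM.
have nR0 := nR_gt0 R n0.
have d0 : 0 < d / 2 by apply: lt_le_trans nd; rewrite invr_gt0.
have dn := nr_dist y n0.
have dN : d / 2 <= nr n y by move: dn; rewrite ler_distl => /andP[u1 u2]; lra.
have dy2 : d / 2 <= enorm y by lra.
rewrite /jump_err annulus_indic// /jump_kernel !indicE.
have -> : y \in eball M by apply: mem_set.
have -> : y \in ~` eball (r / n%:R).
  by apply: mem_set => /=; rewrite /eball /=; lra.
rewrite /= !mul1r -!powRN; set q := pt R n (nearest n y).
set b := 2 + alpha; set N := nr n y.
(* The first term moves the second difference, by the Lipschitz bound; the other moves the power of
   the norm, by [powRN_dist]. *)
have -> : D2 f x q * N `^ (- b) - enorm y `^ (- b) * D2 f x y =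
  (D2 f x q - D2 f x y) * N `^ (- b) + D2 f x y * (N `^ (- b) - enorm y `^ (- b)) by ring.
apply: le_trans (ler_normD _ _) _; rewrite [X in _ <= X]mulrDl !normrM; apply: lerD.
  rewrite (ger0_norm (powR_ge0 _ _)).
  have h1 : `|D2 f x q - D2 f x y| <= 2 * L / n%:R.
    have e1 : enorm (q - y) <= n%:R^-1 by rewrite -enormN opprB; exact: nearest_dist.
    have g1 : `|f (x + q) - f (x + y)| <= L / n%:R.
      have := f_lip (x + y) (q - y); rewrite -addrA [y + _]addrC subrK => h.
      by apply: le_trans h _; rewrite ler_wpM2l.
    have g2 : `|f (x - q) - f (x - y)| <= L / n%:R.
      have := f_lip (x - y) (y - q); rewrite -addrA [- y + _]addrA addNr add0r => h.
      by apply: le_trans h _; rewrite -enormN opprB ler_wpM2l.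
    have -> : D2 f x q - D2 f x y = (f (x + q) - f (x + y)) + (f (x - q) - f (x - y)).
      by rewrite /D2; ring.
    by apply: le_trans (ler_normD _ _) _; lra.
  rewrite mulrAC; apply: ler_pM => //; first exact: powR_ge0.
  by apply: powRN_anti => //; rewrite /b; lra.
have b04 : 0 <= b <= 4 by rewrite /b; apply/andP; split; lra.
have h2 := powRN_dist d0 dN dy2 b04.
have -> : 3 + alpha = b + 1 by rewrite /b; ring.
apply: (@le_trans _ _ (C * M ^+ 2 * (4 * `|N - enorm y| * (d / 2) `^ (- (b + 1))))).
  apply: ler_pM => //; apply: le_trans (f_D2 _ _) _; apply: ler_wpM2l => //.
  by apply: lerXn2r; rewrite ?nnegrE ?enorm_ge0//; lra.
apply: (@le_trans _ _ (C * M ^+ 2 * (4 * n%:R^-1 * (d / 2) `^ (- (b + 1))))); last first.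
  by rewrite le_eqVlt; apply/orP; left; apply/eqP; ring.
apply: ler_wpM2l; first by rewrite mulr_ge0 ?exprn_ge0//; lra.
by apply: ler_wpM2r; [exact: powR_ge0|exact: ler_wpM2l].
Qed.

Lemma jump_err_out n x y : M <= enorm y -> jump_err n x y = 0.
Proof.
move=> yM; rewrite /jump_err jker_out// mul0r subr0.
by rewrite indicE memNset ?mul0r// => -[]; rewrite /eball /= ltNge yM.
Qed.

Lemma meas2_jump_err n x : (0 < n)%N -> meas2 (jump_err n x).
Proof.
move=> n0; apply: meas2B.
  apply: meas2M; first by apply: meas2_indic; exact: measurable_annulus.
  exact: (measurable_box_ext n0 (fun z => D2 f x (pt R n z) / enorm (pt R n z) `^ (2 + alpha))).
apply: meas2M; first exact: measurable_jker.
exact: continuous_measurable2 (continuous_D2 f_cont).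
Qed.

Lemma intg_jump_err n x : (0 < n)%N -> intg2 (jump_err n x).
Proof.
have a1 := alpha_gt1; have a2 := alpha_lt2.
move=> n0; apply: (@int2_le _ _ (fun y => 5 * C * (\1_(eball M) y * enorm y `^ (- alpha)))).
- exact: meas2_jump_err.
- by apply: intgZ; apply: intg_near; lra.
- by move=> y; exact: jump_err_near.
Qed.

(** Three errors are made small: the neighbour term, of order n^(alpha - 2); the integral of
    [jump_err], split at radius [d]; and [c_ n - c] times the bounded [jump_op]. Only the constants
    [C] and [L] of [f] enter, hence uniformity in [x]. *)
Lemma consistency e : 0 < e -> exists N, forall n, (N <= n)%N ->
  forall x, `|scaled_jump n f x - L_M alpha r M f x| <= e.
Proof.
have a1 := alpha_gt1; have a2 := alpha_lt2; have C0 := C_ge0; have L0 := L_ge0; move=> e0.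
have [K K0 [N1 HN1]] := c_bounds.
pose A : R := \int[@leb2 R]_y \1_(eball M) y.
pose I : R := \int[@leb2 R]_y jdom alpha M y.
have A0 : 0 <= A by apply: Rint2_ge0.
have I0 : 0 <= I by apply: Rint2_ge0 => y; exact: jdom_ge0.
(* [B] collects the coefficients of the common tolerance [t] in the final estimate. *)
pose B := K / 2 * (4 * K * C + 5 * C + A) + C * I / 2.
have B0 : 0 <= B by rewrite /B !addr_ge0 ?mulr_ge0 ?addr_ge0 ?mulr_ge0 ?divr_ge0 ?(ltW K0)//.
pose t := e / (B + 1).
have t0 : 0 < t by rewrite divr_gt0// ltr_wpDl.
have [d d0 Hd] := intg_small_ball t0.
have [N2 HN2] := powRN_small t0.
have [N3 HN3] := (cvgn_eps _ _).1 (c_lim_spec.1) t t0.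
pose E := 2 * L * (d / 2) `^ (- (2 + alpha)) + 4 * C * M ^+ 2 * (d / 2) `^ (- (3 + alpha)).
pose N4 := (Num.truncn (2 / d + r / d + E / t)).+1.
exists (maxn (maxn N1 N2) (maxn N3 N4)) => n; rewrite !geq_max => /andP[/andP[n1 n2] /andP[n3 n4]] x.
have [n0 cn0 cnK _ knK] := HN1 n n1.
have nR0 := nR_gt0 R n0; have kn0 := k_gt0 n0.
have r0 := r_gt0; have M1 := M_gt1.
have E0 : 0 <= E.
  by rewrite /E addr_ge0// !mulr_ge0 ?powR_ge0 ?exprn_ge0//; lra.
have n4' : 2 / d + r / d + E / t <= n%:R.
  by apply: le_trans (ltW (truncnS_gt _)) _; rewrite ler_nat.
have p1 : 0 < 2 / d by rewrite divr_gt0.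
have p2 : 0 < r / d by rewrite divr_gt0.
have p3 : 0 <= E / t by rewrite divr_ge0// ltW.
have hn1 : n%:R^-1 <= d / 2.
  by rewrite -[leRHS]invrK lef_pV2 ?posrE ?invr_gt0 ?divr_gt0// invf_div; lra.
have hn2 : r / n%:R <= d.
  by rewrite ler_pdivrMr// mulrC -ler_pdivrMr//; lra.
have hn3 : E / n%:R <= t.
  by rewrite ler_pdivrMr// mulrC -ler_pdivrMr//; lra.
have Ig := intg_near d (a := alpha) ltac:(lra).
pose g y : R := 5 * C * (\1_(eball d) y * enorm y `^ (- alpha)) + t * \1_(eball M) y.
have Igg : intg2 g by apply: intgD; [exact: intgZ|apply: intgZ; exact: int2_ball].
have err_g y : `|jump_err n x y| <= g y.
  rewrite /g; have g1 : 0 <= 5 * C * (\1_(eball d) y * enorm y `^ (- alpha)).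
    by rewrite !mulr_ge0 ?powR_ge0.
  have g2 : 0 <= t * \1_(eball M) y by rewrite mulr_ge0// ltW.
  have [yM|yM] := ltP (enorm y) M; last by rewrite jump_err_out// normr0 addr_ge0.
  have [yd|yd] := ltP (enorm y) d.
    apply: ler_wpDr => //; apply: le_trans (jump_err_near x y n0) _.
    rewrite !indicE mem_set// mem_set//.
  apply: ler_wpDl => //; apply: le_trans (@jump_err_far n x y d n0 hn1 hn2 yd yM) _.
  by rewrite indicE mem_set// mulr1.
have Ierr := intg_jump_err x n0.
have bound_err : `|\int[@leb2 R]_y jump_err n x y| <= 5 * C * t + t * A.
  apply: le_trans (Rint2_norm Ierr Igg err_g) _.
  rewrite Rint2D; [|exact: intgZ|apply: intgZ; exact: int2_ball].
  rewrite Rint2Z// Rint2Z; last exact: int2_ball.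
  by rewrite lerD2r ler_wpM2l// mulr_ge0.
have IJ : intg2 (fun y => jump_kernel alpha M y * D2 f x y).
  exact: (intg_jker_D2 alpha_gt1 alpha_lt2 f_cont (fun y _ => f_D2 x y)).
have eI : \int[@leb2 R]_y (\1_(annulus r M n) y *
    (D2 f x (pt R n (nearest n y)) / nr n y `^ (2 + alpha))) =
    \int[@leb2 R]_y jump_err n x y + jump_op alpha M f x.
  by rewrite /jump_op -Rint2D//; apply: Rint2_eq => y; rewrite /jump_err subrK.
have bJ : `|jump_op alpha M f x| <= C * I.
  rewrite /I -Rint2Z; last exact: intg_jdom.
  apply: Rint2_norm => //; first by apply: intgZ; exact: intg_jdom.
  move=> y; rewrite normrM (ger0_norm (jker_ge0 _ _ y)) -(jker_sqr M alpha_gt1) mulrCA.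
  by rewrite ler_wpM2l ?jker_ge0.
have bS : `|\sum_(z <- nbrs) D2 f x (pt R n z)| <= 4 * C * n%:R ^- 2.
  have ez z : z \in nbrs -> `|D2 f x (pt R n z)| <= C * n%:R ^- 2.
    rewrite -(nbrsP alpha_gt1 alpha_lt2 r_gt0 r_ltM M_gt1 n0 (k_gt0 n0)) => /eqP h.
    by apply: le_trans (f_D2 _ _) _; rewrite h exprVn.
  apply: le_trans (ler_norm_sum _ _ _) _; rewrite /nbrs !big_cons big_nil.
  have := ez (1, 0) isT; have := ez (-1, 0) isT; have := ez (0, 1) isT; have := ez (0, -1) isT; lra.
rewrite Ln_D2// eI L_ME.
set S := \sum_(_ <- _) _ in bS *; set JJ := jump_op _ _ _ _ in bJ *.
set EE := \int[_]_y _ in bound_err *.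
have -> : c_ n / 2 * (n%:R `^ alpha * k_ n * S + (EE + JJ)) - c / 2 * JJ =
  c_ n / 2 * (n%:R `^ alpha * k_ n * S + EE) + (c_ n - c) / 2 * JJ by ring.
have b1 : `|n%:R `^ alpha * k_ n * S| <= 4 * K * C * t.
  rewrite normrM normrM (ger0_norm (powR_ge0 _ _)) (gtr0_norm kn0).
  apply: (@le_trans _ _ (n%:R `^ alpha * K * (4 * C * n%:R ^- 2))).
    by apply: ler_pM => //; [rewrite mulr_ge0 ?powR_ge0 ?ltW|rewrite ler_wpM2l ?powR_ge0].
  have -> : n%:R `^ alpha * K * (4 * C * n%:R ^- 2) = 4 * K * C * (n%:R `^ alpha * n%:R ^- 2) by ring.
  rewrite -powR_invn ?(ltW nR0)// -powRD; last by apply/implyP => _; exact: lt0r_neq0.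
  by rewrite ler_wpM2l ?HN2// !mulr_ge0// ltW.
have b2 : `|c_ n / 2 * (n%:R `^ alpha * k_ n * S + EE)| <=
    K / 2 * (4 * K * C * t + (5 * C * t + t * A)).
  rewrite normrM; apply: ler_pM => //; first by rewrite ger0_norm ?divr_ge0 ?(ltW cn0)//; lra.
  by apply: le_trans (ler_normD _ _) _; exact: lerD.
have b3 : `|(c_ n - c) / 2 * JJ| <= t / 2 * (C * I).
  rewrite normrM; apply: ler_pM => //.
  by rewrite normrM (ger0_norm (x := 2^-1))// ler_wpM2r// HN3.
apply: le_trans (ler_normD _ _) _; apply: le_trans (lerD b2 b3) _.
have -> : K / 2 * (4 * K * C * t + (5 * C * t + t * A)) + t / 2 * (C * I) = B * t.
  by rewrite /B; field.
rewrite /t mulrA ler_pdivrMr ?ltr_wpDl// mulrC; apply: ler_wpM2l; [exact: ltW|lra].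
Qed.

End Error.

End Consistency.

(** * The potential kernel *)

Section PlaneTopology.
Variable R : realType.
Implicit Types (x y : R * R) (f : R * R -> R).

Lemma nbhs_enorm x (A : set (R * R)) :
  nbhs x A <-> exists2 d : R, 0 < d & forall y, enorm (y - x) < d -> A y.
Proof.
split.
  move=> /nbhs_ballP[d /= d0 H]; exists d => // y yd; apply: H; split; rewrite /ball /=.
    by apply: le_lt_trans yd; rewrite distrC; exact: (fst_le_enorm (y - x)).
  by apply: le_lt_trans yd; rewrite distrC; exact: (snd_le_enorm (y - x)).
move=> [d d0 H]; apply/nbhs_ballP; exists (d / 2); rewrite /= ?divr_gt0//.
move=> y [h1 h2]; apply: H; apply: le_lt_trans (enorm_le _) _.
rewrite /ball /= in h1 h2; rewrite distrC in h1; rewrite distrC in h2.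
by move: h1 h2 => /= h1 h2; rewrite [d]splitr; exact: ltrD.
Qed.

Lemma continuous_eps f : continuous f <->
  forall x e, 0 < e -> exists2 d : R, 0 < d & forall y, enorm (y - x) < d -> `|f y - f x| <= e.
Proof.
split=> H x.
  move=> e e0; have /cvgrPdist_le/(_ e e0) := H x.
  by move=> /nbhs_enorm[d d0 Hd]; exists d => // y yd; rewrite distrC; exact: Hd.
apply/cvgrPdist_le => e e0; have [d d0 Hd] := H x e e0.
by apply/nbhs_enorm; exists d => // y yd; rewrite distrC; exact: Hd.
Qed.

Definition area : R := \int[@leb2 R]_y \1_(eball 1) y.

Lemma area_gt0 : 0 < area.
Proof.
have q0 : 0 <= 1 / 4 :> R by lra.
have ib := int2_indic (measurable_box (1 / 4 : R)) (leb2_box_lty _).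
apply: (@lt_le_trans _ _ (\int[@leb2 R]_y \1_(box (1 / 4)) y)).
  by rewrite (Rint_indicE (measurable_box _)) (leb2_box q0) /= exprn_gt0//; lra.
apply: Rint2_mono => //; first exact: int2_ball.
move=> y; rewrite !indicE; case: (boolP (y \in box _)) => [/set_mem/boxE[h1 h2]|_]; last by rewrite ler0n.
by rewrite mem_set// /eball /=; apply: le_lt_trans (enorm_le _) _; lra.
Qed.

Lemma area_ball (rad : R) : 0 < rad -> \int[@leb2 R]_y \1_(eball rad) y = rad ^+ 2 * area.
Proof.
move=> r0; have rn0 : rad != 0 by rewrite gt_eqF.
rewrite (Rint_aff2 rn0 0 (int2_ball rad)) (gtr0_norm r0); congr (_ * _).
apply: Rint2_eq => y; rewrite !indicE; congr (_%:R); congr nat_of_bool.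
have E : (rad * enorm y < rad) = (enorm y < 1) by rewrite -{2}(mulr1 rad) ltr_pM2l.
apply/idP/idP => /set_mem h; apply: mem_set; move: h;
  by rewrite /eball /= enorm_aff (gtr0_norm r0) E.
Qed.

Lemma indic_ball rad y : \1_(eball rad) y = (enorm y < rad)%R%:R :> R.
Proof. by rewrite indicE; congr (_%:R); congr nat_of_bool; apply/idP/idP => [/set_mem|h]; [|exact: mem_set]. Qed.

Lemma min1_powR (t b : R) : 0 <= t -> 0 <= b <= 1 -> t <= 1 -> t <= t `^ b.
Proof.
move=> t0 /andP[b0 b1] t1; have [->|tn] := eqVneq t 0; first exact: powR_ge0.
by apply: ger1_powR => //; rewrite lt_neqAle eq_sym tn t0.
Qed.

End PlaneTopology.

(** * Growth and modulus of continuity of the symbol *)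

Section PsiBounds.
Variables (R : realType) (alpha M : R).
Hypothesis alpha_gt1 : 1 < alpha.
Hypothesis alpha_lt2 : alpha < 2.
Hypothesis M_gt1 : 1 < M.
Implicit Types (x y theta h : R * R).
Local Notation psi1 := (jump_symbol alpha M).

Lemma psi1_ge0 theta : 0 <= psi1 theta.
Proof. by apply: Rint2_ge0 => y; rewrite mulr_ge0 ?jker_ge0 ?onem_cos_ge0. Qed.

(* The integral is restricted to the ball of radius [s / 4] around [q], the vector of norm [s / 2]
   parallel to [theta], where the phase is at least [s * enorm theta / 4]. *)
Lemma psi1_lb theta s : theta != 0 -> 0 < s -> s <= 1 -> s * enorm theta <= 1 ->
  area R / (16 * 16 * 8) * (enorm theta ^+ 2 * s `^ (2 - alpha)) <= psi1 theta.
Proof.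
have a1 := alpha_gt1; have a2 := alpha_lt2; have M1 := M_gt1.
move=> t0 s0 s1 st; have T0 : 0 < enorm theta by rewrite enorm_gt0.
set T := enorm theta in T0 st *.
pose k := s / 2 / T; have k0 : 0 < k by rewrite !divr_gt0.
pose q : R * R := (k * theta.1, k * theta.2).
have eq : enorm q = s / 2.
  by rewrite /q enorm_scale (gtr0_norm k0) -/T /k divfK// gt_eqF.
have dq : dotp theta q = s / 2 * T.
  have -> : dotp theta q = k * enorm theta ^+ 2 by rewrite enorm_sqr /dotp /q /=; ring.
  by rewrite -/T /k; field; exact: lt0r_neq0.
have s4 : 0 < s / 4 by rewrite divr_gt0.
pose W := (T * s / 4) ^+ 2 / 8 * s `^ (- (2 + alpha)).
have W0 : 0 <= W by rewrite mulr_ge0 ?powR_ge0// divr_ge0// sqr_ge0.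
have Iball : intg2 (fun y => \1_(eball (s / 4)) (y - q) : R).
  by have := intg_shift (- q) (int2_ball (s / 4)).
apply: (@le_trans _ _ (\int[@leb2 R]_y (W * \1_(eball (s / 4)) (y - q)))).
  rewrite Rint2Z// (Rint_shift (- q) (int2_ball _)) area_ball//.
  have -> : W * ((s / 4) ^+ 2 * area R) =
     area R / (16 * 16 * 8) * (T ^+ 2 * (s ^+ 4 * s `^ (- (2 + alpha)))) by rewrite /W; field.
  rewrite -(powR_mulrn 4 (ltW s0)) -powRD; last by apply/implyP => _; exact: lt0r_neq0.
  by rewrite (_ : 4%:R - (2 + alpha) = 2 - alpha)//; ring.
apply: Rint2_mono; [exact: intgZ|exact: intg_psi1|move=> y].
rewrite indic_ball; case: ltP => [hy|_]; last by rewrite mulr0 mulr_ge0 ?jker_ge0 ?onem_cos_ge0.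
rewrite mulr1.
have y1 : enorm y < s.
  have := enormD (y - q) q; rewrite subrK eq => h; lra.
have y2 : s / 4 <= enorm y.
  have := enorm_geB q (q - y); rewrite opprB addrCA subrr addr0 -(enormN (q - y)) opprB eq; lra.
have d1 : T * s / 4 <= dotp theta y.
  have e : dotp theta y = s / 2 * T + dotp theta (y - q) by rewrite dotpB dq addrC subrK.
  have h := dotp_le theta (y - q); rewrite ler_norml in h; case/andP: h => h _.
  have h2 : enorm theta * enorm (y - q) <= T * (s / 4) by rewrite ler_wpM2l ?enorm_ge0// ltW.
  by rewrite e; move: h h2; rewrite -/T; set u := T * enorm _ => *; lra.
have d2 : `|dotp theta y| <= 1.
  apply: le_trans (dotp_le _ _) _; rewrite -/T; apply: le_trans st; rewrite mulrC.
  by rewrite ler_wpM2r// ltW.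
rewrite /W mulrC; apply: ler_pM.
- exact: powR_ge0.
- by rewrite divr_ge0// sqr_ge0.
- rewrite /jump_kernel indic_ball; have -> : enorm y < M by lra.
  rewrite mul1r -powRN; apply: powRN_anti; lra.
- apply: le_trans (onem_cos_ge d2); rewrite ler_pM2r ?invr_gt0//.
  by apply: lerXn2r; rewrite ?nnegrE//; nra.
Qed.

Definition ellipticity : R := area R / (16 * 16 * 8).

Lemma kap_gt0 : 0 < ellipticity.
Proof. by apply: divr_gt0; [exact: area_gt0|rewrite !mulr_gt0]. Qed.

(** [psi1_lb] at scale [s = 1]. *)
Lemma psi1_ge_small theta : enorm theta <= 1 -> ellipticity * enorm theta ^+ 2 <= psi1 theta.
Proof.
move=> h; have [->|t0] := eqVneq theta 0; first by rewrite enorm0 expr0n mulr0 psi1_ge0.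
by have := psi1_lb t0 ltr01 (lexx 1); rewrite mul1r powR1 mulr1; exact.
Qed.

(** [psi1_lb] at scale [s = 1 / enorm theta], where the phase is of order one. *)
Lemma psi1_ge_large theta : 1 <= enorm theta -> ellipticity * enorm theta `^ alpha <= psi1 theta.
Proof.
move=> h; have T0 : 0 < enorm theta by apply: lt_le_trans h.
have t0 : theta != 0 by rewrite -enorm_gt0.
have := @psi1_lb theta (enorm theta)^-1 t0; rewrite invr_gt0 invf_le1// mulVf ?gt_eqF//.
move=> /(_ T0 h (lexx 1)).
rewrite -(powR_inv1 (ltW T0)) -powRrM -(powR_mulrn 2 (ltW T0)) -powRD; last first.
  by apply/implyP => _; exact: lt0r_neq0.
by rewrite (_ : 2%:R + -1 * (2 - alpha) = alpha)//; ring.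
Qed.

Lemma psi1_gt0 theta : theta != 0 -> 0 < psi1 theta.
Proof.
move=> t0; have T0 : 0 < enorm theta by rewrite enorm_gt0.
have [h|/ltW h] := leP (enorm theta) 1.
  by apply: lt_le_trans (psi1_ge_small h); rewrite mulr_gt0 ?kap_gt0// exprn_gt0.
by apply: lt_le_trans (psi1_ge_large h); rewrite mulr_gt0 ?kap_gt0// powR_gt0.
Qed.

(** One choice among those satisfying [eps_bounds]. It makes |y|^-(2 - osc_eps) integrable near 0,
    keeps [osc_exponent] between 0 and 1, and leaves [del_] positive. *)
Definition osc_eps : R := (alpha - 1) * (2 - alpha).
Definition osc_exponent : R := alpha - 1 + osc_eps.

Lemma eps_bounds : 0 < osc_eps /\ osc_eps < alpha - 1 /\ osc_eps < 2 - alpha.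
Proof.
have a1 := alpha_gt1; have a2 := alpha_lt2.
by rewrite /osc_eps; split; [rewrite mulr_gt0; lra|split; nra].
Qed.

(** The sine in [cosB_le] is at most (T |y|)^osc_exponent, both for small and for large T |y|.
    Against the kernel this leaves the integrable power |y|^-(2 - osc_eps). *)
Lemma psi1_modulus : exists2 C : R, 0 <= C & forall theta h T,
  enorm theta <= T -> enorm (theta + h) <= T ->
  `|psi1 (theta + h) - psi1 theta| <= C * enorm h * T `^ osc_exponent.
Proof.
have a1 := alpha_gt1; have a2 := alpha_lt2; have [e0 [e1 e2]] := eps_bounds.
have Ik : intg2 (fun y => \1_(@eball R M) y * enorm y `^ (- (2 - osc_eps))).
  by apply: intg_near; lra.
exists (\int[@leb2 R]_y (\1_(@eball R M) y * enorm y `^ (- (2 - osc_eps)))).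
  by apply: Rint2_ge0 => y; rewrite mulr_ge0 ?powR_ge0.
move=> theta h T hT1 hT2; have T0 : 0 <= T by apply: le_trans hT1; exact: enorm_ge0.
have I1 := @intg_psi1 R alpha M alpha_gt1 alpha_lt2 theta.
have I2 := @intg_psi1 R alpha M alpha_gt1 alpha_lt2 (theta + h).
rewrite /jump_symbol -Rint2B// -mulrA mulrC -Rint2Z//.
apply: Rint2_norm; [exact: intgB|exact: intgZ|move=> y].
rewrite -mulrBr opprB addrC addrA subrK.
rewrite normrM distrC (ger0_norm (jker_ge0 _ _ _)).
have cb : `|cos (dotp (theta + h) y) - cos (dotp theta y)| <=
    enorm h * enorm y * (T * enorm y) `^ osc_exponent.
  apply: le_trans (cosB_le _ _) _; apply: ler_pM => //.
    by rewrite dotpDl addrAC subrr add0r dotp_le.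
  have yT : 0 <= T * enorm y by rewrite mulr_ge0 ?enorm_ge0.
  have [t1|/ltW t1] := leP (T * enorm y) 1; last first.
    apply: le_trans (sin_max _) _; rewrite -(powRr0 (T * enorm y)).
    by apply: ler_powR => //; rewrite /osc_exponent; lra.
  apply: le_trans (sin_le_norm _) _; apply: le_trans (min1_powR yT _ t1); last first.
    by rewrite /osc_exponent; apply/andP; split; lra.
  rewrite normrM (ger0_norm (x := 2^-1))//.
  have h1 := dotp_le (theta + h) y; have h2 := dotp_le theta y.
  have h3 : enorm (theta + h) * enorm y <= T * enorm y by rewrite ler_wpM2r ?enorm_ge0.
  have h4 : enorm theta * enorm y <= T * enorm y by rewrite ler_wpM2r ?enorm_ge0.
  have h5 := ler_normD (dotp (theta + h) y) (dotp theta y).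
  by move: h1 h2 h3 h4 h5; set u := T * enorm y => *; lra.
apply: le_trans (ler_wpM2l (jker_ge0 _ _ _) cb) _.
rewrite /jump_kernel -[X in X <= _]mulrA [X in _ <= X]mulrCA; apply: ler_wpM2l => //.
have [y0|y0] := eqVneq (enorm y) 0; first by rewrite y0 powR0 ?invr0 ?mul0r ?mulr_ge0 ?enorm_ge0 ?powR_ge0//; rewrite gt_eqF//; lra.
rewrite powRM ?enorm_ge0// -powRN.
have -> : enorm y `^ (- (2 + alpha)) * (enorm h * enorm y * (T `^ osc_exponent * enorm y `^ osc_exponent)) =
  enorm h * T `^ osc_exponent * (enorm y * enorm y `^ osc_exponent * enorm y `^ (- (2 + alpha))) by ring.
rewrite -[X in _ * (X * _ * _) <= _](powRr1 (enorm_ge0 y)) -!powRD ?y0 ?implybT//.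
by rewrite (_ : 1 + osc_exponent - (2 + alpha) = - (2 - osc_eps))// /osc_exponent; ring.
Qed.

Lemma continuous_psi1 : continuous psi1.
Proof.
have [C C0 HC] := psi1_modulus.
apply/continuous_eps => x e e0; pose T := enorm x + 1.
have T0 : 0 < T by rewrite ltr_wpDl ?enorm_ge0.
pose K := C * T `^ osc_exponent + 1; have K0 : 0 < K by rewrite ltr_wpDl// mulr_ge0 ?powR_ge0.
exists (Num.min 1 (e / K)); first by rewrite lt_min ltr01 divr_gt0.
move=> y; rewrite lt_min => /andP[y1 y2].
have := HC x (y - x) T; rewrite addrC subrK => h.
have n1 : enorm x <= T by rewrite lerDl.
have n2 : enorm y <= T by have := enormD (y - x) x; rewrite subrK /T; lra.
apply: le_trans (h n1 n2) _; rewrite mulrAC.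
rewrite ltr_pdivlMr// in y2; apply: le_trans (ltW y2); rewrite mulrC ler_wpM2l ?enorm_ge0//.
by rewrite /K lerDl.
Qed.

End PsiBounds.

(** * Cancellation in oscillatory integrals of the inverse symbol *)

Section Oscillation.
Variables (R : realType) (alpha M : R).
Hypothesis alpha_gt1 : 1 < alpha.
Hypothesis alpha_lt2 : alpha < 2.
Hypothesis M_gt1 : 1 < M.
Implicit Types (x y z theta h : R * R) (rad : R).
Local Notation psi1 := (jump_symbol alpha M).
Local Notation eps_ := (osc_eps alpha).
Local Notation beta_ := (osc_exponent alpha).
Local Notation kap := (ellipticity R).

Definition inv_symbol theta : R := (psi1 theta)^-1.
(** The gain beyond |theta|^-2 in [Phi_diff]: the modulus gives |theta|^osc_exponent and the two
    inverse symbols |theta|^(-2 alpha), in total |theta|^-(2 + del_), integrable at infinity. *)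
Definition del_ : R := alpha - 1 - eps_.
Definition shell (a b : R) theta : R := \1_(eball b) theta - \1_(eball a) theta.

Lemma del_bounds : 0 < del_ /\ del_ <= alpha - 1.
Proof. by have [h1 [h2 h3]] := eps_bounds alpha_gt1 alpha_lt2; rewrite /del_; split; lra. Qed.

Lemma shellE a b theta : a <= b -> shell a b theta = ((a <= enorm theta) && (enorm theta < b))%:R.
Proof.
move=> ab; rewrite /shell !indic_ball; case: (ltP (enorm theta) a) => h1; case: ltP => h2 //=;
  rewrite ?subrr ?subr0//; lra.
Qed.

Lemma shell_ge0 a b theta : a <= b -> 0 <= shell a b theta.
Proof. by move=> ab; rewrite shellE. Qed.

Lemma intg_shell a b : intg2 (shell a b).
Proof. by apply: intgB; exact: int2_ball. Qed.

Lemma Phi_ge0 theta : 0 <= inv_symbol theta.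
Proof. by rewrite invr_ge0 psi1_ge0. Qed.

Lemma measurable_Phi : meas2 inv_symbol.
Proof. by apply: meas2V; apply: continuous_measurable2; exact: continuous_psi1. Qed.

Lemma Phi_le theta : 1 <= enorm theta -> inv_symbol theta <= kap^-1 * enorm theta `^ (- alpha).
Proof.
move=> h; have T0 : 0 < enorm theta by apply: lt_le_trans h.
have kp : 0 < kap * enorm theta `^ alpha by apply: mulr_gt0; [exact: kap_gt0|exact: powR_gt0].
have h1 := psi1_ge_large alpha_gt1 alpha_lt2 M_gt1 h.
rewrite /inv_symbol powRN -invfM lef_pV2// posrE//; exact: lt_le_trans h1.
Qed.

Lemma Phi_diff : exists2 C : R, 0 <= C & forall theta h, 1 <= enorm theta -> 1 <= enorm (theta + h) ->
  2 * enorm h <= enorm theta ->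
  `|inv_symbol theta - inv_symbol (theta + h)| <= C * enorm h * enorm theta `^ (- (2 + del_)).
Proof.
have a1 := alpha_gt1; have a2 := alpha_lt2.
have [C C0 HC] := psi1_modulus M alpha_gt1 alpha_lt2.
have k0 := kap_gt0 R.
pose D := C * 2 `^ beta_ * kap^-1 * kap^-1 * 2^-1 `^ (- alpha).
exists D; first by rewrite !mulr_ge0 ?powR_ge0 ?invr_ge0 ?(ltW k0).
move=> theta h t1 th1 h2; set T := enorm theta in t1 h2 *.
have T0 : 0 < T by apply: lt_le_trans t1.
have hle : enorm (theta + h) <= 2 * T by have := enormD theta h; rewrite -/T; lra.
have hge : T / 2 <= enorm (theta + h).
  by have := enorm_geB theta (- h); rewrite opprK enormN -/T; lra.
have p1 : 0 < psi1 theta by apply: psi1_gt0 => //; rewrite -enorm_gt0.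
have p2 : 0 < psi1 (theta + h) by apply: psi1_gt0 => //; rewrite -enorm_gt0; lra.
have -> : inv_symbol theta - inv_symbol (theta + h) = (psi1 (theta + h) - psi1 theta) * (inv_symbol theta * inv_symbol (theta + h)).
  by rewrite /inv_symbol; field; rewrite !gt_eqF.
rewrite normrM (ger0_norm (x := inv_symbol _ * _)) ?mulr_ge0 ?Phi_ge0//.
have T2 : T <= 2 * T by lra.
apply: (@le_trans _ _ (C * enorm h * (2 * T) `^ beta_ *
   ((kap^-1 * T `^ (- alpha)) * (kap^-1 * (T / 2) `^ (- alpha))))).
  apply: ler_pM; rewrite ?mulr_ge0 ?Phi_ge0//; first exact: HC.
  apply: ler_pM; rewrite ?Phi_ge0//; first exact: Phi_le.
  apply: le_trans (Phi_le th1) _; rewrite ler_wpM2l ?invr_ge0 ?(ltW k0)//.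
  by apply: powRN_anti => //; lra.
rewrite !powRM ?(ltW T0)//.
have -> : C * enorm h * (2 `^ beta_ * T `^ beta_) *
   (kap^-1 * T `^ (- alpha) * (kap^-1 * (T `^ (- alpha) * 2^-1 `^ (- alpha)))) =
   D * enorm h * (T `^ beta_ * T `^ (- alpha) * T `^ (- alpha)) by rewrite /D; ring.
rewrite -!powRD; try (by apply/implyP => _; exact: lt0r_neq0).
rewrite (_ : beta_ - alpha - alpha = - (2 + del_))//.
by rewrite /osc_exponent /del_; ring.
Qed.

Lemma area_shell rad (d : R) : 0 < d -> 2 * d <= rad ->
  \int[@leb2 R]_y shell (rad - d) (rad + 2 * d) y <= 9 * d * rad * area R.
Proof.
move=> d0 dr; have ap := area_gt0 R.
rewrite /shell Rint2B; try exact: int2_ball.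
rewrite !area_ball; try lra.
by rewrite -mulrBl ler_pM2r//; nra.
Qed.

Lemma shell_Phi_meas a b : meas2 (fun theta => shell a b theta * inv_symbol theta).
Proof. by apply: meas2M; [exact: int2_meas (intg_shell a b)|exact: measurable_Phi]. Qed.

Lemma shell_Phi_le a b theta : 1 <= a -> a <= b ->
  `|shell a b theta * inv_symbol theta| <= kap^-1 * shell a b theta.
Proof.
move=> a1 ab; rewrite shellE//; case: (boolP (_ && _)) => [/andP[h1 h2]|_] /=; last by rewrite mul0r mulr0 normr0.
have t1 : 1 <= enorm theta by apply: le_trans h1.
rewrite mul1r mulr1 ger0_norm ?Phi_ge0//; apply: le_trans (Phi_le t1) _.
rewrite ler_piMr ?invr_ge0 ?(ltW (kap_gt0 R))//.
have := powRN_anti ltr01 t1 (_ : 0 <= alpha); rewrite powR1; apply.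
by have := alpha_gt1; lra.
Qed.

Lemma intg_shell_Phi a b : 1 <= a -> a <= b -> intg2 (fun theta => shell a b theta * inv_symbol theta).
Proof.
move=> a1 ab; apply: (@int2_le _ _ (fun theta => kap^-1 * shell a b theta)).
- exact: shell_Phi_meas.
- by apply: intgZ; exact: intg_shell.
- by move=> theta; exact: shell_Phi_le.
Qed.

Lemma meas2_cos z : meas2 (fun theta => cos (dotp theta z)).
Proof.
apply: continuous_measurable2 => theta.
rewrite (_ : (fun t => cos (dotp t z)) = (fun t => cos (dotp z t))).
  exact: continuous_cosdot.
by apply/funext => t; rewrite dotpC.
Qed.

Lemma intg_cosM f z : intg2 f -> intg2 (fun theta => cos (dotp theta z) * f theta).
Proof.
move=> If; apply: (@int2_le _ _ (fun t => `|f t|)).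
- by apply: meas2M; [exact: meas2_cos|exact: int2_meas].
- exact: intg_norm.
- by move=> t; rewrite normrM ler_piMl// cos_max.
Qed.

(** If both points lie in the shell, [Phi_diff] applies. If just one does, [theta] is within the
    shift of one of the two boundary circles, and the size of the inverse symbol there suffices;
    near the outer circle the norm is at least rad' / 2, whence the factor 4. *)
Lemma shift_diff_le (C1 : R) rad rad' h theta :
  (forall theta h, 1 <= enorm theta -> 1 <= enorm (theta + h) -> 2 * enorm h <= enorm theta ->
    `|inv_symbol theta - inv_symbol (theta + h)| <= C1 * enorm h * enorm theta `^ (- (2 + del_))) ->
  0 <= C1 -> 1 <= rad -> rad <= rad' -> 2 * enorm h <= rad -> 0 < enorm h ->
  `|shell rad rad' theta * inv_symbol theta - shell rad rad' (theta + h) * inv_symbol (theta + h)| <=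
    C1 * enorm h * (\1_(~` eball rad) theta * enorm theta `^ (- (2 + del_)))
    + kap^-1 * rad `^ (- alpha) * shell (rad - enorm h) (rad + 2 * enorm h) theta
    + 4 * kap^-1 * rad' `^ (- alpha) * shell (rad' - enorm h) (rad' + 2 * enorm h) theta.
Proof.
move=> HC C10 r1 rr' hr h0; have a1 := alpha_gt1; have a2 := alpha_lt2.
have [dl0 dl1] := del_bounds; have k0 := kap_gt0 R.
have ki : 0 <= kap^-1 by rewrite invr_ge0 ltW.
set eta := enorm h in hr h0 *.
have e1 := enorm_geB theta (- h); rewrite opprK enormN -/eta in e1.
have e2 : enorm theta - eta <= enorm (theta + h) by exact: e1.
have e3 := enormD theta h; rewrite -/eta in e3.
have e4 : enorm theta <= enorm (theta + h) + eta.
  by have := enormB (theta + h) h; rewrite addrK -/eta.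
set t := enorm theta in e2 e3 e4 *.
have co0 : 0 <= \1_(~` eball rad) theta :> R by rewrite indicE ler0n.
have g1 : 0 <= C1 * eta * (\1_(~` eball rad) theta * t `^ (- (2 + del_))).
  by rewrite !mulr_ge0 ?powR_ge0// ltW.
have g2 : 0 <= kap^-1 * rad `^ (- alpha) * shell (rad - eta) (rad + 2 * eta) theta.
  by rewrite !mulr_ge0 ?powR_ge0 ?shell_ge0//; lra.
have g3 : 0 <= 4 * kap^-1 * rad' `^ (- alpha) * shell (rad' - eta) (rad' + 2 * eta) theta.
  by rewrite !mulr_ge0 ?powR_ge0 ?shell_ge0//; lra.
have half : (rad' / 2) `^ (- alpha) <= 4 * rad' `^ (- alpha).
  rewrite powRM//; last lra.
  rewrite mulrC ler_wpM2r ?powR_ge0//.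
  have h4 : (2^-1 : R) `^ 2 <= 2^-1 `^ alpha by apply: ger_powR; lra.
  rewrite powRN -[leRHS]invrK lef_pV2 ?posrE ?powR_gt0//; apply: le_trans h4.
  by rewrite (powR_mulrn 2)//; lra.
have near1 u : rad <= u -> 1 <= u -> kap^-1 * u `^ (- alpha) <= kap^-1 * rad `^ (- alpha).
  by move=> ru u1; rewrite ler_wpM2l//; apply: powRN_anti; lra.
have near2 u : rad' / 2 <= u -> kap^-1 * u `^ (- alpha) <= 4 * kap^-1 * rad' `^ (- alpha).
  move=> ru; rewrite [4 * _]mulrC -mulrA ler_wpM2l//; apply: le_trans half.
  by apply: powRN_anti; lra.
rewrite (shellE theta rr') (shellE (theta + h) rr') -/t; set t' := enorm (theta + h) in e2 e3 e4 *.
case: (boolP ((rad <= t) && (t < rad'))) => [/andP[A1 A2]|A];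
  case: (boolP ((rad <= t') && (t' < rad'))) => [/andP[B1 B2]|B] /=.
- rewrite !mul1r; apply: ler_wpDr => //; apply: ler_wpDr => //.
  have -> : \1_(~` eball rad) theta = 1 :> R.
    by rewrite indicE mem_set//= /eball /=; rewrite -/t; lra.
  by rewrite mul1r; apply: HC; rewrite -?/t -?/t' -?/eta; lra.
- rewrite mul1r mul0r subr0 ger0_norm ?Phi_ge0//.
  have t1 : 1 <= enorm theta by rewrite -/t; lra.
  apply: le_trans (Phi_le t1) _; rewrite -/t.
  move: B; rewrite negb_and -!leNgt -ltNge => /orP[B|B].
    apply: ler_wpDr => //; apply: ler_wpDl => //.
    rewrite shellE; last lra. rewrite -/t.
    have -> : (rad - eta <= t) && (t < rad + 2 * eta) by apply/andP; split; lra.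
    by rewrite mulr1; apply: near1; lra.
  apply: ler_wpDl; first exact: addr_ge0.
  rewrite shellE; last lra. rewrite -/t.
  have -> : (rad' - eta <= t) && (t < rad' + 2 * eta) by apply/andP; split; lra.
  by rewrite mulr1; apply: near2; lra.
- rewrite mul1r mul0r sub0r normrN ger0_norm ?Phi_ge0//.
  have t1 : 1 <= enorm (theta + h) by rewrite -/t'; lra.
  apply: le_trans (Phi_le t1) _; rewrite -/t'.
  move: A; rewrite negb_and -!leNgt -ltNge => /orP[A|A].
    apply: ler_wpDr => //; apply: ler_wpDl => //.
    rewrite shellE; last lra. rewrite -/t.
    have -> : (rad - eta <= t) && (t < rad + 2 * eta) by apply/andP; split; lra.
    by rewrite mulr1; apply: near1; lra.
  apply: ler_wpDl; first exact: addr_ge0.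
  rewrite shellE; last lra. rewrite -/t.
  have -> : (rad' - eta <= t) && (t < rad' + 2 * eta) by apply/andP; split; lra.
  by rewrite mulr1; apply: near2; lra.
- by rewrite !mul0r subrr normr0 !addr_ge0.
Qed.

(* Translating [theta] by [h] changes the sign of the cosine, so twice the integral is the integral
   of the cosine against a difference of the density at distance [h]. *)
Lemma oscillation : exists2 C : R, 0 <= C & forall rad rad' z h, 1 <= rad -> rad <= rad' ->
  2 * enorm h <= rad -> dotp h z = pi ->
  `|\int[@leb2 R]_theta (cos (dotp theta z) * (shell rad rad' theta * inv_symbol theta))| <=
    C * enorm h * rad `^ (- (del_ / 2)).
Proof.
have a1 := alpha_gt1; have a2 := alpha_lt2; have [dl0 dl1] := del_bounds.
have [C1 C10 HC] := Phi_diff; have k0 := kap_gt0 R; have ap := area_gt0 R.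
have ki : 0 <= kap^-1 by rewrite invr_ge0 ltW.
pose If : R := \int[@leb2 R]_y (\1_(~` @eball R 1) y * enorm y `^ (- (2 + del_ / 2))).
have If0 : 0 <= If by apply: Rint2_ge0 => y; rewrite mulr_ge0 ?powR_ge0// indicE ler0n.
(* The 45 is 9 + 4 * 9, from the areas of the two boundary shells. *)
exists (C1 * If + 45 * kap^-1 * area R).
  by rewrite addr_ge0// !mulr_ge0// ltW.
move=> rad rad' z h r1 rr' hr hz; have rad0 : 0 < rad := lt_le_trans ltr01 r1.
have h0 : 0 < enorm h.
  rewrite enorm_gt0; apply/eqP => hh; move: hz; rewrite hh /dotp /= !mul0r addr0 => /esym/eqP.
  by rewrite gt_eqF// pi_gt0.
set eta := enorm h in hr h0 *.
pose a theta : R := shell rad rad' theta * inv_symbol theta.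
have Ia : intg2 a by exact: intg_shell_Phi.
have Ia' : intg2 (fun theta => a (theta + h)) by exact: (intg_shift h Ia).
set I := \int[@leb2 R]_theta (cos (dotp theta z) * a theta).
have eI : I = - \int[@leb2 R]_theta (cos (dotp theta z) * a (theta + h)).
  rewrite /I -(Rint_shift h (intg_cosM z Ia)) -RintN; last exact: intg_cosM.
  apply: Rint2_eq => theta; rewrite dotpDl hz cosDpi; ring.
have e2 : I + I = \int[@leb2 R]_theta (cos (dotp theta z) * (a theta - a (theta + h))).
  rewrite {2}eI /I -Rint2B; try exact: intg_cosM.
  by apply: Rint2_eq => theta; rewrite mulrBr.
pose g theta : R := C1 * eta * (\1_(~` eball rad) theta * enorm theta `^ (- (2 + del_)))
    + kap^-1 * rad `^ (- alpha) * shell (rad - eta) (rad + 2 * eta) theta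
    + 4 * kap^-1 * rad' `^ (- alpha) * shell (rad' - eta) (rad' + 2 * eta) theta.
have Ifar : intg2 (fun theta => \1_(~` @eball R rad) theta * enorm theta `^ (- (2 + del_))).
  by apply: intg_far => //; rewrite ltrDl.
have Ifar1 : intg2 (fun y => \1_(~` @eball R 1) y * enorm y `^ (- (2 + del_ / 2))).
  by apply: intg_far; [exact: ltr01|rewrite ltrDl divr_gt0].
have Is1 := intg_shell (rad - eta) (rad + 2 * eta).
have Is2 := intg_shell (rad' - eta) (rad' + 2 * eta).
have Ig : intg2 g by apply: intgD; [apply: intgD|]; exact: intgZ.
have ag theta : `|cos (dotp theta z) * (a theta - a (theta + h))| <= g theta.
  rewrite normrM; apply: (@le_trans _ _ (1 * `|a theta - a (theta + h)|)).
    by rewrite ler_wpM2r// cos_max.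
  by rewrite mul1r; exact: shift_diff_le.
have bI : `|I + I| <= \int[@leb2 R]_theta g theta.
  by rewrite e2; apply: Rint2_norm => //; apply: intg_cosM; exact: intgB.
(* Half of the gain becomes the decay in [rad]; the other half keeps the integral [If] over the
   exterior of the unit ball finite. *)
set b := del_ / 2; have b0 : 0 <= b := divr_ge0 (ltW dl0) (ler0n _ 2).
have rb : 0 <= rad `^ (- b) by exact: powR_ge0.
have far_le : \int[@leb2 R]_theta (\1_(~` @eball R rad) theta * enorm theta `^ (- (2 + del_))) <=
    rad `^ (- b) * If.
  rewrite -Rint2Z//; apply: Rint2_mono => //; first exact: intgZ.
  move=> y; rewrite !indicE; case: (boolP (y \in ~` eball rad)) => [/set_mem yr|_]; last first.
    by rewrite mul0r !mulr_ge0 ?powR_ge0.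
  have yr' : rad <= enorm y by move: yr; rewrite /eball /= => /negP; rewrite -leNgt.
  rewrite mem_set /=; last by rewrite /eball /=; apply/negP; rewrite -leNgt; exact: le_trans r1 yr'.
  rewrite !mul1r; apply: (@le_trans _ _ (enorm y `^ (- b) * enorm y `^ (- (2 + b)))).
    rewrite -powRD; last by apply/implyP => _; exact: lt0r_neq0 (lt_le_trans rad0 yr').
    by rewrite (_ : - b - (2 + b) = - (2 + del_))// /b; field.
  by rewrite ler_wpM2r ?powR_ge0//; exact: (powRN_anti rad0 yr' b0).
(* Here 1 - alpha <= - b, because [del_ <= alpha - 1]. *)
have pow1 u : rad <= u -> u `^ (- alpha) * u <= rad `^ (- b).
  move=> ru; have u0 : 0 < u := lt_le_trans rad0 ru.
  rewrite -[X in _ * X](powRr1 (ltW u0)) -powRD; last by apply/implyP => _; exact: lt0r_neq0.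
  apply: (@le_trans _ _ (u `^ (- b))); first by apply: ler_powR; [exact: le_trans r1 ru|rewrite /b; lra].
  exact: (powRN_anti rad0 ru b0).
have sh1 := area_shell h0 hr.
have sh2 : \int[@leb2 R]_y shell (rad' - eta) (rad' + 2 * eta) y <= 9 * eta * rad' * area R.
  exact: area_shell h0 (le_trans hr rr').
have tot : \int[@leb2 R]_theta g theta <=
    (C1 * If + 45 * kap^-1 * area R) * eta * rad `^ (- b).
  rewrite /g Rint2D; [|apply: intgD; exact: intgZ|exact: intgZ].
  rewrite Rint2D; try exact: intgZ.
  rewrite !Rint2Z//.
  have t1 := ler_wpM2l (mulr_ge0 C10 (ltW h0)) far_le.
  have t2 := ler_wpM2l (mulr_ge0 ki (powR_ge0 rad (- alpha))) sh1.
  have t3 := ler_wpM2l (mulr_ge0 (mulr_ge0 (ler0n R 4) ki) (powR_ge0 rad' (- alpha))) sh2.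
  apply: le_trans (lerD (lerD t1 t2) t3) _.
  have p1 := pow1 rad (lexx _); have p2 := pow1 rad' rr'.
  have q0 : 0 <= 9 * kap^-1 * eta * area R by rewrite !mulr_ge0// ltW.
  have s1 := ler_wpM2l q0 p1; have s2 := ler_wpM2l q0 p2.
  set u := rad `^ (- alpha) in s1 *; set v := rad' `^ (- alpha) in s2 *.
  have -> : kap^-1 * u * (9 * eta * rad * area R) = 9 * kap^-1 * eta * area R * (u * rad) by ring.
  have -> : 4 * kap^-1 * v * (9 * eta * rad' * area R) = 4 * (9 * kap^-1 * eta * area R * (v * rad')) by ring.
  have -> : (C1 * If + 45 * kap^-1 * area R) * eta * rad `^ (- b) =
    C1 * eta * (rad `^ (- b) * If) + (9 * kap^-1 * eta * area R * rad `^ (- b)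
     + 4 * (9 * kap^-1 * eta * area R * rad `^ (- b))) by ring.
  by rewrite -addrA lerD2l; apply: lerD => //; rewrite ler_wpM2l.
have := le_trans bI tot; have : `|I + I| = 2 * `|I|.
  rewrite (_ : I + I = 2 * I); last by ring.
  by rewrite normrM ger0_norm.
by move=> -> hh; apply: le_trans hh; rewrite ler_peMl ?ler1n.
Qed.

End Oscillation.

(** * Existence and size of the potential kernel *)

Section Potential.
Variables (R : realType) (alpha M : R).
Hypothesis alpha_gt1 : 1 < alpha.
Hypothesis alpha_lt2 : alpha < 2.
Hypothesis M_gt1 : 1 < M.
Variable x0 : R * R.
Hypothesis x0_unit : enorm x0 = 1.
Implicit Types (x y z theta h : R * R) (rad : R).
Local Notation psi1 := (jump_symbol alpha M).
Local Notation kap := (ellipticity R).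
Local Notation Phi := (inv_symbol alpha M).

Definition Eker theta x : R := (cos (dotp theta x) - cos (dotp theta x0)) * Phi theta.

Definition green_trunc rad x : R := \int[@leb2 R]_theta (\1_(eball rad) theta * Eker theta x).

(** For small [theta] both cosines are 1 up to a quadratic error, which matches the quadratic lower
    bound of the symbol; for large [theta] the inverse symbol is bounded. The subtracted cosine thus
    removes the singularity at 0. *)
Lemma Eker_le x theta : `|Eker theta x| <= kap^-1 * (enorm x ^+ 2 + 3).
Proof.
have k0 := kap_gt0 R; have ki : 0 < kap^-1 by rewrite invr_gt0.
have P0 := Phi_ge0 alpha M theta.
rewrite normrM (ger0_norm P0).
have [t1|t1] := leP 1 (enorm theta).
  apply: (@le_trans _ _ (2 * kap^-1)).
    apply: ler_pM => //.
      have := ler_normB (cos (dotp theta x)) (cos (dotp theta x0)).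
      by have := cos_max (dotp theta x); have := cos_max (dotp theta x0); lra.
    apply: le_trans (Phi_le alpha_gt1 alpha_lt2 M_gt1 t1) _.
    rewrite ler_piMr ?(ltW ki)//.
    have := powRN_anti ltr01 t1 (_ : 0 <= alpha); rewrite powR1; apply.
    by have := alpha_gt1; lra.
  by rewrite mulrC ler_wpM2l ?(ltW ki)//; have := sqr_ge0 (enorm x); lra.
have num : `|cos (dotp theta x) - cos (dotp theta x0)| <= (enorm x ^+ 2 + 1) * enorm theta ^+ 2.
  have h1 := onem_cosdot_le theta x; have h2 := onem_cosdot_le theta x0.
  have h3 := onem_cos_ge0 (dotp theta x); have h4 := onem_cos_ge0 (dotp theta x0).
  rewrite x0_unit expr1n mulr1 in h2; rewrite mulrC in h1.
  have q := sqr_ge0 (enorm theta); have q' : 0 <= enorm x ^+ 2 * enorm theta ^+ 2.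
    by rewrite mulr_ge0 ?sqr_ge0.
  rewrite mulrDl mul1r; move: h1 h2 h3 h4 q q'; rewrite mulrA.
  set u := enorm x ^+ 2 * enorm theta ^+ 2; set v := enorm theta ^+ 2.
  by move=> *; rewrite ler_norml; apply/andP; split; lra.
have [->|t0] := eqVneq theta 0.
  rewrite /dotp /= !mul0r addr0 subrr normr0 mul0r mulr_ge0 ?(ltW ki)//.
  by rewrite addr_ge0// sqr_ge0.
have T0 : 0 < enorm theta by rewrite enorm_gt0.
have Pb : Phi theta <= kap^-1 * enorm theta ^- 2.
  have h1 := psi1_ge_small alpha_gt1 alpha_lt2 M_gt1 (ltW t1).
  have kp : 0 < kap * enorm theta ^+ 2 by apply: mulr_gt0 => //; exact: exprn_gt0.
  rewrite /inv_symbol -invfM lef_pV2// posrE//; exact: lt_le_trans h1.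
apply: (@le_trans _ _ ((enorm x ^+ 2 + 1) * enorm theta ^+ 2 * (kap^-1 * enorm theta ^- 2))).
  by apply: ler_pM.
have -> : (enorm x ^+ 2 + 1) * enorm theta ^+ 2 * (kap^-1 * enorm theta ^- 2) =
   kap^-1 * (enorm x ^+ 2 + 1) by field; rewrite !lt0r_neq0.
by rewrite ler_wpM2l ?(ltW ki)//; lra.
Qed.

Lemma Eker_far x theta : 1 <= enorm theta -> `|Eker theta x| <= 2 * kap^-1 * enorm theta `^ (-1).
Proof.
move=> t1; have P0 := Phi_ge0 alpha M theta; have ki : 0 < kap^-1 by rewrite invr_gt0 kap_gt0.
rewrite normrM (ger0_norm P0) -mulrA; apply: ler_pM => //.
  have := ler_normB (cos (dotp theta x)) (cos (dotp theta x0)).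
  by have := cos_max (dotp theta x); have := cos_max (dotp theta x0); lra.
apply: le_trans (Phi_le alpha_gt1 alpha_lt2 M_gt1 t1) _.
by rewrite ler_wpM2l ?(ltW ki)//; apply: ler_powR => //; have := alpha_gt1; lra.
Qed.

Lemma Eker_meas4 : meas4 Eker.
Proof.
have L (a b : R * R -> R) : continuous a -> continuous b -> meas4 (fun x y => a x * b y).
  move=> ca cb; apply: meas4M; [apply: meas4_l|apply: meas4_r]; exact: continuous_measurable2.
have md := meas4D (L _ _ (@continuous_fstR R) (@continuous_fstR R))
  (L _ _ (@continuous_sndR R) (@continuous_sndR R)).
have mc : meas4 (fun theta x => cos (dotp theta x)).
  exact: (measurableT_comp (continuous_measurable_fun (@continuous_cos R)) md).
apply: meas4M; last by apply: meas4_l; exact: measurable_Phi.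
by apply: meas4B => //; apply: meas4_l; exact: meas2_cos.
Qed.

Lemma Eker_meas x : meas2 (fun theta => Eker theta x).
Proof. exact: (meas4_sectr x Eker_meas4). Qed.

Lemma intg_Eker rad x : intg2 (fun theta => \1_(eball rad) theta * Eker theta x).
Proof.
apply: (@int2_le _ _ (fun theta => kap^-1 * (enorm x ^+ 2 + 3) * \1_(eball rad) theta)).
- by apply: meas2M; [exact: meas2_ball|exact: Eker_meas].
- by apply: intgZ; exact: int2_ball.
- move=> theta; rewrite normrM indic_ball (ger0_norm (ler0n _ _)) [X in X <= _]mulrC.
  by rewrite ler_wpM2r ?ler0n// Eker_le.
Qed.

Lemma invnorm_ball rad : 0 < rad ->
  \int[@leb2 R]_y (\1_(eball rad) y * enorm y `^ (-1)) =
  rad * \int[@leb2 R]_y (\1_(eball 1) y * enorm y `^ (-1)).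
Proof.
move=> r0; have rn0 : rad != 0 by rewrite gt_eqF.
have I1 : intg2 (fun y => \1_(@eball R rad) y * enorm y `^ (-1)) by apply: intg_near; lra.
have I2 : intg2 (fun y => \1_(@eball R 1) y * enorm y `^ (-1)) by apply: intg_near; lra.
have I3 := intg_aff2 rn0 0 I1.
rewrite (Rint_aff2 rn0 0 I1) (gtr0_norm r0) -(Rint2Z rad I2).
apply: etrans (esym (Rint2Z (rad ^+ 2) I3)) _; rewrite /=.
apply: Rint2_eq => y; rewrite enorm_aff (gtr0_norm r0) powRM ?enorm_ge0 ?(ltW r0)//.
rewrite powR_inv1 ?(ltW r0)// !indic_ball enorm_aff (gtr0_norm r0).
have -> : (rad * enorm y < rad) = (enorm y < 1) by rewrite -{2}(mulr1 rad) ltr_pM2l.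
by field.
Qed.

Definition Inv1 : R := \int[@leb2 R]_y (\1_(@eball R 1) y * enorm y `^ (-1)).

Lemma Inv1_ge0 : 0 <= Inv1.
Proof. by apply: Rint2_ge0 => y; rewrite mulr_ge0 ?powR_ge0. Qed.

Lemma Eint_crude rad x : 0 < rad ->
  `|green_trunc rad x| <= kap^-1 * (enorm x ^+ 2 + 3) * area R + 2 * kap^-1 * (rad * Inv1).
Proof.
move=> r0; have ki : 0 < kap^-1 by rewrite invr_gt0 kap_gt0.
have I1 : intg2 (fun y => \1_(@eball R rad) y * enorm y `^ (-1)) by apply: intg_near; lra.
rewrite /Inv1 -invnorm_ball// /area -Rint2Z; last exact: int2_ball.
rewrite -[X in _ <= _ + X]Rint2Z// -Rint2D; [|apply: intgZ; exact: int2_ball|exact: intgZ].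
apply: Rint2_norm; [exact: intg_Eker|apply: intgD; [apply: intgZ; exact: int2_ball|exact: intgZ]|].
move=> theta; rewrite normrM !indic_ball (ger0_norm (ler0n _ _)).
have c0 : 0 <= kap^-1 * (enorm x ^+ 2 + 3) by rewrite mulr_ge0 ?(ltW ki)// addr_ge0// sqr_ge0.
have c1 : 0 <= 2 * kap^-1 * enorm theta `^ (-1) by rewrite !mulr_ge0 ?powR_ge0 ?(ltW ki).
case: (ltP (enorm theta) rad) => h; last first.
  by rewrite !mul0r mulr0 addr0 mulr_ge0// ler0n.
rewrite !mul1r; case: (ltP (enorm theta) 1) => h1.
  by rewrite mulr1; apply: ler_wpDr => //; exact: Eker_le.
by rewrite mulr0 add0r; exact: Eker_far.
Qed.

(** Some coordinate of [z] is at least |z| / 2 in absolute value, and the translation is taken along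
    that axis. *)
Lemma half_period z : z != 0 -> exists h, dotp h z = pi /\ enorm h <= 2 * pi / enorm z.
Proof.
move=> z0; have Z0 : 0 < enorm z by rewrite enorm_gt0.
have p0 : 0 < pi :> R by exact: pi_gt0.
have hz := enorm_le z.
have key (a : R) : enorm z / 2 <= `|a| -> pi / `|a| <= 2 * pi / enorm z /\ a != 0.
  move=> h; have a0 : 0 < `|a| by apply: lt_le_trans h; rewrite divr_gt0.
  split; last by rewrite -normr_gt0.
  by rewrite ler_pdivrMr// mulrAC ler_pdivlMr//; nra.
have [h|h] := leP (enorm z / 2) `|z.1|.
  have [k1 k2] := key _ h; exists (pi / z.1, 0); split; first by rewrite /dotp /= mul0r addr0 divfK.
  apply: le_trans k1; rewrite /enorm /= expr0n addr0 sqrtr_sqr normrM normfV (gtr0_norm p0)//.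
have {}h : enorm z / 2 <= `|z.2| by lra.
have [k1 k2] := key _ h; exists (0, pi / z.2); split; first by rewrite /dotp /= mul0r add0r divfK.
by apply: le_trans k1; rewrite /enorm /= expr0n add0r sqrtr_sqr normrM normfV (gtr0_norm p0).
Qed.

(** Between two radii at least 1 the two cosines may be separated, and each is treated with its own
    half period. *)
Lemma Eint_diff : exists2 C : R, 0 <= C & forall rad rad' x h h0,
  1 <= rad -> rad <= rad' -> 2 * enorm h <= rad -> 2 * enorm h0 <= rad ->
  dotp h x = pi -> dotp h0 x0 = pi ->
  `|green_trunc rad' x - green_trunc rad x| <= C * (enorm h + enorm h0) * rad `^ (- (del_ alpha / 2)).
Proof.
have [C C0 HC] := oscillation alpha_gt1 alpha_lt2 M_gt1; exists C => // rad rad' x h h0 r1 rr hr hr0 hx hx0.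
have Is := intg_shell_Phi alpha_gt1 alpha_lt2 M_gt1 r1 rr.
have -> : green_trunc rad' x - green_trunc rad x =
   \int[@leb2 R]_theta (cos (dotp theta x) * (shell rad rad' theta * Phi theta)) -
   \int[@leb2 R]_theta (cos (dotp theta x0) * (shell rad rad' theta * Phi theta)).
  rewrite /green_trunc -!Rint2B; try exact: intg_cosM; try exact: intg_Eker.
  by apply: Rint2_eq => theta; rewrite /Eker /shell; ring.
apply: le_trans (ler_normB _ _) _; rewrite mulrDr mulrDl; apply: lerD; exact: HC.
Qed.

(* The oscillation estimate applies from a radius of order [1 + 1 / enorm x] on; below it the
   integrand is at most a constant plus a multiple of [1 / enorm theta]. *)
Lemma Eint_bound (rho0 : R) : 0 <= rho0 -> exists2 K : R, 0 <= K & forall rad x, 0 < rad -> x != 0 ->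
  enorm x <= rho0 -> `|green_trunc rad x| <= K * (1 + (enorm x)^-1).
Proof.
move=> rho00; have [C C0 HC] := Eint_diff; have ki : 0 < kap^-1 by rewrite invr_gt0 kap_gt0.
have p0 : 0 < pi :> R by exact: pi_gt0.
have ap := area_gt0 R; have J0 := Inv1_ge0; have a1 := alpha_gt1.
have x0n : x0 != 0 by rewrite -enorm_gt0 x0_unit ltr01.
have [h0 [hh0 eh0]] := half_period x0n; rewrite x0_unit divr1 in eh0.
pose A := kap^-1 * (rho0 ^+ 2 + 3) * area R.
pose B := 2 * kap^-1 * Inv1.
have A0 : 0 <= A.
  by rewrite /A !mulr_ge0 ?(ltW ki) ?(ltW ap)// addr_ge0// sqr_ge0.
have B0 : 0 <= B by rewrite /B !mulr_ge0 ?(ltW ki).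
exists (A + B * (1 + 4 * pi) + C * (2 * pi)).
  by apply: addr_ge0; [apply: addr_ge0 => //; apply: mulr_ge0 => //; lra|apply: mulr_ge0 => //; lra].
move=> rad x r0 x1 xr; have X0 : 0 < enorm x by rewrite enorm_gt0.
have [h [hh eh]] := half_period x1.
set q := (enorm x)^-1; have q0 : 0 < q by rewrite invr_gt0.
have eh' : enorm h <= 2 * pi * q by [].
pose R1 := 1 + 2 * enorm h + 2 * enorm h0.
have hp := enorm_ge0 h; have hp0 := enorm_ge0 h0.
have R11 : 1 <= R1 by rewrite /R1; lra.
have crude s : 0 < s -> s <= R1 -> `|green_trunc s x| <= A + B * (1 + 4 * pi) * (1 + q).
  move=> s0 sR; apply: le_trans (Eint_crude x s0) _; apply: lerD.
    rewrite /A ler_wpM2r ?(ltW ap)// ler_wpM2l ?(ltW ki)// lerD2r.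
    by apply: lerXn2r; rewrite ?nnegrE ?enorm_ge0.
  have -> : 2 * kap^-1 * (s * Inv1) = B * s by rewrite /B; ring.
  rewrite -mulrA ler_wpM2l//; apply: le_trans sR _; rewrite /R1.
  have : 0 <= pi * q by rewrite mulr_ge0 ?ltW.
  by move: eh' eh0; nra.
have [rR|rR] := leP rad R1.
  apply: le_trans (crude rad r0 rR) _.
  have : 0 <= A * q by rewrite mulr_ge0 ?(ltW q0).
  have : 0 <= C * (2 * pi) * (1 + q) by apply: mulr_ge0; [apply: mulr_ge0 => //; lra|lra].
  by lra.
have d : `|green_trunc rad x - green_trunc R1 x| <= C * (2 * pi) * (1 + q).
  apply: le_trans (HC R1 rad x h h0 R11 (ltW rR) _ _ hh hh0) _; [rewrite /R1; lra|rewrite /R1; lra|].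
  apply: (@le_trans _ _ (C * (enorm h + enorm h0) * 1)).
    apply: ler_wpM2l; first by rewrite mulr_ge0 ?addr_ge0.
    have := powRN_anti ltr01 R11 (_ : 0 <= del_ alpha / 2); rewrite powR1; apply.
    by have [] := del_bounds alpha_gt1 alpha_lt2; lra.
  by rewrite mulr1 -mulrA ler_wpM2l//; lra.
have e : green_trunc rad x = (green_trunc rad x - green_trunc R1 x) + green_trunc R1 x by rewrite subrK.
rewrite e; apply: le_trans (ler_normD _ _) _.
have cr := crude R1 ltac:(lra) (lexx _).
have : 0 <= A * q by rewrite mulr_ge0 ?(ltW q0).
by lra.
Qed.

Lemma Eint_cvg x : x != 0 -> cvg (green_trunc rad x @[rad --> +oo]).
Proof.
move=> x1; have [C C0 HC] := Eint_diff.
have x0n : x0 != 0 by rewrite -enorm_gt0 x0_unit ltr01.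
have [h0 [hh0 _]] := half_period x0n; have [h [hh _]] := half_period x1.
have hp := enorm_ge0 h; have hp0 := enorm_ge0 h0.
have [dl0 _] := del_bounds alpha_gt1 alpha_lt2.
set b := del_ alpha / 2; have b0 : 0 < b by rewrite /b; lra.
apply/cauchy_cvgP; apply: cauchy_exP => e e0.
pose D := C * (enorm h + enorm h0) + 1.
have D0 : 0 < D by rewrite ltr_wpDl// mulr_ge0// addr_ge0.
(* The last summand solves D * R1^-b <= e / 2; the others satisfy the conditions of [Eint_diff]. *)
pose R1 := 1 + 2 * enorm h + 2 * enorm h0 + (2 * D / e) `^ b^-1.
have u0 : 0 <= 2 * D / e by rewrite divr_ge0 ?mulr_ge0 ?(ltW D0) ?(ltW e0).
have pp : 0 <= (2 * D / e) `^ b^-1 by exact: powR_ge0.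
have R11 : 1 <= R1 by rewrite /R1; lra.
have R1b : R1 `^ (- b) <= e / (2 * D).
  have ip : 0 < 2 * D / e by rewrite divr_gt0 ?mulr_gt0.
  rewrite powRN -[leRHS]invrK lef_pV2 ?posrE ?invr_gt0 ?divr_gt0 ?mulr_gt0 ?powR_gt0//; last by lra.
  have e1 : 2 * D / e = ((2 * D / e) `^ b^-1) `^ b.
    by rewrite -powRrM mulVf ?lt0r_neq0// powRr1.
  rewrite invf_div {1}e1.
  by apply: ge0_ler_powR; rewrite ?nnegrE ?(ltW b0)// /R1; lra.
exists (green_trunc R1 x).
suff H : \forall rad \near +oo, ball (green_trunc R1 x) e (green_trunc rad x) by exact: H.
near=> rad.
rewrite /ball /= distrC; have rR : R1 <= rad by near: rad; apply: nbhs_pinfty_ge; exact: num_real.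
apply: le_lt_trans (HC R1 rad x h h0 R11 rR _ _ hh hh0) _; [rewrite /R1; lra|rewrite /R1; lra|].
apply: (@le_lt_trans _ _ (D * (e / (2 * D)))).
  apply: ler_pM => //; first by rewrite mulr_ge0// addr_ge0.
    exact: powR_ge0.
  by rewrite /D lerDl.
have -> : D * (e / (2 * D)) = e / 2 by field; exact: lt0r_neq0.
lra.
Unshelve. all: by end_near. Qed.

Lemma Eint_seq x : x != 0 ->
  green_trunc n.+1%:R x @[n --> \oo] --> lim (green_trunc rad x @[rad --> +oo]).
Proof.
move=> /Eint_cvg /cvg_pinftyP; apply.
by rewrite cvg_shiftS; exact: cvgr_idn.
Qed.

Lemma G_ME r x : 0 < c_lim alpha r M ->
  G_M alpha r M x0 x = ((2 * pi) ^+ 2)^-1 *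
    (lim ((fun rad : R => (c_lim alpha r M)^-1 * green_trunc rad x) @ +oo) : R).
Proof.
move=> c0; rewrite /G_M; have -> : (fun rad : R => \int[@leb2 R]_(theta in eball rad)
    ((cos (dotp theta x) - cos (dotp theta x0)) / psi_M alpha r M theta)) =
    (fun rad : R => (c_lim alpha r M)^-1 * green_trunc rad x); last by [].
apply/funext => rad.
rewrite Rint_indic /green_trunc -Rint2Z; last exact: intg_Eker.
apply: Rint2_eq => theta; rewrite psi_ME /Eker /inv_symbol invfM; ring.
Qed.

Lemma G_M_lim r x : 0 < c_lim alpha r M -> x != 0 ->
  ((2 * pi) ^+ 2)^-1 * ((c_lim alpha r M)^-1 * green_trunc n.+1%:R x) @[n --> \oo] -->
    G_M alpha r M x0 x.
Proof.
move=> c0 x1; rewrite G_ME//.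
have -> : (lim ((fun rad : R => (c_lim alpha r M)^-1 * green_trunc rad x) @ +oo) : R) =
    (c_lim alpha r M)^-1 * (lim (green_trunc rad x @[rad --> +oo]) : R).
  apply/cvg_lim => //; apply: cvgMr; exact: Eint_cvg.
by apply: cvgMr; apply: cvgMr; exact: Eint_seq.
Qed.

End Potential.

(** * Fourier inversion for test functions *)

Section PoissonLine.
Variable R : realType.
Local Notation mR := (measurableTypeR R).
Local Notation lam := (@lebesgue_measure R).
Local Notation intg1 f := (lam.-integrable setT (EFin \o f)).
Implicit Types (a b d s t x eps : R).

Lemma FTC (f F : R -> R) a b : a < b -> continuous f ->
  (forall t, is_derive t (1 : R) F (f t)) ->
  \int[lam]_(t in `[a, b]) f t = F b - F a.
Proof.
move=> ab cf HF; have cF := derive_continuous HF.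
rewrite /Rintegral (@continuous_FTC2 _ f F)//.
- exact: continuous_subspaceT.
- split.
  + by move=> t _; have [] := HF t.
  + by apply: cvg_at_right_filter; exact: cF.
  + by apply: cvg_at_left_filter; exact: cF.
- by move=> t _; rewrite derive1E; have [_] := HF t.
Qed.

Lemma continuous_cauchy : continuous (fun t : R => (1 + t ^+ 2)^-1).
Proof. exact: continuous_oneDsqrV. Qed.

Lemma Rint_cauchy : intg1 (fun t : R => (1 + t ^+ 2)^-1) /\
  \int[lam]_t (1 + t ^+ 2)^-1 = pi.
Proof.
have f0 t : 0 <= (1 + t ^+ 2)^-1 :> R by rewrite invr_ge0 addr_ge0// sqr_ge0.
have E : (\int[lam]_t ((1 + t ^+ 2)^-1)%:E = (pi)%:E)%E.
  rewrite (ge0_symfun_integralT f0 continuous_cauchy); last by move=> t /=; rewrite sqrrN.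
  rewrite -set_itvcy integral0y_oneDsqr -EFinM; congr EFin.
  by rewrite mulrC divfK.
split; last by rewrite /Rintegral E.
apply/integrableP; split.
  by apply/measurable_EFinP; apply: continuous_measurable_fun; exact: continuous_cauchy.
under eq_integral do rewrite /= ger0_norm//.
by rewrite E ltry.
Qed.

Definition expabs eps t : R := expR (- (eps * `|t|)).

Lemma expabs_gt0 eps t : 0 < expabs eps t. Proof. exact: expR_gt0. Qed.

Lemma continuous_expabs eps : continuous (expabs eps).
Proof.
move=> t; apply: (@continuous_comp _ _ _ (fun t : R => - (eps * `|t|)) expR).
  by apply: cvgN; apply: cvgMr; exact: norm_continuous.
exact: continuous_expR.
Qed.

Lemma expabs_le eps t : 0 < eps -> expabs eps t <= (1 + 2 / eps ^+ 2) * (1 + t ^+ 2)^-1.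
Proof.
move=> e0; have e2 : 0 < eps ^+ 2 by exact: exprn_gt0.
have t2 := sqr_ge0 t.
have et0 : 0 <= eps * `|t| by rewrite mulr_ge0// ltW.
have h := expR_ge1Dxn 1 et0; rewrite exprMn real_normK ?num_real// in h.
have f2 : (2`!)%:R = 2 :> R by [].
rewrite f2 in h.
rewrite /expabs expRN ler_pdivlMr; last by rewrite ltr_wpDr.
rewrite mulrC ler_pdivrMr ?expR_gt0//.
have k0 : 0 < 1 + 2 / eps ^+ 2 by rewrite addr_gt0 ?divr_gt0.
apply: le_trans (ler_wpM2l (ltW k0) h).
have -> : (1 + 2 / eps ^+ 2) * (1 + eps ^+ 2 * t ^+ 2 / 2%:R) =
   1 + t ^+ 2 + (2 / eps ^+ 2 + eps ^+ 2 * t ^+ 2 / 2) by field; exact: lt0r_neq0.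
rewrite lerDl; apply: addr_ge0; first by apply: divr_ge0 => //; exact: ltW.
by apply: divr_ge0 => //; apply: mulr_ge0 => //; exact: ltW.
Qed.

Lemma intg_expabs eps : 0 < eps -> intg1 (expabs eps).
Proof.
move=> e0; apply: (intg_le _ (intgZ (1 + 2 / eps ^+ 2) Rint_cauchy.1)).
  by apply: continuous_measurable_fun; exact: continuous_expabs.
by move=> t; rewrite (gtr0_norm (expabs_gt0 _ _)); exact: expabs_le.
Qed.

(** A primitive of cos(x t + d) exp(s t) in [t]. *)
Definition prim x d s t : R :=
  expR (s * t) * (x * sin (x * t + d) + s * cos (x * t + d)) * (s ^+ 2 + x ^+ 2)^-1.

Lemma is_derive_prim x d s t : s != 0 ->
  is_derive t (1 : R) (prim x d s) (cos (x * t + d) * expR (s * t)).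
Proof.
move=> s0.
have hE : is_derive t (1 : R) (fun t : R => expR (s * t)) (expR (s * t) * s).
  rewrite (_ : (fun t : R => expR (s * t)) = expR \o (fun u : R => s * u + 0)); last first.
    by apply/funext => u /=; rewrite addr0.
  apply: (is_derive_eq (@is_derive1_comp R expR (fun u : R => s * u + 0) t _ _
    (is_derive_expR _) (is_derive_affine s 0 t))).
  by rewrite addr0.
have hs : is_derive t (1 : R) (fun t : R => sin (x * t + d)) (cos (x * t + d) * x).
  exact: (is_derive1_comp (is_derive_sin _) (is_derive_affine x d t)).
have hc : is_derive t (1 : R) (fun t : R => cos (x * t + d)) (- sin (x * t + d) * x).
  exact: (is_derive1_comp (is_derive_cos _) (is_derive_affine x d t)).
have h1 := is_deriveM (is_derive_cst x t (1 : R)) hs.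
have h2 := is_deriveM (is_derive_cst s t (1 : R)) hc.
have h3 := is_deriveM (is_deriveM hE (is_deriveD h1 h2)) (is_derive_cst ((s ^+ 2 + x ^+ 2)^-1) t (1 : R)).
apply: (is_derive_eq h3).
have n0 : s ^+ 2 + x ^+ 2 != 0.
  by rewrite gt_eqF// ltr_wpDr ?sqr_ge0// lt_neqAle eq_sym sqrf_eq0 s0 sqr_ge0.
rewrite /= !scaler0 !add0r !addr0 /GRing.scale /=.
transitivity ((s ^+ 2 + x ^+ 2)^-1 *
  (expR (s * t) * (x * (cos (x * t + d) * x) + s * (- sin (x * t + d) * x)) +
   (x * sin (x * t + d) + s * cos (x * t + d)) * (expR (s * t) * s))); first by [].
by field.
Qed.

Lemma prim_bound x d s t : 0 < s ^+ 2 + x ^+ 2 ->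
  `|prim x d s t| <= expR (s * t) * ((`|x| + `|s|) * (s ^+ 2 + x ^+ 2)^-1).
Proof.
move=> n0; rewrite /prim -mulrA normrM (ger0_norm (expR_ge0 _)) ler_wpM2l ?expR_ge0//.
rewrite normrM (ger0_norm (x := _^-1)) ?invr_ge0 ?(ltW n0)// ler_wpM2r ?invr_ge0 ?(ltW n0)//.
apply: le_trans (ler_normD _ _) _; rewrite !normrM; apply: lerD.
  by rewrite ler_piMr// sin_max.
by rewrite ler_piMr// cos_max.
Qed.

Lemma intg_cos_expabs x d eps : 0 < eps -> intg1 (fun t => cos (x * t + d) * expabs eps t).
Proof.
move=> e0; apply: (intg_le _ (intg_expabs e0)).
  apply: continuous_measurable_fun => t; apply: cvgM; last exact: continuous_expabs.
  apply: (@continuous_comp _ _ _ (fun t => x * t + d) (@cos R)); last exact: continuous_cos.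
  by apply: (@derive_continuous _ _ (fun=> x)) => u; exact: is_derive_affine.
by move=> t; rewrite normrM (gtr0_norm (expabs_gt0 _ _)) ler_piMl ?(ltW (expabs_gt0 _ _))// cos_max.
Qed.

(** The weight has a kink at 0, so the two half-lines are integrated separately with [prim]. The
    phase [d] is carried along because the planar cosine is later integrated one variable at a
    time. *)
Lemma poisson_line x d eps : 0 < eps ->
  \int[lam]_t (cos (x * t + d) * expabs eps t) = 2 * eps / (eps ^+ 2 + x ^+ 2) * cos d.
Proof.
move=> e0; set f := fun t => cos (x * t + d) * expabs eps t.
have If : intg1 f := intg_cos_expabs x d e0.
have n0 : 0 < eps ^+ 2 + x ^+ 2 by rewrite ltr_wpDr ?sqr_ge0// exprn_gt0.
pose N (n : nat) : R := n.+1%:R.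
pose f_ n t := \1_(`[0, N n]%classic : set R) t * f t + \1_(`[- N n, 0]%classic : set R) t * f t.
(* Both closed intervals contain 0, so the pointwise limit counts [f 0] twice. *)
pose g t := f t + (t == 0)%:R * f 0.
have mI a b : measurable (`[a, b]%classic : set mR) by exact: measurable_itv.
have mf : measurable_fun setT (f : mR -> mR) := intg_meas If.
have If1 a b : intg1 (fun t => \1_(`[a, b]%classic : set R) t * f t).
  by apply/(intg_indic lam _ (mI a b)); apply: integrableS If.
have mf_ n : measurable_fun setT (f_ n : mR -> mR).
  by apply: measurable_funD; exact: intg_meas (If1 _ _).
have cv t : f_ n t @[n --> \oo] --> g t.
  apply/cvgn_eps => e' e'0; exists (Num.truncn `|t|) => n Nn.
  have tN : `|t| < N n by apply: lt_le_trans (truncnS_gt _) _; rewrite ler_nat.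
  rewrite (_ : f_ n t = g t) ?subrr ?normr0 ?ltW// /f_ /g !indicE.
  move: tN; rewrite ltr_norml => /andP[h1 h2].
  have [t0|t0|->] := ltgtP t 0.
  - rewrite memNset; last by rewrite /= in_itv /= => /andP[h3 _]; lra.
    rewrite mem_set /=; first by rewrite mul0r mul1r mul0r add0r addr0.
    by rewrite in_itv /=; apply/andP; split; lra.
  - rewrite mem_set; last by rewrite /= in_itv /=; apply/andP; split; lra.
    rewrite memNset /=; first by rewrite mul0r mul1r mul0r.
    by rewrite in_itv /= => /andP[_ h3]; lra.
  - have -> : (0 \in (`[0, N n]%classic : set R)) = true.
      by apply: mem_set; rewrite /= in_itv /= lexx ler0n.
    have -> : (0 \in (`[- N n, 0]%classic : set R)) = true.
      by apply: mem_set; rewrite /= in_itv /= lexx oppr_le0 ler0n.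
    by rewrite /= mul1r.
have dom n t : `|f_ n t| <= 2 * `|f t|.
  rewrite /f_ !indicE; apply: le_trans (ler_normD _ _) _.
  have H (A : bool) : `|A%:R * f t| <= `|f t|.
    by case: A; rewrite ?mul1r// mul0r normr0.
  by have := H (t \in `[0, N n]%classic); have := H (t \in `[- N n, 0]%classic); lra.
have [Ig c1] := Rint_dct mf_ cv (intgZ 2 (intg_norm If)) dom.
have eg : \int[lam]_t g t = \int[lam]_t f t.
  have m0 : measurable ([set 0] : set mR) by exact: measurable_set1.
  have l0 : (lam [set 0%R] < +oo)%E by rewrite lebesgue_measure_set1 ltry.
  have I00 : intg1 (\1_([set 0] : set R) : R -> R) by exact: intg_indicT m0 l0.
  have I0 : intg1 (fun t => f 0 * \1_([set 0] : set R) t) by exact: intgZ.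
  have -> : g = (fun t => f t + f 0 * \1_([set 0] : set R) t).
    apply/funext => t; rewrite /g indicE mulrC; congr (_ + _ * (nat_of_bool _)%:R).
    by apply/eqP/idP => [->|/set_mem]; [exact: mem_set|].
  rewrite RintegralD// RintegralZl//.
  have -> : \int[lam]_t \1_([set 0] : set R) t = 0.
    apply: (etrans (congr1 fine (integral_indic lam measurableT m0))); rewrite setIT.
    exact: (congr1 fine (lebesgue_measure_set1 (0 : R))).
  by rewrite mulr0 addr0.
have val n : \int[lam]_t f_ n t =
    (prim x d (- eps) (N n) - prim x d (- eps) 0) + (prim x d eps 0 - prim x d eps (- N n)).
  have N0 : 0 < N n by rewrite ltr0n.
  have cE s : continuous (fun t : R => cos (x * t + d) * expR (s * t)).
    move=> t; apply: cvgM.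
      apply: (@continuous_comp _ _ _ (fun t => x * t + d) (@cos R)); last exact: continuous_cos.
      by apply: (@derive_continuous _ _ (fun=> x)) => u; exact: is_derive_affine.
    apply: (@continuous_comp _ _ _ (fun t : R => s * t) expR); last exact: continuous_expR.
    by apply: cvgMr; exact: cvg_id.
  rewrite /f_ RintegralD// -!Rint_indic; congr (_ + _).
    have ne : - eps != 0 by rewrite oppr_eq0 gt_eqF.
    rewrite -(FTC N0 (cE (- eps)) (fun t => is_derive_prim x d t ne)).
    apply: eq_Rintegral => t; rewrite inE /= in_itv /= => /andP[t0 _].
    by rewrite /f /expabs (ger0_norm t0) mulNr.
  have N1 : - N n < 0 by rewrite oppr_lt0.
  rewrite -(FTC N1 (cE eps) (fun t => is_derive_prim x d t (lt0r_neq0 e0))).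
  apply: eq_Rintegral => t; rewrite inE /= in_itv /= => /andP[_ t0].
  by rewrite /f /expabs (ler0_norm t0) mulrN opprK.
pose L := 2 * eps / (eps ^+ 2 + x ^+ 2) * cos d.
have c2 : \int[lam]_t f_ n t @[n --> \oo] --> L.
  apply/cvgn_eps => e' e'0.
  pose K := (`|x| + `|eps|) * (eps ^+ 2 + x ^+ 2)^-1.
  have K0 : 0 <= K by rewrite mulr_ge0 ?addr_ge0// invr_ge0 ltW.
  exists (Num.truncn (2 * K / (eps * e'))) => n Nn.
  have N0 : 0 < N n by rewrite ltr0n.
  have NN : 2 * K / (eps * e') <= N n.
    by apply: le_trans (ltW (truncnS_gt _)) _; rewrite ler_nat.
  rewrite val.
  have -> : (prim x d (- eps) (N n) - prim x d (- eps) 0) + (prim x d eps 0 - prim x d eps (- N n)) - L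
      = prim x d (- eps) (N n) - prim x d eps (- N n).
    have e1 : prim x d eps 0 - prim x d (- eps) 0 = L.
      by rewrite /prim /L sqrrN !mulr0 expR0 !add0r !mul1r; field; exact: lt0r_neq0.
    by rewrite -e1; ring.
  have b1 := @prim_bound x d (- eps) (N n); rewrite sqrrN normrN in b1.
  have b2 := @prim_bound x d eps (- N n).
  have := b1 n0; have := b2 n0; rewrite -/K mulrN -mulNr => h2 h1.
  apply: le_trans (ler_normB _ _) _; apply: le_trans (lerD h1 h2) _.
  have ex : expR (- eps * N n) <= (eps * N n)^-1.
    rewrite mulNr expRN lef_pV2 ?posrE ?expR_gt0 ?mulr_gt0//.
    by apply: le_trans (expR_ge1Dx _); rewrite lerDr.
  have h3 := ler_wpM2r K0 ex.
  apply: (@le_trans _ _ (2 * ((eps * N n)^-1 * K))).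
    by rewrite [2 * _]mulr_natl mulr2n; exact: lerD.
  rewrite mulrCA mulrC ler_pdivrMr ?mulr_gt0//.
  move: NN; rewrite ler_pdivrMr ?mulr_gt0// => NN.
  by apply: le_trans NN _; rewrite le_eqVlt; apply/orP; left; apply/eqP; ring.
rewrite -eg; exact: (cvg_unique _ c1 c2).
Qed.

End PoissonLine.

(** * Cosine transforms in the plane and inversion at the origin *)

Section Inversion.
Variable R : realType.
Local Notation mR := (measurableTypeR R).
Local Notation lam := (@lebesgue_measure R).
Local Notation intg1 f := (lam.-integrable setT (EFin \o f)).
Implicit Types (x theta h : R * R) (f phi : R * R -> R) (eps : R).

(** The real part of the Fourier transform; the imaginary part is odd in [theta] and would not
    contribute to the inversion formula at 0. *)
Definition cosft f theta : R := \int[@leb2 R]_x (cos (dotp theta x) * f x).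

Lemma intg_cosl theta f : intg2 f -> intg2 (fun x => cos (dotp theta x) * f x).
Proof.
move=> If; apply: (@int2_le _ _ (fun t => `|f t|)).
- by apply: meas2M; [apply: continuous_measurable2; exact: continuous_cosdot|exact: int2_meas].
- exact: intg_norm.
- by move=> t; rewrite normrM ler_piMl// cos_max.
Qed.

Lemma continuous_cosft f : continuous f -> compactly_supported f -> continuous (cosft f).
Proof.
move=> cf sf; have [rad r0 Hr] := cs_box sf; have If := intg_cs cf sf.
pose K := rad * \int[@leb2 R]_x `|f x|.
have K0 : 0 <= K by rewrite mulr_ge0 ?(ltW r0)// Rint2_ge0.
apply/continuous_eps => x e e0; exists (e / (K + 1)); first by rewrite divr_gt0// ltr_wpDl.
move=> y; rewrite ltr_pdivlMr ?ltr_wpDl// => yx.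
rewrite /cosft -Rint2B; try exact: intg_cosl.
apply: (@le_trans _ _ (\int[@leb2 R]_z ((enorm (y - x) * rad) * `|f z|))).
  apply: Rint2_norm; [apply: intgB; exact: intg_cosl|apply: intgZ; exact: intg_norm|].
  move=> z; rewrite -mulrBl normrM; have [->|fz] := eqVneq (f z) 0.
    by rewrite normr0 !mulr0.
  apply: ler_wpM2r => //; apply: le_trans (cosB_le _ _) _.
  apply: (@le_trans _ _ (`|dotp y z - dotp x z| * 1)); first by rewrite ler_wpM2l// sin_max.
  rewrite mulr1 [dotp y z]dotpC [dotp x z]dotpC -dotpB dotpC.
  by apply: le_trans (dotp_le _ _) _; rewrite ler_wpM2l ?enorm_ge0// ltW// Hr.
rewrite Rint2Z; last exact: intg_norm.
rewrite -mulrA -/K; apply: le_trans (ltW yx); rewrite ler_wpM2l ?enorm_ge0//; lra.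
Qed.

Lemma cosft_dif f theta h : intg2 f -> dotp theta h = pi ->
  cosft (dif h f) theta = - 2 * cosft f theta.
Proof.
move=> If hp; have Is : intg2 (fun x => f (h + x)).
  by have := intg_shift h If; apply: int2_eq => x; rewrite addrC.
rewrite /cosft.
have -> : \int[@leb2 R]_x (cos (dotp theta x) * dif h f x) =
  \int[@leb2 R]_x (cos (dotp theta x) * f (h + x)) - \int[@leb2 R]_x (cos (dotp theta x) * f x).
  rewrite -Rint2B; try exact: intg_cosl.
  by apply: Rint2_eq => x; rewrite /dif mulrBr.
have -> : \int[@leb2 R]_x (cos (dotp theta x) * f (h + x)) = - \int[@leb2 R]_x (cos (dotp theta x) * f x).
  rewrite -(Rint_shift h (intg_cosl theta If)) -RintN.
    apply: Rint2_eq => x; rewrite dotpD hp cosDpi [x + h]addrC; ring.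
  exact: (intg_shift h (intg_cosl theta If)).
ring.
Qed.

Lemma intg_dif f h : intg2 f -> intg2 (dif h f).
Proof.
move=> If; apply: intgB => //.
by have := intg_shift h If; apply: int2_eq => x; rewrite addrC.
Qed.

Lemma iter_dif_supp f h k rad : (forall x, f x != 0 -> enorm x < rad) ->
  forall x, iter k (dif h) f x != 0 -> enorm x < rad + k%:R * enorm h.
Proof.
move=> H; elim: k => [|k IH] x /=; first by rewrite mul0r addr0; exact: H.
have h0 := enorm_ge0 h; have k1 : k.+1%:R = k%:R + 1 :> R by rewrite natr1.
have [e0|e0] := eqVneq (iter k (dif h) f (h + x)) 0; last first.
  move=> _; have := IH _ e0; have := enormB (h + x) h; rewrite addrAC subrr add0r k1; lra.
by rewrite /dif e0 sub0r oppr_eq0 => /IH; rewrite k1; lra.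
Qed.

Lemma enorm_dir (t : R) b : enorm (t *: dir R b) = `|t|.
Proof.
rewrite /dir /enorm; case: b; rewrite /= [t *: 0]mulr0 [t *: 1]mulr1 expr0n /= ?addr0 ?add0r;
by rewrite sqrtr_sqr.
Qed.

Lemma dotp_dir theta (t : R) b :
  dotp theta (t *: dir R b) = t * (if b then theta.1 else theta.2).
Proof.
by rewrite /dotp /dir; case: b; rewrite /= [t *: 0]mulr0 [t *: 1]mulr1 !mulr0 ?addr0 ?add0r mulrC.
Qed.

(* Translating by a half period three times replaces [phi] by its third difference. *)
Lemma cosft_decay phi : is_test_function phi -> exists2 C : R, 0 <= C & forall theta,
  1 <= enorm theta -> `|cosft phi theta| <= C * enorm theta `^ (- 3).
Proof.
move=> tphi; have cphi := test_continuous tphi; have p0 := pi_gt0 R.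
have [rad r0 Hr] := cs_box tphi.2; have If := intg_cs cphi tphi.2.
have [K1 K10 H1] := test_iter_dif true 3 tphi; have [K2 K20 H2] := test_iter_dif false 3 tphi.
pose rr := rad + 3 * (2 * pi).
have rr0 : 0 < rr by rewrite /rr; lra.
have ap := area_gt0 R.
exists ((K1 + K2) * (2 * pi) ^+ 3 * (rr ^+ 2 * area R)).
  apply: mulr_ge0; last by apply: mulr_ge0; [exact: sqr_ge0|exact: ltW].
  by apply: mulr_ge0; [exact: addr_ge0|apply: exprn_ge0; lra].
move=> theta t1; have T0 : 0 < enorm theta by lra.
(* The half period is taken along a coordinate axis, so that the difference is one of those bounded
   by [test_iter_dif]. *)
have [b hb] : exists b, enorm theta / 2 <= `|if b then theta.1 else theta.2|.
  have h := enorm_le theta; have [h1|h1] := leP (enorm theta / 2) `|theta.1|; first by exists true.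
  by exists false; lra.
set u := (if b then _ else _) in hb.
have un0 : u != 0 by rewrite -normr_gt0; lra.
pose t := pi / u.
have tle : `|t| <= 2 * pi / enorm theta.
  rewrite /t normrM normfV (gtr0_norm p0) ler_pdivrMr ?normr_gt0// mulrAC ler_pdivlMr//; nra.
have tle1 : `|t| <= 2 * pi.
  by apply: le_trans tle _; rewrite ler_pdivrMr//; nra.
have hpi : dotp theta (t *: dir R b) = pi.
  by rewrite dotp_dir -/u /t divfK.
set h := t *: dir R b in hpi; have eh : enorm h = `|t| by exact: enorm_dir.
pose g := iter 3 (dif h) phi.
(* Each of the three differences contributes a factor -2. *)
have e8 : cosft g theta = - 8 * cosft phi theta.
  by rewrite /g /= !cosft_dif//; try (by do ?apply: intg_dif); ring.
have gK x : `|g x| <= (K1 + K2) * `|t| ^+ 3.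
  rewrite /g /h; case: (b); [have := H1 x t|have := H2 x t] => hh; apply: le_trans hh _;
  by rewrite ler_wpM2r ?exprn_ge0// ?lerDl ?lerDr.
have gS x : g x != 0 -> enorm x < rr.
  move=> /(iter_dif_supp Hr) hh; apply: lt_le_trans hh _; rewrite /rr eh lerD2l.
  by rewrite ler_wpM2l.
have Ig : intg2 g by rewrite /g /=; do 3 apply: intg_dif.
have bg : `|cosft g theta| <= (K1 + K2) * `|t| ^+ 3 * (rr ^+ 2 * area R).
  rewrite -area_ball// -Rint2Z; last exact: int2_ball.
  apply: Rint2_norm; [exact: intg_cosl|apply: intgZ; exact: int2_ball|move=> x].
  rewrite normrM; apply: (@le_trans _ _ `|g x|); first by rewrite ler_piMl// cos_max.
  have [->|gx] := eqVneq (g x) 0.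
    by rewrite normr0 !mulr_ge0 ?addr_ge0 ?exprn_ge0.
  by rewrite indic_ball (gS x gx) mulr1.
have t3 : `|t| ^+ 3 <= (2 * pi) ^+ 3 * enorm theta `^ (- 3).
  rewrite powR_invn ?enorm_ge0// -expr_div_n.
  by apply: lerXn2r; rewrite ?nnegrE// divr_ge0 ?(ltW T0)//; lra.
have A0 : 0 <= rr ^+ 2 * area R by rewrite mulr_ge0 ?sqr_ge0 ?(ltW ap).
have K0 : 0 <= K1 + K2 by exact: addr_ge0.
have h2 : (K1 + K2) * `|t| ^+ 3 * (rr ^+ 2 * area R) <=
   (K1 + K2) * (2 * pi) ^+ 3 * (rr ^+ 2 * area R) * enorm theta `^ (- 3).
  have -> : (K1 + K2) * (2 * pi) ^+ 3 * (rr ^+ 2 * area R) * enorm theta `^ (- 3) =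
    (K1 + K2) * ((2 * pi) ^+ 3 * enorm theta `^ (- 3)) * (rr ^+ 2 * area R) by ring.
  by rewrite ler_wpM2r// ler_wpM2l.
have := le_trans bg h2; rewrite e8 normrM normrN (ger0_norm (x := 8))//.
by have := normr_ge0 (cosft phi theta); lra.
Qed.

Lemma cosft_le f theta : intg2 f -> `|cosft f theta| <= \int[@leb2 R]_x `|f x|.
Proof.
move=> If; apply: Rint2_norm; [exact: intg_cosl|exact: intg_norm|move=> x].
by rewrite normrM ler_piMl// cos_max.
Qed.

Lemma intg_cosft phi : is_test_function phi -> intg2 (cosft phi).
Proof.
move=> tphi; have cphi := test_continuous tphi; have If := intg_cs cphi tphi.2.
have [C C0 HC] := cosft_decay tphi.
set A := \int[@leb2 R]_x `|phi x|; have A0 : 0 <= A by exact: Rint2_ge0.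
apply: (@int2_le _ _ (fun y => A * \1_(eball 1) y + C * (\1_(~` eball 1) y * enorm y `^ (- 3)))).
- by apply: continuous_measurable2; apply: continuous_cosft => //; exact: tphi.2.
- by apply: intgD; apply: intgZ; [exact: int2_ball|apply: intg_far; lra].
- move=> y; rewrite indic_ball indicE; case: (ltP (enorm y) 1) => h.
    rewrite mulr1; apply: ler_wpDr; last exact: cosft_le.
    by rewrite !mulr_ge0 ?powR_ge0.
  rewrite mulr0 add0r mem_set /= ?mul1r; first exact: HC.
  by rewrite /eball /= => hh; lra.
Qed.

(** A product of functions of one variable, so that its transform is a product of Poisson kernels
    given by [poisson_line]. *)
Definition window eps theta : R := expabs eps theta.1 * expabs eps theta.2.

Lemma window01 eps theta : 0 < eps -> 0 <= window eps theta <= 1.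
Proof.
have H t : 0 < eps -> expabs eps t <= 1.
  by move=> e0; rewrite -(expR0 R) /expabs ler_expR oppr_le0 mulr_ge0// ltW.
move=> e0; rewrite /window mulr_ge0 ?(ltW (expabs_gt0 _ _))//=.
by rewrite mulr_ile1 ?(ltW (expabs_gt0 _ _))// H.
Qed.

Lemma intg_window eps : 0 < eps -> intg2 (window eps).
Proof. by move=> e0; have [] := Rint_prod (intg_expabs e0) (intg_expabs e0). Qed.

Definition poisson eps (t : R) : R := 2 * eps / (eps ^+ 2 + t ^+ 2).

Lemma cosft_window eps x : 0 < eps ->
  cosft (window eps) x = poisson eps x.1 * poisson eps x.2.
Proof.
move=> e0.
pose F (z : mR * mR) : R := cos (dotp x z) * window eps z.
have IF := intg_cosl x (intg_window e0).
have mF : measurable_fun setT F := int2_meas IF.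
have dF (s t : mR) : `|F (s, t)| <= expabs eps s * expabs eps t.
  rewrite /F normrM (ger0_norm (x := window _ _)); last first.
    by rewrite mulr_ge0 ?(ltW (expabs_gt0 _ _)).
  by rewrite ler_piMl ?cos_max// mulr_ge0 ?(ltW (expabs_gt0 _ _)).
have [_ _ E _] := Rint_fubini mF (intg_expabs e0) (intg_expabs e0) dF.
rewrite /cosft; apply: (etrans (esym E)).
have inner s : \int[lam]_t F (s, t) = expabs eps s * (poisson eps x.2 * cos (x.1 * s)).
  rewrite -(poisson_line x.2 (x.1 * s) e0) -RintegralZl//; last exact: intg_cos_expabs.
  by apply: eq_Rintegral => t _; rewrite /F /dotp /window /= [x.1 * s + _]addrC; ring.
under eq_Rintegral do rewrite inner.
transitivity (\int[lam]_s (poisson eps x.2 * (cos (x.1 * s + 0) * expabs eps s))).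
  by apply: eq_Rintegral => s _; rewrite addr0; ring.
rewrite RintegralZl//; last exact: intg_cos_expabs.
by rewrite poisson_line// cos0 mulr1 mulrC.
Qed.

Lemma cosft_swap eps phi : 0 < eps -> continuous phi -> compactly_supported phi ->
  \int[@leb2 R]_theta (window eps theta * cosft phi theta) =
  \int[@leb2 R]_x (phi x * cosft (window eps) x).
Proof.
move=> e0 cphi sphi; have If := intg_cs cphi sphi; have Iw := intg_window e0.
pose F theta x : R := cos (dotp theta x) * (window eps theta * phi x).
have mF : meas4 F.
  have L (a b : R * R -> R) : continuous a -> continuous b -> meas4 (fun x y => a x * b y).
    move=> ca cb; apply: meas4M; [apply: meas4_l|apply: meas4_r]; exact: continuous_measurable2.
  have md := meas4D (L _ _ (@continuous_fstR R) (@continuous_fstR R))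
    (L _ _ (@continuous_sndR R) (@continuous_sndR R)).
  apply: meas4M; first exact: (measurableT_comp (continuous_measurable_fun (@continuous_cos R)) md).
  by apply: meas4M; [apply: meas4_l|apply: meas4_r]; exact: int2_meas.
have dF theta x : `|F theta x| <= window eps theta * `|phi x|.
  have /andP[w0 _] := window01 theta e0.
  rewrite /F normrM; apply: (@le_trans _ _ (1 * `|window eps theta * phi x|)).
    by rewrite ler_wpM2r// cos_max.
  by rewrite mul1r normrM (ger0_norm w0).
have [_ _ E] := Rint2_fubini mF Iw (intg_norm If) dF.
transitivity (\int[@leb2 R]_theta \int[@leb2 R]_x F theta x).
  apply: Rint2_eq => theta; rewrite /cosft -Rint2Z; last exact: intg_cosl.
  by apply: Rint2_eq => x; rewrite /F mulrCA.
rewrite E; apply: Rint2_eq => x; rewrite /cosft -Rint2Z; last exact: intg_cosl.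
by apply: Rint2_eq => theta; rewrite /F dotpC; ring.
Qed.

(* Multiplication by [window] is, on the other side, a Poisson kernel, an approximate identity. *)
Lemma fourier_inversion phi : is_test_function phi ->
  \int[@leb2 R]_theta cosft phi theta = (2 * pi) ^+ 2 * phi 0.
Proof.
move=> tphi; have cphi := test_continuous tphi; have If := intg_cs cphi tphi.2.
have Ic := intg_cosft tphi.
pose ep (n : nat) : R := n.+1%:R^-1.
have ep0 n : 0 < ep n by rewrite invr_gt0.
have epc : ep n @[n --> \oo] --> (0 : R).
  by apply/cvgn_eps => e e0; exists (Num.truncn e^-1) => n Nn; rewrite subr0 gtr0_norm//
    /ep -[leRHS]invrK lef_pV2 ?posrE ?invr_gt0// (le_trans (ltW (truncnS_gt _)))// ler_nat.
have c1 : \int[@leb2 R]_theta (window (ep n) theta * cosft phi theta) @[n --> \oo] -->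
    \int[@leb2 R]_theta cosft phi theta.
  have H1 theta : window (ep n) theta * cosft phi theta @[n --> \oo] --> cosft phi theta.
    rewrite -[X in _ --> X]mul1r; apply: cvgMl.
    have E t : expabs (ep n) t @[n --> \oo] --> (1 : R).
      apply/cvgn_eps => e e0; have t1 : 0 < `|t| + 1 by rewrite ltr_wpDl.
      have [N HN] := (cvgn_eps _ _).1 epc (e / (`|t| + 1)) (divr_gt0 e0 t1).
      exists N => n Nn; have := HN n Nn; rewrite subr0 (gtr0_norm (ep0 n)) ler_pdivlMr// => hn.
      have et : 0 <= ep n * `|t| by rewrite mulr_ge0// ltW.
      have h1 := expR_ge1Dx (- (ep n * `|t|)).
      have h2 : expabs (ep n) t <= 1 by rewrite -(expR0 R) /expabs ler_expR oppr_le0.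
      rewrite distrC ger0_norm ?subr_ge0// /expabs.
      have h3 := ep0 n; move: h1 hn; rewrite mulrDr mulr1; lra.
    by rewrite -[X in _ --> X]mul1r; apply: cvgM; exact: E.
  have mw n : meas2 (fun theta => window (ep n) theta * cosft phi theta).
    by apply: meas2M; [exact: int2_meas (intg_window (ep0 n))|exact: int2_meas Ic].
  have H2 n theta : `|window (ep n) theta * cosft phi theta| <= `|cosft phi theta|.
    by have /andP[w0 w1] := window01 theta (ep0 n); rewrite normrM (ger0_norm w0) ler_piMl.
  by have [] := Rint2_dct mw H1 (intg_norm Ic) H2.
pose q x : R := (1 + x.1 ^+ 2)^-1 * (1 + x.2 ^+ 2)^-1.
have [Ic1 Ec1] := Rint_cauchy R.
have [Iq Eq] : intg2 q /\ \int[@leb2 R]_x q x = pi * pi.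
  by have [h1 h2] := Rint_prod Ic1 Ic1; split => //; apply: etrans h2 _; rewrite Ec1.
have q0 x : 0 <= q x by rewrite mulr_ge0// invr_ge0 addr_ge0// sqr_ge0.
have [K K0 HK] := cs_bounded cphi tphi.2.
(* The substitution of [ep n * x] for [x] turns the Poisson kernels into the fixed density 4 q, of
   total mass 4 pi^2, and dominated convergence applies. *)
have E2 n : \int[@leb2 R]_theta (window (ep n) theta * cosft phi theta) =
    \int[@leb2 R]_x (4 * (phi (ep n * x.1, ep n * x.2) * q x)).
  rewrite cosft_swap//; last exact: tphi.2.
  have en0 : ep n != 0 by rewrite gt_eqF.
  have pn0 t : ep n ^+ 2 + t ^+ 2 != 0.
    by rewrite gt_eqF// ltr_wpDr ?sqr_ge0// exprn_gt0.
  have mP : measurable_fun setT (poisson (ep n) : mR -> mR).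
    apply: continuous_measurable_fun => t; apply: cvgMr; apply: cvgV; first exact: pn0.
    by apply: cvgD; [exact: cvg_cst|exact: exprn_continuous].
  have P0 t : 0 <= poisson (ep n) t.
    by rewrite divr_ge0 ?mulr_ge0 ?(ltW (ep0 n))// addr_ge0 ?sqr_ge0.
  have P1 t : poisson (ep n) t <= 2 / ep n.
    rewrite ler_pdivrMr; last by rewrite lt_neqAle eq_sym pn0 addr_ge0 ?sqr_ge0.
    rewrite mulrAC ler_pdivlMr// -mulrA -expr2 ler_wpM2l// lerDl sqr_ge0//.
  have I1 : intg2 (fun x => phi x * (poisson (ep n) x.1 * poisson (ep n) x.2)).
    apply: (@int2_le _ _ (fun x => (2 / ep n * (2 / ep n)) * `|phi x|)).
    - apply: meas2M; first exact: int2_meas.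
      apply: meas2M; first exact: (measurableT_comp mP measurable_fst).
      exact: (measurableT_comp mP measurable_snd).
    - by apply: intgZ; exact: intg_norm.
    - move=> x; rewrite normrM [X in X <= _]mulrC (ger0_norm (mulr_ge0 (P0 _) (P0 _))) ler_wpM2r// ler_pM//.
  rewrite (@Rint2_eq _ _ (fun x => phi x * (poisson (ep n) x.1 * poisson (ep n) x.2))); last first.
    by move=> x; rewrite cosft_window.
  rewrite (Rint_aff2 en0 0 I1) (gtr0_norm (ep0 n)).
  apply: (etrans (esym (Rint2Z _ (intg_aff2 en0 0 I1)))); apply: Rint2_eq => x.
  rewrite /= /aff1 !addr0 /aff2 /aff1 /= !addr0 /poisson /q.
  have q1 : 1 + x.1 ^+ 2 != 0 by rewrite gt_eqF// ltr_wpDr ?sqr_ge0.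
  have q2 : 1 + x.2 ^+ 2 != 0 by rewrite gt_eqF// ltr_wpDr ?sqr_ge0.
  have E1 (u t : R) : u != 0 -> 1 + t ^+ 2 != 0 ->
      2 * u / (u ^+ 2 + (u * t) ^+ 2) = 2 / u * (1 + t ^+ 2)^-1.
    move=> u0 t0; have -> : u ^+ 2 + (u * t) ^+ 2 = u ^+ 2 * (1 + t ^+ 2) by ring.
    by field; rewrite ?u0 ?t0.
  rewrite !E1//; move: (phi _) => v; move: (ep n) en0 => u u0.
  by field; rewrite ?u0 ?q1 ?q2.
have c2 : \int[@leb2 R]_x (4 * (phi (ep n * x.1, ep n * x.2) * q x)) @[n --> \oo] -->
    \int[@leb2 R]_x (4 * (phi 0 * q x)).
  have mm n : meas2 (fun x => 4 * (phi (ep n * x.1, ep n * x.2) * q x)).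
    apply: meas2M; first exact: meas2_cst.
    apply: meas2M; last exact: int2_meas Iq.
    have := measurableT_comp (continuous_measurable2 cphi) (measurable_aff2 (ep n) 0).
    by apply: eq_measurable_fun => x _ /=; rewrite /aff2 /aff1 !addr0.
  have H1 x : 4 * (phi (ep n * x.1, ep n * x.2) * q x) @[n --> \oo] --> 4 * (phi 0 * q x).
    apply: cvgMr; apply: cvgMl; apply/cvgn_eps => e e0.
    have [d d0 Hd] := (continuous_eps phi).1 cphi 0 e e0.
    have x1 : 0 < enorm x + 1 by rewrite ltr_wpDl ?enorm_ge0.
    have d2 : 0 < d / 2 by rewrite divr_gt0.
    have [N HN] := (cvgn_eps _ _).1 epc (d / 2 / (enorm x + 1)) (divr_gt0 d2 x1).
    exists N => n Nn; apply: Hd; rewrite subr0 enorm_scale (gtr0_norm (ep0 n)).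
    have := HN n Nn; rewrite subr0 (gtr0_norm (ep0 n)) ler_pdivlMr// mulrDr mulr1.
    by have := ep0 n; lra.
  have H2 n x : `|4 * (phi (ep n * x.1, ep n * x.2) * q x)| <= (4 * K) * q x.
    rewrite normrM normrM (ger0_norm (q0 x)) (ger0_norm (x := 4))// -mulrA ler_wpM2l//.
    by rewrite ler_wpM2r.
  by have [] := Rint2_dct mm H1 (intgZ (4 * K) Iq) H2.
have E3 : \int[@leb2 R]_x (4 * (phi 0 * q x)) = (2 * pi) ^+ 2 * phi 0.
  by rewrite Rint2Z ?Rint2Z// ?Eq; [ring|exact: intgZ].
have c3 : \int[@leb2 R]_x (4 * (phi (ep n * x.1, ep n * x.2) * q x)) @[n --> \oo] -->
    \int[@leb2 R]_theta cosft phi theta.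
  rewrite (_ : (fun n => \int[@leb2 R]_x (4 * (phi (ep n * x.1, ep n * x.2) * q x))) =
    (fun n => \int[@leb2 R]_theta (window (ep n) theta * cosft phi theta))); first exact: c1.
  by apply/funext => n; rewrite E2.
by rewrite -E3; exact: (cvg_unique _ c3 c2).
Qed.

End Inversion.

(** * The equation satisfied by the obstacle *)

Section Translation.
Variable R : realType.
Implicit Types (f phi : R * R -> R) (x y p : R * R).

Lemma Ck_shift k f y : is_Ck k f -> is_Ck k (fun x => f (x + y)).
Proof.
elim: k f => [|k IH] f; first by move=> cf; exact: continuous_addl.
move=> [cf df c1 c2].
have e x v : (fun s : R => s^-1 *: (((fun z => f (z + y) : R^o) \o shift x) (s *: v) - f (x + y))) =
   (fun s : R => s^-1 *: (((f : R * R -> R^o) \o shift (x + y)) (s *: v) - f (x + y))).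
  by apply/funext => s /=; rewrite addrA.
have D v : 'D_v ((fun z => f (z + y)) : R * R -> R^o) = fun x => 'D_v (f : R * R -> R^o) (x + y).
  by apply/funext => x; rewrite /derive e.
split; first exact: continuous_addl.
- move=> x; have [d1 d2] := df (x + y).
  by split; [rewrite /derivable e; exact: d1|rewrite /derivable e; exact: d2].
- by rewrite D; exact: (IH ('D_(e1 R) (f : R * R -> R^o) : R * R -> R)).
- by rewrite D; exact: (IH ('D_(e2 R) (f : R * R -> R^o) : R * R -> R)).
Qed.

Lemma test_shift f y : is_test_function f -> is_test_function (fun x => f (x + y)).
Proof.
move=> [Hk cf]; split; first by move=> k; exact: Ck_shift.
have [rad r0 H] := cs_box cf.
apply: (@cs_rad _ _ (rad + enorm y)) => x /H h.
have := enormB (x + y) y; rewrite addrK; lra.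
Qed.

Lemma leb2_pt p : leb2 [set p] = 0%E :> \bar R.
Proof.
have -> : [set p] = [set p.1] `*` [set p.2] by apply/seteqP; split=> [x ->|[a b] /= [-> ->]] //; case: p.
rewrite leb2X//.
have -> : lebesgue_measure [set p.1 : measurableTypeR R] = 0%E by exact: lebesgue_measure_set1.
by rewrite mul0e.
Qed.

Lemma measurable_pt p : measurable ([set p] : set (measurableTypeR R * measurableTypeR R)).
Proof.
have -> : [set p] = [set p.1] `*` [set p.2] by apply/seteqP; split=> [x ->|[a b] /= [-> ->]] //; case: p.
by apply: measurableX; exact: measurable_set1.
Qed.

(** Stands in for almost-everywhere reasoning: below, the exceptional set is a single point. *)
Lemma Rint2_off f g p : (forall x, x != p -> g x = f x) -> intg2 f ->
  intg2 g /\ \int[@leb2 R]_x g x = \int[@leb2 R]_x f x.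
Proof.
move=> fg If.
have e x : f x + (g p - f p) * \1_[set p] x = g x.
  rewrite indicE; have [->|xp] := eqVneq x p; first by rewrite mem_set// mulr1 addrC subrK.
  by rewrite memNset/= ?mulr0 ?addr0 ?fg//; apply/eqP.
have I1 : intg2 (\1_[set p] : R * R -> R).
  by apply: int2_indic; [exact: measurable_pt|rewrite leb2_pt].
split; first by apply: (int2_eq e); apply: intgD => //; exact: intgZ.
rewrite -(Rint2_eq e) Rint2D//; last exact: intgZ.
by rewrite Rint2Z// Rint_indicE ?leb2_pt ?mulr0 ?addr0//; exact: measurable_pt.
Qed.

End Translation.

(** * The potential kernel as a fundamental solution *)

Section PotentialEquation.
Variables (R : realType) (alpha r M : R).
Hypothesis alpha_gt1 : 1 < alpha.
Hypothesis alpha_lt2 : alpha < 2.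
Hypothesis M_gt1 : 1 < M.
Variable x0 : R * R.
Hypothesis x0_unit : enorm x0 = 1.
Local Notation c := (c_lim alpha r M).
Hypothesis c_gt0 : 0 < c.
Implicit Types (x y z theta : R * R) (phi : R * R -> R) (rad : R).
Local Notation psi1 := (jump_symbol alpha M).
Local Notation J := (jump_op alpha M).
Local Notation G_M := (G_M alpha r M x0).
Local Notation L_M := (L_M alpha r M).
Local Notation Phi := (inv_symbol alpha M).
Local Notation Eint := (green_trunc alpha M x0).

Lemma J_cst (a : R) x : J (fun=> a) x = 0.
Proof. by apply: Rint2_0 => y; rewrite /D2 (_ : a + a - 2 * a = 0) ?mulr0//; ring. Qed.

(** Self-adjointness against the constant 1, which the operator annihilates. The vanishing integral
    is what eliminates [x0] from the equation. *)
Lemma test_J phi : is_test_function phi ->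
  intg2 (J phi) /\ \int[@leb2 R]_x J phi x = 0.
Proof.
move=> tp; have [K K0 HK] := test_dif2 tp.
have [|I1 _ E] := @J_selfadj _ _ M alpha_gt1 alpha_lt2 (fun=> 1) phi 0 K (fun x => cvg_cst _)
  (test_continuous tp) tp.2 _ HK.
  by move=> x y; rewrite /D2 mul0r (_ : 1 + 1 - 2 * 1 = 0) ?normr0//; ring.
split; first by apply: int2_eq I1 => x; rewrite mul1r.
rewrite -[RHS](_ : \int[@leb2 R]_x (phi x * J (fun=> 1) x) = 0); last first.
  by apply: Rint2_0 => x; rewrite J_cst mulr0.
by rewrite -E; apply: Rint2_eq => x; rewrite mul1r.
Qed.

Lemma test_J_cos phi theta : is_test_function phi ->
  \int[@leb2 R]_x (cos (dotp theta x) * J phi x) = - 2 * psi1 theta * cosft phi theta.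
Proof.
move=> tp; have [K K0 HK] := test_dif2 tp.
have [_ I2 E] := @J_selfadj _ _ M alpha_gt1 alpha_lt2 (fun x => cos (dotp theta x)) phi _ K
  (continuous_cosdot (theta := theta)) (test_continuous tp) tp.2 (D2_cosdot_le theta) HK.
rewrite E /cosft -Rint2Z; last exact: intg_cosl (intg_cs (test_continuous tp) tp.2).
apply: Rint2_eq => x. rewrite (J_cosdot M alpha_gt1 alpha_lt2); ring.
Qed.

Lemma test_J_bound phi : is_test_function phi -> exists2 A : R, 0 < A & exists2 B : R, 0 <= B &
  forall x, `|J phi x| <= B * \1_(eball A) x.
Proof.
move=> tp; have [K K0 HK] := test_dif2 tp; have [rad r0 Hr] := cs_box tp.2.
have m1 := M_gt1; have I0 := intg_jdom M alpha_gt1 alpha_lt2.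
exists (rad + M); first by lra.
exists (K * \int[@leb2 R]_y jdom alpha M y).
  by rewrite mulr_ge0// Rint2_ge0// => y; exact: jdom_ge0.
move=> x; rewrite indic_ball; case: ltP => xr; last first.
  rewrite mulr0 /jump_op Rint2_0 ?normr0// => y.
  have [yM|yM] := leP M (enorm y); first by rewrite jker_out// mul0r.
  have z u : rad <= enorm u -> phi u = 0.
    by move=> h; apply/eqP/negPn/negP => /Hr; rewrite ltNge h.
  have h1 := enorm_geB x (- y); rewrite opprK enormN in h1.
  have h2 := enorm_geB x y; have e0 := enorm_ge0 y.
  by rewrite /D2 !z ?mulr0 ?addr0 ?subr0 ?mulr0//; lra.
rewrite mulr1 -Rint2Z//; apply: Rint2_norm; last 1 first.
- move=> y; rewrite -(jker_sqr M alpha_gt1) normrM (ger0_norm (jker_ge0 _ _ _)) mulrCA.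
  by rewrite ler_wpM2l ?jker_ge0// HK.
- apply: (@intg_jker_D2 _ _ _ alpha_gt1 alpha_lt2 _ K) => [|y _]; last exact: HK.
  exact: test_continuous.
- exact: intgZ.
Qed.

Lemma J_shift phi x y : J (fun z => phi (z + y)) x = J phi (x + y).
Proof.
by apply: Rint2_eq => z; rewrite /D2 ![_ + _ + y]addrAC.
Qed.

(* At [0], where the defining limit of [G_M] does not exist, the value is set to 0; this does not
   affect integrals. *)
Definition green x : R := (x != 0)%:R * G_M x.

Lemma Green_lim x :
  (x != 0)%:R * (((2 * pi) ^+ 2)^-1 * (c^-1 * Eint n.+1%:R x)) @[n --> \oo] --> green x.
Proof.
rewrite /green; have [->|x_n] := eqVneq x 0.
  rewrite mul0r; rewrite (_ : (fun n => _) = (fun=> 0)); first exact: cvg_cst.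
  by apply/funext => n; rewrite mul0r.
apply: cvgMr; exact: (G_M_lim alpha_gt1 alpha_lt2 M_gt1 x0_unit).
Qed.

(** The majorant of order 1 + 1/|x| is integrable on balls and independent of the truncation
    radius. *)
Lemma Green_approx (A : R) : 0 <= A -> exists2 g : R * R -> R, intg2 g & forall n x,
  `|\1_(eball A) x * ((x != 0)%:R * (((2 * pi) ^+ 2)^-1 * (c^-1 * Eint n.+1%:R x)))| <= g x.
Proof.
move=> A0; have [K K0 HK] := Eint_bound alpha_gt1 alpha_lt2 M_gt1 x0_unit A0.
have q0 : 0 <= ((2 * pi) ^+ 2)^-1 * c^-1 by rewrite mulr_ge0 ?invr_ge0 ?sqr_ge0// ltW.
exists (fun x => ((2 * pi) ^+ 2)^-1 * c^-1 * K * (\1_(eball A) x + \1_(eball A) x * enorm x `^ (-1))).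
  apply: intgZ; apply: intgD; first exact: int2_ball.
  by apply: intg_near; lra.
move=> n x; rewrite indic_ball.
case: ltP => xA; last by rewrite !mul0r normr0 addr0 mulr0.
have [->|x_n] := eqVneq x 0.
  by rewrite /= mul0r mulr0 normr0 mulr_ge0 ?(mulr_ge0 q0 K0)// addr_ge0 ?ler0n// mulr_ge0 ?ler0n// powR_ge0.
rewrite !mul1r mulrA normrM (ger0_norm q0) -[X in _ <= X]mulrA ler_wpM2l// powR_inv1 ?enorm_ge0//.
by apply: HK => //; exact: ltW.
Qed.

Lemma intg_Eint_ball rad A (a : R * R -> R) : 0 <= A -> intg2 a -> (forall x, A <= enorm x -> a x = 0) ->
  intg2 (fun x => a x * Eint rad x) /\
  \int[@leb2 R]_x (a x * Eint rad x) =
  \int[@leb2 R]_theta (\1_(eball rad) theta * \int[@leb2 R]_x (a x * Eker alpha M x0 theta x)).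
Proof.
move=> A0 Ia az.
have bE theta x : `|a x * Eker alpha M x0 theta x| <= (ellipticity R)^-1 * (A ^+ 2 + 3) * `|a x|.
  rewrite normrM; have [xA|xA] := leP A (enorm x); first by rewrite (az x xA) normr0 mul0r mulr0.
  rewrite [X in X <= _]mulrC ler_wpM2r//; apply: le_trans (Eker_le alpha_gt1 alpha_lt2 M_gt1 x0_unit _ _) _.
  have := kap_gt0 R; rewrite -invr_gt0 => k0; rewrite ler_wpM2l ?(ltW k0)// lerD2r ler_sqr ?nnegrE ?enorm_ge0//.
  exact: ltW.
pose F theta x : R := \1_(eball rad) theta * (a x * Eker alpha M x0 theta x).
have mF : meas4 F.
  apply: meas4M; first by apply: meas4_l; exact: meas2_ball.
  apply: meas4M; first by apply: meas4_r; exact: int2_meas.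
  exact: Eker_meas4.
have Ig : intg2 (fun theta => (ellipticity R)^-1 * (A ^+ 2 + 3) * \1_(eball rad) theta).
  by apply: intgZ; exact: int2_ball.
have bF theta x : `|F theta x| <= (ellipticity R)^-1 * (A ^+ 2 + 3) * \1_(eball rad) theta * `|a x|.
  rewrite /F normrM (ger0_norm (x := \1_(eball rad) theta)) ?indic_ball ?ler0n//.
  by rewrite [X in _ <= X]mulrAC [X in _ <= X]mulrC ler_wpM2l ?ler0n.
have [I1 I2 E] := Rint2_fubini mF Ig (intg_norm Ia) bF.
have e x : \int[@leb2 R]_theta F theta x = a x * Eint rad x.
  rewrite /green_trunc -Rint2Z; last exact: (intg_Eker alpha_gt1 alpha_lt2 M_gt1 x0_unit).
  by apply: Rint2_eq => theta; rewrite /F; ring.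
split; first exact: int2_eq I2.
have IE theta : intg2 (fun x => a x * Eker alpha M x0 theta x).
  apply: (@int2_le _ _ (fun x => (ellipticity R)^-1 * (A ^+ 2 + 3) * `|a x|)).
  - apply: meas2M; first exact: int2_meas.
    by apply: (@meas4_sectl _ (Eker alpha M x0) theta); exact: Eker_meas4.
  - by apply: intgZ; exact: intg_norm.
  - exact: bE.
transitivity (\int[@leb2 R]_x \int[@leb2 R]_theta F theta x).
  by apply: Rint2_eq => x; rewrite e.
apply: etrans (esym E) _; apply: Rint2_eq => theta.
exact: (Rint2Z (\1_(eball rad) theta) (IE theta)).
Qed.

(** Integrals against the kernel are limits of integrals against its truncations, by dominated
    convergence; for the truncations the order of integration can be exchanged. *)
Lemma Green_pairing (A B : R) (a : R * R -> R) : 0 <= A -> 0 <= B -> intg2 a ->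
  (forall x, `|a x| <= B * \1_(eball A) x) ->
  intg2 (fun x => a x * green x) /\
  ((2 * pi) ^+ 2)^-1 * c^-1 * \int[@leb2 R]_x (a x * Eint n.+1%:R x) @[n --> \oo] -->
    \int[@leb2 R]_x (a x * green x).
Proof.
move=> A0 B0 Ia Ha.
have az x : A <= enorm x -> a x = 0.
  move=> xA; have := Ha x; rewrite indic_ball ltNge xA mulr0 normr_le0; exact: eqP.
have [g Ig Hg] := Green_approx A0.
pose q : R := ((2 * pi) ^+ 2)^-1 * c^-1.
pose f_ n x : R := a x * ((x != 0)%:R * (((2 * pi) ^+ 2)^-1 * (c^-1 * Eint n.+1%:R x))).
have fE n x : x != 0 -> f_ n x = q * (a x * Eint n.+1%:R x).
  by move=> xn; rewrite /f_ xn mul1r /q; ring.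
have fI n := Rint2_off (fE n) (intgZ q (intg_Eint_ball n.+1%:R A0 Ia az).1).
have [I1 C1] : intg2 (fun x => a x * green x) /\
   \int[@leb2 R]_x f_ n x @[n --> \oo] --> \int[@leb2 R]_x (a x * green x).
  apply: (@Rint2_dct _ f_ _ (fun x => B * g x)).
  - by move=> n; exact: int2_meas (fI n).1.
  - by move=> x; apply: cvgMr; exact: Green_lim.
  - exact: intgZ.
  - move=> n x; apply: le_trans (ler_wpM2l B0 (Hg n x)).
    suff h t : `|a x * t| <= B * `|\1_(eball A) x * t| by exact: h.
    rewrite !normrM mulrA ler_wpM2r//.
    apply: le_trans (Ha x) _; rewrite (ger0_norm (x := \1_(eball A) x))//.
split=> //; rewrite (_ : (fun n => _) = (fun n => \int[@leb2 R]_x f_ n x)) //.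
apply/funext => n; rewrite (fI n).2 Rint2Z//.
exact: (intg_Eint_ball n.+1%:R A0 Ia az).1.
Qed.

Lemma intg_Green_ball A : 0 <= A -> intg2 (fun x => \1_(eball A) x * green x).
Proof.
move=> A0; apply: (Green_pairing A0 ler01 (int2_ball A) _).1.
by move=> x; rewrite mul1r ger0_norm// indic_ball ler0n.
Qed.

Lemma intg_J_Green phi x : is_test_function phi -> intg2 (fun z => J phi (x + z) * green z).
Proof.
move=> tp; have [A A0 [B B0 H]] := test_J_bound (test_shift x tp).
have e z : J (fun z => phi (z + x)) z = J phi (x + z) by rewrite J_shift addrC.
have [I1 _] := test_J (test_shift x tp).
apply: (int2_eq (f := fun z => J (fun z => phi (z + x)) z * green z)); first by move=> z; rewrite e.
exact: (Green_pairing (ltW A0) B0 I1 H).1.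
Qed.

(** On the Fourier side the operator multiplies by -2 [psi1], which cancels the inverse symbol. The
    integral of [cosft phi] over a growing ball remains, and Fourier inversion gives its limit. *)
Lemma Green_fundamental0 phi : is_test_function phi ->
  \int[@leb2 R]_x (J phi x * green x) = - (2 / c) * phi 0.
Proof.
move=> tp; have [A A0 [B B0 H]] := test_J_bound tp; have [I1 J0] := test_J tp.
have [_ C1] := Green_pairing (ltW A0) B0 I1 H.
have az x : A <= enorm x -> J phi x = 0.
  move=> xA; have := H x; rewrite indic_ball ltNge xA mulr0 normr_le0; exact: eqP.
have p0 : (2 * pi) ^+ 2 != 0 :> R by rewrite sqrf_eq0 mulf_neq0// gt_eqF// pi_gt0.
have c0 : c != 0 by rewrite gt_eqF.
have Ic := intg_cosft tp.
pose Fn (n : nat) : R := \int[@leb2 R]_theta (\1_(eball n.+1%:R) theta * cosft phi theta).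
have EE n : \int[@leb2 R]_x (J phi x * Eint n.+1%:R x) = -2 * Fn n.
  rewrite (intg_Eint_ball n.+1%:R (ltW A0) I1 az).2.
  have Ib : intg2 (fun theta => \1_(eball n.+1%:R) theta * cosft phi theta).
    apply: (int2_le _ (intg_norm Ic)); first by apply: meas2M; [exact: meas2_ball|exact: int2_meas].
    by move=> t; rewrite normrM ler_piMl// ger0_norm indic_ball ?ler0n// lern1 leq_b1.
  (* The cancellation fails at [theta = 0], where the symbol vanishes; a single point is
     discarded. *)
  rewrite /Fn -Rint2Z//; apply: (Rint2_off (p := 0) _ (intgZ (-2) Ib)).2 => theta tn.
  have -> : \int[@leb2 R]_x (J phi x * Eker alpha M x0 theta x) =
    Phi theta * (\int[@leb2 R]_x (cos (dotp theta x) * J phi x)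
      - cos (dotp theta x0) * \int[@leb2 R]_x J phi x).
    rewrite -(Rint2Z (cos _) I1) -Rint2B; [|exact: intg_cosl|exact: intgZ].
    rewrite -Rint2Z; last by apply: intgB; [exact: intg_cosl|exact: intgZ].
    by apply: Rint2_eq => x; rewrite /Eker; ring.
  rewrite J0 mulr0 subr0 (test_J_cos _ tp) /inv_symbol.
  have pn : psi1 theta != 0 by rewrite gt_eqF// (psi1_gt0 alpha_gt1 alpha_lt2 M_gt1).
  move: (\1_(eball _) theta) => u; field; exact: pn.
have Fc : Fn n @[n --> \oo] --> (2 * pi) ^+ 2 * phi 0.
  rewrite -(fourier_inversion tp).
  apply: (Rint2_dct _ _ (intg_norm Ic) _).2 => [n|theta|n theta].
  - by apply: meas2M; [exact: meas2_ball|exact: int2_meas].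
  - apply/cvgn_eps => e e0; exists (Num.truncn (enorm theta)).+1 => n Nn.
    rewrite indic_ball (_ : enorm theta < n.+1%:R) ?mul1r ?subrr ?normr0 ?ltW//.
    apply: lt_le_trans (truncnS_gt _) _; rewrite ler_nat; exact: leq_trans Nn _.
  - by rewrite normrM ler_piMl// ger0_norm indic_ball ?ler0n// lern1 leq_b1.
have C2 : ((2 * pi) ^+ 2)^-1 * c^-1 * \int[@leb2 R]_x (J phi x * Eint n.+1%:R x) @[n --> \oo] -->
   ((2 * pi) ^+ 2)^-1 * c^-1 * (-2 * ((2 * pi) ^+ 2 * phi 0)).
  rewrite (_ : (fun n => _) = (fun n => ((2 * pi) ^+ 2)^-1 * c^-1 * (-2 * Fn n))); last first.
    by apply/funext => n; rewrite EE.
  by apply: cvgMr; exact: cvgMr.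
rewrite (cvg_unique (@Rhausdorff R) C1 C2).
by move: ((2 * pi) ^+ 2) p0 => P p0; field; rewrite p0 c0.
Qed.

Lemma Green_fundamental phi y : is_test_function phi ->
  \int[@leb2 R]_z (J phi (y + z) * green z) = - (2 / c) * phi y.
Proof.
move=> tp; have := Green_fundamental0 (test_shift y tp); rewrite add0r => <-.
by apply: Rint2_eq => z; rewrite J_shift addrC.
Qed.

End PotentialEquation.

Lemma far_sub (R : realType) (x z : R * R) (a b : R) :
  a + b <= enorm z -> enorm x < a -> b <= enorm (x - z).
Proof. have := enormB x (x - z); rewrite opprB [x + _]addrC subrK; lra. Qed.

Lemma far_add (R : realType) (x z : R * R) (a b : R) :
  a + b <= enorm z -> enorm x < b -> a <= enorm (x + z).
Proof. have := enormB (x + z) x; rewrite [x + z]addrC addrK; lra. Qed.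

(** Fubini for a convolution with a kernel that is only locally integrable: on the supports of [h]
    and [rho] just the part of [g] in the ball of radius [A + rad] is seen, so [g] may be cut off
    there. *)
Lemma conv_swap (R : realType) (h g rho : R * R -> R) (A B rad K : R) :
  intg2 h -> 0 <= B -> (forall x, `|h x| <= B) -> (forall x, A <= enorm x -> h x = 0) ->
  intg2 rho -> 0 <= K -> (forall x, `|rho x| <= K) -> (forall x, rad <= enorm x -> rho x = 0) ->
  intg2 (fun z => \1_(eball (A + rad)) z * g z) ->
  (forall x, intg2 (fun z => rho (x - z) * g z)) -> (forall x, intg2 (fun z => h (x + z) * g z)) ->
  intg2 (fun x => h x * \int[@leb2 R]_z (rho (x - z) * g z)) /\
  \int[@leb2 R]_x (h x * \int[@leb2 R]_z (rho (x - z) * g z)) =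
  \int[@leb2 R]_x (rho x * \int[@leb2 R]_z (h (x + z) * g z)).
Proof.
set gb := fun z => _ * _; move=> Ih B0 Bh h0 Ir K0 Br r0 Ig Ip Iq.
have mr := int2_meas Ir; have mh := int2_meas Ih; have mg := int2_meas Ig.
have bM (b u v k : R) : `|v| <= k -> `|b * (u * v)| <= `|b| * (k * `|u|).
  by move=> vk; rewrite !normrM ler_wpM2l// mulrC ler_wpM2r.
have gE x : A + rad <= enorm x -> gb x = 0.
  by move=> xA; rewrite /gb indic_ball ltNge xA mul0r.
have gE' x : enorm x < A + rad -> gb x = g x.
  by move=> xA; rewrite /gb indic_ball xA mul1r.
move: (gb) Ig mg gE gE' => {}gb Ig mg gE gE'.
have [I1 _ E1] : [/\ intg2 (fun x => \int[@leb2 R]_z (h x * (gb z * rho (x - z)))),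
   intg2 (fun z => \int[@leb2 R]_x (h x * (gb z * rho (x - z)))) &
  \int[@leb2 R]_x \int[@leb2 R]_z (h x * (gb z * rho (x - z))) =
  \int[@leb2 R]_z \int[@leb2 R]_x (h x * (gb z * rho (x - z)))].
  apply: (Rint2_fubini _ (intg_norm Ih) (intgZ K (intg_norm Ig))); last by move=> x z; exact: bM.
  apply: meas4M; first exact: meas4_l.
  by apply: meas4M; [exact: meas4_r|exact: meas4_sub].
have [_ _ E2] : [/\ intg2 (fun x => \int[@leb2 R]_z (rho x * (gb z * h (x + z)))),
   intg2 (fun z => \int[@leb2 R]_x (rho x * (gb z * h (x + z)))) &
  \int[@leb2 R]_x \int[@leb2 R]_z (rho x * (gb z * h (x + z))) =
  \int[@leb2 R]_z \int[@leb2 R]_x (rho x * (gb z * h (x + z)))].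
  apply: (Rint2_fubini _ (intg_norm Ir) (intgZ B (intg_norm Ig))); last by move=> x z; exact: bM.
  apply: meas4M; first exact: meas4_l.
  by apply: meas4M; [exact: meas4_r|exact: meas4_add].
have e1 x : \int[@leb2 R]_z (h x * (gb z * rho (x - z))) = h x * \int[@leb2 R]_z (rho (x - z) * g z).
  rewrite -(Rint2Z (h x) (Ip x)); apply: Rint2_eq => z.
  have [zA|zA] := ltP (enorm z) (A + rad); first by rewrite (gE' z zA) [g z * _]mulrC.
  have [xA|xA] := leP A (enorm x); first by rewrite (h0 x xA) !mul0r.
  by rewrite (r0 (x - z) (far_sub zA xA)) mul0r !mulr0.
have e2 x : \int[@leb2 R]_z (rho x * (gb z * h (x + z))) = rho x * \int[@leb2 R]_z (h (x + z) * g z).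
  rewrite -(Rint2Z (rho x) (Iq x)); apply: Rint2_eq => z.
  have [zA|zA] := ltP (enorm z) (A + rad); first by rewrite (gE' z zA) [g z * _]mulrC.
  have [xr|xr] := leP rad (enorm x); first by rewrite (r0 x xr) !mul0r.
  by rewrite (h0 (x + z) (far_add zA xr)) mul0r !mulr0.
split; first exact: int2_eq e1 I1.
rewrite -(Rint2_eq e1) -(Rint2_eq e2) E1 E2.
apply: Rint2_eq => z.
have I3 : intg2 (fun x => h x * (gb z * rho (x - z))).
  apply: (int2_le _ (intgZ (`|gb z| * K) (intg_norm Ih))).
    apply: meas2M; first exact: mh.
    apply: meas2M; first exact: meas2_cst.
    exact: (meas2_shift (- z) mr).
  by move=> x; rewrite !normrM mulrC; exact: (ler_wpM2r (normr_ge0 _) (ler_wpM2l (normr_ge0 _) (Br _))).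
by rewrite -(Rint_shift z I3); apply: Rint2_eq => x; rewrite addrK mulrC -mulrA mulrCA.
Qed.

(** * The weak equation for the obstacle *)

Section Obstacle.
Variables (R : realType) (alpha r M : R).
Hypothesis alpha_gt1 : 1 < alpha.
Hypothesis alpha_lt2 : alpha < 2.
Hypothesis M_gt1 : 1 < M.
Variable x0 : R * R.
Hypothesis x0_unit : enorm x0 = 1.
Local Notation c := (c_lim alpha r M).
Hypothesis c_gt0 : 0 < c.
Variable rho : R * R -> R.
Variables (L : R).
Hypothesis rho_cont : continuous rho.
Hypothesis rho_supp : compactly_supported rho.
Hypothesis L_ge0 : 0 <= L.
Hypothesis rho_lip : forall x y, `|rho (x + y) - rho x| <= L * enorm y.
Implicit Types (x y z : R * R) (phi : R * R -> R).
Local Notation J := (jump_op alpha M).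
Local Notation Green := (green alpha r M x0).
Local Notation L_M := (L_M alpha r M).
Local Notation gamma := (obstacle alpha r M x0 rho).

(** The translation is put on [rho], so that continuity is inherited from the Lipschitz bound of
    [rho]. *)
Definition pot x : R := \int[@leb2 R]_z (rho (x - z) * Green z).

Lemma intg_pot x : intg2 (fun z => rho (x - z) * Green z).
Proof.
have [rad rad0 Hr] := cs_box rho_supp; have [K K0 HK] := cs_bounded rho_cont rho_supp.
have A0 : 0 <= enorm x + rad by rewrite addr_ge0 ?enorm_ge0// ltW.
have Ir := intg_cs rho_cont rho_supp.
apply: (Green_pairing alpha_gt1 alpha_lt2 M_gt1 x0_unit c_gt0 A0 K0 (intg_reflect x Ir) _).1 => z.
rewrite indic_ball; case: ltP => h; first by rewrite mulr1 HK.
rewrite mulr0 (_ : rho (x - z) = 0) ?normr0//; apply/eqP/negPn/negP => /Hr h2.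
have := enormB x (x - z); rewrite opprB addrC subrK; lra.
Qed.

Lemma potE x : \int[@leb2 R]_y (G_M alpha r M x0 (x - y) * rho y) = pot x.
Proof.
have h y : y != x -> G_M alpha r M x0 (x - y) * rho y = rho (x - (x - y)) * Green (x - y).
  by move=> yx; rewrite /green subr_eq0 eq_sym yx mul1r mulrC; congr (rho _ * _); apply: pair_eqR => /=; ring.
by rewrite (Rint2_off h (intg_reflect x (intg_pot x))).2 (Rint_reflect x (intg_pot x)).
Qed.

Lemma continuous_pot : continuous pot.
Proof.
have [rad rad0 Hr] := cs_box rho_supp.
apply/continuous_eps => x e e0.
pose A := enorm x + 1 + rad.
have A0 : 0 <= A by rewrite !addr_ge0 ?enorm_ge0// ltW.
have IA := intg_norm (intg_Green_ball alpha_gt1 alpha_lt2 M_gt1 x0_unit c_gt0 A0).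
set I := \int[@leb2 R]_z `|\1_(eball A) z * Green z|.
have I0 : 0 <= I by apply: Rint2_ge0.
have K0 : 0 < L * I + 1 by rewrite ltr_wpDl ?mulr_ge0.
exists (Num.min 1 (e / (L * I + 1))); first by rewrite lt_min ltr01 divr_gt0.
move=> y; rewrite lt_min => /andP[yx1 yx2].
rewrite /pot -Rint2B; [|exact: intg_pot|exact: intg_pot].
apply: (@le_trans _ _ (L * enorm (y - x) * I)); last first.
  rewrite ltr_pdivlMr// in yx2; have := enorm_ge0 (y - x).
  move: (enorm (y - x)) yx2 => t; nra.
rewrite /I -Rint2Z//; apply: Rint2_norm; [by apply: intgB; exact: intg_pot|exact: intgZ|].
move=> z; rewrite -mulrBl normrM [X in _ <= _ * X]normrM mulrA.
rewrite ler_wpM2r// indic_ball; case: ltP => h.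
  rewrite normr1 mulr1; have := rho_lip (x - z) (y - x).
  by rewrite (_ : x - z + (y - x) = y - z)//; apply: pair_eqR => /=; ring.
have rz u : enorm (u - x) < 1 -> rho (u - z) = 0.
  move=> ux; apply/eqP/negPn/negP => /Hr h2.
  have h3 := enormB u (u - z); have h4 := enormD (u - x) x.
  rewrite opprB addrC subrK in h3; rewrite subrK in h4.
  by move: h; rewrite /A; lra.
by rewrite !rz ?subrr ?normr0 ?mulr0// enorm0.
Qed.

Lemma continuous_obstacle : continuous gamma.
Proof.
move=> x; rewrite /obstacle.
rewrite (_ : (fun x => _) = (fun x => - (enorm x ^+ 2 / sigma2_M alpha r M) - pot x)); last first.
  by apply/funext => y; rewrite potE.
apply: cvgB; last exact: continuous_pot.
apply: cvgN; apply: cvgMl; rewrite expr2.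
rewrite (_ : (fun x => _) = (fun x => enorm x * enorm x)); last by apply/funext => y; rewrite expr2.
by apply: cvgM; exact: continuous_enorm.
Qed.

Lemma intg_rhoM phi : is_test_function phi -> intg2 (fun x => rho x * phi x).
Proof.
move=> tp; apply: intg_cs.
  by move=> x; apply: cvgM; [exact: rho_cont|exact: test_continuous].
have [rad rad0 Hr] := cs_box rho_supp.
by apply: (@cs_rad _ _ rad) => x; rewrite mulf_eq0 negb_or => /andP[/Hr].
Qed.

(** [conv_swap] exposes integrals of the kernel against translates of [jump_op phi], which
    [Green_fundamental] evaluates. *)
Lemma pot_J phi : is_test_function phi ->
  intg2 (fun x => pot x * J phi x) /\
  \int[@leb2 R]_x (pot x * J phi x) = - (2 / c) * \int[@leb2 R]_x (rho x * phi x).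
Proof.
move=> tp; have [A A0 [B B0 H]] := test_J_bound alpha_gt1 alpha_lt2 M_gt1 tp.
have [IJ _] := test_J M alpha_gt1 alpha_lt2 tp.
have [rad rad0 Hr] := cs_box rho_supp; have [K K0 HK] := cs_bounded rho_cont rho_supp.
have Ir := intg_cs rho_cont rho_supp.
have az x : A <= enorm x -> J phi x = 0.
  move=> xA; have := H x; rewrite indic_ball ltNge xA mulr0 normr_le0; exact: eqP.
have rz x : rad <= enorm x -> rho x = 0.
  by move=> xA; apply/eqP/negPn/negP => /Hr; rewrite ltNge xA.
have A1 : 0 <= A + rad by rewrite addr_ge0// ltW.
have Bh x : `|J phi x| <= B.
  by apply: le_trans (H x) _; rewrite -[X in _ <= X]mulr1 ler_wpM2l// indic_ball lern1 leq_b1.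
have [I1 E1] := conv_swap IJ B0 Bh az Ir K0 HK rz
  (intg_Green_ball alpha_gt1 alpha_lt2 M_gt1 x0_unit c_gt0 A1) intg_pot
  (fun x => intg_J_Green alpha_gt1 alpha_lt2 M_gt1 x0_unit c_gt0 x tp).
split; first by apply: int2_eq I1 => x; exact: mulrC.
rewrite (Rint2_eq (g := fun x => J phi x * pot x)); last by move=> x; exact: mulrC.
rewrite E1 -Rint2Z; last exact: (intg_rhoM tp).
apply: Rint2_eq => x.
by rewrite (Green_fundamental alpha_gt1 alpha_lt2 M_gt1 x0_unit c_gt0 x tp) mulrCA.
Qed.

(** The symbol at a unit vector is positive and at most half of this integral. *)
Lemma intg_jdom_gt0 : 0 < \int[@leb2 R]_y jdom alpha M y.
Proof.
have e0 : e1 R != 0 by apply/eqP => -[/eqP]; rewrite oner_eq0.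
have h := psi1_gt0 alpha_gt1 alpha_lt2 M_gt1 e0.
have e1n : enorm (e1 R) = 1 by rewrite /enorm /= expr0n addr0 expr1n sqrtr1.
suff : jump_symbol alpha M (e1 R) <= 2^-1 * \int[@leb2 R]_y jdom alpha M y by lra.
have Ij := intg_jdom M alpha_gt1 alpha_lt2.
rewrite -Rint2Z//; apply: Rint2_mono; [exact: intg_psi1|exact: intgZ|move=> y].
rewrite -(jker_sqr M alpha_gt1) mulrCA ler_wpM2l ?jker_ge0//.
by have := onem_cosdot_le (e1 R) y; rewrite e1n expr1n div1r.
Qed.

(** The operator sends the squared norm to the constant [sigma2_M], so the quadratic part accounts
    for the integral of [phi], with a minus sign, and the potential for that of [rho * phi]. *)
Lemma obstacle_eq phi : is_test_function phi ->
  intg2 (fun x => gamma x * L_M phi x) /\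
  \int[@leb2 R]_x (gamma x * L_M phi x) = \int[@leb2 R]_x (rho x * phi x) - \int[@leb2 R]_x phi x.
Proof.
move=> tp; have [Ip Ep] := pot_J tp; have [K K0 HK] := test_dif2 tp.
have Iphi := intg_cs (test_continuous tp) tp.2.
have c0 : c != 0 by rewrite gt_eqF.
have cE : continuous (fun x => enorm x ^+ 2 : R).
  move=> x; rewrite (_ : (fun x => _) = (fun x => enorm x * enorm x)); last by apply/funext => y; rewrite expr2.
  by apply: cvgM; exact: continuous_enorm.
have [|I1 _ E] := @J_selfadj _ _ M alpha_gt1 alpha_lt2 _ phi 2 K cE (test_continuous tp) tp.2 _ HK.
  by move=> x y; rewrite D2_enorm2 ger0_norm// mulr_ge0// sqr_ge0.
pose s := sigma2_M alpha r M.
have sE : s = c * \int[@leb2 R]_y jdom alpha M y by rewrite /s sigma2_ME.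
have I0 := intg_jdom_gt0.
have s0 : s != 0 by rewrite sE; exact: mulf_neq0 c0 (lt0r_neq0 I0).
have e x : - (c / 2 * s^-1) * (enorm x ^+ 2 * J phi x) - c / 2 * (pot x * J phi x) = gamma x * L_M phi x.
  by rewrite L_ME /obstacle potE -/s; ring.
split; first by apply: (int2_eq e); apply: intgB; exact: intgZ.
rewrite -(Rint2_eq e) Rint2B; [|exact: intgZ|exact: intgZ].
rewrite (Rint2Z _ I1) (Rint2Z _ Ip) Ep E.
rewrite (Rint2_eq (g := fun x => (2 * \int[@leb2 R]_y jdom alpha M y) * phi x)); last first.
  by move=> x; rewrite (J_enorm2 M alpha_gt1 alpha_lt2) mulrC.
rewrite (Rint2Z _ Iphi) sE; field.
by rewrite c0 gt_eqF.
Qed.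

End Obstacle.

(** * Bounds on the discrete odometers *)

Section DiscreteOdometer.
Variables (R : realType) (alpha r M : R) (n : nat).
Hypothesis alpha_gt1 : 1 < alpha.
Hypothesis alpha_lt2 : alpha < 2.
Hypothesis r_gt0 : 0 < r.
Hypothesis r_ltM : r < M.
Hypothesis M_gt1 : 1 < M.
Hypothesis n_gt0 : (0 < n)%N.
Hypothesis k_gt0 : 0 < k_ alpha r M n.
Local Notation p := (p_ alpha r M n).
Local Notation S := (Sn M n).
Local Notation pt := (pt R n).
Local Notation I := (\int[@leb2 R]_(y in eball M) (enorm y `^ alpha)^-1).
Hypothesis I_gt0 : 0 < I.
Variables (rho : R * R -> R) (a L : R) (j : nat).
Hypothesis rho_ge0 : forall x, 0 <= rho x.
Hypothesis rho_le : forall x, rho x <= (10 / 9) ^+ j.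
Hypothesis a_gt0 : 0 < a.
Hypothesis rho_supp : forall x, rho x != 0 -> enorm x < a.
Hypothesis L_ge0 : 0 <= L.
Hypothesis rho_lip : forall x y, `|rho (x + y) - rho x| <= L * enorm y.
Variable X : nat -> option site.
Local Notation eta := (fun z : site => rho (pt z)).
Hypothesis X_legal : legal_toppling p eta X.
Local Notation V := (total_emitted p eta X).
Local Notation u := (odometer alpha n p eta X).

(** Since [rho] is at most (10/9)^j, [j] barrier steps with jump range [M + 1] suffice; the radius
    is free of [n]. *)
Definition supp_rad : R := barrier_rad (M + 1) j a.

Definition scaled_lap (f : site -> R) z : R := n%:R `^ alpha * lap p S f z.

Let na : 0 < n%:R `^ alpha :> R.
Proof. exact: (powR_gt0 _ (nR_gt0 R n_gt0)). Qed.

Let nN : n%:R `^ (- alpha) * n%:R `^ alpha = 1 :> R.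
Proof. by rewrite powRN mulVf ?gt_eqF. Qed.

Let p_range := pn_range alpha_gt1 alpha_lt2 r_gt0 r_ltM M_gt1 n_gt0 k_gt0.
Let p_ge0 := pn_ge0 alpha_gt1 alpha_lt2 r_gt0 r_ltM M_gt1 n_gt0 k_gt0.
Let p_opp := pn_opp alpha_gt1 alpha_lt2 r_gt0 r_ltM M_gt1 n_gt0 k_gt0.
Let p_supp := pn_supp alpha_gt1 alpha_lt2 r_gt0 r_ltM M_gt1 n_gt0 k_gt0.
Let p_sum := pn_sum alpha_gt1 alpha_lt2 r_gt0 r_ltM M_gt1 n_gt0 k_gt0.
Let p_e1 := pn_e1 alpha_gt1 alpha_lt2 r_gt0 r_ltM M_gt1 n_gt0 k_gt0.
Let cn_gt0 := c_gt0 alpha_gt1 alpha_lt2 r_gt0 r_ltM M_gt1 n_gt0 k_gt0.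
Let S_uniq := uniq_ibox (Num.truncn (n%:R * (M + 1))).+1.
Let S_opp := perm_ibox_opp (Num.truncn (n%:R * (M + 1))).+1.
Let ptD := ptD R n.

Lemma sig2_gt0 : 0 < sig2 p S pt.
Proof.
have h := sig2E alpha_gt1 alpha_lt2 r_gt0 r_ltM M_gt1 n_gt0 k_gt0.
by rewrite -(pmulr_rgt0 _ na) h mulr_gt0.
Qed.

Let M1 : 0 < M + 1.
Proof. by have := M_gt1; lra. Qed.

Lemma emission_barrier : exists W : site -> R, [/\ forall z, 0 <= W z,
    forall z, supp_rad <= enorm (pt z) -> W z = 0 &
    forall z, eta z + lap p S W z <= 1].
Proof.
have [W [W0 Wout Wle]] := barrier S_opp p_ge0 p_opp ptD p_range M1 j sig2_gt0 a_gt0.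
exists W; split=> // z; apply: le_trans (Wle z); rewrite lerD2r.
case: ltP => h; first exact: rho_le.
rewrite le_eqVlt (_ : rho _ = 0) ?eqxx//; apply/eqP/negPn/negP => /rho_supp.
by rewrite ltNge h.
Qed.

Lemma odometer_ge0 z : 0 <= u z.
Proof.
have [W [W0 _ Wle]] := emission_barrier.
rewrite /odometer mulr_ge0 ?powR_ge0//.
exact: (total_emitted_ge0 S_uniq S_opp p_supp p_ge0 p_opp (pn0 _ _ _ _) p_sum X_legal W0 Wle).
Qed.

Lemma odometer_gt0 z : (0 < u z) = (0 < V z).
Proof. by rewrite /odometer pmulr_rgt0//; exact: (powR_gt0 _ (nR_gt0 R n_gt0)). Qed.

Lemma odometer_out z : supp_rad <= enorm (pt z) -> u z = 0.
Proof.
have [W [W0 Wout Wle]] := emission_barrier => h.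
have V0 := total_emitted_ge0 S_uniq S_opp p_supp p_ge0 p_opp (pn0 _ _ _ _) p_sum X_legal W0 Wle z.
have := total_emitted_le S_uniq S_opp p_supp p_ge0 p_opp (pn0 _ _ _ _) p_sum X_legal W0 Wle z.
rewrite Wout// => V1; rewrite /odometer (_ : V z = 0) ?mulr0//.
by apply/eqP; rewrite eq_le V1.
Qed.

Lemma lapn_odometer z : scaled_lap u z = lap p S V z.
Proof. by rewrite /scaled_lap /odometer lapZ mulrA [X in X * _]mulrC nN mul1r. Qed.

Lemma odometer_super z : eta z + scaled_lap u z <= 1.
Proof.
have [W [W0 _ Wle]] := emission_barrier; rewrite lapn_odometer.
exact: (final_mass_le1 S_uniq S_opp p_supp p_ge0 p_opp (pn0 _ _ _ _) p_sum X_legal W0 Wle).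
Qed.

(** The price of the quadratic corrector of [comparison_q] after rescaling; by [sig2E] it depends on
    [n] through [c_ n] alone. *)
Definition sup_coef : R := (supp_rad + (M + 1)) ^+ 2 / (c_ alpha r M n * I).

(** [comparison_q] for the rescaled functions on the set of emitting sites, where the final mass is
    exactly 1. Elsewhere the odometer is 0 and the bound is trivial. *)
Lemma odometer_comparison (v : site -> R) (eta' : site -> R) (del : R) : 0 <= del ->
  (forall z, enorm (pt z) < supp_rad -> eta' z + scaled_lap v z <= 1) ->
  (forall z, eta z - eta' z <= del) ->
  (forall z, 0 <= v z) ->
  forall z, u z <= v z + del * sup_coef.
Proof.
move=> d0 Hv He v0 z.
have [W [W0 Wout Wle]] := emission_barrier.
have V0 z' : 0 <= V z' by exact: (total_emitted_ge0 S_uniq S_opp p_supp p_ge0 p_opp (pn0 _ _ _ _) p_sum X_legal W0 Wle).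
have s0 := sig2_gt0.
have r0 : 0 <= supp_rad.
  rewrite /supp_rad; move: a_gt0; elim: j a => [|j' IH] b b0 /=; first exact: ltW.
  by apply: IH; have := M1; lra.
have VR z' : 0 < V z' -> enorm (pt z') < supp_rad.
  rewrite -odometer_gt0 => h; rewrite ltNge; apply/negP => /odometer_out h'.
  by rewrite h' ltxx in h.
have sc : n%:R `^ (- alpha) * (del * (supp_rad + (M + 1)) ^+ 2 / sig2 p S pt) = del * sup_coef.
  have h := sig2E alpha_gt1 alpha_lt2 r_gt0 r_ltM M_gt1 n_gt0 k_gt0.
  rewrite /sup_coef -h powRN; move: s0 (sig2 _ _ _) na (_ `^ _) => _ s t0 t.
  by rewrite invfM; ring.
have [Vz|Vz] := ltP 0 (V z); last first.
  have -> : u z = 0 by rewrite /odometer (_ : V z = 0) ?mulr0//; apply/eqP; rewrite eq_le Vz V0.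
  by rewrite -sc addr_ge0// mulr_ge0 ?powR_ge0// divr_ge0 ?(ltW s0)// mulr_ge0// sqr_ge0.
rewrite -sc /odometer.
have -> : v z = n%:R `^ (- alpha) * (n%:R `^ alpha * v z) by rewrite mulrA nN mul1r.
rewrite -mulrDr ler_wpM2l ?powR_ge0//.
apply: (comparison_q S_uniq S_opp p_supp p_ge0 p_opp ptD p_range M1 p_e1 (v := fun z => n%:R `^ alpha * v z) (eta := eta) (eta' := eta')
  (K := (Num.truncn (n%:R * supp_rad)).+1)) => //.
- move=> z' /VR /ltW /(index_bound n_gt0); rewrite mem_ibox; exact: andP.
- by move=> z' /VR /ltW.
- by move=> z'; exact: (final_mass_eq1 S_uniq S_opp p_supp p_ge0 p_opp (pn0 _ _ _ _) p_sum X_legal W0 Wle).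
- by move=> z' /VR h; rewrite lapZ; exact: Hv.
- by move=> z' _; rewrite mulr_ge0// ltW.
Qed.

Lemma odometer_le z : u z <= (10 / 9) ^+ j * sup_coef.
Proof.
rewrite -[X in _ <= X]add0r; apply: (@odometer_comparison (fun=> 0) (fun=> 0)) => //.
- by move=> z' _; rewrite /scaled_lap /lap big1 ?mulr0 ?addr0// => y _; rewrite subrr mulr0.
- by move=> z'; rewrite subr0.
Qed.

(** A translated odometer is a supersolution for the translated density, which is within
    [L * enorm (pt h)] of [eta]; the comparison is made for [h] and for [- h]. *)
Lemma odometer_lip z h : `|u (z + h) - u z| <= L * enorm (pt h) * sup_coef.
Proof.
have H z' h' : u z' <= u (z' + h') + L * enorm (pt h') * sup_coef.
  apply: (@odometer_comparison (fun z => u (z + h')) (fun z => eta (z + h'))).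
  - by rewrite mulr_ge0 ?enorm_ge0.
  - by move=> y _; rewrite /scaled_lap lap_shift; exact: odometer_super.
  - move=> y; rewrite ptD; have := rho_lip (pt y) (pt h').
    by rewrite distrC; apply: le_trans; exact: ler_norm.
  - by move=> y; exact: odometer_ge0.
have h1 := H z h; have h2 := H (z + h) (- h).
rewrite addrK ptN enormN in h2.
by rewrite ler_norml; apply/andP; split; lra.
Qed.

End DiscreteOdometer.

(** * Exchanging competitors *)

Section JumpLinear.
Variables (R : realType) (alpha M : R).
Hypothesis alpha_gt1 : 1 < alpha.
Hypothesis alpha_lt2 : alpha < 2.
Local Notation J := (jump_op alpha M).
Implicit Types (f g phi : R * R -> R) (x y : R * R).

Lemma J_lin f g (d C C' : R) x : continuous f -> continuous g ->
  (forall x y, `|D2 f x y| <= C * enorm y ^+ 2) ->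
  (forall x y, `|D2 g x y| <= C' * enorm y ^+ 2) ->
  J (fun x => f x + d * g x) x = J f x + d * J g x.
Proof.
move=> cf cg Hf Hg.
have If := intg_jker_D2 alpha_gt1 alpha_lt2 (M := M) (x := x) cf (fun y _ => Hf x y).
have Ig := intg_jker_D2 alpha_gt1 alpha_lt2 (M := M) (x := x) cg (fun y _ => Hg x y).
rewrite /jump_op -(Rint2Z d Ig) -(Rint2D If (intgZ d Ig)).
by apply: Rint2_eq => y; rewrite /D2; ring.
Qed.

Lemma J_out phi rad x : (forall y, phi y != 0 -> enorm y < rad) -> 0 < M -> rad + M <= enorm x ->
  J phi x = 0.
Proof.
move=> Hr m0 xr; apply: Rint2_0 => y.
have [yM|yM] := leP M (enorm y); first by rewrite jker_out// mul0r.
have z u : rad <= enorm u -> phi u = 0.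
  by move=> h; apply/eqP/negPn/negP => /Hr; rewrite ltNge h.
have h1 := enorm_geB x (- y); rewrite opprK enormN in h1.
have h2 := enorm_geB x y; have e0 := enorm_ge0 y.
by rewrite /D2 !z ?mulr0 ?addr0 ?subr0 ?mulr0//; lra.
Qed.

End JumpLinear.
Section Mollification.
Variables (R : realType) (alpha M : R).
Hypothesis alpha_gt1 : 1 < alpha.
Hypothesis alpha_lt2 : alpha < 2.
Local Notation J := (jump_op alpha M).
Variables (a eta : R * R -> R).
Hypothesis a_int : intg2 a.
Hypothesis eta_test : is_test_function eta.
Implicit Types (x y t : R * R).

Definition mollify x : R := \int[@leb2 R]_t (a t * eta (x - t)).

Let eta_cont := test_continuous eta_test.

Let eta_int x : intg2 (fun t => eta (x - t)).
Proof. exact: intg_reflect (intg_cs eta_cont eta_test.2). Qed.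

Lemma intg_amul (b : R * R -> R) (C : R) : meas2 b -> (forall t, `|b t| <= C) ->
  intg2 (fun t => a t * b t).
Proof.
move=> mb Hb; apply: (int2_le _ (intgZ C (intg_norm a_int))).
  by apply: meas2M => //; exact: int2_meas.
by move=> t; rewrite normrM mulrC ler_wpM2r.
Qed.

Lemma intg_mollify x : intg2 (fun t => a t * eta (x - t)).
Proof.
have [K K0 HK] := cs_bounded eta_cont eta_test.2.
by apply: (@intg_amul _ K) => //; exact: int2_meas.
Qed.

Lemma mollify_lip : exists2 L : R, 0 <= L & forall x y, `|mollify (x + y) - mollify x| <= L * enorm y.
Proof.
have [L L0 HL] := test_lip eta_test.
exists (L * \int[@leb2 R]_t `|a t|); first by rewrite mulr_ge0// Rint2_ge0.
move=> x y; rewrite /mollify -Rint2B; [|exact: intg_mollify|exact: intg_mollify].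
rewrite mulrAC -Rint2Z; last exact: intg_norm.
apply: Rint2_norm; [by apply: intgB; exact: intg_mollify|by apply: intgZ; exact: intg_norm|move=> t].
rewrite -mulrBr normrM mulrC ler_wpM2r//.
by have := HL (x - t) y; rewrite addrAC.
Qed.

Lemma continuous_mollify : continuous mollify.
Proof.
have [L L0 HL] := mollify_lip.
apply/continuous_eps => x e e0; exists (e / (L + 1)); first by rewrite divr_gt0// ltr_wpDl.
move=> y; rewrite ltr_pdivlMr ?ltr_wpDl// => h.
have := HL x (y - x); rewrite [x + _]addrC subrK => h'; apply: (le_trans h').
have := enorm_ge0 (y - x); nra.
Qed.

Lemma mollify_D2E x y : D2 mollify x y = \int[@leb2 R]_t (a t * D2 eta (x - t) y).
Proof.
have I := intg_mollify.
rewrite /D2 /mollify -(Rint2D (I _) (I _)) -(Rint2Z 2 (I _)) -Rint2B; [|exact: intgD|exact: intgZ].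
apply: Rint2_eq => t; rewrite (addrAC x (- t) y) (addrAC x (- t) (- y)); ring.
Qed.

Lemma mollify_D2 : exists2 C : R, 0 <= C & forall x y, `|D2 mollify x y| <= C * enorm y ^+ 2.
Proof.
have [K K0 HK] := test_dif2 eta_test.
exists (K * \int[@leb2 R]_t `|a t|); first by rewrite mulr_ge0// Rint2_ge0.
move=> x y; rewrite mollify_D2E mulrAC -Rint2Z; last exact: intg_norm.
have b t : `|D2 eta (x - t) y| <= K * enorm y ^+ 2 by exact: HK.
apply: Rint2_norm; last 1 first.
- by move=> t; rewrite normrM mulrC ler_wpM2r.
- apply: (intg_amul _ b); apply: int2_meas.
  by apply: (intg_reflect x (f := fun t => D2 eta t y)); apply: intgB; [apply: intgD|apply: intgZ];
    [exact: (intg_shift y (intg_cs eta_cont eta_test.2))|exact: (intg_shift (- y) (intg_cs eta_cont eta_test.2))|exact: intg_cs eta_cont eta_test.2].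
- by apply: intgZ; exact: intg_norm.
Qed.

(** Second differences of the mollification fall on [eta] alone, and [J_fubini] exchanges the
    integrals. *)
Lemma mollify_J x : intg2 (fun t => a t * J eta (x - t)) /\
  J mollify x = \int[@leb2 R]_t (a t * J eta (x - t)).
Proof.
have [K K0 HK] := test_dif2 eta_test.
have D2r t y : D2 (fun t => eta (x - t)) t y = D2 eta (x - t) y.
  by rewrite /D2 !opprD opprK addrA (addrA x (- t)) [eta (x - t - y) + _]addrC.
have Jr t : J (fun t => eta (x - t)) t = J eta (x - t).
  by apply: Rint2_eq => y; rewrite D2r.
have cr : continuous (fun t => eta (x - t)).
  move=> t; apply: (@continuous_comp _ _ _ (fun t => x - t) eta); last exact: eta_cont.
  by apply: cvgB; [exact: cvg_cst|exact: cvg_id].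
have [|I1 E1] := @J_fubini _ alpha M alpha_gt1 alpha_lt2 a (fun t => eta (x - t))
   (fun t => K * `|a t|) (int2_meas a_int) cr (intgZ K (intg_norm a_int)).
  move=> t y _; rewrite D2r normrM mulrAC mulrC ler_wpM2r//; exact: HK.
split; first by apply: int2_eq I1 => t; rewrite Jr.
rewrite (Rint2_eq (g := fun t => a t * J (fun t => eta (x - t)) t)); last by move=> t; rewrite Jr.
rewrite E1; apply: Rint2_eq => y; congr (_ * _).
by rewrite mollify_D2E; apply: Rint2_eq => t; rewrite D2r.
Qed.

End Mollification.

Section RealInequalities.
Variable R : realType.
Implicit Types (t e : R).

Lemma cos_ge_half t : `|t| <= 1 -> 2^-1 <= cos t.
Proof.
move=> t1; have h2 := onem_cos_le t.
have h3 : t ^+ 2 <= 1 by rewrite -real_normK ?num_real// expr_le1.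
by move: h2 h3; lra.
Qed.

Lemma onep_cos_bounds t : 0 <= 1 + cos t <= 2.
Proof. by have := cos_max t; rewrite ler_norml => /andP[]; lra. Qed.

Lemma mul_le_quarter (C Q t e : R) : 0 <= C -> 0 <= Q -> 0 <= t ->
  t * (4 * (C + 1) * (Q + 1)) <= e -> C * t * Q <= e / 4.
Proof.
move=> C0 Q0 t0; rewrite (_ : t * _ = 4 * (C * t * Q) + 4 * t * (C + Q + 1)); last by ring.
have := mulr_ge0 (mulr_ge0 (ler0n R 4) t0) (addr_ge0 (addr_ge0 C0 Q0) ler01); lra.
Qed.

Lemma drop_le (b t : R) : 0 < b -> b <= 2^-1 -> - 1 <= t -> 0 - 2 * b * t <= 1 - 0.
Proof. by move=> b0 b1 t1; have := ler_wpM2l (ltW b0) t1; lra. Qed.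

Lemma sum_lt_third (s t u d : R) : s <= u -> t <= u -> u <= d / 3 -> 0 < d -> s + t < d.
Proof. by lra. Qed.

Lemma sum_le_halves (s t e : R) : s <= e / 4 -> t <= e / 4 -> s + t <= e / 2.
Proof. by lra. Qed.

Lemma le_eighths (w u t s e : R) : w <= u + 3 * s -> t <= e / 2 -> s <= e / 8 -> 0 <= e -> w + t <= u + e.
Proof. by lra. Qed.

End RealInequalities.

(** * Upper and lower comparison of odometers with admissible functions *)

Section Comparison.
Variables (R : realType) (alpha r M : R).
Hypothesis alpha_gt1 : 1 < alpha.
Hypothesis alpha_lt2 : alpha < 2.
Hypothesis r_gt0 : 0 < r.
Hypothesis r_ltM : r < M.
Hypothesis M_gt1 : 1 < M.
Hypothesis k_gt0 : forall n : nat, (0 < n)%N -> 0 < k_ alpha r M n.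
Variables (rho : R * R -> R) (a L : R) (j : nat).
Hypothesis rho_cont : continuous rho.
Hypothesis rho_ge0 : forall x, 0 <= rho x.
Hypothesis rho_le : forall x, rho x <= (10 / 9) ^+ j.
Hypothesis a_gt0 : 0 < a.
Hypothesis rho_supp : forall x, rho x != 0 -> enorm x < a.
Hypothesis L_ge0 : 0 <= L.
Hypothesis rho_lip : forall x y, `|rho (x + y) - rho x| <= L * enorm y.
Variable X : nat -> nat -> option site.
Hypothesis X_legal : forall n : nat, (0 < n)%N ->
  legal_toppling (p_ alpha r M n) (fun z : site => rho (pt R n z)) (X n).
Local Notation p := (p_ alpha r M).
Local Notation pt := (pt R).
Local Notation J := (jump_op alpha M).
Local Notation L_M := (L_M alpha r M).
Local Notation c := (c_lim alpha r M).
Local Notation Ln := (scaled_jump alpha r M).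
Local Notation lapn n := (scaled_lap alpha r M n).
Local Notation u n := (odometer alpha n (p n) (fun z : site => rho (pt n z)) (X n)).
Local Notation ue n := (box_ext n (u n)).
Local Notation R0 := (supp_rad M a j).
Local Notation coef n := (sup_coef alpha r M n a j).
Implicit Types (x y t : R * R) (z : site) (w phi : R * R -> R).

Let clim_gt0 : 0 < c.
Proof. exact: (c_lim_spec alpha_gt1 alpha_lt2 r_gt0 r_ltM M_gt1 k_gt0).2. Qed.

Lemma int_alphaE : \int[@leb2 R]_(y in eball M) (enorm y `^ alpha)^-1 = \int[@leb2 R]_y jdom alpha M y.
Proof.
by have := sigma2_ME alpha M r; rewrite /sigma2_M => /(mulfI (lt0r_neq0 clim_gt0)).
Qed.

Let I_gt0 : 0 < \int[@leb2 R]_(y in eball M) (enorm y `^ alpha)^-1.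
Proof. by rewrite int_alphaE; exact: intg_jdom_gt0. Qed.

Lemma coef_bound : exists2 Q : R, 0 <= Q & exists N, forall n, (N <= n)%N ->
  (0 < n)%N /\ 0 <= coef n <= Q.
Proof.
have [K K0 [N HN]] := c_bounds alpha_gt1 alpha_lt2 r_gt0 r_ltM M_gt1 k_gt0.
exists ((R0 + (M + 1)) ^+ 2 * (K * (\int[@leb2 R]_(y in eball M) (enorm y `^ alpha)^-1)^-1)).
  by rewrite mulr_ge0 ?sqr_ge0// mulr_ge0 ?(ltW K0)// invr_ge0 ltW.
exists N => n /HN[n0 c0 _ cK _]; split=> //; rewrite /sup_coef invfM.
have i0 : 0 <= (\int[@leb2 R]_(y in eball M) (enorm y `^ alpha)^-1)^-1 by rewrite invr_ge0 ltW.
have ci : 0 <= (c_ alpha r M n)^-1 by rewrite invr_ge0 ltW.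
rewrite (mulr_ge0 (sqr_ge0 _) (mulr_ge0 ci i0)) ler_wpM2l ?sqr_ge0// ler_wpM2r//.
by rewrite invf_ple ?posrE.
Qed.

(* The differences [f - gamma] of the competitors [f] in the least superharmonic majorant. *)
Definition is_admissible w : Prop := [/\ continuous w, forall x, 0 <= w x &
  forall phi, is_test_function phi -> (forall x, 0 <= phi x) ->
    \int[@leb2 R]_x (w x * L_M phi x) <= \int[@leb2 R]_x phi x - \int[@leb2 R]_x (rho x * phi x)].

Let Lip x y : `|rho y - rho x| <= L * enorm (y - x).
Proof. by have := rho_lip x (y - x); rewrite [x + _]addrC subrK. Qed.

Lemma nearest_close n x : (0 < n)%N -> enorm (pt n (nearest n x) - x) <= n%:R^-1.
Proof. by move=> n0; rewrite -enormN opprB; exact: nearest_dist. Qed.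

Lemma Ln_out n phi rad x : (0 < n)%N -> (forall y, phi y != 0 -> enorm y < rad) ->
  rad + (M + 1) <= enorm x -> Ln n phi x = 0.
Proof.
move=> n0 Hr xr; rewrite /scaled_jump big1 ?mulr0// => z _.
have [->|pz] := eqVneq (p n z) 0; first by rewrite mul0r.
have h := pn_range alpha_gt1 alpha_lt2 r_gt0 r_ltM M_gt1 n0 (k_gt0 n0) pz.
have h1 := enorm_geB x (- pt n z); rewrite opprK enormN in h1.
have m1 := M_gt1.
have ph y : rad <= enorm y -> phi y = 0.
  by move=> hy; apply/eqP/negPn/negP => /Hr; rewrite ltNge hy.
by rewrite !ph ?subrr ?mulr0//; lra.
Qed.

(** The site enters only through the translate of [eta], so by symmetry of the law the discrete
    operator passes from the site to [eta]. *)
Lemma lapn_pairing n w eta z : (0 < n)%N -> (forall y, intg2 (fun t => w t * eta (t - y))) ->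
  intg2 (fun t => w t * Ln n eta (t - pt n z)) /\
  lapn n (fun z => \int[@leb2 R]_t (w t * eta (t - pt n z))) z =
  \int[@leb2 R]_t (w t * Ln n eta (t - pt n z)).
Proof.
move=> n0 Iv.
pose F (y : site) t := (n%:R `^ alpha * p n y) * (w t * eta (t - pt n (z - y)) - w t * eta (t - pt n z)).
have IF (y : site) : intg2 (F y) by apply: intgZ; apply: intgB; exact: Iv.
have e t : \sum_(y <- Sn M n) F y t = w t * Ln n eta (t - pt n z).
  rewrite /scaled_jump mulrCA !mulr_sumr; apply: eq_bigr => y _.
  rewrite /F ptD ptN (_ : t - (pt n z - pt n y) = t - pt n z + pt n y); last first.
    by rewrite opprD opprK addrA.
  by move: (_ `^ _) (p n y) => u1 u2; ring.
split; first by apply: (int2_eq e); exact: intg_sum.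
rewrite -(Rint2_eq e) (Rint_sum _ IF) /scaled_lap /lap mulr_sumr.
rewrite -(sum_opp (perm_ibox_opp _)); apply: eq_bigr => y _.
rewrite (pn_opp alpha_gt1 alpha_lt2 r_gt0 r_ltM M_gt1 n0 (k_gt0 n0)).
by rewrite /F Rint2Z ?Rint2B ?mulrA//; apply: intgB; exact: Iv.
Qed.

(** The averaged competitor is a supersolution for a slightly smaller density. The loss is [L * eps]
    for averaging [rho] over the bump, plus [e'] times a bound on the integral of [w] for exchanging
    the two operators on [eta]. *)
Lemma admissible_pairing n w eta eps Kw e' z : (0 < n)%N -> is_admissible w ->
  is_test_function eta -> (forall y, 0 <= eta y) -> (forall y, eta y != 0 -> enorm y <= eps) ->
  \int[@leb2 R]_y eta y = 1 -> eps <= 1 -> 0 <= Kw -> 0 <= e' ->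
  (forall t, enorm t < `|R0| + M + 4 -> `|w t| <= Kw) ->
  (forall y, `|Ln n eta y - L_M eta y| <= e') ->
  enorm (pt n z) < R0 ->
  rho (pt n z) - (L * eps + e' * (Kw * \int[@leb2 R]_y \1_(eball (`|R0| + M + 4)) y)) +
    lapn n (fun z => \int[@leb2 R]_t (w t * eta (t - pt n z))) z <= 1.
Proof.
move=> n0 [cw w0 Hw] teta eta0 eta_supp eta1 eps1 Kw0 e'0 HKw He zR0.
(* Both operators applied to the bump vanish beyond distance 2 + (M + 1) of [q], and [q] lies within
   [R0] of the origin, so [R3] leaves a margin of 1. *)
set R3 := `|R0| + M + 4 in HKw *; set q := pt n z in zR0 *.
have m1 := M_gt1.
have tsh y : is_test_function (fun t => eta (t - y)) by exact: test_shift.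
have Iv y : intg2 (fun t => w t * eta (t - y)).
  apply: intg_cs.
    by move=> t; apply: cvgM; [exact: cw|exact: (test_continuous (tsh y))].
  have [rad rad0 Hr] := cs_box (tsh y).2.
  by apply: (@cs_rad _ _ rad) => t; rewrite mulf_eq0 negb_or => /andP[_ /Hr].
have [I1 ->] := lapn_pairing z n0 Iv; rewrite -/q in I1 *.
have Iq := intg_cs (test_continuous (tsh q)) (tsh q).2.
have Ir : intg2 (fun x => rho x * eta (x - q)).
  apply: intg_cs.
    by move=> t; apply: cvgM; [exact: rho_cont|exact: (test_continuous (tsh q))].
  have [rad rad0 Hr] := cs_box (tsh q).2.
  by apply: (@cs_rad _ _ rad) => t; rewrite mulf_eq0 negb_or => /andP[_ /Hr].
have H1 := Hw _ (tsh q) (fun x => eta0 _).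
have eq1 : \int[@leb2 R]_x eta (x - q) = 1.
  by rewrite (Rint_shift (- q) (intg_cs (test_continuous teta) teta.2)).
rewrite eq1 in H1.
have Lsh x : L_M (fun t => eta (t - q)) x = L_M eta (x - q) by rewrite !L_ME J_shift.
have I2 : intg2 (fun x => w x * L_M eta (x - q)).
  have [K K0 HK] := test_dif2 (tsh q).
  have [I _] := test_J M alpha_gt1 alpha_lt2 (tsh q).
  have [A A0 [B B0 HB]] := test_J_bound alpha_gt1 alpha_lt2 M_gt1 (tsh q).
  have [Kw' Kw'0 HKw'] := bounded_on_ball A cw.
  apply: (int2_le _ (intgZ (c / 2 * Kw') (intg_norm I))).
    apply: (meas2M (continuous_measurable2 cw)).
    rewrite (_ : (fun x => _) = (fun x => c / 2 * J (fun t => eta (t - q)) x)).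
      by apply: meas2M; [exact: meas2_cst|exact: int2_meas].
    by apply/funext => x; rewrite -Lsh L_ME.
  move=> x; rewrite -Lsh L_ME mulrCA normrM gtr0_norm ?divr_gt0// -mulrA ler_wpM2l ?divr_ge0 ?(ltW clim_gt0)//.
  rewrite normrM; have [xA|xA] := ltP (enorm x) A; first by rewrite ler_wpM2r// HKw'.
  rewrite (_ : J _ x = 0) ?normr0 ?mulr0//.
  by have := HB x; rewrite indic_ball ltNge xA mulr0 normr_le0 => /eqP.
rewrite (Rint2_eq (g := fun x => w x * L_M eta (x - q))) in H1; last by move=> x; rewrite Lsh.
have H2 : \int[@leb2 R]_t (w t * Ln n eta (t - q)) - \int[@leb2 R]_x (w x * L_M eta (x - q)) <=
   e' * (Kw * \int[@leb2 R]_y \1_(eball R3) y).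
  have I3 := int2_ball R3.
  rewrite -Rint2B// -(Rint2Z Kw I3) -(Rint2Z e' (intgZ Kw I3)).
  apply: Rint2_mono; [exact: intgB|by apply: intgZ; exact: intgZ|move=> t].
  rewrite -mulrBr indic_ball; case: ltP => tR.
    rewrite mulr1 mulrC; apply: le_trans (ler_norm _) _; rewrite normrM.
    by apply: ler_pM => //; exact: HKw.
  have h2 : 2 + (M + 1) <= enorm (t - q).
    have := enorm_geB t q; have := ler_norm R0; rewrite /R3 in tR; lra.
  have etaS y : eta y != 0 -> enorm y < 2.
    by move=> /eta_supp h; apply: le_lt_trans h _; lra.
  rewrite (Ln_out n0 etaS h2) L_ME (@J_out _ alpha M eta 2 (t - q) etaS) ?mulr0 ?subrr ?mulr0//; lra.
have H3 : rho q - L * eps <= \int[@leb2 R]_x (rho x * eta (x - q)).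
  rewrite -[X in X <= _]mulr1 -eq1 -Rint2Z//.
  apply: Rint2_mono => // [|t]; first exact: intgZ.
  have [->|et] := eqVneq (eta (t - q)) 0; first by rewrite !mulr0.
  rewrite ler_wpM2r//; have h1 := eta_supp _ et.
  have := Lip q t; rewrite ler_norml => /andP[h2 _].
  have : L * enorm (t - q) <= L * eps by rewrite ler_wpM2l.
  lra.
move: H1 H2 H3; lra.
Qed.

(** The point is fixed because [w] is only continuous: the average of [w] near [x] is compared with
    [w x] through the modulus of continuity at [x]. *)
Lemma odometer_le_admissible w x e : is_admissible w -> 0 < e ->
  exists N, forall n, (N <= n)%N -> ue n x <= w x + e.
Proof.
move=> adm e0; have [cw w0 Hw] := adm.
have m1 := M_gt1.
have [Q Q0 [N0 HN0]] := coef_bound.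
have [d d0 Hd] := (continuous_eps w).1 cw x (e / 2) (divr_gt0 e0 (ltr0Sn _ 1)).
(* Bump radius and mesh each take at most d / 3, which keeps the averaging within [d] of [x]; the
   last entry makes [L * eps * Q] at most e / 4. *)
pose eps := Num.min 1 (Num.min (d / 3) (e / (4 * (L + 1) * (Q + 1)))).
have L1 : 0 < L + 1 by rewrite ltr_wpDl.
have Q1 : 0 < Q + 1 by rewrite ltr_wpDl.
have eps0 : 0 < eps by rewrite !lt_min ltr01 !divr_gt0// !mulr_gt0.
have [eps1 [epsd epse]] : eps <= 1 /\ eps <= d / 3 /\ eps * (4 * (L + 1) * (Q + 1)) <= e.
  by rewrite -ler_pdivlMr ?mulr_gt0//; split; [|split]; rewrite /eps !ge_min lexx ?orbT.
have [eta [teta eta0 eta_supp eta1]] := bump_exists eps0.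
have etaS y : eta y != 0 -> enorm y < 2 by move=> /eta_supp h; apply: le_lt_trans h _; lra.
have ceta := test_continuous teta.
have Ieta := intg_cs ceta teta.2.
pose R3 := `|R0| + M + 4.
have [Kw Kw0 HKw] := bounded_on_ball R3 cw.
have [C C0 HC] := test_dif2 teta; have [L' L'0 HL'] := test_lip teta.
pose A := Kw * \int[@leb2 R]_y \1_(eball R3) y.
have A0 : 0 <= A by rewrite mulr_ge0// Rint2_ge0// => y; rewrite indic_ball ler0n.
pose e' := e / (4 * (A + 1) * (Q + 1)).
have A1 : 0 < A + 1 by rewrite ltr_wpDl.
have e'0 : 0 < e' by rewrite divr_gt0// !mulr_gt0.
have e'e : e' * (4 * (A + 1) * (Q + 1)) <= e by rewrite /e' divfK// gt_eqF ?mulr_gt0.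
have [N1 HN1] := consistency alpha_gt1 alpha_lt2 r_gt0 r_ltM M_gt1 k_gt0 ceta C0 L'0 HC HL' e'0.
exists (maxn (maxn N0 N1) (Num.truncn eps^-1).+1) => n; rewrite !geq_max => /andP[/andP[n0' n1'] n2'].
have [n0 /andP[s0 sQ]] := HN0 n n0'.
have ninv : n%:R^-1 <= eps.
  rewrite invf_ple ?posrE ?ltr0n//; apply: ltW; apply: lt_le_trans (truncnS_gt _) _.
  by rewrite ler_nat.
pose v (z : site) : R := \int[@leb2 R]_t (w t * eta (t - pt n z)).
have Iw (phi : R * R -> R) : continuous phi -> compactly_supported phi -> intg2 (fun t => w t * phi t).
  move=> cp sp; apply: intg_cs.
    by move=> t; apply: cvgM; [exact: cw|exact: cp].
  have [rad rad0 Hr] := cs_box sp.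
  by apply: (@cs_rad _ _ rad) => t; rewrite mulf_eq0 negb_or => /andP[_ /Hr].
have tsh y : is_test_function (fun t => eta (t - y)) by exact: test_shift.
have Iv y : intg2 (fun t => w t * eta (t - y)).
  by apply: Iw; [exact: test_continuous (tsh y)|exact: (tsh y).2].
pose del := L * eps + e' * A.
have del0 : 0 <= del by rewrite addr_ge0// mulr_ge0// ltW.
have main : forall z, u n z <= v z + del * coef n.
  apply: (odometer_comparison alpha_gt1 alpha_lt2 r_gt0 r_ltM M_gt1 n0 (k_gt0 n0) I_gt0
    rho_le a_gt0 rho_supp (X_legal n0) (eta' := fun z => rho (pt n z) - del) del0).
  - move=> z zR.
    apply: (@admissible_pairing n w eta eps Kw e' z) => //; first exact: ltW.
    by move=> y; exact: HN1.
  - by move=> z; rewrite opprB addrC subrK.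
  - by move=> z; apply: Rint2_ge0 => t; rewrite mulr_ge0.
apply: le_trans (main (nearest n x)) _.
have vx : v (nearest n x) <= w x + e / 2.
  set W := w x + e / 2; rewrite -[W]mulr1.
  have <- : \int[@leb2 R]_t eta (t - pt n (nearest n x)) = 1 by rewrite (Rint_shift (- pt n (nearest n x)) Ieta).
  rewrite -Rint2Z; last exact: (intg_shift (- pt n (nearest n x)) Ieta).
  apply: Rint2_mono => [||t]; [exact: Iv|by apply: intgZ; exact: (intg_shift (- pt n (nearest n x)) Ieta)|].
  have [->|et] := eqVneq (eta (t - pt n (nearest n x))) 0; first by rewrite !mulr0.
  rewrite ler_wpM2r//.
  have h1 := eta_supp _ et; have h2 := nearest_close x n0.
  have h3 := enormD (t - pt n (nearest n x)) (pt n (nearest n x) - x); rewrite addrA subrK in h3.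
  have h4 : enorm (t - x) < d := le_lt_trans h3 (sum_lt_third h1 (le_trans h2 ninv) epsd d0).
  by rewrite /W -lerBlDl; exact: le_trans (ler_norm _) (Hd t h4).
have dQ : del * coef n <= e / 2.
  apply: (@le_trans _ _ (del * Q)); first by rewrite ler_wpM2l.
  rewrite /del mulrDl [e' * A]mulrC.
  exact: sum_le_halves (mul_le_quarter L_ge0 Q0 (ltW eps0) epse)
    (mul_le_quarter A0 Q0 (ltW e'0) e'e).
rewrite [e](splitr e) addrA lerD//.
Qed.

Section BoxExtension.
Variable n : nat.
Hypothesis n_gt0 : (0 < n)%N.

Lemma ue_ge0 x : 0 <= ue n x.
Proof.
exact: (odometer_ge0 alpha_gt1 alpha_lt2 r_gt0 r_ltM M_gt1 n_gt0 (k_gt0 n_gt0) I_gt0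
  rho_le a_gt0 rho_supp (X_legal n_gt0)).
Qed.

Lemma ue_le x : ue n x <= (10 / 9) ^+ j * coef n.
Proof.
exact: (odometer_le alpha_gt1 alpha_lt2 r_gt0 r_ltM M_gt1 n_gt0 (k_gt0 n_gt0) I_gt0
  rho_le a_gt0 rho_supp (X_legal n_gt0)).
Qed.

Lemma ue_out x : R0 + 1 <= enorm x -> ue n x = 0.
Proof.
move=> xR; apply: (odometer_out alpha_gt1 alpha_lt2 r_gt0 r_ltM M_gt1 n_gt0 (k_gt0 n_gt0) I_gt0
  rho_le a_gt0 rho_supp (X_legal n_gt0)).
have h1 := nearest_dist n_gt0 x; have h2 := invn_le1 R n_gt0.
have := enormD (x - pt n (nearest n x)) (pt n (nearest n x)); rewrite subrK.
lra.
Qed.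

Lemma ue_lip x y : `|ue n y - ue n x| <= L * coef n * (enorm (y - x) + 2 * n%:R^-1).
Proof.
have h := odometer_lip alpha_gt1 alpha_lt2 r_gt0 r_ltM M_gt1 n_gt0 (k_gt0 n_gt0) I_gt0
  rho_le a_gt0 rho_supp L_ge0 rho_lip (X_legal n_gt0) (nearest n x) (nearest n y - nearest n x).
rewrite [nearest n x + _]addrC subrK in h; apply: (le_trans h).
have c0 : 0 <= coef n.
  rewrite /sup_coef divr_ge0 ?sqr_ge0// mulr_ge0 ?(ltW I_gt0)// ltW//.
  exact: (c_gt0 alpha_gt1 alpha_lt2 r_gt0 r_ltM M_gt1 n_gt0 (k_gt0 n_gt0)).
rewrite mulrAC; apply: ler_wpM2l; first exact: mulr_ge0.
rewrite ptD ptN.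
have h1 := nearest_dist n_gt0 x; have h2 := nearest_close y n_gt0.
have h3 := enormD (pt n (nearest n y) - y) (y - pt n (nearest n x)); rewrite addrA subrK in h3.
have h4 := enormD (y - x) (x - pt n (nearest n x)); rewrite addrA subrK in h4.
lra.
Qed.

Lemma meas2_ue : meas2 (ue n).
Proof. exact: measurable_box_ext. Qed.

Lemma intg_ue : intg2 (ue n).
Proof.
apply: (int2_le meas2_ue (intgZ ((10 / 9) ^+ j * coef n) (int2_ball (R0 + 1)))) => x.
rewrite ger0_norm ?ue_ge0// indic_ball; case: ltP => h; first by rewrite mulr1 ue_le.
by rewrite mulr0 ue_out.
Qed.

(** Box extension commutes with lattice translations, so each jump can be shifted from [eta] to the
    odometer under the integral. *)
Lemma Ln_mollify eta x : is_test_function eta ->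
  intg2 (fun t => ue n t * Ln n eta (x - t)) /\
  intg2 (fun t => lapn n (u n) (nearest n t) * eta (x - t)) /\
  \int[@leb2 R]_t (ue n t * Ln n eta (x - t)) =
  \int[@leb2 R]_t (lapn n (u n) (nearest n t) * eta (x - t)).
Proof.
move=> teta.
have I y := intg_mollify intg_ue teta y.
pose F (z : site) t := (n%:R `^ alpha * p n z) * (ue n t * eta (x + pt n z - t) - ue n t * eta (x - t)).
pose G (z : site) t := (n%:R `^ alpha * p n z) * (ue n (t + pt n z) * eta (x - t) - ue n t * eta (x - t)).
have IF z : intg2 (F z) by apply: intgZ; apply: intgB; exact: I.
have I' z : intg2 (fun t => ue n (t + pt n z) * eta (x - t)).
  have := intg_shift (pt n z) (I (x + pt n z)); apply: int2_eq => t.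
  by congr (_ * eta _); rewrite opprD addrACA subrr addr0.
have IG z : intg2 (G z) by apply: intgZ; apply: intgB; [exact: I'|exact: I].
have eF t : \sum_(z <- Sn M n) F z t = ue n t * Ln n eta (x - t).
  rewrite /scaled_jump mulrCA !mulr_sumr; apply: eq_bigr => z _.
  rewrite /F (addrAC x (pt n z)); by move: (_ `^ _) (p n z) => u1 u2; ring.
have eG t : \sum_(z <- Sn M n) G z t = lapn n (u n) (nearest n t) * eta (x - t).
  rewrite /scaled_lap /lap -mulrA mulr_suml mulr_sumr; apply: eq_bigr => z _.
  rewrite /G /box_ext nearest_add_pt//; by move: (_ `^ _) (p n z) => u1 u2; ring.
split; [|split].
- by apply: (int2_eq eF); exact: intg_sum.
- by apply: (int2_eq eG); exact: intg_sum.
rewrite -(Rint2_eq eF) -(Rint2_eq eG) (Rint_sum _ IF) (Rint_sum _ IG).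
apply: eq_bigr => z _; rewrite /F /G.
rewrite !Rint2Z; [|by apply: intgB; [exact: I'|exact: I]|by apply: intgB; exact: I].
rewrite !Rint2B; [|exact: I'|exact: I|exact: I|exact: I].
congr (_ * (_ - _)); rewrite -(Rint_shift (pt n z) (I (x + pt n z))); apply: Rint2_eq => t.
by congr (_ * eta _); rewrite opprD addrACA subrr addr0.
Qed.

(** The operator acts on [eta], is replaced by the discrete one at cost [e'] times the integral of
    the odometer, and then moves onto the odometer, a discrete supersolution. Evaluating [rho] at
    nearby sites costs the Lipschitz term. *)
Lemma L_mollify_le eta eps e' x : is_test_function eta ->
  (forall y, 0 <= eta y) -> (forall y, eta y != 0 -> enorm y <= eps) ->
  \int[@leb2 R]_y eta y = 1 -> 0 <= e' ->
  (forall y, `|Ln n eta y - L_M eta y| <= e') ->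
  L_M (mollify (ue n) eta) x <= 1 - rho x + L * (eps + n%:R^-1) +
    e' * \int[@leb2 R]_t ue n t.
Proof.
move=> teta eta0 eta_supp eta1 e'0 He.
have [I1 E1] := mollify_J M alpha_gt1 alpha_lt2 intg_ue teta x.
have [I2 [I3 E2]] := Ln_mollify x teta.
have Ieta := intg_reflect x (intg_cs (test_continuous teta) teta.2).
have I4 : intg2 (fun t => ue n t * L_M eta (x - t)).
  by apply: int2_eq (intgZ (c / 2) I1) => t; rewrite L_ME mulrCA.
have E3 : L_M (mollify (ue n) eta) x = \int[@leb2 R]_t (ue n t * L_M eta (x - t)).
  by rewrite L_ME E1 -(Rint2Z _ I1); apply: Rint2_eq => t; rewrite L_ME mulrCA.
have H1 : \int[@leb2 R]_t (ue n t * L_M eta (x - t)) - \int[@leb2 R]_t (ue n t * Ln n eta (x - t)) <=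
   e' * \int[@leb2 R]_t ue n t.
  rewrite -(Rint2B I4 I2) -(Rint2Z _ intg_ue).
  apply: Rint2_mono; [exact: intgB|exact: intgZ intg_ue|move=> t].
  rewrite -mulrBr mulrC ler_wpM2r ?ue_ge0//.
  by apply: le_trans (ler_norm _) _; rewrite distrC.
have H2 : \int[@leb2 R]_t (lapn n (u n) (nearest n t) * eta (x - t)) <= 1 - rho x + L * (eps + n%:R^-1).
  set W := (X in _ <= X); rewrite -[W]mulr1.
  have <- : \int[@leb2 R]_t eta (x - t) = 1 by rewrite (Rint_reflect x (intg_cs (test_continuous teta) teta.2)).
  rewrite -(Rint2Z _ Ieta); apply: Rint2_mono => // [|t]; first exact: intgZ.
  have [->|et] := eqVneq (eta (x - t)) 0; first by rewrite !mulr0.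
  rewrite ler_wpM2r// /W.
  have h1 := odometer_super alpha_gt1 alpha_lt2 r_gt0 r_ltM M_gt1 n_gt0 (k_gt0 n_gt0) I_gt0
    rho_le a_gt0 rho_supp (X_legal n_gt0) (nearest n t).
  have h2 := Lip x (pt n (nearest n t)).
  have h3 := nearest_close t n_gt0; have h4 := eta_supp _ et.
  have h5 := enormD (pt n (nearest n t) - t) (t - x); rewrite addrA subrK in h5.
  have h6 : enorm (t - x) = enorm (x - t) by rewrite -enormN opprB.
  have h7 : L * enorm (pt n (nearest n t) - x) <= L * (eps + n%:R^-1).
    by rewrite ler_wpM2l// (le_trans h5)// h6 addrC lerD.
  move: h2; rewrite ler_norml => /andP[h2 _].
  by lra.
rewrite E3; rewrite E2 in H1; lra.
Qed.

End BoxExtension.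

Lemma ue_integral_le n Q : (0 < n)%N -> coef n <= Q ->
  \int[@leb2 R]_t ue n t <= (10 / 9) ^+ j * Q * \int[@leb2 R]_t \1_(eball (R0 + 1)) t.
Proof.
move=> n0 cQ; have I1 := int2_ball (R0 + 1).
rewrite -Rint2Z//; apply: Rint2_mono; [exact: intg_ue|exact: intgZ|move=> t].
rewrite indic_ball; case: ltP => h; last by rewrite mulr0 ue_out.
rewrite mulr1; apply: le_trans (ue_le n0 t) _.
by rewrite ler_wpM2l// exprn_ge0// divr_ge0.
Qed.

Lemma L_mollify_out n eta x : (0 < n)%N -> is_test_function eta ->
  (forall y, eta y != 0 -> enorm y < 2) -> `|R0| + M + 4 <= enorm x ->
  L_M (mollify (ue n) eta) x = 0.
Proof.
move=> n0 teta etaS xR; have m1 := M_gt1.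
rewrite L_ME (mollify_J M alpha_gt1 alpha_lt2 (intg_ue n0) teta x).2 Rint2_0 ?mulr0// => t.
have [tR|tR] := leP (R0 + 1) (enorm t); first by rewrite ue_out// mul0r.
rewrite (@J_out _ alpha M eta 2 (x - t) etaS) ?mulr0//; first by lra.
have h1 := enorm_geB x t; have h2 := ler_norm R0; lra.
Qed.

Lemma mollify_ue_le n eta eps Q x : (0 < n)%N -> is_test_function eta ->
  (forall y, 0 <= eta y) -> (forall y, eta y != 0 -> enorm y <= eps) ->
  \int[@leb2 R]_y eta y = 1 -> coef n <= Q -> n%:R^-1 <= eps ->
  mollify (ue n) eta x <= ue n x + L * Q * (3 * eps).
Proof.
move=> n0 teta eta0 eta_supp eta1 cQ ne.
have Ieta := intg_reflect x (intg_cs (test_continuous teta) teta.2).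
set W := ue n x + _; rewrite -[W]mulr1.
have <- : \int[@leb2 R]_t eta (x - t) = 1 by rewrite (Rint_reflect x (intg_cs (test_continuous teta) teta.2)).
rewrite -(Rint2Z _ Ieta); apply: Rint2_mono => [||t]; [exact: (intg_mollify (intg_ue n0) teta)|exact: intgZ|].
have [->|et] := eqVneq (eta (x - t)) 0; first by rewrite !mulr0.
rewrite ler_wpM2r// /W; have h1 := eta_supp _ et.
have h2 := ue_lip n0 x t; move: h2; rewrite ler_norml => /andP[_ h2].
have h3 : enorm (t - x) = enorm (x - t) by rewrite -enormN opprB.
have n0' : 0 <= n%:R^-1 :> R by rewrite invr_ge0 ler0n.
have : L * coef n * (enorm (t - x) + 2 * n%:R^-1) <= L * Q * (3 * eps).
  apply: (@le_trans _ _ (L * Q * (enorm (t - x) + 2 * n%:R^-1))).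
    by rewrite ler_wpM2r ?addr_ge0 ?enorm_ge0 ?mulr_ge0// ler_wpM2l.
  have Q0 : 0 <= Q.
    apply: le_trans cQ; have := ue_le n0 0; have := ue_ge0 n0 0 => u1 u2.
    have := le_trans u1 u2; rewrite pmulr_rge0// exprn_gt0// divr_gt0//.
  by rewrite ler_wpM2l ?mulr_ge0// h3; lra.
lra.
Qed.

(** Self-adjointness turns the pointwise inequality into its weak form. *)
Lemma admissible_intro w C : continuous w -> (forall x, 0 <= w x) ->
  (forall x y, `|D2 w x y| <= C * enorm y ^+ 2) -> (forall x, L_M w x <= 1 - rho x) -> is_admissible w.
Proof.
move=> cw w0 Dw Lw; split=> // phi tphi phi0.
have [K K0 HK] := test_dif2 tphi.
have [I1 I2 E] := @J_selfadj _ _ M alpha_gt1 alpha_lt2 w phi C K cw (test_continuous tphi) tphi.2 Dw HK.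
have Iphi := intg_cs (test_continuous tphi) tphi.2.
have Irho : intg2 (fun x => rho x * phi x).
  apply: intg_cs; first by move=> x; apply: cvgM; [exact: rho_cont|exact: test_continuous].
  have [rad rad0 Hr] := cs_box tphi.2.
  by apply: (@cs_rad _ _ rad) => x; rewrite mulf_eq0 negb_or => /andP[_ /Hr].
rewrite (Rint2_eq (g := fun x => c / 2 * (w x * J phi x))); last by move=> x; rewrite L_ME mulrCA.
rewrite (Rint2Z _ I1) E -(Rint2Z _ I2) -(Rint2B Iphi Irho).
apply: Rint2_mono; [exact: intgZ|exact: intgB|move=> x].
have := ler_wpM2l (phi0 x) (Lw x); rewrite L_ME; by rewrite mulrCA mulrBr mulr1 [rho x * _]mulrC.
Qed.

Lemma admissible_above e : 0 < e -> exists N, forall n, (N <= n)%N ->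
  exists2 w, is_admissible w & forall x, w x <= ue n x + e.
Proof.
move=> e0; have m1 := M_gt1; have a0 := a_gt0; have L0 := L_ge0.
have [Q Q0 [N0 HN0]] := coef_bound.
(* Beyond [R2] both [rho] and the operator applied to the mollified odometer vanish, while inside
   the phase x_1 / R2 is at most 1 in absolute value. *)
pose R2 := `|R0| + M + 4 + a.
have R21 : 0 < R2 by rewrite /R2; have := normr_ge0 R0; lra.
pose theta : R * R := (R2^-1, 0).
have etheta : enorm theta = R2^-1.
  by rewrite /enorm /= expr0n addr0 sqrtr_sqr ger0_norm// invr_ge0 ltW.
have theta0 : theta != 0 by rewrite -enorm_gt0 etheta invr_gt0.
pose psi := c * jump_symbol alpha M theta.
have psi0 : 0 < psi by rewrite mulr_gt0// psi1_gt0.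
pose e2 := Num.min 2^-1 (e * psi / 8).
have e20 : 0 < e2 by rewrite lt_min invr_gt0 ltr0n /= divr_gt0// mulr_gt0.
have [e2h e2e] : e2 <= 2^-1 /\ e2 <= e * psi / 8.
  by split; rewrite /e2 ge_min lexx ?orbT.
have L1 : 0 < L + 1 by rewrite ltr_wpDl.
have Lu1 : 0 < L * Q + 1 by rewrite ltr_wpDl ?mulr_ge0.
pose eps := Num.min 1 (Num.min (e2 / (4 * (L + 1))) (e / (8 * (L * Q + 1)))).
have eps0 : 0 < eps by rewrite !lt_min ltr01 !divr_gt0// !mulr_gt0.
have [eps1 [epsL epse]] : eps <= 1 /\ L * eps <= e2 / 4 /\ L * Q * eps <= e / 8.
  have [h1 [h2 h3]] : eps <= 1 /\ eps * (4 * (L + 1)) <= e2 /\ eps * (8 * (L * Q + 1)) <= e.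
    by rewrite -!ler_pdivlMr ?mulr_gt0//; split; [|split]; rewrite /eps !ge_min lexx ?orbT.
  split=> //; split.
    by move: h2; rewrite (_ : eps * (4 * (L + 1)) = 4 * (L * eps) + 4 * eps); [lra|ring].
  by move: h3; rewrite (_ : eps * (8 * (L * Q + 1)) = 8 * (L * Q * eps) + 8 * eps); [lra|ring].
have [eta [teta eta0 eta_supp eta1]] := bump_exists eps0.
have etaS y : eta y != 0 -> enorm y < 2 by move=> /eta_supp h; apply: le_lt_trans h _; lra.
have [C C0 HC] := test_dif2 teta; have [L' L'0 HL'] := test_lip teta.
pose B := (10 / 9) ^+ j * Q * \int[@leb2 R]_t \1_(eball (R0 + 1)) t.
have B0 : 0 <= B.
  rewrite mulr_ge0 ?mulr_ge0// ?exprn_ge0 ?divr_ge0//.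
  by apply: Rint2_ge0 => t; rewrite indic_ball ler0n.
pose e' := e2 / (2 * (B + 1)).
have B1 : 0 < B + 1 by rewrite ltr_wpDl.
have e'0 : 0 < e' by rewrite divr_gt0// mulr_gt0.
have e'B : e' * B <= e2 / 2.
  have : e' * (2 * (B + 1)) = e2 by rewrite /e' divfK// gt_eqF// mulr_gt0.
  by rewrite (_ : e' * (2 * (B + 1)) = 2 * (e' * B) + 2 * e'); [lra|ring].
have [N1 HN1] := consistency alpha_gt1 alpha_lt2 r_gt0 r_ltM M_gt1 k_gt0 (test_continuous teta) C0 L'0 HC HL' e'0.
exists (maxn (maxn N0 N1) (Num.truncn eps^-1).+1) => n; rewrite !geq_max => /andP[/andP[n0' n1'] n2'].
have [n0 /andP[s0 sQ]] := HN0 n n0'.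
have ninv : n%:R^-1 <= eps.
  rewrite invf_ple ?posrE ?ltr0n//; apply: ltW; apply: lt_le_trans (truncnS_gt _) _.
  by rewrite ler_nat.
pose m := mollify (ue n) eta.
have Hm x : L_M m x <= 1 - rho x + e2.
  apply: (le_trans (L_mollify_le n0 x teta eta0 eta_supp eta1 (ltW e'0) (HN1 n n1'))).
  have h1 : e' * \int[@leb2 R]_t ue n t <= e' * B by rewrite ler_wpM2l ?(ltW e'0)// ue_integral_le.
  have h2 : L * (eps + n%:R^-1) <= L * (2 * eps) by rewrite ler_wpM2l//; lra.
  move: h1 h2 epsL e'B; lra.
have [Cm Cm0 HCm] := mollify_D2 (intg_ue n0) teta.
have cm := continuous_mollify (intg_ue n0) teta.
(* The corrector contributes -2 e2 cos, at most -e2 inside the ball where the cosine is at least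
   1/2: this absorbs the excess of [Hm]. Outside it is at most 2 e2 <= 1, which is admissible there,
   and [e2 <= e * psi / 8] keeps the corrector below e / 2. *)
pose d := 2 * e2 / psi.
have d0 : 0 <= d by exact: ltW (divr_gt0 (mulr_gt0 (ltr0Sn _ 1) e20) psi0).
have dpsi : d * psi = 2 * e2 by rewrite /d divfK// gt_eqF.
have d2 : d * 2 <= e / 2 by rewrite /d mulrAC ler_pdivrMr//; move: e2e; lra.
clearbody d.
pose g x : R := 1 + cos (dotp theta x).
have gD x y : D2 g x y = D2 (fun x => cos (dotp theta x)) x y by rewrite /D2 /g; ring.
have Dg x y : `|D2 g x y| <= R2^-1 ^+ 2 * enorm y ^+ 2.
  by rewrite gD -etheta; exact: D2_cosdot_le.
have cg : continuous g.
  by move=> x; apply: cvgD; [exact: cvg_cst|exact: continuous_cosdot].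
have g02 x : 0 <= g x <= 2.
  exact: onep_cos_bounds.
exists (fun x => m x + d * g x); last first.
  move=> x; have := mollify_ue_le x n0 teta eta0 eta_supp eta1 sQ ninv; rewrite -/m => h1.
  have h2 : d * g x <= d * 2 by rewrite ler_wpM2l//; case/andP: (g02 x).
  rewrite mulrCA in h1; exact: le_eighths h1 (le_trans h2 d2) epse (ltW e0).
apply: (@admissible_intro _ (Cm + d * R2^-1 ^+ 2)).
- by move=> x; apply: cvgD; [exact: cm|apply: cvgMr; exact: cg].
- move=> x; rewrite addr_ge0//; last by rewrite mulr_ge0//; case/andP: (g02 x).
  by apply: Rint2_ge0 => t; rewrite mulr_ge0 ?ue_ge0.
- move=> x y.
  have -> : D2 (fun x => m x + d * g x) x y = D2 m x y + d * D2 g x y by rewrite /D2; ring.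
  apply: le_trans (ler_normD _ _) _; rewrite mulrDl lerD//.
  by rewrite normrM (ger0_norm d0) -mulrA ler_wpM2l.
- move=> x.
  have -> : L_M (fun x => m x + d * g x) x = L_M m x - 2 * e2 * cos (dotp theta x).
    rewrite !L_ME (@J_lin _ alpha M alpha_gt1 alpha_lt2 m g d _ _ x cm cg HCm Dg).
    have -> : J g x = J (fun x => cos (dotp theta x)) x by apply: Rint2_eq => y; rewrite gD.
    rewrite J_cosdot// -dpsi /psi; move: (jump_symbol _ _ _) (cos _) (J _ _) => u1 u2 u3.
    by field.
  have [xR|xR] := ltP (enorm x) R2.
    have h1 : `|dotp theta x| <= 1.
      apply: le_trans (dotp_le _ _) _; rewrite etheta mulrC ler_pdivrMr// mul1r; exact: ltW.
    have h4 := cos_ge_half h1.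
    have h5 : e2 <= 2 * e2 * cos (dotp theta x).
      by rewrite [2 * e2]mulrC -mulrA ler_peMr ?(ltW e20)// -ler_pdivrMl// mulr1.
    by rewrite lerBlDr (le_trans (Hm x))// lerD2l.
  rewrite (L_mollify_out n0 teta etaS); last by apply: le_trans xR; rewrite /R2 lerDl ltW.
  have aR : a <= R2 by rewrite /R2 lerDr !addr_ge0// ltW// (lt_trans ltr01).
  have -> : rho x = 0.
    by apply/eqP/negPn/negP => /rho_supp; rewrite ltNge (le_trans aR xR).
  have := cos_max (dotp theta x); rewrite ler_norml => /andP[h1 _].
  exact: drop_le.
Qed.

End Comparison.

(** * Uniform convergence *)

Section UniformFromPointwise.
Variable R : realType.
Implicit Types (x y : R * R).

Lemma dist4 (a b a' b' p q s : R) : `|a - b| <= p -> `|a' - b'| <= q -> `|a - a'| <= s ->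
  `|b - b'| <= p + q + s.
Proof. by rewrite !ler_norml => /andP[? ?] /andP[? ?] /andP[? ?]; apply/andP; split; lra. Qed.

Lemma invn_small (d : R) : 0 < d -> exists N, forall n, (N <= n)%N -> n%:R^-1 <= d.
Proof.
move=> d0; exists (Num.truncn d^-1).+1 => n Nn.
have n0 : (0 < n)%N by apply: leq_trans Nn.
rewrite invf_ple ?posrE ?ltr0n//; apply: ltW; apply: lt_le_trans (truncnS_gt _) _.
by rewrite ler_nat.
Qed.

Lemma eventually_all (P : nat -> site -> Prop) (s : seq site) :
  (forall z, exists N, forall n, (N <= n)%N -> P n z) ->
  exists N, forall n, (N <= n)%N -> forall z, z \in s -> P n z.
Proof.
move=> H; elim: s => [|z s [N IH]]; first by exists 0%N.
have [N' H'] := H z; exists (maxn N N') => n; rewrite geq_max => /andP[n1 n2] y.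
by rewrite inE => /predU1P[->|]; [exact: H'|exact: IH].
Qed.

Lemma mul_small (C d t : R) (k : nat) : 0 <= C -> 0 < d -> (0 < k)%N ->
  t <= d / (k%:R * (C + 1)) -> 0 <= t -> C * (k%:R * t) <= d.
Proof.
move=> C0 d0 k0 + t0; have C1 : 0 < C + 1 by rewrite ltr_wpDl.
rewrite ler_pdivlMr ?mulr_gt0 ?ltr0n//; apply: le_trans.
rewrite (_ : t * _ = C * (k%:R * t) + k%:R * t); last by ring.
by rewrite lerDl mulr_ge0.
Qed.

Variables (f : nat -> R * R -> R) (g : R * R -> R) (C rad : R) (N0 : nat).
Hypothesis C_ge0 : 0 <= C.
Hypothesis f_lip : forall n x y, (N0 <= n)%N -> `|f n y - f n x| <= C * (enorm (y - x) + 2 * n%:R^-1).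
Hypothesis f_out : forall n x, (N0 <= n)%N -> rad <= enorm x -> f n x = 0.
Hypothesis f_cvg : forall x e, 0 < e -> exists N, forall n, (N <= n)%N -> `|f n x - g x| <= e.

Lemma pointwise_lip x y : `|g y - g x| <= C * enorm (y - x).
Proof.
apply/ler_addgt0Pr => d d0.
have d3 : 0 < d / 3 by rewrite divr_gt0.
have d5 : 0 < d / 3 / (2%:R * (C + 1)) by rewrite divr_gt0// mulr_gt0// ltr_wpDl.
have [N1 H1] := f_cvg x d3; have [N2 H2] := f_cvg y d3; have [N3 H3] := invn_small d5.
pose n := maxn (maxn N1 N2) (maxn N3 N0).
have h1 := H1 n (leq_trans (leq_maxl _ _) (leq_maxl _ _)).
have h2 := H2 n (leq_trans (leq_maxr _ _) (leq_maxl _ _)).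
have h3 := mul_small C_ge0 d3 (ltn0Sn 1) (H3 n (leq_trans (leq_maxl _ _) (leq_maxr _ _))).
have h4 := f_lip x y (leq_trans (leq_maxr _ _) (leq_maxr _ _) : (N0 <= n)%N).
apply: le_trans (dist4 h2 h1 h4) _; rewrite mulrDr.
have : C * (2 * n%:R^-1) <= d / 3 by apply: h3; rewrite invr_ge0.
move: (C * _) (C * _) => t1 t2; lra.
Qed.

Lemma pointwise_out x : rad <= enorm x -> g x = 0.
Proof.
move=> xR; apply/eqP; rewrite -normr_le0; apply/ler_addgt0Pr => d d0; rewrite add0r.
have [N1 H1] := f_cvg x d0.
have := H1 (maxn N1 N0) (leq_maxl _ _).
by rewrite f_out ?leq_maxr// sub0r normrN.
Qed.

(** On the ball, convergence at the finitely many points of a lattice of mesh 1/m is spread by the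
    common Lipschitz bound, which holds up to an error 2/n for [f n] and passes to [g]; outside,
    everything vanishes. *)
Lemma uniform_of_pointwise e : 0 < e ->
  exists N, forall n, (N <= n)%N -> forall x, `|f n x - g x| <= e.
Proof.
move=> e0; have e4 : 0 < e / 4 by rewrite divr_gt0.
have d5 : 0 < e / 4 / (2%:R * (C + 1)) by rewrite divr_gt0// mulr_gt0// ltr_wpDl.
have [m' Hm] := invn_small d5; pose m := maxn m' 1; have m0 : (0 < m)%N by rewrite leq_max orbT.
have hm := Hm m (leq_maxl _ _).
pose s := ibox (Num.truncn (m%:R * (rad + 1))).+1.
have [N2 H2] := @eventually_all (fun n z => `|f n (pt R m z) - g (pt R m z)| <= e / 4) s
  (fun z => f_cvg (pt R m z) e4).
have [N3 H3] := invn_small d5.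
exists (maxn N2 (maxn N3 N0)) => n; rewrite !geq_max => /andP[n2 /andP[n3 n0']] x.
have [xR|xR] := leP rad (enorm x).
  by rewrite pointwise_out// f_out// subrr normr0 ltW.
pose z := nearest m x; have hz := nearest_dist m0 x; rewrite -/z in hz.
have zs : z \in s.
  apply: (index_bound (R := R) m0).
  have h1 := enormB x (x - pt R m z); rewrite opprB [x + _]addrC subrK in h1.
  have h2 := invn_le1 R m0; lra.
have h1 := H2 n n2 z zs; have h2 := f_lip (pt R m z) x n0'.
have h3 := pointwise_lip (pt R m z) x.
rewrite distrC in h2; rewrite distrC in h3.
have := mul_small C_ge0 e4 (ltn0Sn 1) (H3 n n3) _; rewrite invr_ge0 ler0n => /(_ isT) h4.
have := mul_small C_ge0 e4 (ltn0Sn 1) (le_trans hz hm) (enorm_ge0 _) => h5.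
have ab (a b a' b' p q t : R) : `|a - b| <= p -> `|a - a'| <= q -> `|b - b'| <= t -> `|a' - b'| <= p + q + t.
  by rewrite !ler_norml => /andP[? ?] /andP[? ?] /andP[? ?]; apply/andP; split; lra.
apply: le_trans (ab _ _ _ _ _ _ _ h1 h2 h3) _; rewrite mulrDr.
move: h4 h5; rewrite (_ : C * (2%:R * enorm (x - pt R m z)) = 2 * (C * enorm (x - pt R m z))); last by ring.
move: (C * _) (C * _) => t1 t2; lra.
Qed.

End UniformFromPointwise.
Section Convergence.
Variables (R : realType) (alpha r M : R).
Hypothesis alpha_gt1 : 1 < alpha.
Hypothesis alpha_lt2 : alpha < 2.
Hypothesis r_gt0 : 0 < r.
Hypothesis r_ltM : r < M.
Hypothesis M_gt1 : 1 < M.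
Hypothesis k_gt0 : forall n : nat, (0 < n)%N -> 0 < k_ alpha r M n.
Variables (rho : R * R -> R) (a L : R) (j : nat).
Hypothesis rho_cont : continuous rho.
Hypothesis rho_ge0 : forall x, 0 <= rho x.
Hypothesis rho_le : forall x, rho x <= (10 / 9) ^+ j.
Hypothesis a_gt0 : 0 < a.
Hypothesis rho_supp : forall x, rho x != 0 -> enorm x < a.
Hypothesis L_ge0 : 0 <= L.
Hypothesis rho_lip : forall x y, `|rho (x + y) - rho x| <= L * enorm y.
Variable X : nat -> nat -> option site.
Hypothesis X_legal : forall n : nat, (0 < n)%N ->
  legal_toppling (p_ alpha r M n) (fun z : site => rho (pt R n z)) (X n).
Local Notation p := (p_ alpha r M).
Local Notation pt := (pt R).
Local Notation J := (jump_op alpha M).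
Local Notation L_M := (L_M alpha r M).
Local Notation c := (c_lim alpha r M).
Local Notation Ln := (scaled_jump alpha r M).
Local Notation lapn n := (scaled_lap alpha r M n).
Local Notation u n := (odometer alpha n (p n) (fun z : site => rho (pt n z)) (X n)).
Local Notation ue n := (box_ext n (u n)).
Local Notation R0 := (supp_rad M a j).
Local Notation coef n := (sup_coef alpha r M n a j).
Implicit Types (x y t : R * R) (z : site) (w phi : R * R -> R).

Variable x0 : R * R.
Hypothesis x0_unit : enorm x0 = 1.
Local Notation gamma := (obstacle alpha r M x0 rho).
Local Notation U := (cont_odometer alpha r M x0 rho).
Local Notation admissible := (is_admissible alpha r M rho).

Let clim_gt0 : 0 < c.
Proof. exact: (c_lim_spec alpha_gt1 alpha_lt2 r_gt0 r_ltM M_gt1 k_gt0).2. Qed.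

Let rho_cs : compactly_supported rho.
Proof. exact: cs_rad rho_supp. Qed.

Lemma intg_LM (f : R * R -> R) phi : continuous f -> is_test_function phi -> intg2 (fun x => f x * L_M phi x).
Proof.
move=> cf tphi.
have [I _] := test_J M alpha_gt1 alpha_lt2 tphi.
have [A A0 [B B0 HB]] := test_J_bound alpha_gt1 alpha_lt2 M_gt1 tphi.
have [K K0 HK] := bounded_on_ball A cf.
have I' : intg2 (fun x => f x * J phi x).
  apply: (int2_le _ (intgZ K (intg_norm I))).
    by apply: meas2M; [exact: continuous_measurable2|exact: int2_meas].
  move=> x; rewrite normrM; have [xA|xA] := ltP (enorm x) A; first by rewrite ler_wpM2r// HK.
  rewrite (_ : J phi x = 0) ?normr0 ?mulr0//.
  by have := HB x; rewrite indic_ball ltNge xA mulr0 normr_le0 => /eqP.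
by apply: int2_eq (intgZ (c / 2) I') => x; rewrite L_ME mulrCA.
Qed.

Lemma continuous_L1loc (f : R * R -> R) : continuous f -> is_L1loc f.
Proof.
move=> cf K cK; have [rad rad0 Hr] := bounded_in_box cK.
have mK := compact_measurable2 cK.
have [B B0 HB] := bounded_on_ball rad cf.
apply/intg_indic => //; apply: (int2_le _ (intgZ B (int2_ball rad))).
  by apply: meas2M; [exact: meas2_indic|exact: continuous_measurable2].
move=> x; rewrite normrM indicE; have [xK|xK] := boolP (x \in K); last first.
  by rewrite normr0 mul0r mulr_ge0// indic_ball ler0n.
by rewrite normr1 mul1r indic_ball Hr ?mulr1 ?HB ?Hr//; exact: set_mem.
Qed.

(** By [obstacle_eq], adding the obstacle shifts the weak inequality by the integral of [phi] minus
    that of [rho * phi], so admissible functions correspond to continuous superharmonic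
    majorants. *)
Lemma admissibleE w : admissible w <->
  [/\ continuous (fun x => gamma x + w x), superharmonic alpha r M (fun x => gamma x + w x) &
      forall x, gamma x <= gamma x + w x].
Proof.
have cg : continuous gamma.
  exact: (continuous_obstacle alpha_gt1 alpha_lt2 M_gt1 x0_unit clim_gt0 rho_cont rho_cs L_ge0 rho_lip).
have eq phi : is_test_function phi -> continuous w ->
    \int[@leb2 R]_x ((gamma x + w x) * L_M phi x) =
    \int[@leb2 R]_x (w x * L_M phi x) - (\int[@leb2 R]_x phi x - \int[@leb2 R]_x (rho x * phi x)).
  move=> tphi cw.
  have [I1 E1] := obstacle_eq alpha_gt1 alpha_lt2 M_gt1 x0_unit clim_gt0 rho_cont rho_cs tphi.
  rewrite (Rint2_eq (g := fun x => gamma x * L_M phi x + w x * L_M phi x)); last by move=> x; rewrite mulrDl.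
  by rewrite (Rint2D I1 (intg_LM cw tphi)) E1 opprB addrC.
split=> [[cw w0 Hw]|[cgw [_ Hs] gw]].
  have cgw : continuous (fun x => gamma x + w x) by move=> x; apply: cvgD; [exact: cg|exact: cw].
  split=> // [|x]; last by rewrite lerDl.
  split; first exact: continuous_L1loc.
  by move=> phi tphi phi0; rewrite eq// subr_le0; exact: Hw.
have cw : continuous w.
  have -> : w = (fun x => gamma x + w x - gamma x) by apply/funext => x; rewrite addrC addKr.
  by move=> x; apply: cvgB; [exact: cgw|exact: cg].
split=> // [x|phi tphi phi0]; first by have := gw x; rewrite lerDl.
by have := Hs phi tphi phi0; rewrite eq// subr_le0.
Qed.

Lemma cont_odometer_le w x : admissible w -> U x <= w x.
Proof.
move=> /admissibleE [cf sf gf]; rewrite /cont_odometer lerBlDl.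
apply: ge_inf; last by exists (fun x => gamma x + w x).
by exists (gamma x) => _ [f [_ _ h] <-].
Qed.

Lemma cont_odometer_approx w0 x e : admissible w0 -> 0 < e ->
  exists2 w, admissible w & w x <= U x + e.
Proof.
move=> /admissibleE hw0 e0.
set S := [set f x | f in [set f : R * R -> R |
  [/\ continuous f, superharmonic alpha r M f & forall y, gamma y <= f y]]].
(* The function [w0] guarantees a majorant: the infimum of an empty set would be a mere default
   value. *)
have hS : has_inf S.
  split; first by exists (gamma x + w0 x); exists (fun x => gamma x + w0 x).
  by exists (gamma x) => _ [f [_ _ h] <-].
have [_ [f [cf sf gf] <-] hf] := inf_adherent e0 hS.
have fE : f = (fun y => gamma y + (f y - gamma y)) by apply/funext => y; rewrite addrC subrK.
exists (fun y => f y - gamma y).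
  apply/admissibleE; rewrite -fE; split=> // y; by rewrite addrC subrK.
by rewrite /cont_odometer /least_majorant -/S addrAC lerD2r ltW.
Qed.

Lemma ue_pointwise x e : 0 < e -> exists N, forall n, (N <= n)%N -> `|ue n x - U x| <= e.
Proof.
move=> e0; have e20 : 0 < e / 2 by rewrite divr_gt0.
have [N1 H1] := admissible_above alpha_gt1 alpha_lt2 r_gt0 r_ltM M_gt1 k_gt0 rho_cont rho_le a_gt0
  rho_supp L_ge0 rho_lip X_legal e0.
have [w0 aw0 _] := H1 N1 (leqnn _).
have [w aw wx] := cont_odometer_approx x aw0 e20.
have [N2 H2] := odometer_le_admissible alpha_gt1 alpha_lt2 r_gt0 r_ltM M_gt1 k_gt0 rho_cont rho_le a_gt0
  rho_supp L_ge0 rho_lip X_legal x aw e20.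
exists (maxn N1 N2) => n; rewrite geq_max => /andP[n1 n2].
have [w' aw' /(_ x) h1] := H1 n n1; have h2 := cont_odometer_le x aw'; have h3 := H2 n n2.
by rewrite ler_norml; apply/andP; split; lra.
Qed.

Lemma ue_uniform e : 0 < e -> exists N, forall n, (N <= n)%N -> forall x, `|ue n x - U x| <= e.
Proof.
have [Q Q0 [N0 HN0]] := coef_bound alpha_gt1 alpha_lt2 r_gt0 r_ltM M_gt1 k_gt0 a j.
apply: (@uniform_of_pointwise R (fun n => ue n) U (L * Q) (R0 + 1) N0).
- exact: mulr_ge0.
- move=> n x y /HN0[n0 /andP[s0 sQ]].
  apply: le_trans (ue_lip alpha_gt1 alpha_lt2 r_gt0 r_ltM M_gt1 k_gt0 rho_le a_gt0 rho_supp L_ge0 rho_lip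
    X_legal n0 x y) _.
  by rewrite ler_wpM2r ?addr_ge0 ?enorm_ge0 ?mulr_ge0 ?invr_ge0// ler_wpM2l.
- move=> n x /HN0[n0 _]; exact: (ue_out alpha_gt1 alpha_lt2 r_gt0 r_ltM M_gt1 k_gt0 rho_le a_gt0
    rho_supp X_legal n0).
- exact: ue_pointwise.
Qed.

End Convergence.

(** Bernoulli's inequality; it provides the number of barrier steps for a given bound on the
    density. *)
Lemma bernoulli_pow (R : realType) (K : R) : exists j : nat, K <= (10 / 9) ^+ j.
Proof.
have H j : 1 + j%:R / 9 <= (10 / 9 : R) ^+ j.
  elim: j => [|j IH]; first by rewrite mul0r addr0 expr0.
  have j0 : 0 <= j%:R :> R by [].
  by rewrite exprS -natr1; move: IH; lra.
exists (Num.truncn (9 * K)).+1; apply: le_trans (H _).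
have := truncnS_gt (9 * K); lra.
Qed.

Lemma uniform_eps (R : realType) (f : nat -> R * R -> R) (g : R * R -> R) :
  (forall e, 0 < e -> exists N, forall n, (N <= n)%N -> forall x, `|f n x - g x| <= e) ->
  {uniform, f @ \oo --> g}.
Proof.
move=> H P /uniform_nbhs [E [entE EsubP]].
have [e e0 eE] : exists2 e : R, 0 < e & forall x y : R, `|x - y| <= e -> E (y, x).
  move: entE; rewrite -entourage_ballE => -[e /= e0 eE]; exists (e / 2); first by rewrite divr_gt0.
  move=> x y xy; apply: eE => /=; rewrite /ball /= distrC; apply: le_lt_trans xy _; lra.
have [N HN] := H e e0.
exists N => // n /= Nn; apply: EsubP => x _ /=; apply: eE; exact: HN.
Qed.

Theorem theorem1p3 (R : realType) (alpha r M : R)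
    (alpha_gt1 : 1 < alpha) (alpha_lt2 : alpha < 2)
    (r_gt0 : 0 < r) (r_ltM : r < M) (M_gt1 : 1 < M)
    (k_gt0 : forall n : nat, (0 < n)%N -> 0 < k_ alpha r M n)
    (x0 : R * R) (x0_unit : enorm x0 = 1)
    (rho : R * R -> R)
    (rho_C2 : is_Ck 2 rho) (rho_supp : compactly_supported rho)
    (rho_ge0 : forall x : R * R, 0 <= rho x)
    (X : nat -> nat -> option site)
    (X_legal : forall n : nat, (0 < n)%N ->
       legal_toppling (p_ alpha r M n) (fun z : site => rho (pt R n z)) (X n)) :
  {uniform, (fun n : nat => box_ext n
      (odometer alpha n (p_ alpha r M n) (fun z : site => rho (pt R n z)) (X n)))
    @ \oo --> cont_odometer alpha r M x0 rho}.
Proof.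
have [rho_cont d12 C11 C12] := rho_C2.
have [a a_gt0 Ha] := cs_box rho_supp.
have [K K_ge0 HK] := cs_bounded rho_cont rho_supp.
have [j Kj] := bernoulli_pow K.
have rho_le x : rho x <= (10 / 9) ^+ j.
  by apply: le_trans (ler_norm _) _; apply: le_trans (HK x) Kj.
have [c11 _ _ _] := C11; have [c12 _ _ _] := C12.
have C1 : is_Ck 1 rho := And4 rho_cont d12 c11 c12.
have [L L_ge0 HL] := C1_lip C1 rho_supp.
apply: uniform_eps => e e0.
exact: (ue_uniform alpha_gt1 alpha_lt2 r_gt0 r_ltM M_gt1 k_gt0 rho_cont rho_le a_gt0 Ha L_ge0 HL X_legal x0_unit e0).
Qed.
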